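(* Write $z=e^\varphi$ and put $$c_{i,j;p}=\frac{1}{n_i-j}\,\frac{1}{2n_i-j}\cdots\frac{1}{(p+1)n_i-j},\qquad c_p=\sum_{s=1}^p\frac1s .$$ The Hamiltonian densities of the principal hierarchy for the Frobenius manifold $M^{Toda}$ are given, for $p\ge0$, by $$\theta_{t_{0,j},p}=-\operatorname{Res}_\infty c_{0,j;p}\,w_0(z)^{(p+1)n_0-j}\frac{dz}z,\quad j=1,\dots,n_0-1,$$ $$\theta_{t_{i,j},p}=\operatorname{Res}_{a_{i,0}}c_{i,j;p}\,w_i(z)^{(p+1)n_i-j}\frac{dz}z,\quad i=1,\dots,m,\ j=0,\dots,n_i-1,$$ and, for $i=1,\dots,m$, $$\theta_{t_{i,n_i},p}=-\operatorname{Res}_\infty\frac{\lambda^p}{p!}\Big(\log\frac{w_0}{z-a_{i,0}}-\frac{c_p}{n_0}\Big)\frac{dz}z+\operatorname{Res}_{a_{i,0}}\frac{\lambda^p}{p!}\Big(\log\big((z-a_{i,0})w_i\big)-\frac{c_p}{n_i}\Big)\frac{dz}z+\sum_{s\ne i}\operatorname{Res}_{a_{s,0}}\frac{\lambda^p}{p!}\log(z-a_{i,0})\frac{dz}z .$$ The corresponding Hamiltonian flows are, for $p\ge1$, $$\frac{\partial\lambda(z)}{\partial T^{t_{0,j},p-1}}=\{(c_{0,j;p-1}w_0(z)^{pn_0-j})_{\infty,\ge0},\lambda(z)\},\quad j=1,\dots,n_0-1,$$ $$\frac{\partial\lambda(z)}{\partial T^{t_{i,j},p-1}}=-\{(c_{i,j;p-1}w_i(z)^{pn_i-j})_{a_{i,0},\le-1},\lambda(z)\},\quad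 i=1,\dots,m,\ j=0,\dots,n_i-1,$$ and, for $p\ge0$ and $i=1,\dots,m$, $$\frac{\partial\lambda(z)}{\partial T^{t_{i,n_i},p}}=\Big\{\Big(\frac{\lambda^p}{p!}\Big(\log\frac{w_0}{z-a_{i,0}}-\frac{c_p}{n_0}\Big)\Big)_{\infty,\ge0}-\Big(\frac{\lambda^p}{p!}\Big(\log\big((z-a_{i,0})w_i\big)-\frac{c_p}{n_i}\Big)\Big)_{a_{i,0},\le-1},\lambda\Big\}$$ $$\qquad-\sum_{s\ne i}\Big\{\Big(\frac{\lambda^p}{p!}\log(z-a_{i,0})\Big)_{a_{s,0},\le-1},\lambda\Big\}+\Big\{\frac{\lambda^p}{p!}\log(z-a_{i,0}),\lambda\Big\},$$ where $\{f,g\}=z\frac{\partial f}{\partial z}\frac{\partial g}{\partial x}-z\frac{\partial f}{\partial x}\frac{\partial g}{\partial z}$ for functions $f(z,x),g(z,x)$.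
   Context: **The manifold.** Let $m\ge1$ and $n_0,\dots,n_m$ be positive integers. $M^{Toda}$ is the space of functions of $z=e^\varphi$: $\lambda=\frac1{n_0}z^{n_0}+a_{0,n_0-1}z^{n_0-1}+\dots+a_{0,0}+\sum_{i=1}^m\sum_{j=1}^{n_i}a_{i,j}(z-a_{i,0})^{-j}$ with $a_{1,0}=0$, $a_{i,n_i}\ne0$ and $a_{1,0},\dots,a_{m,0}$ pairwise distinct; the remaining coefficients are coordinates. A tangent vector $\partial$ is identified with $\partial\lambda(z)$ (derivative at fixed $z$); $'=d/dz$. The Frobenius structure is: $\eta(\partial',\partial'')=\sum_{z_0:\lambda'(z_0)=0}\operatorname{Res}_{z_0}\frac{\partial'\lambda\,\partial''\lambda}{z^2\lambda'}dz$; $\ \eta(\partial'\circ\partial'',\partial''')=\sum_{z_0:\lambda'(z_0)=0}\operatorname{Res}_{z_0}\frac{\partial'\lambda\,\partial''\lambda\,\partial'''\lambda}{z^2\lambda'}dz$; Euler field $E$ with $E\lambda=\lambda-\frac z{n_0}\lambda'$; charge $d=1$. **Flat coordinates.** $w_0=(n_0\lambda)^{1/n_0}=z+O(1)$ near $z=\infty$, and $w_i=(n_i\lambda)^{1/n_i}$ is a (locally fixed) branch with a simple pole at $a_{i,0}$, $1\le i\le m$. Flat coordinates $\{t_{0,j}\}_{j=1}^{n_0-1}\cup\bigcup_{i=1}^m\{t_{i,j}\}_{j=0}^{n_i}$ of $\eta$: $\varphi=\log w_0-t_{0,1}w_0^{-1}-t_{0,2}w_0^{-2}-\cdots$ as $z\to\infty$;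 $\varphi=-\log w_1+t_{1,0}+t_{1,1}w_1^{-1}+\cdots$ as $z\to0$; $\varphi=t_{i,0}+t_{i,1}w_i^{-1}+\cdots$ as $z\to a_{i,0}$, $i\ge2$. **Notation.** $(f)_{\infty,\ge0}$ is the polynomial part (in $z$) of the Laurent expansion of $f$ at $z=\infty$; $(f)_{a,\le-1}$ is the principal part at $z=a$. $\operatorname{Res}_\infty\frac{dz}z=-1$. $\log\frac{w_0}{z-a_{i,0}}$ is the branch vanishing at $\infty$; $\log((z-a_{i,0})w_i)$ is a branch holomorphic at $a_{i,0}$; for $s\ne i$, $\log(z-a_{i,0})$ near $a_{s,0}$ is a locally fixed branch, the same one in the densities and in the flows. **Principal hierarchy.** For a Frobenius manifold with metric $\eta$ (Levi-Civita connection $\nabla$), product $\circ$, Euler field $E$, charge $d$, let $t^\alpha$ be flat coordinates with $\frac{2-d}2\partial_\alpha-\nabla_{\partial_\alpha}E=\mu_\alpha\partial_\alpha$, $\eta_{\alpha\beta}=\eta(\partial_\alpha,\partial_\beta)$, $(\eta^{\alpha\beta})$ the inverse matrix, $\partial_\beta\circ\partial_\gamma=c^\epsilon_{\beta\gamma}\partial_\epsilon$. Hamiltonian densities of the principal hierarchy are functions $\theta_{\alpha,p}(t)$, $p\ge0$, such that (1) $\partial_\beta\partial_\gamma\theta_{\alpha,p+1}=c^\epsilon_{\beta\gamma}\partial_\epsilon\theta_{\alpha,p}$; (2) $E(\partial_\beta\theta_{\alpha,p})=(p+\mu_\alpha+\mu_\beta)\partial_\beta\theta_{\alpha,p}+\partial_\beta\sum_{s=1}^p\theta_{\epsilon,p-s}(R_s)^\epsilon_\alpha$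 for some constant matrices $R_s$ with $(R_s)^\alpha_\beta=0$ unless $\mu_\alpha-\mu_\beta=s$, and $(R_s)^\gamma_\alpha\eta_{\gamma\beta}=(-1)^{s+1}(R_s)^\gamma_\beta\eta_{\gamma\alpha}$; (3) $\theta_{\alpha,0}=\eta_{\alpha\beta}t^\beta$, up to additive constants. The principal hierarchy is the system of flows on the loop space $\{S^1\to M\}$ ($x\in S^1$): $\frac{\partial t^\gamma}{\partial T^{\alpha,p}}=\eta^{\gamma\beta}\,\partial_x\!\left(\partial_\beta\theta_{\alpha,p+1}\right)$, $p\ge0$. *)

(* Defs.v *)
From HB Require Import structures.
From mathcomp Require Import all_boot all_order all_algebra.
From mathcomp Require Import all_classical all_reals all_analysis.
From mathcomp.real_closed Require Import complex.
From mathcomp Require Import zify ring.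
Import Order.TTheory GRing.Theory Num.Theory.
Import numFieldNormedType.Exports.

Set Implicit Arguments.
Unset Strict Implicit.
Unset Printing Implicit Defensive.

Local Open Scope classical_set_scope.
Local Open Scope ring_scope.

(* Formal Laurent series in one variable, as a field.  A germ of meromorphic
   function is represented by its Laurent expansion in a local parameter, and
   residues and principal parts are read off the coefficients. *)
Record laurent (K : fieldType) := Laurent {
  lcoef : int -> K;
  lcoef_bounded : exists N : int, forall k, k < N -> lcoef k = 0 }.

Section LaurentField.
Variable K : fieldType.
Local Notation L := (laurent K).
Implicit Types (f g h : L) (k : int).

Lemma laurentP f g : (forall k, lcoef f k = lcoef g k) -> f = g.
Proof.
case: f g => [f fb] [g gb] /= fg.
have {}fg : f = g by apply/funext.
by subst g; congr Laurent; exact: Prop_irrelevance.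
Qed.

Lemma lcoef_natbounded f : exists N : nat, forall k, k < - N%:Z -> lcoef f k = 0.
Proof.
have [N fN] := lcoef_bounded f; exists (absz N) => k kN; apply: fN; lia.
Qed.

HB.instance Definition _ := gen_eqMixin L.
HB.instance Definition _ := gen_choiceMixin L.

Lemma lzero_subproof : exists N : int, forall k, k < N -> 0 = 0 :> K.
Proof. by exists 0. Qed.
Definition lzero : L := Laurent lzero_subproof.

Lemma lopp_subproof f : exists N : int, forall k, k < N -> - lcoef f k = 0.
Proof. by have [N fN] := lcoef_bounded f; exists N => k /fN ->; rewrite oppr0. Qed.
Definition lopp f : L := Laurent (lopp_subproof f).

Lemma ladd_subproof f g :
  exists N : int, forall k, k < N -> lcoef f k + lcoef g k = 0.
Proof.
have [N fN] := lcoef_bounded f; have [M gM] := lcoef_bounded g.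
by exists (Num.min N M) => k; rewrite lt_min => /andP[/fN-> /gM->]; rewrite addr0.
Qed.
Definition ladd f g : L := Laurent (ladd_subproof f g).

Fact laddA : associative ladd.
Proof. by move=> f g h; apply: laurentP => k /=; rewrite addrA. Qed.
Fact laddC : commutative ladd.
Proof. by move=> f g; apply: laurentP => k /=; rewrite addrC. Qed.
Fact ladd0 : left_id lzero ladd.
Proof. by move=> f; apply: laurentP => k /=; rewrite add0r. Qed.
Fact laddN : left_inverse lzero lopp ladd.
Proof. by move=> f; apply: laurentP => k /=; rewrite addNr. Qed.
HB.instance Definition _ := GRing.isZmodule.Build L laddA laddC ladd0 laddN.

Definition mulcoef f g k : K :=
  \sum_(i \in [set: int]) (lcoef f i * lcoef g (k - i)).

Let ptrunc f (N m : nat) : {poly K} := \poly_(i < m.+1) lcoef f (i%:Z - N%:Z).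

Let mulcoefE f g (N M m : nat) :
  (forall k, k < - N%:Z -> lcoef f k = 0) ->
  (forall k, k < - M%:Z -> lcoef g k = 0) ->
  mulcoef f g (m%:Z - (N + M)%N%:Z) = (ptrunc f N m * ptrunc g M m)`_m.
Proof.
move=> fN gM; pose r : seq int := [seq i%:Z - N%:Z | i <- iota 0 m.+1].
have ru : uniq r.
  by rewrite map_inj_uniq ?iota_uniq // => i j /addIr [].
rewrite /mulcoef -(fsbig_widen [set` r]) //; last first.
  move=> k /= [_ kr]; case: (ltP k (- N%:Z)) => [/fN->|Nk]; first by rewrite mul0r.
  rewrite gM ?mulr0 //; case: (ltP (m%:Z - N%:Z) k) => [?|km]; first lia.
  exfalso; apply: kr; apply/mapP; exists (absz (k + N%:Z)); last lia.
  by rewrite mem_iota; lia.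
rewrite -fsbig_seq // big_map -[iota _ _]/(index_iota 0 m.+1) big_mkord.
rewrite coefM; apply: eq_bigr => i _; rewrite !coef_poly ltn_ord ltnS leq_subr.
congr (_ * lcoef g _); have := ltn_ord i; lia.
Qed.

Let mulcoef_lt f g (N M : nat) k :
  (forall k, k < - N%:Z -> lcoef f k = 0) ->
  (forall k, k < - M%:Z -> lcoef g k = 0) ->
  k < - (N + M)%N%:Z -> mulcoef f g k = 0.
Proof.
move=> fN gM kNM; apply: fsbig1 => i _.
case: (ltP i (- N%:Z)) => [/fN->|Ni]; first by rewrite mul0r.
by rewrite gM ?mulr0 //; lia.
Qed.

Lemma lmul_subproof f g :
  exists N : int, forall k, k < N -> mulcoef f g k = 0.
Proof.
have [N fN] := lcoef_natbounded f; have [M gM] := lcoef_natbounded g.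
by exists (- (N + M)%N%:Z) => k; exact: mulcoef_lt.
Qed.
Definition lmul f g : L := Laurent (lmul_subproof f g).

Let lmul_bound f g (N M : nat) :
  (forall k, k < - N%:Z -> lcoef f k = 0) ->
  (forall k, k < - M%:Z -> lcoef g k = 0) ->
  forall k, k < - (N + M)%N%:Z -> lcoef (lmul f g) k = 0.
Proof. by move=> fN gM k; exact: mulcoef_lt. Qed.

Lemma lconst_subproof (c : K) :
  exists N : int, forall k, k < N -> (if k == 0 then c else 0) = 0.
Proof. by exists 0 => k k0; case: eqP k0 => // ->; rewrite ltxx. Qed.
Definition lconst (c : K) : L := Laurent (lconst_subproof c).

Let lmulC : commutative lmul.
Proof.
move=> f g; apply: laurentP => k /=.
have [N fN] := lcoef_natbounded f; have [M gM] := lcoef_natbounded g.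
case: (ltP k (- (N + M)%N%:Z)) => kNM.
  rewrite (mulcoef_lt fN gM kNM); rewrite addnC in kNM.
  by rewrite (mulcoef_lt gM fN kNM).
have -> : k = (absz (k + (N + M)%N%:Z))%:Z - (N + M)%N%:Z by lia.
by rewrite mulcoefE // addnC mulcoefE // mulrC.
Qed.

Let ptrunc_mul f g (N M m : nat) (p : {poly K}) :
  (forall k, k < - N%:Z -> lcoef f k = 0) ->
  (forall k, k < - M%:Z -> lcoef g k = 0) ->
  (ptrunc (lmul f g) (N + M) m * p)`_m = (ptrunc f N m * ptrunc g M m * p)`_m.
Proof.
move=> fN gM; rewrite !coefM; apply: eq_bigr => i _; congr (_ * _).
rewrite coef_poly ltn_ord /= mulcoefE // !coefM; apply: eq_bigr => j _.
have im : (i <= m)%N by rewrite -ltnS.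
have ji : (j <= i)%N by rewrite -ltnS.
rewrite !coef_poly !ltnS ji leq_subr (leq_trans ji im).
by rewrite (leq_trans (leq_subr _ _) im).
Qed.

Let lmulA : associative lmul.
Proof.
move=> f g h; apply: laurentP => k.
have [N fN] := lcoef_natbounded f; have [M gM] := lcoef_natbounded g.
have [P hP] := lcoef_natbounded h.
case: (ltP k (- (N + M + P)%N%:Z)) => kb.
  rewrite (lmul_bound (lmul_bound fN gM) hP kb).
  by rewrite -addnA in kb; rewrite (lmul_bound fN (lmul_bound gM hP) kb).
have -> : k = (absz (k + (N + M + P)%N%:Z))%:Z - (N + M + P)%N%:Z by lia.
move: (absz _) => m /=; rewrite [RHS](mulcoefE m (lmul_bound fN gM) hP).
rewrite ptrunc_mul // -addnA (mulcoefE m fN (lmul_bound gM hP)).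
by rewrite mulrC ptrunc_mul // mulrC mulrA.
Qed.

Let lmulDl : left_distributive lmul +%R.
Proof.
move=> f g h; apply: laurentP => k.
have [N fN] := lcoef_natbounded f; have [M gM] := lcoef_natbounded g.
have [P hP] := lcoef_natbounded h.
pose Q := (N + M)%N.
have fQ k' : k' < - Q%:Z -> lcoef f k' = 0 by move=> ?; apply: fN; lia.
have gQ k' : k' < - Q%:Z -> lcoef g k' = 0 by move=> ?; apply: gM; lia.
have fgQ k' : k' < - Q%:Z -> lcoef (f + g) k' = 0.
  by move=> kQ; rewrite /= fQ // gQ // addr0.
case: (ltP k (- (Q + P)%N%:Z)) => kb.
  by rewrite /= !(@mulcoef_lt _ _ Q P) // addr0.
have -> : k = (absz (k + (Q + P)%N%:Z))%:Z - (Q + P)%N%:Z by lia.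
move: (absz _) => m; rewrite /= !mulcoefE //.
have -> : ptrunc (f + g) Q m = ptrunc f Q m + ptrunc g Q m.
  by apply/polyP => i; rewrite coefD !coef_poly; case: ifP; rewrite ?addr0.
by rewrite mulrDl coefD.
Qed.

Let lmulc (c : K) f k : lcoef (lmul (lconst c) f) k = c * lcoef f k.
Proof.
rewrite /= /mulcoef -(fsbig_widen [set 0]) //.
  by rewrite fsbig_set1 /= subr0.
by move=> i /= [_ /eqP/negbTE->]; rewrite mul0r.
Qed.

Let lmul1 : left_id (lconst 1) lmul.
Proof. by move=> f; apply: laurentP => k; rewrite lmulc mul1r. Qed.

Let lone_neq0 : lconst 1 != 0.
Proof.
apply/eqP => /(congr1 (fun f => lcoef f 0)) /=.
by move/eqP; rewrite oner_eq0.
Qed.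

HB.instance Definition _ :=
  GRing.Zmodule_isComNzRing.Build L lmulA lmulC lmul1 lmulDl lone_neq0.

Lemma lcoefD f g k : lcoef (f + g) k = lcoef f k + lcoef g k. Proof. by []. Qed.
Lemma lcoefN f k : lcoef (- f) k = - lcoef f k. Proof. by []. Qed.
Lemma lcoef0 k : lcoef (0 : L) k = 0. Proof. by []. Qed.
Lemma lcoef1 k : lcoef (1 : L) k = (k == 0)%:R.
Proof. by rewrite /=; case: eqP. Qed.
Lemma lcoefM f g k :
  lcoef (f * g) k = \sum_(i \in [set: int]) (lcoef f i * lcoef g (k - i)).
Proof. by []. Qed.
Lemma lcoefC (c : K) k : lcoef (lconst c) k = if k == 0 then c else 0.
Proof. by []. Qed.
Lemma lcoefCM (c : K) f k : lcoef (lconst c * f) k = c * lcoef f k.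
Proof. exact: lmulc. Qed.

Fact lconst_zmod_morphism : zmod_morphism lconst.
Proof.
by move=> c d; apply: laurentP => k /=; case: eqP; rewrite ?subr0.
Qed.
Fact lconst_monoid_morphism : monoid_morphism lconst.
Proof.
by split=> // c d; apply: laurentP => k; rewrite lcoefCM !lcoefC;
  case: eqP; rewrite ?mulr0.
Qed.
HB.instance Definition _ :=
  GRing.isZmodMorphism.Build K L lconst lconst_zmod_morphism.
HB.instance Definition _ :=
  GRing.isMonoidMorphism.Build K L lconst lconst_monoid_morphism.

Let linv_exists f : f != 0 -> exists g, g * f = 1.
Proof.
move=> f0; have [N fN] := lcoef_natbounded f.
have exn : exists n : nat, lcoef f (n%:Z - N%:Z) != 0.
  apply: contrapT => nex; case/eqP: f0; apply: laurentP => k.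
  case: (ltP k (- N%:Z)) => [/fN //|kN]; apply/eqP; apply: contrapT => fk.
  apply: nex; exists (absz (k + N%:Z)); apply/negP => fk'; apply: fk.
  by move: fk'; congr (lcoef f _ == 0); lia.
pose v := ex_minn exn; pose u (n : nat) := lcoef f (v%:Z + n%:Z - N%:Z).
have u0 : u 0%N != 0.
  by rewrite /u /v; case: ex_minnP => w fw _; rewrite addr0.
have fu k : k < v%:Z - N%:Z -> lcoef f k = 0.
  case: (ltP k (- N%:Z)) => [/fN //|kN] kv; apply/eqP; apply: contrapT => fk.
  move: kv; rewrite /v; case: ex_minnP => w fw wmin kw.
  have := wmin (absz (k + N%:Z)); have -> : (absz (k + N%:Z))%:Z - N%:Z = k by lia.
  by move=> /(_ (introN idP fk)); lia.
pose next (s : seq K) := (u 0%N)^-1 *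
  ((size s == 0%N)%:R - \sum_(i < size s) s`_i * u (size s - i)%N).
pose s n := iter n (fun s => rcons s (next s)) [::].
have szs n : size (s n) = n by elim: n => //= n IHn; rewrite size_rcons IHn.
have snth n i : (i < n)%N -> (s n)`_i = next (s i).
  elim: n => //= n IHn; rewrite ltnS nth_rcons szs leq_eqVlt => /predU1P[->|lt].
    by rewrite ltnn eqxx.
  by rewrite lt IHn.
pose w n := next (s n).
have wE n : \sum_(i < n.+1) w i * u (n - i)%N = (n == 0%N)%:R.
  rewrite big_ord_recr /= subnn {2}/w /next szs mulrAC mulVf // mul1r.
  rewrite [X in X + _](_ : _ = \sum_(i < n) (s n)`_i * u (n - i)%N).
    by rewrite addrC subrK.
  by apply: eq_bigr => i _; rewrite snth.
pose vi : int := v%:Z - N%:Z.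
have gb : exists M : int, forall k, k < M ->
    (if 0 <= k + vi then w (absz (k + vi)) else 0) = 0.
  by exists (- vi) => k kv; case: ifP => //; lia.
exists (Laurent gb); apply: laurentP => k; rewrite lcoefM lcoef1.
case: (ltP k 0) => k0.
  rewrite fsbig1 => [|i _]; first by case: eqP k0 => // ->; rewrite ltxx.
  rewrite /=; case: ifP => iv; last by rewrite mul0r.
  by rewrite fu ?mulr0 // -/vi; lia.
pose r : seq int := [seq i%:Z - vi | i <- iota 0 (absz k).+1].
have ru : uniq r by rewrite map_inj_uniq ?iota_uniq // => i j /addIr [].
rewrite -(fsbig_widen [set` r]) //; last first.
  move=> i /= [_ ir]; case: ifP => iv; last by rewrite mul0r.
  rewrite fu ?mulr0 // -/vi; case: (ltP (k - vi) i) => [?|ik]; first lia.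
  exfalso; apply: ir; apply/mapP; exists (absz (i + vi)); last lia.
  by rewrite mem_iota; lia.
rewrite -fsbig_seq // big_map -[iota _ _]/(index_iota 0 (absz k).+1) big_mkord.
have -> : (k == 0) = ((absz k) == 0%N) by lia.
rewrite -wE; apply: eq_bigr => i _ /=; have := ltn_ord i; rewrite ltnS => ik.
rewrite ifT; last lia.
by congr (w _ * lcoef f _); rewrite /vi; lia.
Qed.

Definition linv f : L := xget 0 [set g | g * f = 1].

Let lmulVf f : f != 0 -> linv f * f = 1.
Proof. by move=> /linv_exists[g gf]; rewrite /linv; case: xgetP => [h _ //|/(_ g)]. Qed.

Let linv0 : linv 0 = 0.
Proof.
rewrite /linv; case: xgetP => // g _ /=; rewrite mulr0 => /esym/eqP.
by rewrite oner_eq0.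
Qed.

HB.instance Definition _ := GRing.ComNzRing_isField.Build L lmulVf linv0.

(* the local parameter and the derivation with respect to it *)
Lemma lvar_subproof :
  exists N : int, forall k, k < N -> (k == 1)%:R = 0 :> K.
Proof. by exists 0 => k k0; case: eqP k0 => // ->. Qed.
Definition lvar : L := Laurent lvar_subproof.

Lemma lderiv_subproof f :
  exists N : int, forall k, k < N -> (k + 1)%:~R * lcoef f (k + 1) = 0.
Proof.
have [N fN] := lcoef_bounded f; exists (N - 1) => k kN.
by rewrite fN ?mulr0 //; lia.
Qed.
Definition lderiv f : L := Laurent (lderiv_subproof f).

End LaurentField.

(* z at the finite point c, resp. at infinity, in terms of the local parameter
   [lvar]; [res_inf] accounts for dz = - lvar ^- 2 d(lvar) when z = lvar^-1. *)
Definition zat (K : fieldType) (c : K) : laurent K := lconst c + lvar K.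
Definition zinf (K : fieldType) : laurent K := (lvar K)^-1.
Arguments zinf {K}.
Definition res_at (K : fieldType) (f : laurent K) : K := lcoef f (-1).
Definition res_inf (K : fieldType) (f : laurent K) : K := - lcoef f 1.

Definition polpart_inf (K : fieldType) (f : laurent K) (z : K) : K :=
  \sum_(k \in [set k : int | k <= 0]) (lcoef f k * z ^ (- k)).
Definition princpart (K : fieldType) (c : K) (f : laurent K) (z : K) : K :=
  \sum_(k \in [set k : int | k <= -1]) (lcoef f k * (z - c) ^ k).

Lemma res_inf_dz_z (K : fieldType) : res_inf (zinf^-1 : laurent K) = -1.
Proof. by rewrite /res_inf /zinf invrK. Qed.

(* R[i], with the structure from which its topology and norm are inferred. *)
Definition Cx (R : realType) : numClosedFieldType := R[i].

Definition expC (R : realType) (z : Cx R) : Cx R :=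
  (expR (complex.Re z) * cos (complex.Im z) +i*
   (expR (complex.Re z) * sin (complex.Im z)))%C.

Definition derivx (R : realType) (f : R -> Cx R) (x : R) : Cx R :=
  (derive1 (fun y => complex.Re (f y)) x +i*
   derive1 (fun y => complex.Im (f y)) x)%C.
Definition derivablex (R : realType) (f : R -> Cx R) (x : R) : Prop :=
  derivable (fun y => complex.Re (f y)) x 1 /\
  derivable (fun y => complex.Im (f y)) x 1.

Definition bracket (R : realType) (f g : Cx R -> R -> Cx R)
    (z : Cx R) (x : R) : Cx R :=
  z * derive1 (f^~ x) z * derivx (g z) x - z * derivx (f z) x * derive1 (g^~ x) z.

(* [l] is the Laurent series of a branch, holomorphic at the centre, of the
   logarithm of [f]. *)
Definition is_log (R : realType) (l f : laurent (Cx R)) : Prop :=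
  [/\ forall k : int, k < 0 -> lcoef l k = 0,
      expC (lcoef l 0) = lcoef f 0
    & lderiv l = lderiv f / f].

Section Coordinates.
Variables (R : realType) (I : finType).
Local Notation C := (Cx R).
Local Notation V := 'rV[C]_#|I|.

Definition crd (t : V) (al : I) : C := t 0 (enum_rank al).
Definition pd (al : I) (f : V -> C) (t : V) : C :=
  'D_(delta_mx 0 (enum_rank al)) f t.
Definition holo (D : set V) (f : V -> C) : Prop :=
  forall t, D t -> differentiable f t.
Definition hololaurent (D : set V) (f : V -> laurent C) : Prop :=
  forall k, holo D (fun t => lcoef (f t) k).

(* A Frobenius manifold in flat coordinates: [eta al be] and [c3 al be ga] are
   the values of the metric and of eta(_ o _, _) on coordinate vector fields,
   [E al] are the components of the Euler field, [d] is the charge. *)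
Section Frobenius.
Variables (D : set V) (eta : I -> I -> V -> C) (c3 : I -> I -> I -> V -> C)
  (E : I -> V -> C) (d : C).

Definition etainv (al be : I) (t : V) : C :=
  invmx (\matrix_(k < #|I|, l < #|I|) eta (enum_val k) (enum_val l) t)
    (enum_rank al) (enum_rank be).

(* c^ep_{be ga} *)
Definition structc (ep be ga : I) (t : V) : C :=
  \sum_(de : I) c3 be ga de t * etainv de ep t.

(* [mu al] are the spectrum and [Rs s al be] is (R_s)^al_be.  The coordinates
   being flat, nabla_{pd al} E has components [pd al (E be)]. *)
Definition hamiltonian_densities (theta : I -> nat -> V -> C) : Prop :=
  exists (mu : I -> C) (Rs : nat -> I -> I -> C),
  [/\ forall al be t, D t ->
        (2 - d) / 2 * (al == be)%:R - pd al (E be) t = mu al * (al == be)%:R,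
      forall al p, holo D (theta al p),
      forall al be ga p t, D t ->
        pd be (pd ga (theta al p.+1)) t =
        \sum_(ep : I) structc ep be ga t * pd ep (theta al p) t,
      [/\ forall al be p t, D t ->
            \sum_(ga : I) E ga t * pd ga (pd be (theta al p)) t =
            (p%:R + mu al + mu be) * pd be (theta al p) t +
            pd be (fun t' => \sum_(1 <= s < p.+1) \sum_(ep : I)
                               theta ep (p - s)%N t' * Rs s ep al) t,
          forall s al be, (0 < s)%N ->
            mu al - mu be != s%:R -> Rs s al be = 0
        & forall s al be t, (0 < s)%N -> D t ->
            \sum_(ga : I) Rs s ga al * eta ga be t =
            (-1) ^+ s.+1 * \sum_(ga : I) Rs s ga be * eta ga al t]
    & forall al, exists k : C, forall t, D t ->
        theta al 0 t = \sum_(be : I) eta al be t * crd t be + k].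

(* Component [ga] at [x] of the flow d/dT^{al,p} of the principal hierarchy, as
   a vector field on the loop space, at the loop [u].  It depends only on the
   germ of [u] at [x], so that [u] need only be a curve near [x]. *)
Definition principal_flow (theta : I -> nat -> V -> C) (al : I) (p : nat)
    (u : R -> V) (x : R) (ga : I) : C :=
  \sum_(be : I) etainv ga be (u x) *
    derivx (fun y => pd be (theta al p.+1) (u y)) x.

End Frobenius.
End Coordinates.

Section Toda.
Variables (R : realType) (m : nat) (n : nat -> nat).
Local Notation C := (Cx R).
Local Notation L := (laurent C).

(* The function lambda with coefficients [a], over any field F containing C
   through [inj]: F = C gives the function itself, F = laurent C and
   z = zat c or zinf its Laurent expansions. *)
Definition lam (F : fieldType) (inj : C -> F) (a : nat -> nat -> C) (z : F) : F :=
  inj ((n 0)%:R^-1) * z ^+ n 0 + \sum_(j < n 0) inj (a 0%N j) * z ^+ j +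
  \sum_(1 <= i < m.+1) \sum_(1 <= j < (n i).+1)
     inj (a i j) * (z - inj (a i 0%N)) ^- j.

(* Derivative of [lam inj a z] with respect to [a], at fixed [z], along [v]. *)
Definition dlam (F : fieldType) (inj : C -> F) (a v : nat -> nat -> C) (z : F) : F :=
  \sum_(j < n 0) inj (v 0%N j) * z ^+ j +
  \sum_(1 <= i < m.+1) \sum_(1 <= j < (n i).+1)
     (inj (v i j) * (z - inj (a i 0%N)) ^- j +
      inj (j%:R * a i j * v i 0%N) * (z - inj (a i 0%N)) ^- j.+1).

Definition is_pole (a : nat -> nat -> C) (z : C) : Prop :=
  exists2 i, (1 <= i <= m)%N & z = a i 0%N.

(* The indices of the flat coordinates: [idx0 j] is that of t_{0,j+1} and
   [idx i j] that of t_{i+1,j}. *)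
Definition flat_index : finType := ('I_(n 0).-1 + {i : 'I_m & 'I_(n i.+1).+1})%type.
Definition idx0 (j : 'I_(n 0).-1) : flat_index := inl j.
Definition idx (i : 'I_m) (j : 'I_(n i.+1).+1) : flat_index :=
  inr (existT (fun i : 'I_m => 'I_(n i.+1).+1) i j).
Local Notation V := 'rV[C]_#|flat_index|.

(* [l] = \sum_(j >= 0) c_j w^{-j}, for [w] with a simple pole at the centre. *)
Definition expands_in (l w : L) (c : nat -> C) : Prop :=
  forall k : nat, lcoef l k = \sum_(j < k.+1) c j * lcoef (w ^- j) k.

(* A chart of M^Toda given by the flat coordinates: [coef t i j] is the
   coefficient a_{i,j} of the point with flat coordinates t.  The chart comes
   with the branches used in the flat coordinates and in the densities: of the
   roots w_i, of log (w_0 / (z - a_{i,0})) at infinity ([log_winf i]), of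
   log ((z - a_{i,0}) w_i) at a_{i,0} ([log_w i]), and of log (z - a_{i,0}) at
   a_{s,0} ([log_z i s]).  Since [coef t] has
   flat coordinates t, [coef] is a biholomorphism onto an open subset of
   M^Toda; as the flat coordinates are local coordinates, these charts cover
   M^Toda. *)
Record flat_chart := FlatChart {
  dom : set V;
  dom_open : open dom;
  dom_connected : connected dom;
  coef : V -> nat -> nat -> C;
  coef_holo : forall i j, holo dom (fun t => coef t i j);
  coef10 : forall t, dom t -> coef t 1 0 = 0;
  coef_lead : forall t i, dom t -> (1 <= i <= m)%N -> coef t i (n i) != 0;
  coef_distinct : forall t i s, dom t -> (1 <= i <= m)%N -> (1 <= s <= m)%N ->
    i != s -> coef t i 0%N != coef t s 0%N;
  winf : V -> L;
  winf_root : forall t, dom t ->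
    winf t ^+ n 0 = (n 0)%:R * lam (@lconst C) (coef t) zinf;
  winf_lead : forall t, dom t -> lcoef (winf t) (-1) = 1;
  w : nat -> V -> L;
  w_root : forall t i, dom t -> (1 <= i <= m)%N ->
    w i t ^+ n i = (n i)%:R * lam (@lconst C) (coef t) (zat (coef t i 0%N));
  w_holo : forall i, (1 <= i <= m)%N -> hololaurent dom (w i);
  log_winf : nat -> V -> L;
  log_winf_log : forall t i, dom t -> (1 <= i <= m)%N ->
    is_log (log_winf i t) (winf t / (zinf - lconst (coef t i 0%N)));
  log_winf_branch : forall t i, dom t -> (1 <= i <= m)%N ->
    lcoef (log_winf i t) 0 = 0;
  log_w : nat -> V -> L;
  log_w_log : forall t i, dom t -> (1 <= i <= m)%N ->
    is_log (log_w i t) ((zat (coef t i 0%N) - lconst (coef t i 0%N)) * w i t);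
  log_w_holo : forall i, (1 <= i <= m)%N -> hololaurent dom (log_w i);
  log_z : nat -> nat -> V -> L;
  log_z_log : forall t i s, dom t -> (1 <= i <= m)%N -> (1 <= s <= m)%N ->
    i != s -> is_log (log_z i s t) (zat (coef t s 0%N) - lconst (coef t i 0%N));
  log_z_holo : forall i s, (1 <= i <= m)%N -> (1 <= s <= m)%N -> i != s ->
    hololaurent dom (log_z i s);
  (* log (w_0 / z) = t_{0,1} w_0^{-1} + t_{0,2} w_0^{-2} + ... at infinity *)
  flat0 : forall t, dom t -> exists (l : L) (c : nat -> C),
    [/\ is_log l (winf t / zinf), lcoef l 0 = 0, expands_in l (winf t) c,
        c 0%N = 0 & forall j : 'I_(n 0).-1, c j.+1 = crd t (idx0 j)];
  (* log (z w_1) = t_{1,0} + t_{1,1} w_1^{-1} + ... at a_{1,0} = 0 and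
     log z = t_{i,0} + t_{i,1} w_i^{-1} + ... at a_{i,0}, i > 1 *)
  flatS : forall t (i : 'I_m), dom t -> exists (l : L) (c : nat -> C),
    [/\ is_log l (zat (coef t i.+1 0%N) *
                  (if i.+1 == 1%N then w i.+1 t else 1)),
        expands_in l (w i.+1 t) c
      & forall j : 'I_(n i.+1).+1, c j = crd t (idx j)] }.

Variable X : flat_chart.

Definition lamX (t : V) : C -> C := lam idfun (coef X t).
Definition lam_at (t : V) (c : C) : L := lam (@lconst C) (coef X t) (zat c).
Definition lam_inf (t : V) : L := lam (@lconst C) (coef X t) zinf.
Definition dcoef (al : flat_index) (t : V) (i j : nat) : C :=
  pd al (fun s => coef X s i j) t.

(* [dlam] is the derivative of lambda at fixed z. *)
Lemma dlamE (al : flat_index) (t : V) (z : C) : dom X t -> ~ is_pole (coef X t) z ->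
  pd al (fun s => lamX s z) t = dlam idfun (coef X t) (dcoef al t) z.
Proof.
move=> Dt zpole; rewrite /pd /dcoef; set v := delta_mx _ _.
have da i j : is_derive t v (fun s => coef X s i j) (pd al (fun s => coef X s i j) t).
  by apply: DeriveDef => //; apply: diff_derivable; exact: coef_holo.
have dsum (r : seq nat) (F : nat -> V -> C) (G : nat -> C) :
    (forall i, i \in r -> is_derive t v (F i) (G i)) ->
    is_derive t v (fun s => \sum_(i <- r) F i s) (\sum_(i <- r) G i).
  elim: r => [|i r IHr] FG.
    rewrite big_nil (_ : (fun _ => _) = cst 0); first exact: is_derive_cst.
    by apply/funext => s; rewrite big_nil.
  rewrite big_cons (_ : (fun _ => _) = F i + (fun s => \sum_(j <- r) F j s)).
    apply: is_deriveD; first by apply: FG; rewrite mem_head.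
    by apply: IHr => j jr; apply: FG; rewrite inE jr orbT.
  by apply/funext => s; rewrite big_cons.
have dinv i j : (1 <= i <= m)%N -> is_derive t v
    (fun s => (z - coef X s i 0%N) ^- j)
    (j%:R * pd al (fun s => coef X s i 0%N) t * (z - coef X t i 0%N) ^- j.+1).
  move=> im.
  have za : z - coef X t i 0%N != 0.
    by rewrite subr_eq0; apply/eqP => ?; apply: zpole; exists i.
  have dX : is_derive t v (fun s => (z - coef X s i 0%N) ^+ j)
      ((j%:R * (z - coef X t i 0%N) ^+ j.-1) *:
       (0 - pd al (fun s => coef X s i 0%N) t)).
    have dz : is_derive t v ((cst z : V -> C) - (fun s => coef X s i 0%N))
        (0 - pd al (fun s => coef X s i 0%N) t) by exact: is_deriveB.
    have := is_deriveX j dz.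
    by congr is_derive; apply/funext => s; rewrite exprfctE.
  apply: DeriveDef.
    by apply: derivableV; [exact: expf_neq0|exact: (@ex_derive _ _ _ _ _ _ _ dX)].
  rewrite deriveV; [|exact: expf_neq0|exact: (@ex_derive _ _ _ _ _ _ _ dX)].
  rewrite (@derive_val _ _ _ _ _ _ _ dX); rewrite sub0r {dX}; move: (pd _ _ _) => d.
  rewrite -[LHS]/(- (((z - coef X t i 0%N) ^+ j) ^- 2) *
                  ((j%:R * (z - coef X t i 0%N) ^+ j.-1) * (- d))).
  case: j => [|j]; first by rewrite mulr0n !mul0r mulr0.
  by rewrite /= !exprS; field; rewrite za expf_neq0.
have dM (f : V -> C) (df : C) (g : V -> C) (dg : C) :
    is_derive t v f df -> is_derive t v g dg ->
    is_derive t v (fun s => f s * g s) (df * g t + f t * dg).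
  move=> dF dG; rewrite (_ : (fun _ => _) = f * g) //.
  rewrite (_ : df * g t + f t * dg = f t *: dg + g t *: df); first exact: is_deriveM.
  by rewrite addrC [df * _]mulrC.
have dfree : is_derive t v (fun s => \sum_(j < n 0) coef X s 0%N j * z ^+ j)
    (\sum_(j < n 0) pd al (fun s => coef X s 0%N j) t * z ^+ j).
  rewrite (_ : (fun _ => _) =
      fun s => \sum_(j <- index_iota 0 (n 0)) coef X s 0%N j * z ^+ j); last first.
    by apply/funext => s; rewrite big_mkord.
  rewrite -(big_mkord xpredT (fun j => pd al (fun s => coef X s 0%N j) t * z ^+ j)).
  apply: dsum => j _; have := dM _ _ _ _ (da 0%N j) (is_derive_cst (z ^+ j) t v).
  by rewrite mulr0 addr0.
pose P i j s := coef X s i j * (z - coef X s i 0%N) ^- j.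
pose dP i j := pd al (fun s => coef X s i j) t * (z - coef X t i 0%N) ^- j +
  j%:R * coef X t i j * pd al (fun s => coef X s i 0%N) t *
    (z - coef X t i 0%N) ^- j.+1.
have dPP i j : (1 <= i <= m)%N -> is_derive t v (P i j) (dP i j).
  move=> im; have := dM _ _ _ _ (da i j) (dinv i j im).
  by rewrite /dP !mulrA [coef X t i j * _]mulrC.
have dpole (Q : nat -> nat -> V -> C) (dQ : nat -> nat -> C) :
    (forall i j, (1 <= i <= m)%N -> is_derive t v (Q i j) (dQ i j)) ->
    is_derive t v (fun s => \sum_(1 <= i < m.+1) (\sum_(1 <= j < (n i).+1) Q i j s))
      (\sum_(1 <= i < m.+1) \sum_(1 <= j < (n i).+1) dQ i j).
  move=> dQP.
  pose F i s := \sum_(1 <= j < (n i).+1) Q i j s.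
  pose G i := \sum_(1 <= j < (n i).+1) dQ i j.
  have FG i : i \in index_iota 1 m.+1 -> is_derive t v (F i) (G i).
    rewrite mem_index_iota ltnS => im.
    by have := dsum (index_iota 1 (n i).+1) (Q i) (dQ i) (fun j _ => dQP i j im).
  by have := dsum (index_iota 1 m.+1) F G FG.
have {}dpole := dpole P dP dPP.
have dcst := is_derive_cst ((n 0)%:R^-1 * z ^+ n 0) t v.
have := is_deriveD (is_deriveD dcst dfree) dpole.
rewrite add0r => dlam; rewrite -[RHS](@derive_val _ _ _ _ _ _ _ dlam).
by [].
Qed.

Definition dlam_at (al : flat_index) (t : V) (c : C) : L :=
  dlam (@lconst C) (coef X t) (dcoef al t) (zat c).

Definition crit (t : V) : set C :=
  [set c | ~ is_pole (coef X t) c /\ derive1 (lamX t) c = 0].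

Definition eta (al be : flat_index) (t : V) : C :=
  \sum_(c \in crit t)
    res_at (dlam_at al t c * dlam_at be t c / (zat c ^+ 2 * lderiv (lam_at t c))).
Definition c3 (al be ga : flat_index) (t : V) : C :=
  \sum_(c \in crit t)
    res_at (dlam_at al t c * dlam_at be t c * dlam_at ga t c /
            (zat c ^+ 2 * lderiv (lam_at t c))).

Definition is_euler (E : flat_index -> V -> C) : Prop :=
  forall t z, dom X t -> ~ is_pole (coef X t) z ->
    \sum_(al : flat_index) E al t * pd al (fun s => lamX s z) t =
    lamX t z - z / (n 0)%:R * derive1 (lamX t) z.

Definition cnum (i j p : nat) : C :=
  \prod_(1 <= k < p.+2) (k%:R * (n i)%:R - j%:R)^-1.
Definition csum (p : nat) : C := \sum_(1 <= s < p.+1) s%:R^-1.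

(* The functions whose projections and residues enter the logarithmic
   densities and flows: lambda^p/p! (log (w_0/(z-a_{i,0})) - c_p/n_0), etc. *)
Definition Linf (i p : nat) (t : V) : L :=
  lam_inf t ^+ p / p`!%:R * (log_winf X i t - lconst (csum p / (n 0)%:R)).
Definition Lpole (i p : nat) (t : V) : L :=
  lam_at t (coef X t i 0%N) ^+ p / p`!%:R *
  (log_w X i t - lconst (csum p / (n i)%:R)).
Definition Lother (i s p : nat) (t : V) : L :=
  lam_at t (coef X t s 0%N) ^+ p / p`!%:R * log_z X i s t.

(* c_{0,j;p} w_0^{(p+1)n_0-j} and c_{i,j;p} w_i^{(p+1)n_i-j} *)
Definition Winf (j p : nat) (t : V) : L :=
  lconst (cnum 0 j p) * winf X t ^+ (p.+1 * n 0 - j).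
Definition Wpole (i j p : nat) (t : V) : L :=
  lconst (cnum i j p) * w X i t ^+ (p.+1 * n i - j).

Definition theta (al : flat_index) (p : nat) (t : V) : C :=
  match al with
  | inl j => - res_inf (Winf j.+1 p t / zinf)
  | inr (existT i j) =>
      if (j < n i.+1)%N then
        res_at (Wpole i.+1 j p t / zat (coef X t i.+1 0%N))
      else
        - res_inf (Linf i.+1 p t / zinf)
        + res_at (Lpole i.+1 p t / zat (coef X t i.+1 0%N))
        + \sum_(1 <= s < m.+1 | s != i.+1)
            res_at (Lother i.+1 s p t / zat (coef X t s 0%N))
  end.

(* d lambda(z) / dT^{al,p} at the loop [u] *)
Definition lam_flow (al : flat_index) (p : nat) (u : R -> V) (z : C) (x : R) : C :=
  \sum_(ga : flat_index) principal_flow eta theta al p u x ga *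
                    pd ga (fun t => lamX t z) (u x).

Definition is_log_branch (a : R -> C) (ell : C -> R -> C) (z : C) (x : R) : Prop :=
  [/\ \forall z' \near z, expC (ell z' x) = z' - a x,
      \forall x' \near x, expC (ell z x') = z - a x',
      derivable (ell^~ x) z 1
    & derivablex (ell z) x].

End Toda.

(* Main.v *)
(* Write Lambda_{al,p} for the germs at the punctures (infinity and the
   a_{s,0}) whose residues against dz/z add up to theta_{al,p}, and
   Lambda_{al,-1} for the corresponding +-w_s^{-j}.  They satisfy
     d Lambda_{al,p} = Lambda_{al,p-1} d lambda + lambda^p/p! d kappa
   for d = d/dz and for the derivatives d_ga in the flat coordinates at fixed
   z, where kappa = log (z - a_{i,0}) if al = t_{i,n_i} and kappa = 0 otherwise.
   The last term is rational with poles at the punctures only, so it does not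
   contribute to sums of residues.

   Differentiating the expansions that define the flat coordinates at fixed
   lambda shows that d_ga lambda / (z lambda') agrees with -Lambda_{ga,-1} at
   the punctures up to terms without residues.  By the residue theorem, eta and
   the product are therefore residues at the punctures: eta is a constant
   antidiagonal matrix, and a tangent vector d is recovered from the residues
   of (d lambda / z) Lambda_{ga,-1}.

   Let d_be lambda d_ga lambda / (z lambda') = K + F, where F is the singular
   part at the critical points.  Then z lambda' F represents d_be o d_ga, and
   d_be d_ga lambda = z K' by Liouville's theorem, the difference being
   regular everywhere.  The recursion for theta follows by parts.  The Euler
   condition comes from lambda Lambda_{al,p-1} = c Lambda_{al,p} + e lambda^p/p!
   with constants c, e.  For the flows, the vector field
   {B + lambda^p/p! kappa, lambda}, B being minus the singular parts of
   Lambda_{al,p}, is tangent, and its pairings with the coordinate fields are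
   the second derivatives of theta_{al,p+1}. *)
From HB Require Import structures.
Require Import Defs.
From mathcomp Require Import all_boot all_order all_algebra.
From mathcomp Require Import all_classical all_reals all_analysis.
From mathcomp.real_closed Require Import complex.
From mathcomp Require Import zify ring.
Import Order.TTheory GRing.Theory Num.Theory.
Import numFieldNormedType.Exports.

Set Implicit Arguments.
Unset Strict Implicit.
Unset Printing Implicit Defensive.

Local Open Scope classical_set_scope.
Local Open Scope ring_scope.

(** * Orders of Laurent series *)

(** Germs in z are formal Laurent series; analysis enters only in the dependence on the flat
    coordinates, on x, and on z when values are taken at the end. The residue theorem and
    Liouville's theorem are therefore statements about partial fractions. Two obstacles shape the
    rest. The expansions at a_{s,0} use the moving parameter z - a_{s,0}, so derivatives at fixed z
    need a correction term, and one notion of derivation has to serve d/dz and the d_ga, on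
    functions and on expansions alike. Moreover a chart provides coefficients that are complex
    differentiable once, while the recursion and the Euler condition involve second derivatives of
    the densities. These are reached without Cauchy's formula: the polar parts of d_ga lambda are
    expressed through lambda, z and the w_s, which are known to be differentiable, and second
    derivatives of the densities commute because the product is commutative. Critical points of
    lambda may be degenerate, so the argument does not pass through canonical coordinates. *)

Section LaurentOrder.
Variable K : fieldType.
Local Notation L := (laurent K).
Implicit Types (f g h : L) (N M k : int).

(** Lower bounds on the order hold for the zero series as well and are stable under sums; the exact
    order [lord] is what survives inversion. *)
Definition lge N f := forall k, k < N -> lcoef f k = 0.
Definition lord N f := lge N f /\ lcoef f N != 0.

Lemma lge_le N M f : M <= N -> lge N f -> lge M f.
Proof. by move=> MN fN k kM; apply: fN; exact: lt_le_trans MN. Qed.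

Lemma lge_ex f : exists N, lge N f.
Proof. exact: lcoef_bounded. Qed.

Lemma lge0 N : lge N 0.
Proof. by []. Qed.

Lemma lgeD N f g : lge N f -> lge N g -> lge N (f + g).
Proof. by move=> fN gN k kN; rewrite lcoefD fN // gN // addr0. Qed.

Lemma lgeN N f : lge N f -> lge N (- f).
Proof. by move=> fN k kN; rewrite lcoefN fN // oppr0. Qed.

Lemma lgeB N f g : lge N f -> lge N g -> lge N (f - g).
Proof. by move=> fN gN; apply: lgeD => //; exact: lgeN. Qed.

Lemma lge_sum N (J : Type) (r : seq J) (P : pred J) (F : J -> L) :
  (forall i, P i -> lge N (F i)) -> lge N (\sum_(i <- r | P i) F i).
Proof. by move=> FN; elim/big_ind: _ => //; exact: lgeD. Qed.

Lemma lcoef_sum (J : Type) (r : seq J) (P : pred J) (F : J -> L) k :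
  lcoef (\sum_(i <- r | P i) F i) k = \sum_(i <- r | P i) lcoef (F i) k.
Proof. exact: (big_morph (fun f : L => lcoef f k)). Qed.

(** The window [N, ..., N + q - 1] only has to contain the indices that contribute. Any larger [q]
    gives the same sum, which allows one [q] for a whole family of series. *)
Lemma lcoefM_sum N f g k (q : nat) : lge N f -> lge (k - N - q%:Z + 1) g ->
  lcoef (f * g) k = \sum_(i < q) lcoef f (i%:Z + N) * lcoef g (k - N - i%:Z).
Proof.
move=> fN gM; pose r : seq int := [seq i%:Z + N | i <- iota 0 q].
have ru : uniq r by rewrite map_inj_uniq ?iota_uniq // => i j /addIr [].
rewrite lcoefM -(fsbig_widen [set` r]) //; last first.
  move=> i /= [_ ir]; case: (ltP i N) => [/fN->|Ni]; first by rewrite mul0r.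
  rewrite [X in _ * X]gM ?mulr0 //; case: (ltP i (q%:Z + N)) => iq; last lia.
  exfalso; apply: ir; apply/mapP; exists (absz (i - N)); last lia.
  by rewrite mem_iota; lia.
rewrite -fsbig_seq // big_map (_ : iota 0 q = index_iota 0 q) ?big_mkord; last first.
  by rewrite /index_iota subn0.
by apply: eq_bigr => i _; congr (_ * lcoef g _); lia.
Qed.

Lemma lgeM N M f g : lge N f -> lge M g -> lge (N + M) (f * g).
Proof.
move=> fN gM k kNM; rewrite (@lcoefM_sum N _ _ _ 0%N) ?big_ord0 //.
by apply: lge_le gM; lia.
Qed.

Lemma lcoefM_low N M f g : lge N f -> lge M g ->
  lcoef (f * g) (N + M) = lcoef f N * lcoef g M.
Proof.
move=> fN gM; rewrite (@lcoefM_sum N _ _ _ 1%N) //; last by apply: lge_le gM; lia.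
by rewrite big_ord1 /= add0r subr0 [N + M]addrC addrK.
Qed.

Lemma lge_const (c : K) : lge 0 (lconst c).
Proof. by move=> k k0; rewrite lcoefC; case: eqP k0 => // ->; rewrite ltxx. Qed.

Lemma lge1 : lge 0 (1 : L).
Proof. by rewrite -(rmorph1 (@lconst K)); exact: lge_const. Qed.

Lemma lgeX N f (q : nat) : lge N f -> lge (q%:Z * N) (f ^+ q).
Proof.
move=> fN; elim: q => [|q IHq]; first by rewrite mul0r; exact: lge1.
by rewrite exprS; apply: lge_le (lgeM fN IHq); lia.
Qed.

Lemma lge_constM N (c : K) f : lge N f -> lge N (lconst c * f).
Proof. by move=> fN; have := lgeM (lge_const c) fN; rewrite add0r. Qed.

Lemma lcoef0M f g : lge 0 f -> lge 0 g -> lcoef (f * g) 0 = lcoef f 0 * lcoef g 0.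
Proof. by move=> f0 g0; rewrite -(lcoefM_low f0 g0). Qed.

Lemma lord_ge N f : lord N f -> lge N f. Proof. by case. Qed.

Lemma lord_neq0 N f : lord N f -> f != 0.
Proof. by case=> _; apply: contra => /eqP ->; rewrite lcoef0. Qed.

Lemma lord_ex f : f != 0 -> exists N, lord N f.
Proof.
move=> f0; have [N fN] := lcoef_natbounded f.
have exn : exists q : nat, lcoef f (q%:Z - N%:Z) != 0.
  apply: contrapT => nex; case/eqP: f0; apply: laurentP => k.
  case: (ltP k (- N%:Z)) => [/fN //|kN]; apply/eqP; apply: contrapT => fk.
  apply: nex; exists (absz (k + N%:Z)); apply/negP => fk'; apply: fk.
  by move: fk'; congr (lcoef f _ == 0); lia.
case: (ex_minnP exn) => v fv vmin; exists (v%:Z - N%:Z); split=> // k kv.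
case: (ltP k (- N%:Z)) => [/fN //|kN]; apply/eqP; apply: contrapT => fk.
have := vmin (absz (k + N%:Z)); have -> : (absz (k + N%:Z))%:Z - N%:Z = k by lia.
by move=> /(_ (introN idP fk)); lia.
Qed.

Lemma lord_inj N M f : lord N f -> lord M f -> N = M.
Proof.
move=> [fN fN0] [fM fM0]; case: (ltgtP N M) => // [/fM|/fN] /eqP.
  by rewrite (negbTE fN0).
by rewrite (negbTE fM0).
Qed.

Lemma lordM N M f g : lord N f -> lord M g -> lord (N + M) (f * g).
Proof.
move=> [fN fN0] [gM gM0]; split; first exact: lgeM.
by rewrite lcoefM_low // mulf_neq0.
Qed.

Lemma lord_const (c : K) : c != 0 -> lord 0 (lconst c).
Proof. by move=> c0; split; [exact: lge_const|rewrite lcoefC]. Qed.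

Lemma lord1 : lord 0 (1 : L).
Proof. by rewrite -(rmorph1 (@lconst K)); apply: lord_const; exact: oner_neq0. Qed.

Lemma lordX N f (q : nat) : lord N f -> lord (q%:Z * N) (f ^+ q).
Proof.
move=> fN; elim: q => [|q IHq]; first by rewrite mul0r; exact: lord1.
rewrite exprS; have -> : q.+1%:Z * N = N + q%:Z * N by lia.
exact: lordM.
Qed.

Lemma lordV N f : lord N f -> lord (- N) f^-1.
Proof.
move=> fN; have f0 := lord_neq0 fN.
have [M gM] := @lord_ex f^-1 (invr_neq0 f0).
have := lordM fN gM; rewrite divff // => /(lord_inj lord1) NM.
by have -> : - N = M by lia.
Qed.

Lemma lcoefV N f : lord N f -> lcoef f^-1 (- N) = (lcoef f N)^-1.
Proof.
move=> fN; have := lcoefM_low (lord_ge fN) (lord_ge (lordV fN)).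
rewrite divff ?(lord_neq0 fN) // subrr lcoef1 eqxx => h.
by apply: (mulfI fN.2); rewrite -h divff // fN.2.
Qed.

Lemma lordVn N f (q : nat) : lord N f -> lord (- (q%:Z * N)) (f ^- q).
Proof. by move=> fN; apply: lordV; exact: lordX. Qed.

Lemma lordN N f : lord N f -> lord N (- f).
Proof. by case=> fN f0; split; [exact: lgeN|rewrite lcoefN oppr_eq0]. Qed.

Lemma lord_lvar : lord 1 (lvar K).
Proof.
split=> [k k1|]; first by rewrite /=; case: eqP k1 => // ->; rewrite ltxx.
exact: oner_neq0.
Qed.

Lemma lord_zinf : lord (-1) (@zinf K).
Proof. exact: lordV lord_lvar. Qed.

Lemma lcoef_zat (c : K) k : lcoef (zat c) k = (k == 0)%:R * c + (k == 1)%:R.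
Proof. by rewrite lcoefD lcoefC /=; case: eqP; rewrite ?mul1r ?mul0r. Qed.

Lemma zatB (c d : K) : zat c - lconst d = zat (c - d).
Proof. by rewrite /zat rmorphB /= addrAC. Qed.

Lemma lord_zat (c : K) : c != 0 -> lord 0 (zat c).
Proof.
move=> c0; split=> [k k0|]; rewrite lcoef_zat; last by rewrite eqxx mul1r addr0.
have [/negbTE-> /negbTE->] : k != 0 /\ k != 1 by split; lia.
by rewrite mul0r addr0.
Qed.

Lemma zat0 : zat (0 : K) = lvar K.
Proof. by rewrite /zat rmorph0 add0r. Qed.

Lemma lge_zat (c : K) : lge 0 (zat c).
Proof.
have [->|/lord_zat/lord_ge//] := eqVneq c 0.
by rewrite zat0; apply: lge_le (lord_ge lord_lvar).
Qed.

Lemma lcoef_lvarM f k : lcoef (lvar K * f) k = lcoef f (k - 1).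
Proof.
rewrite lcoefM -(fsbig_widen [set 1]) //.
  by rewrite fsbig_set1 /= mul1r.
by move=> i /= [_ /eqP/negbTE->]; rewrite mul0r.
Qed.

Lemma lcoef_zinfM f k : lcoef (zinf * f) k = lcoef f (k + 1).
Proof.
rewrite -[in RHS](mulVKf (lord_neq0 lord_lvar) f) lcoef_lvarM.
by congr lcoef; lia.
Qed.

Lemma lge_lord_dvd N M f g : lge N f -> lord M g -> lge (N - M) (f / g).
Proof. by move=> fN /lordV[gM _]; exact: lgeM. Qed.

Lemma lcoef_lderiv f k : lcoef (lderiv f) k = (k + 1)%:~R * lcoef f (k + 1).
Proof. by []. Qed.

Lemma lderivD f g : lderiv (f + g) = lderiv f + lderiv g.
Proof. by apply: laurentP => k; rewrite lcoefD !lcoef_lderiv lcoefD mulrDr. Qed.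

Lemma lderivM f g : lderiv (f * g) = lderiv f * g + f * lderiv g.
Proof.
apply: laurentP => k; have [N fN] := lcoef_bounded f; have [M gM] := lcoef_bounded g.
(* [lderiv f] may have order [N - 1], so all three products are summed from this common start. *)
pose N1 := N - 1; have fN1 : lge N1 f by apply: lge_le fN; lia.
have dfN : lge N1 (lderiv f).
  by move=> i iN; rewrite lcoef_lderiv fN ?mulr0 //; lia.
have dgM : lge (M - 1) (lderiv g).
  by move=> i iN; rewrite lcoef_lderiv gM ?mulr0 //; lia.
pose q := absz (k + 3 - N1 - M)%R.
rewrite lcoefD lcoef_lderiv (@lcoefM_sum N1 _ _ _ q.+1) //; last first.
  by apply: lge_le gM; lia.
rewrite (@lcoefM_sum N1 _ _ _ q) //; last by apply: lge_le gM; lia.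
rewrite (@lcoefM_sum N1 _ _ _ q.+1) //; last by apply: lge_le dgM; lia.
rewrite mulr_sumr; pose a (i : nat) := (i%:Z + N1)%:~R * (lcoef f (i%:Z + N1) *
  lcoef g (k + 1 - N1 - i%:Z)).
have -> : \sum_(i < q) lcoef (lderiv f) (i%:Z + N1) * lcoef g (k - N1 - i%:Z) =
    \sum_(i < q.+1) a i.
  rewrite big_ord_recl {1}/a fN ?mul0r ?mulr0 ?add0r; last lia.
  apply: eq_bigr => i _; rewrite /a lcoef_lderiv -mulrA /= /bump leq0n add1n.
  have -> : i.+1%:Z + N1 = i%:Z + N1 + 1 by lia.
  by have -> : k + 1 - N1 - i.+1%:Z = k - N1 - i%:Z by lia.
rewrite -big_split; apply: eq_bigr => i _; rewrite lcoef_lderiv /a.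
have -> : k - N1 - i%:Z + 1 = k + 1 - N1 - i%:Z by lia.
have -> : (k + 1 - N1 - i%:Z)%:~R = (k + 1)%:~R - (i%:Z + N1)%:~R :> K.
  by rewrite -rmorphB; congr (_%:~R); lia.
rewrite /=; move: (k + 1)%:~R (_ + N1)%:~R (lcoef f _) (lcoef g _) => x y u v; ring.
Qed.

Lemma lderiv_const (c : K) : lderiv (lconst c) = 0.
Proof.
apply: laurentP => k; rewrite lcoef_lderiv lcoefC lcoef0.
by case: eqP => [->|_]; rewrite ?mul0r ?mulr0.
Qed.

Lemma lderiv_lvar : lderiv (lvar K) = 1.
Proof.
apply: laurentP => k; rewrite lcoef_lderiv lcoef1 /=.
rewrite (_ : (k + 1 == 1) = (k == 0)); last by lia.
by case: eqP => [->|_]; rewrite ?mulr0 // mulr1.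
Qed.

Lemma lderiv_zat (c : K) : lderiv (zat c) = 1.
Proof. by rewrite /zat lderivD lderiv_const lderiv_lvar add0r. Qed.

Lemma lge_lderiv N f : lge N f -> lge (N - 1) (lderiv f).
Proof. by move=> fN k kN; rewrite lcoef_lderiv fN ?mulr0 //; lia. Qed.

Lemma lge0_lderiv f : lge 0 f -> lge 0 (lderiv f).
Proof.
move=> f0 k k0; rewrite lcoef_lderiv; have [->|k1] := eqVneq k (-1).
  by rewrite mul0r.
by rewrite f0 ?mulr0 //; lia.
Qed.

(** [None] is infinity with local parameter x = 1/z. There d/dz = - x^2 d/dx, whence the form of
    [dzo], the derivation d/dz at every point of the projective line. *)
Definition zo (o : option K) : L := if o is Some c then zat c else zinf.
Definition dzo (o : option K) f : L :=
  if o is Some _ then lderiv f else - (lvar K ^+ 2 * lderiv f).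
Definition reso (o : option K) f : K :=
  if o is Some _ then res_at f else res_inf f.

Lemma dzoD o f g : dzo o (f + g) = dzo o f + dzo o g.
Proof. by case: o => [c|] /=; rewrite lderivD // mulrDr opprD. Qed.

Lemma dzoM o f g : dzo o (f * g) = dzo o f * g + f * dzo o g.
Proof.
case: o => [c|] /=; rewrite lderivM // mulrDr opprD mulNr mulrN mulrA.
by congr (_ - _); rewrite mulrCA.
Qed.

Lemma dzo_const o (c : K) : dzo o (lconst c) = 0.
Proof. by case: o => [d|] /=; rewrite lderiv_const // mulr0 oppr0. Qed.

Lemma dzo_zo o : dzo o (zo o) = 1.
Proof.
case: o => [c|]; first exact: lderiv_zat.
have v0 := lord_neq0 lord_lvar.
have := lderivM (lvar K) (lvar K)^-1; rewrite divff // lderiv_lvar mul1r.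
rewrite -(rmorph1 (@lconst K)) lderiv_const => /esym/eqP; rewrite addr_eq0 => /eqP h.
rewrite /= /zinf -[RHS](divff v0) {2}h expr2 -mulrA.
by rewrite mulrN.
Qed.

Lemma reso_is_zmod o : zmod_morphism (reso o).
Proof.
by move=> f g; case: o => [c|] //=; rewrite /res_inf lcoefD lcoefN opprD.
Qed.
HB.instance Definition _ o := GRing.isZmodMorphism.Build L K (reso o) (reso_is_zmod o).

Lemma reso_constM o (c : K) f : reso o (lconst c * f) = c * reso o f.
Proof. by case: o => [d|] /=; [exact: lcoefCM|rewrite /res_inf lcoefCM mulrN]. Qed.

Lemma reso_dzo o f : reso o (dzo o f) = 0.
Proof.
case: o => [c|] /=; rewrite ?/res_at ?/res_inf ?lcoef_lderiv ?mul0r //.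
by rewrite lcoefN opprK expr2 -mulrA !lcoef_lvarM lcoef_lderiv mul0r.
Qed.

(** The bound is 2 at infinity because dz has a double pole there. *)
Lemma lge_reso o f : lge (if o is Some _ then 0 else 2) f -> reso o f = 0.
Proof. by case: o => [c|] f0; rewrite /= ?/res_at ?/res_inf f0 ?oppr0. Qed.

Lemma lge_res_at f : lge 0 f -> res_at f = 0.
Proof. exact. Qed.

Lemma lge_dzo o N f : lge N f -> lge (if o is Some _ then N - 1 else N + 1) (dzo o f).
Proof.
move/lge_lderiv; case: o => [c|] //= fN; apply: lgeN.
have := lgeM (@lgeX _ _ 2 (lord_ge lord_lvar)) fN.
by apply: lge_le; lia.
Qed.

End LaurentOrder.

Arguments lcoef : simpl never.

(** * Rational functions and their residues *)

Section Rational.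
Variable K : closedFieldType.
Local Notation L := (laurent K).
Implicit Types (p q : {poly K}) (o : option K) (f g : option K -> L).

Definition pe p o : L := (map_poly (@lconst K) p).[zo o].

Lemma peD p q o : pe (p + q) o = pe p o + pe q o.
Proof. by rewrite /pe rmorphD hornerD. Qed.
Lemma peN p o : pe (- p) o = - pe p o.
Proof. by rewrite /pe rmorphN hornerN. Qed.
Lemma peM p q o : pe (p * q) o = pe p o * pe q o.
Proof. by rewrite /pe rmorphM hornerM. Qed.
Lemma peC (c : K) o : pe c%:P o = lconst c.
Proof. by rewrite /pe map_polyC hornerC. Qed.
Lemma peX o : pe 'X o = zo o.
Proof. by rewrite /pe map_polyX hornerX. Qed.
Lemma peXn p k o : pe (p ^+ k) o = pe p o ^+ k.
Proof. by rewrite /pe rmorphXn horner_exp. Qed.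
Lemma pe0 o : pe 0 o = 0. Proof. by rewrite /pe rmorph0 horner0. Qed.
Lemma peXsubC (c : K) o : pe ('X - c%:P) o = zo o - lconst c.
Proof. by rewrite peD peN peX peC. Qed.

Lemma zoB_neq0 o (c : K) : zo o - lconst c != 0.
Proof.
case: o => [d|] /=; apply/eqP.
  move=> /(congr1 (fun f : L => lcoef f 1)); rewrite zatB lcoef_zat mul0r add0r lcoef0.
  by move/eqP; rewrite oner_eq0.
move=> /(congr1 (fun f : L => lcoef f (-1))); rewrite lcoefD lcoefN lcoefC subr0 lcoef0.
by move/eqP; rewrite (negbTE (lord_zinf K).2).
Qed.

(** Over an algebraically closed field it is enough that linear factors have nonzero expansions. *)
Lemma pe_neq0 p o : p != 0 -> pe p o != 0.
Proof.
move=> p0; have [r ->] := closed_field_poly_normal p.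
rewrite -mul_polyC peM peC mulf_neq0 ?(lord_neq0 (lord_const _)) ?lead_coef_eq0 //.
elim: r => [|c r IHr]; first by rewrite big_nil -polyC1 peC rmorph1 oner_neq0.
by rewrite big_cons peM mulf_neq0 // peXsubC zoB_neq0.
Qed.

Lemma lge_pe p (c : K) : lge 0 (pe p (Some c)).
Proof.
elim/poly_ind: p => [|p a IHp]; first by rewrite pe0.
rewrite peD peM peX peC; apply: lgeD; last exact: lge_const.
by have := lgeM IHp (lge_zat c); rewrite addr0.
Qed.

Lemma lcoef_pe p (c : K) : lcoef (pe p (Some c)) 0 = p.[c].
Proof.
elim/poly_ind: p => [|p a IHp]; first by rewrite pe0 horner0.
rewrite peD peM peX peC lcoefD lcoef0M ?IHp; [|exact: lge_pe|exact: lge_zat].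
by rewrite lcoef_zat lcoefC eqxx hornerMXaddC mul1r addr0.
Qed.

Lemma lord_pe p (c : K) : ~~ root p c -> lord 0 (pe p (Some c)).
Proof. by move=> pc; split; [exact: lge_pe|rewrite lcoef_pe]. Qed.

Lemma lordD N M (u v : L) : lord N u -> lge M v -> N < M -> lord N (u + v).
Proof.
move=> [uN u0] vM NM; split; first by apply: lgeD => //; apply: lge_le vM; exact: ltW.
by rewrite lcoefD vM // addr0.
Qed.

Lemma lord_pe_inf p : p != 0 -> lord (- (size p).-1%:Z) (pe p None).
Proof.
elim/poly_ind: p => [|p c IHp]; first by rewrite eqxx.
rewrite peD peM peX peC size_MXaddC; have [->|p0] := eqVneq p 0.
  rewrite pe0 !mul0r !add0r /= => c0; have {}c0 : c != 0.
    by apply: contraNneq c0 => ->; rewrite polyC0.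
  by rewrite (negbTE c0) size_poly0; exact: lord_const.
move=> _ /=; have sp : (0 < size p)%N by rewrite size_poly_gt0.
have h := lordM (IHp p0) (lord_zinf K).
have -> : - (size p)%:Z = - (size p).-1%:Z + -1 by lia.
by apply: lordD h (lge_const c) _; lia.
Qed.

(** A rational function is represented by all its expansions at once, so that orders and residues at
    different points refer to the same function. *)
Definition ratl f := exists p q, q != 0 /\ forall o, f o = pe p o / pe q o.

Lemma ratl_ext f g : (forall o, f o = g o) -> ratl f -> ratl g.
Proof. by move=> fg [p [q [q0 fE]]]; exists p, q; split=> // o; rewrite -fg. Qed.

Lemma ratl_pe p : ratl (pe p).
Proof.
by exists p, 1; split=> [|o]; rewrite ?oner_neq0 // -polyC1 peC rmorph1 divr1.
Qed.

Lemma ratl_const (c : K) : ratl (fun=> lconst c).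
Proof. by apply: ratl_ext (ratl_pe c%:P) => o; rewrite peC. Qed.

Lemma ratl_zo : ratl (@zo K).
Proof. by apply: ratl_ext (ratl_pe 'X) => o; rewrite peX. Qed.

Lemma ratlD f g : ratl f -> ratl g -> ratl (fun o => f o + g o).
Proof.
move=> [p [q [q0 fE]]] [r [s [s0 gE]]]; exists (p * s + r * q), (q * s).
split=> [|o]; first exact: mulf_neq0.
by rewrite fE gE peD !peM addf_div ?pe_neq0.
Qed.

Lemma ratlM f g : ratl f -> ratl g -> ratl (fun o => f o * g o).
Proof.
move=> [p [q [q0 fE]]] [r [s [s0 gE]]]; exists (p * r), (q * s).
split=> [|o]; first exact: mulf_neq0.
by rewrite fE gE !peM mulf_div.
Qed.

Lemma ratlN f : ratl f -> ratl (fun o => - f o).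
Proof.
move=> [p [q [q0 fE]]]; exists (- p), q; split=> // o.
by rewrite fE peN mulNr.
Qed.

Lemma ratlB f g : ratl f -> ratl g -> ratl (fun o => f o - g o).
Proof. by move=> f_ g_; apply: ratlD => //; exact: ratlN. Qed.

Lemma ratlV f : ratl f -> ratl (fun o => (f o)^-1).
Proof.
move=> [p [q [q0 fE]]]; have [p0|p0] := eqVneq p 0.
  by exists 0, 1; split=> [|o]; rewrite ?oner_neq0 // fE p0 pe0 !mul0r invr0.
by exists q, p; split=> // o; rewrite fE invf_div.
Qed.

Lemma ratlX f k : ratl f -> ratl (fun o => f o ^+ k).
Proof.
move=> fr; elim: k => [|k IHk].
  by apply: ratl_ext (ratl_const 1) => o; rewrite rmorph1.
by apply: ratl_ext (ratlM fr IHk) => o; rewrite exprS.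
Qed.

Lemma ratlVn f k : ratl f -> ratl (fun o => f o ^- k).
Proof. by move=> /(ratlX k)/ratlV. Qed.

Lemma ratl_sum (J : Type) (r : seq J) (P : pred J) (F : J -> option K -> L) :
  (forall i, P i -> ratl (F i)) -> ratl (fun o => \sum_(i <- r | P i) F i o).
Proof.
move=> Fr; elim: r => [|i r IHr].
  by apply: ratl_ext (ratl_const 0) => o; rewrite big_nil rmorph0.
case Pi: (P i); last by apply: ratl_ext IHr => o; rewrite big_cons Pi.
by apply: ratl_ext (ratlD (Fr i Pi) IHr) => o; rewrite big_cons Pi.
Qed.

Lemma ratl_nat (k : nat) : ratl (fun=> k%:R).
Proof. by apply: ratl_ext (ratl_const k%:R) => o; rewrite rmorph_nat. Qed.

Lemma ratl_neq0 f o : ratl f -> f o != 0 -> forall o', f o' != 0.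
Proof.
move=> [p [q [q0 fE]]]; have [p0|p0] := eqVneq p 0; first by rewrite fE p0 pe0 mul0r eqxx.
by move=> _ o'; rewrite fE mulf_neq0 ?invr_neq0 ?pe_neq0.
Qed.

Lemma dzo_pe p o : dzo o (pe p o) = pe p^`() o.
Proof.
elim/poly_ind: p => [|p c IHp].
  by rewrite deriv0 pe0 -(rmorph0 (@lconst K)) dzo_const rmorph0.
rewrite peD peM peX peC dzoD dzoM IHp dzo_const dzo_zo derivD derivM derivX derivC.
by rewrite !peD !peM peX -polyC1 !peC rmorph0 !rmorph1.
Qed.

Lemma dzoV o (u : L) : dzo o u^-1 = - (dzo o u / u ^+ 2).
Proof.
have [->|u0] := eqVneq u 0.
  by rewrite invr0 -(rmorph0 (@lconst K)) dzo_const rmorph0 mul0r oppr0.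
have := dzoM o u u^-1; rewrite divff // -(rmorph1 (@lconst K)) dzo_const.
move=> /esym/eqP; rewrite addrC addr_eq0 => /eqP h.
by apply: (mulfI u0); rewrite h; field.
Qed.

Lemma ratl_dzo f : ratl f -> ratl (fun o => dzo o (f o)).
Proof.
move=> [p [q [q0 fE]]].
apply: (@ratl_ext (fun o => pe p^`() o / pe q o - pe p o * (pe q^`() o / pe q o ^+ 2))).
  by move=> o; rewrite fE dzoM dzoV !dzo_pe mulrN.
apply: ratlB; first by apply: ratlM; [|apply: ratlV]; exact: ratl_pe.
by do ?[apply: ratlM|apply: ratlVn|exact: ratl_pe].
Qed.

Lemma ratl_ord0 f o : ratl f -> f o != 0 ->
  exists r : seq K, forall c, c \notin r -> lord 0 (f (Some c)).
Proof.
move=> [p [q [q0 fE]]] fo; have p0 : p != 0.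
  by apply: contraNneq fo => p0; rewrite fE p0 pe0 mul0r.
have [r rE] := closed_field_poly_normal (p * q).
have pq0 : lead_coef (p * q) != 0 by rewrite lead_coef_eq0 mulf_neq0.
exists r => c cr; have : ~~ root (p * q) c by rewrite rE rootZ // root_prod_XsubC.
rewrite rootM negb_or fE => /andP[/lord_pe pc /lord_pe/lordV qc].
by have := lordM pc qc; rewrite oppr0 addr0.
Qed.

(** The shifted exponent makes each term with a finite point a genuine pole; constants occur only in
    the polynomial part, under [None]. *)
Definition pterm (x : option K * nat * K) o : L :=
  lconst x.2 *
  if x.1.1 is Some a then (zo o - lconst a) ^- x.1.2.+1 else zo o ^+ x.1.2.
Definition pfr (l : seq (option K * nat * K)) o : L := \sum_(x <- l) pterm x o.

Lemma ratl_pterm x : ratl (pterm x).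
Proof.
case: x => [[[a|] k] c]; apply: ratlM (ratl_const c) _ => /=.
  by apply: ratlVn; apply: ratlB; [exact: ratl_zo|exact: ratl_const].
by apply: ratlX; exact: ratl_zo.
Qed.

Lemma ratl_pfr l : ratl (pfr l).
Proof. by apply: ratl_sum => x _; exact: ratl_pterm. Qed.

Lemma ratl_pfrP f : ratl f -> exists l, forall o, f o = pfr l o.
Proof.
move=> [p [q [q0 fE]]]; have [k] := ubnP (size q).
elim: k => // k IHk in p q q0 f fE *; rewrite ltnS => sq.
case: (eqVneq (size q) 1%N) => [/eqP/size_poly1P[c c0 qE]|].
  exists [seq (None, i, p`_i / c) | i <- index_iota 0 (size p)] => o.
  rewrite fE qE peC /pe horner_coef size_map_poly mulr_suml /pfr big_map big_mkord.
  apply: eq_bigr => i _; rewrite /pterm /= coef_map /= rmorphM fmorphV.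
  by rewrite mulrAC.
move/closed_rootP => [c qc]; have [j [q1 q1c qE]] := multiplicity_XsubC q c.
have {}q1c : ~~ root q1 c by move/implyP: q1c; apply.
have j0 : (0 < j)%N.
  by rewrite lt0n; apply: contraTneq qc => j0; rewrite qE j0 expr0 mulr1.
(* The coefficient of the polar term of order [j] at [c]; once that term is removed, numerator and
   denominator share a factor z - c. *)
pose a := p.[c] / q1.[c].
have /factor_theorem[p2 p2E] : root (p - a *: q1) c.
  by rewrite /root hornerD hornerN hornerZ divfK ?subrr.
have q10 : q1 != 0 by apply: contraNneq q1c => ->; rewrite root0.
pose q2 := q1 * ('X - c%:P) ^+ j.-1.
have q2E : q = q2 * ('X - c%:P) by rewrite qE /q2 -mulrA -exprSr prednK.
have q20 : q2 != 0 by apply: contraNneq q0 => q20; rewrite q2E q20 mul0r.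
have [] := IHk p2 q2 q20 (fun o => pe p2 o / pe q2 o) (fun o => erefl).
  by move: sq; rewrite q2E size_Mmonic ?monicXsubC // size_XsubC addn2 /=.
move=> l lE; exists ((Some c, j.-1, a) :: l) => o; rewrite /pfr big_cons -/(pfr l o) -lE.
have pE : p = p2 * ('X - c%:P) + a *: q1 by rewrite -p2E subrK.
rewrite fE pE /pterm /= peD -mul_polyC !peM peC mulrDl addrC; congr (_ + _).
  rewrite qE peM peXn peXsubC -mulrA invfM mulVKf ?pe_neq0 //.
  by rewrite prednK.
rewrite (_ : pe q o = pe q2 o * pe ('X - c%:P) o); last by rewrite q2E peM.
by rewrite peM -[pe q1 o * _]peM -/q2 invfM mulrACA mulfV ?mulr1 // pe_neq0 ?polyXsubC_eq0.
Qed.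

Lemma lge_pterm x (c : K) : x.1.1 != Some c -> lge 0 (pterm x (Some c)).
Proof.
case: x => [[[a|] k] d] /= xc; rewrite /pterm /=; apply: lge_constM.
  have ac : c - a != 0 by apply: contraNneq xc => /eqP; rewrite subr_eq0 => /eqP ->.
  by rewrite zatB; have [] := lordVn k.+1 (lord_zat ac); rewrite mulr0 oppr0.
by have := @lgeX _ _ _ k (lge_zat c); rewrite mulr0.
Qed.

Lemma lcoef_zinfX k (j : int) : lcoef (@zinf K ^+ k) j = (j == - k%:Z)%:R.
Proof.
elim: k j => [|k IHk] j; first by rewrite expr0 lcoef1 oppr0.
by rewrite exprS lcoef_zinfM IHk; congr (nat_of_bool _)%:R; lia.
Qed.

Lemma lcoef_lvarX k (j : int) : lcoef (lvar K ^+ k) j = (j == k%:Z)%:R.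
Proof.
elim: k j => [|k IHk] j; first by rewrite expr0 lcoef1.
by rewrite exprS lcoef_lvarM IHk; congr (nat_of_bool _)%:R; lia.
Qed.

Lemma lord_zinfB (a : K) : lord (-1) (zinf - lconst a).
Proof. by apply: lordD (lord_zinf K) (lgeN (lge_const a)) _. Qed.

Lemma lcoef_zinfB (a : K) : lcoef (zinf - lconst a) (-1) = 1.
Proof. by rewrite lcoefD lcoefN lcoefC subr0 -[zinf]expr1 lcoef_zinfX. Qed.

(** Only multiples of 1/(z - a) have nonzero residues, and those of 1/(z - a) are 1 at [a] and -1 at
    infinity. *)
Lemma residue_pterm x (r : seq K) : uniq r -> (forall a, x.1.1 = Some a -> a \in r) ->
  \sum_(c <- r) reso (Some c) (pterm x (Some c)) + reso None (pterm x None) = 0.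
Proof.
case: x => [[[a|] k] d] ur xr; last first.
  rewrite big1 ?add0r => [|c _]; last by apply: lge_res_at; exact: lge_pterm.
  by rewrite /= /res_inf lcoefCM lcoef_zinfX (_ : _ == _ = false) ?mulr0 ?oppr0 //; lia.
rewrite (bigD1_seq a) ?xr // big1_seq => [|c /andP[ca _]]; last first.
  by apply: lge_res_at; apply: lge_pterm; apply: contraNneq ca => -[->].
rewrite /= addr0 /res_at /res_inf /pterm /= !lcoefCM zatB subrr zat0.
case: k {xr} => [|k].
  rewrite !expr1 -[(lvar K)^-1]expr1 lcoef_zinfX -[X in _ - d * lcoef _ X]opprK.
  by rewrite (lcoefV (lord_zinfB a)) lcoef_zinfB invr1 subrr.
rewrite -exprVn lcoef_zinfX (_ : _ == _ = false) ?mulr0 ?add0r; last by lia.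
by rewrite (lord_ge (lordVn k.+2 (lord_zinfB a))) ?mulr0 ?oppr0 //; lia.
Qed.

Theorem residue_theorem f (r : seq K) : ratl f -> uniq r ->
  (forall c, c \notin r -> lge 0 (f (Some c))) ->
  \sum_(c <- r) reso (Some c) (f (Some c)) + reso None (f None) = 0.
Proof.
move=> /ratl_pfrP[l fE] ur freg.
(* The poles of the single partial fractions are added to [r]; [f] is regular at the new points,
   which contribute nothing. *)
pose r' := undup (r ++ pmap (fun x => x.1.1) l).
have rr' : {subset r <= r'} by move=> c cr; rewrite mem_undup mem_cat cr.
have -> : \sum_(c <- r) reso (Some c) (f (Some c)) =
          \sum_(c <- r') reso (Some c) (f (Some c)).
  rewrite [RHS](bigID (mem r)) /= [X in _ = _ + X]big1 ?addr0 => [|c cr]; last first.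
    by apply: lge_res_at; exact: freg.
  rewrite -[RHS]big_filter; apply: perm_big; apply: uniq_perm => //.
    by rewrite filter_uniq ?undup_uniq.
  move=> c; rewrite mem_filter; have [cr|//] := boolP (c \in r); apply/esym.
  by rewrite /= rr'.
under eq_bigr do rewrite fE raddf_sum.
rewrite fE raddf_sum exchange_big -big_split big1_seq // => x /andP[_ xl].
apply: residue_pterm => [|a xa]; first exact: undup_uniq.
rewrite mem_undup mem_cat mem_pmap orbC -xa.
by apply/orP; left; apply/mapP; exists x.
Qed.

(** The partial fractions are distributed according to the location of their poles. The polynomial
    part goes to [g], hence [h] vanishes at infinity. *)
Lemma ratl_split f (S : pred K) : ratl f -> exists g h,
  [/\ ratl g /\ ratl h, forall o, f o = g o + h o,
      forall c, ~~ S c -> lge 0 (g (Some c)),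
      forall c, S c -> lge 0 (h (Some c)) & lge 1 (h None)].
Proof.
move=> /ratl_pfrP[l fE].
pose P (x : option K * nat * K) := if x.1.1 is Some a then S a else true.
exists (pfr (seq.filter P l)), (pfr (seq.filter (predC P) l)); split.
- by split; exact: ratl_pfr.
- by move=> o; rewrite fE /pfr !big_filter (bigID P).
- move=> c Sc; rewrite /pfr big_filter; apply: lge_sum => x Px; apply: lge_pterm.
  by apply: contraNneq Sc => xc; move: Px; rewrite /P xc.
- move=> c Sc; rewrite /pfr big_filter; apply: lge_sum => x /= Px; apply: lge_pterm.
  by apply: contraNneq Px => xc; rewrite /P xc.
rewrite /pfr big_filter; apply: lge_sum => -[[[a|] k] d] // _; rewrite /pterm /=.
apply: lge_constM; have := lord_ge (lordVn k.+1 (lord_zinfB a)).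
by apply: lge_le; lia.
Qed.

(** At a root of the denominator the numerator vanishes as well, since otherwise there would be a
    pole; cancelling common factors leaves a constant denominator. *)
Lemma ratl_regular f : ratl f -> (forall c, lge 0 (f (Some c))) ->
  exists p, forall o, f o = pe p o.
Proof.
move=> [p [q [q0 fE]]] freg; have [k] := ubnP (size q).
elim: k => // k IHk in p q q0 fE *; rewrite ltnS => sq.
case: (eqVneq (size q) 1%N) => [/eqP/size_poly1P[c c0 qE]|].
  by exists (c^-1 *: p) => o; rewrite fE qE -mul_polyC peM !peC fmorphV mulrC.
move/closed_rootP => [c qc].
have pc : root p c.
  apply/negPn/negP => pc; have := freg c; have /lord_ex[N qN] := pe_neq0 (Some c) q0.
  have N0 : 0 < N.
    rewrite ltNge; apply/negP => N0; case: qN => qN /eqP; apply.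
    case: (ltgtP N 0) N0 => // [N0 _|-> _]; first exact: lge_pe.
    by rewrite lcoef_pe; apply/eqP.
  have h := lordM (lord_pe pc) (lordV qN); rewrite -fE in h.
  by move=> fc; case: h => _; rewrite fc ?eqxx //; lia.
have /factor_theorem[p1 p1E] := pc; have /factor_theorem[q1 q1E] := qc.
have q10 : q1 != 0 by apply: contraNneq q0 => q10; rewrite q1E q10 mul0r.
apply: (IHk p1 q1 q10) => [z|].
  by rewrite fE p1E q1E !peM -mulf_div divff ?mulr1 // pe_neq0 ?polyXsubC_eq0.
by move: sq; rewrite q1E size_Mmonic ?monicXsubC // size_XsubC addn2 /=.
Qed.

Theorem liouville f : ratl f -> (forall c, lge 0 (f (Some c))) -> lge 0 (f None) ->
  exists k, forall o, f o = lconst k.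
Proof.
move=> fr freg finf; have [p fE] := ratl_regular fr freg.
have [p0|p0] := eqVneq p 0; first by exists 0 => o; rewrite fE p0 pe0 rmorph0.
have sp : (size p <= 1)%N.
  rewrite leqNgt; apply/negP => sp; have [_] := lord_pe_inf p0.
  by rewrite -fE finf ?eqxx //; lia.
by exists p`_0 => o; rewrite fE (size1_polyC sp) peC coefC.
Qed.

Corollary liouville0 f : ratl f -> (forall c, lge 0 (f (Some c))) -> lge 1 (f None) ->
  forall o, f o = 0.
Proof.
move=> fr freg finf; have [|k fE o] := liouville fr freg; first exact: lge_le finf.
by have := finf 0 isT; rewrite !fE lcoefC eqxx => ->; rewrite rmorph0.
Qed.

End Rational.

(** * Derivatives along real curves *)

Section RealCurves.
Variable R : realType.
Local Notation C := (Cx R).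
Local Notation Re := complex.Re.
Local Notation Im := complex.Im.

Lemma normC_real (r : R) : `|r%:C%C : C| = `|r|%:C%C.
Proof. by rewrite normc_def /= expr0n addr0 sqrtr_sqr. Qed.

Lemma gtC0 (e : C) : 0 < e -> e = (Re e)%:C%C /\ 0 < Re e.
Proof. by case: e => a b; rewrite ltcE /= => /andP[/eqP -> ->]. Qed.

Lemma norm_Re (z : C) : `|Re z|%:C%C <= `|z|.
Proof. exact: normc_ge_Re. Qed.

Lemma norm_Im (z : C) : `|Im z|%:C%C <= `|z|.
Proof.
rewrite normc_def lecR -sqrtr_sqr ler_sqrt ?addr_ge0 ?sqr_ge0 //.
by rewrite lerDr sqr_ge0.
Qed.

Lemma norm_ReIm (z : C) : `|z| <= (`|Re z| + `|Im z|)%:C%C.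
Proof.
rewrite normc_def lecR -(@ler_pXn2r _ 2) ?nnegrE ?addr_ge0 ?sqrtr_ge0 //.
rewrite sqr_sqrtr ?addr_ge0 ?sqr_ge0 // sqrrD !real_normK ?num_real //.
by rewrite lerD2r lerDl mulrn_wge0 // mulr_ge0.
Qed.

Lemma cvgC (T : Type) (F : set_system T) (FF : Filter F) (f : T -> C) (l : C) :
  f x @[x --> F] --> l <->
  Re (f x) @[x --> F] --> Re l /\ Im (f x) @[x --> F] --> Im l.
Proof.
split=> [/cvgrPdist_lt fl|[/cvgrPdist_lt fr /cvgrPdist_lt fi]].
  split; apply/cvgrPdist_lt => e e0.
    have := fl e%:C%C; rewrite ltcR => /(_ e0); apply: filterS => x h.
    by rewrite -ltcR; apply: le_lt_trans h; rewrite -raddfB; exact: norm_Re.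
  have := fl e%:C%C; rewrite ltcR => /(_ e0); apply: filterS => x h.
  by rewrite -ltcR; apply: le_lt_trans h; rewrite -raddfB; exact: norm_Im.
apply/cvgrPdist_lt => e /gtC0[-> e0]; have e2 : 0 < Re e / 2 by rewrite divr_gt0.
near=> x; apply: le_lt_trans (norm_ReIm _) _; rewrite ltcR !raddfB /= [ltRHS]splitr.
by apply: ltrD; near: x; [exact: fr|exact: fi].
Unshelve. all: by end_near. Qed.

(** The derivative along a real curve in a complex normed space. It links [derivx], which is defined
    by real and imaginary parts, to complex differentials in the flat coordinates. *)
Definition cder (W : normedModType C) (u : R -> W) (x : R) (w : W) : Prop :=
  (h%:C%C : C)^-1 *: (u (h + x) - u x) @[h --> 0^'] --> w.

Lemma Re_scale (r : R) (z : C) : Re ((r%:C%C : C)^-1 *: z) = r^-1 * Re z.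
Proof.
by rewrite -fmorphV; case: z => a b; rewrite /GRing.scale /= mul0r subr0.
Qed.

Lemma Im_scale (r : R) (z : C) : Im ((r%:C%C : C)^-1 *: z) = r^-1 * Im z.
Proof.
by rewrite -fmorphV; case: z => a b; rewrite /GRing.scale /= mul0r addr0.
Qed.

Lemma cderE (f : R -> C) x (l : C) : cder f x l <->
  is_derive x 1 (fun y => Re (f y)) (Re l) /\ is_derive x 1 (fun y => Im (f y)) (Im l).
Proof.
have dE (g : R -> R) (d : R) :
    h^-1 * (g (h + x) - g x) @[h --> 0^'] --> d <-> is_derive x 1 g d.
  have E : (fun h => h^-1 *: (g (h *: 1 + x) - g x)) = (fun h => h^-1 * (g (h + x) - g x)).
    by apply/funext => h; rewrite /GRing.scale /= mulr1.
  split=> [gd|gd].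
    apply: DeriveDef; first by rewrite /derivable E; apply/cvg_ex; exists d.
    by rewrite /derive E; exact: cvg_lim.
  have := @ex_derive _ _ _ _ _ _ _ gd; rewrite /derivable E.
  by have := @derive_val _ _ _ _ _ _ _ gd; rewrite /derive E => <-.
rewrite /cder cvgC -!dE.
have -> : (fun h : R => Re ((h%:C%C : C)^-1 *: (f (h + x) - f x))) =
    (fun h => h^-1 * (Re (f (h + x)) - Re (f x))).
  by apply/funext => h; rewrite Re_scale raddfB.
have -> // : (fun h : R => Im ((h%:C%C : C)^-1 *: (f (h + x) - f x))) =
    (fun h => h^-1 * (Im (f (h + x)) - Im (f x))).
by apply/funext => h; rewrite Im_scale raddfB.
Qed.

Lemma cderP (f : R -> C) x (l : C) :
  cder f x l <-> derivablex f x /\ derivx f x = l.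
Proof.
rewrite cderE; split=> [[dr di]|[[dr di] <-]].
  split; first by split; apply: ex_derive.
  rewrite /derivx !derive1E (derive_val (is_derive := dr)) (derive_val (is_derive := di)).
  by case: l {dr di}.
by have := derivableP dr; have := derivableP di; rewrite -!derive1E.
Qed.

Lemma cder_bound (W : normedModType C) (u : R -> W) x w : cder u x w ->
  exists2 M : C, 0 < M &
    \forall h \near (0 : R), `|u (h + x) - u x| <= `|h%:C%C : C| * M.
Proof.
move=> ux; pose q h := (h%:C%C : C)^-1 *: (u (h + x) - u x).
pose M : C := `|w| + 1.
have M0 : 0 < M by rewrite ltr_wpDl.
have qM : \forall h \near 0^', `|q h| <= M.
  have hn : \forall h \near (0 : R)^', `|w - q h| < 1 by exact: cvgr_dist_lt ux _ ltr01.
  near=> h; have qh : `|w - q h| < 1 by near: h; exact: hn.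
  rewrite -(subrK w (q h)).
  by rewrite (le_trans (ler_normD _ _)) // addrC lerD2l distrC ltW.
exists M; first exact: M0.
have qM0 : \forall h \near (0 : R), h != 0 -> `|q h| <= M by exact: qM.
near=> h; have qh : h != 0 -> `|q h| <= M by near: h; exact: qM0.
have [->|h0] := eqVneq h 0; first by rewrite add0r subrr !normr0 mul0r.
have hC : (h%:C%C : C) != 0 by rewrite (inj_eq (@complexI R)).
rewrite -[_ - _](scalerKV hC) normrZ ler_wpM2l //; exact: qh.
Unshelve. all: by end_near. Qed.

Lemma cder_continuous (W : normedModType C) (u : R -> W) x w :
  cder u x w -> u y @[y --> x] --> u x.
Proof.
move=> /cder_bound[M M0 uM]; apply/cvgrPdist_lt => eps eps0.
have eM : 0 < eps / M by rewrite divr_gt0.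
have [eME r0] := gtC0 eM.
have hx : (y - x) @[y --> x] --> (0 : R).
  by rewrite -[X in _ --> X](subrr x); apply: cvgB; [exact: cvg_id|exact: cvg_cst].
near=> y; rewrite /= distrC -[y in u y](subrK x).
apply: (@le_lt_trans _ _ (`|(y - x)%:C%C : C| * M)).
  by near: y; exact: (hx _ uM).
rewrite -ltr_pdivlMr // normC_real eME ltcR -[y - x]add0r -normrN opprD; near: y.
move/cvgrPdist_lt : hx => /(_ _ r0); apply: filterS => y; by rewrite sub0r oppr0 add0r.
Unshelve. all: by end_near. Qed.

(** The remainder of [g] is small compared with the increment of [u], and [cder_bound] bounds that
    increment by a multiple of h; hence the remainder divided by h tends to 0. *)
Lemma cder_comp (W W' : normedModType C) (u : R -> W) (g : W -> W') x w :
  cder u x w -> differentiable g (u x) -> cder (g \o u) x ('d g (u x) w).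
Proof.
move=> ux gd; have gE := diff_locallyx gd.
pose q h := (h%:C%C : C)^-1 *: (u (h + x) - u x).
set e := (X in forall h, _ = _ + X h) in gE.
have dgc : {for w, continuous ('d g (u x))}.
  exact: (@diff_continuous _ _ _ _ _ gd).
have h1 : 'd g (u x) (q h) @[h --> 0^'] --> 'd g (u x) w.
  exact: (@continuous_cvg _ _ _ _ _ _ _ _ dgc ux).
suff h2 : (h%:C%C : C)^-1 *: e (u (h + x) - u x) @[h --> 0^'] --> (0 : W').
  rewrite -[X in cder _ _ X]addr0 /cder.
  apply: cvg_trans (cvgD h1 h2); apply: near_eq_cvg; near=> h.
  change ('d g (u x) (q h) + (h%:C%C : C)^-1 *: e (u (h + x) - u x) =
    (h%:C%C : C)^-1 *: (g (u (h + x)) - g (u x))).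
  rewrite -[in RHS](subrK (u x) (u (h + x))) gE /q linearZ /= -scalerDr.
  by congr (_ *: _); rewrite addrAC [g (u x) + _]addrC addrK.
have [M M0 uM0] := cder_bound ux.
have uM := nbhs_dnbhs uM0.
have u0 : u (h + x) - u x @[h --> 0^'] --> (0 : W).
  apply/cvgrPdist_lt => eps eps0; have eM : 0 < eps / M by rewrite divr_gt0.
  have [eE r0] := gtC0 eM.
  have hn : \forall h \near (0 : R)^', `|h| < Re (eps / M) by exact: dnbhs0_lt.
  near=> h; rewrite /= sub0r normrN.
  apply: (@le_lt_trans _ _ (`|h%:C%C : C| * M)); first by near: h; exact: uM.
  by rewrite -ltr_pdivlMr // normC_real eE ltcR; near: h; exact: hn.
apply/cvgrPdist_lt => eps eps0.
have e2 : 0 < eps / (2 * M) by rewrite divr_gt0 // mulr_gt0.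
have lo : \forall k \near (0 : W), `|e k| <= eps / (2 * M) * `|k|.
  by rewrite /e; exact: (littleoP _ e2).
have en : \forall h \near (0 : R)^',
    `|e (u (h + x) - u x)| <= eps / (2 * M) * `|u (h + x) - u x| := u0 _ lo.
near=> h; rewrite /= sub0r normrN.
have h0 : (h%:C%C : C) != 0.
  by rewrite (inj_eq (@complexI R)); near: h; exact: nbhs_dnbhs_neq.
rewrite normrZ normfV mulrC ltr_pdivrMr ?normr_gt0 //.
apply: (@le_lt_trans _ _ (eps / (2 * M) * (`|h%:C%C : C| * M))).
  apply: (@le_trans _ _ (eps / (2 * M) * `|u (h + x) - u x|)).
    by near: h; exact: en.
  by rewrite ler_wpM2l ?(ltW e2) //; near: h; exact: uM.
rewrite (_ : _ * _ = eps * `|h%:C%C : C| / 2); last by field; rewrite gt_eqF.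
by rewrite ltr_pdivrMr // ltr_pMr ?ltr1n // mulr_gt0 ?normr_gt0.
Unshelve. all: by end_near. Qed.

Lemma cder_expC (l : R -> C) x (d : C) :
  cder l x d -> cder (fun y => expC (l y)) x (d * expC (l x)).
Proof.
move=> /cderE[lr li]; apply/cderE.
have er := is_derive1_comp (is_derive_expR (Re (l x))) lr.
have ec := is_derive1_comp (is_derive_cos (Im (l x))) li.
have es := is_derive1_comp (is_derive_sin (Im (l x))) li.
have dM (f g : R -> R) a b : is_derive x 1 f a -> is_derive x 1 g b ->
    is_derive x 1 (fun y => f y * g y) (a * g x + f x * b).
  move=> fa gb; have -> : a * g x + f x * b = f x *: b + g x *: a.
    by rewrite addrC [a * _]mulrC.
  exact: is_deriveM.
case: d lr li er ec es => dr di lr li er ec es; rewrite /expC /=; split.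
  have := dM _ _ _ _ er ec; congr is_derive => /=; ring.
have := dM _ _ _ _ er es; congr is_derive => /=; ring.
Qed.

Lemma cder_unique (f : R -> C) x (a b : C) : cder f x a -> cder f x b -> a = b.
Proof. by move=> /cderP[_ <-] /cderP[_ <-]. Qed.

Lemma near_cder (f g : R -> C) x (a : C) :
  (\forall y \near x, f y = g y) -> cder f x a -> cder g x a.
Proof.
move=> fg; rewrite /cder; apply: cvg_trans; apply: near_eq_cvg.
have fg0 : \forall h \near (0 : R)^', f (h + x) = g (h + x).
  apply: nbhs_dnbhs; have hx : (h + x) @[h --> (0 : R)] --> x.
    by rewrite -[X in _ --> X]add0r; apply: cvgD; [exact: cvg_id|exact: cvg_cst].
  exact: (hx _ fg).
by near=> h; rewrite (nbhs_singleton fg) (near fg0 h).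
Unshelve. all: by end_near. Qed.

Lemma cder_cst (W : normedModType C) (w : W) x : cder (cst w) x 0.
Proof.
rewrite /cder; apply: cvg_near_cst; near=> h.
by rewrite /= subrr scaler0.
Unshelve. all: by end_near. Qed.

Lemma cderD (W : normedModType C) (f g : R -> W) x a b :
  cder f x a -> cder g x b -> cder (fun y => f y + g y) x (a + b).
Proof.
move=> fa gb; apply: cvg_trans (cvgD fa gb); apply: near_eq_cvg; near=> h.
change ((h%:C%C : C)^-1 *: (f (h + x) - f x) + (h%:C%C : C)^-1 *: (g (h + x) - g x) =
  (h%:C%C : C)^-1 *: (f (h + x) + g (h + x) - (f x + g x))).
by rewrite -scalerDr opprD addrACA.
Unshelve. all: by end_near. Qed.

Lemma cder_sum (W : normedModType C) (J : Type) (r : seq J) (f : J -> R -> W) x a :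
  (forall j, cder (f j) x (a j)) ->
  cder (fun y => \sum_(j <- r) f j y) x (\sum_(j <- r) a j).
Proof.
move=> fa; elim: r => [|j r IHr].
  rewrite (_ : (fun _ => _) = cst 0) ?big_nil; first exact: cder_cst.
  by apply/funext => y; rewrite big_nil.
rewrite (_ : (fun _ => _) = (fun y => f j y + \sum_(j <- r) f j y)).
  by rewrite big_cons; exact: cderD.
by apply/funext => y; rewrite big_cons.
Qed.

Lemma cderZ (W : normedModType C) (f : R -> C) (w : W) x a :
  cder f x a -> cder (fun y => f y *: w) x (a *: w).
Proof.
move=> fa; apply: cvg_trans (cvgZr_tmp (a := w) fa); apply: near_eq_cvg; near=> h.
by rewrite /= -scalerBl scalerA.
Unshelve. all: by end_near. Qed.

Lemma cder_line (W : normedModType C) (p v : W) x :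
  cder (fun y => p + y%:C%C *: v) x v.
Proof.
rewrite -[X in cder _ _ X]add0r; apply: cderD; first exact: cder_cst.
rewrite -[X in cder _ _ X]scale1r; apply: cderZ; apply/cderE; split=> /=.
  exact: is_derive_id.
exact: is_derive_cst.
Qed.

Section Coordinates.
Variable I : finType.
Local Notation V := 'rV[C]_#|I|.

Lemma row_crd (v : V) : v = \sum_(al : I) crd v al *: delta_mx 0 (enum_rank al).
Proof.
rewrite {1}(matrix_sum_delta v) big_ord1 (reindex (@enum_rank I)) //.
by exists enum_val => i _; [exact: enum_rankK|exact: enum_valK].
Qed.

Lemma cder_row (u : R -> V) x : (forall al, derivablex (fun y => crd (u y) al) x) ->
  cder u x (\sum_(al : I) derivx (fun y => crd (u y) al) x *: delta_mx 0 (enum_rank al)).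
Proof.
move=> du; rewrite (_ : u = fun y => \sum_(al : I) crd (u y) al *: delta_mx 0 (enum_rank al)).
  apply: cder_sum => al; apply: cderZ; apply/cderP; split; first exact: du.
  by congr derivx; apply/funext => y; rewrite -row_crd.
by apply/funext => y; exact: row_crd.
Qed.

Lemma pdE (al : I) (g : V -> C) t : differentiable g t ->
  pd al g t = 'd g t (delta_mx 0 (enum_rank al)).
Proof. by move=> gt; rewrite /pd deriveE. Qed.

Lemma cder_pd (u : R -> V) (g : V -> C) x :
  (forall al, derivablex (fun y => crd (u y) al) x) -> differentiable g (u x) ->
  cder (g \o u) x (\sum_(al : I) derivx (fun y => crd (u y) al) x * pd al g (u x)).
Proof.
move=> du gd; have := cder_comp (cder_row du) gd; congr cder.
by rewrite linear_sum; apply: eq_bigr => al _; rewrite linearZ /= pdE.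
Qed.

(** On the real line through [t] in the direction [al] the exponential is differentiated by its real
    formula [cder_expC], and the derivative along this line is the value of the complex differential
    on that direction. *)
Lemma pd_expC (al : I) (l f : V -> C) t : differentiable l t -> differentiable f t ->
  (\forall s \near t, expC (l s) = f s) -> pd al f t = pd al l t * f t.
Proof.
move=> lt ft lf; pose u y := t + (y%:C%C : C) *: (delta_mx 0 (enum_rank al) : V).
have u0 : u 0 = t by rewrite /u scale0r addr0.
have ul : cder u 0 (delta_mx 0 (enum_rank al)) by exact: cder_line.
have ltu : differentiable l (u 0) by rewrite u0; exact: lt.
have ftu : differentiable f (u 0) by rewrite u0; exact: ft.
have cl := cder_expC (cder_comp ul ltu); have cf := cder_comp ul ftu.
have uc : u y @[y --> (0 : R)] --> t.
  by rewrite -u0; exact: cder_continuous ul.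
have h : \forall y \near (0 : R), (fun y => expC ((l \o u) y)) y = (f \o u) y.
  exact: (uc _ lf).
have E := cder_unique (near_cder h cl) cf.
rewrite (pdE al ft) (pdE al lt) -(nbhs_singleton lf).
by move: E; rewrite /= u0; exact: esym.
Qed.

(** On a ball the real mean value theorem, applied to real and imaginary parts along segments from
    the centre, gives local constancy; a level set is then open and closed in [D]. *)
Lemma connected_pd0 (D : set V) (g : V -> C) : open D -> connected D -> holo D g ->
  (forall al t, D t -> pd al g t = 0) -> forall s t, D s -> D t -> g s = g t.
Proof.
move=> Do Dc gh g0.
have dg0 t v : D t -> 'd g t v = 0.
  move=> Dt; rewrite (row_crd v) linear_sum big1 // => al _.
  rewrite linearZ /= -pdE; last exact: gh.
  by rewrite g0 // scaler0.
have loc t : D t -> \forall s \near t, g s = g t.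
  move=> Dt; have /nbhs_ballP[e /= e0 De] : nbhs t D by exact: open_nbhs_nbhs.
  apply: filterS (nbhsx_ballx t e e0) => s st.
  pose u y := t + (y%:C%C : C) *: (s - t).
  have uD y : y \in `[0, 1] -> D (u y).
    rewrite in_itv /= => /andP[y0 y1]; apply: De; move: st.
    rewrite -ball_normE /= /u opprD addrA subrr sub0r normrN normrZ normC_real.
    rewrite distrC; apply: le_lt_trans; rewrite ger0_norm // ler_piMl //.
    by rewrite (_ : 1 = 1%:C%C) // lecR.
  have gu y : y \in `[0, 1] -> cder (g \o u) y 0.
    move=> /uD Duy; have := cder_comp (@cder_line _ t (s - t) y) (gh _ Duy).
    by rewrite dg0.
  have mvt (f : R -> R) : (forall y : R, y \in `[0, 1] -> is_derive (y : R) 1 f 0) -> f 0 = f 1.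
    move=> fd; have fc : {within `[0 : R, 1 : R], continuous f}.
      by apply: derivable_within_continuous => y /fd fy; exact: (@ex_derive _ _ _ _ _ _ _ fy).
    have fo (y : R) : y \in `]0, 1[ -> is_derive y 1 f 0.
      by move=> y01; apply: fd; exact: subset_itv_oo_cc y01.
    have [c _] := @MVT_segment R f (fun=> 0) 0 1 ler01 fo fc.
    by rewrite mul0r => /eqP; rewrite subr_eq0 => /eqP ->.
  have u0 : u 0 = t by rewrite /u scale0r addr0.
  have u1 : u 1 = s by rewrite /u scale1r addrC subrK.
  rewrite -u0 -u1; apply/eqP; rewrite eq_complex; apply/andP; split; apply/eqP;
    apply/esym.
    apply: (mvt (fun y => Re (g (u y)))) => y /gu/cderE[]; exact.
  apply: (mvt (fun y => Im (g (u y)))) => y /gu/cderE[] _; exact.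
move=> s t Ds Dt; pose B := [set v | D v /\ g v = g t].
suff BD : B = D by have : B s by [rewrite BD]; case.
apply: Dc; first by exists t.
- exists B; last by rewrite setIC; apply/esym/setIidl => v [].
  rewrite openE => v [Dv gv].
  have Dn : nbhs v D by exact: open_nbhs_nbhs.
  by apply: filterS2 Dn (loc v Dv) => w Dw gw; split=> //; rewrite gw.
- exists (~` (D `\` B)).
    apply: open_closedC; rewrite openE => v [Dv nBv].
    have Dn : nbhs v D by exact: open_nbhs_nbhs.
    apply: filterS2 Dn (loc v Dv) => w Dw gw; split=> // -[_ gwt]; apply: nBv.
    by split=> //; rewrite -gw.
  apply/seteqP; split=> [v Bv|v [Dv h]]; first by split; [exact: Bv.1|case].
  by apply: contrapT => nBv; exact: h.
Qed.

End Coordinates.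

End RealCurves.

(** * Holomorphic families of Laurent series *)

Section Holomorphic.
Variables (R : realType) (I : finType).
Local Notation C := (Cx R).
Local Notation V := 'rV[C]_#|I|.
Implicit Types (f g : V -> C) (D : set V).

Lemma near_eq_differentiable f g t : (\forall s \near t, f s = g s) ->
  differentiable f t -> differentiable g t.
Proof.
move=> fg ft.
have fg0 : \forall h \near (0 : V), f (h + t) = g (h + t).
  by move: fg; rewrite (near_shift 0) subr0.
have gE : g \o shift t = cst (g t) + 'd f t +o_ (0 : V) id.
  apply/eqaddoP => e e0; move/diff_locally : ft => /eqaddoP/(_ e e0).
  move=> fo; near=> h.
  have : `|(f \o shift t - (cst (f t) + 'd f t)) h| <= e * `|(id h : V)|.
    by near: h; exact: fo.
  have h1 : f (h + t) = g (h + t) by near: h; exact: fg0.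
  by rewrite !fctE /= h1 (nbhs_singleton fg).
have dE : 'd g t = 'd f t :> (V -> C).
  by apply: diff_unique gE; exact: diff_continuous.
apply/diff_locallyP; rewrite dE; split; last exact: gE.
exact: diff_continuous.
Unshelve. all: by end_near. Qed.

Lemma pd_near_eq (al : I) f g t : (\forall s \near t, f s = g s) ->
  pd al f t = pd al g t.
Proof.
by move=> fg; apply: near_eq_derive; exact: fg.
Qed.

Lemma pdD (al : I) f g t : differentiable f t -> differentiable g t ->
  pd al (fun s => f s + g s) t = pd al f t + pd al g t.
Proof. by move=> ft gt; apply: deriveD; apply: diff_derivable; [exact: ft|exact: gt]. Qed.

Lemma pdN (al : I) f t : differentiable f t -> pd al (fun s => - f s) t = - pd al f t.
Proof. by move=> ft; apply: deriveN; apply: diff_derivable; exact: ft. Qed.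

Lemma pdM (al : I) f g t : differentiable f t -> differentiable g t ->
  pd al (fun s => f s * g s) t = pd al f t * g t + f t * pd al g t.
Proof.
move=> ft gt; rewrite addrC [pd al f t * _]mulrC; apply: deriveM; apply: diff_derivable.
  exact: ft.
exact: gt.
Qed.

Lemma pd_cst (al : I) (c : C) t : pd al (fun=> c) t = 0.
Proof. exact: derive_cst. Qed.

Lemma differentiable_bigsum (J : Type) (r : seq J) (P : pred J) (F : J -> V -> C) t :
  (forall j, P j -> differentiable (F j) t) ->
  differentiable (fun s => \sum_(j <- r | P j) F j s) t.
Proof.
move=> Fd; elim: r => [|j r IHr].
  rewrite (_ : (fun _ => _) = cst 0); last by apply/funext => s; rewrite big_nil.
  exact: differentiable_cst.
case Pj: (P j).
  rewrite (_ : (fun _ => _) = fun s => F j s + \sum_(j <- r | P j) F j s).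
    by apply: differentiableD; [exact: Fd|exact: IHr].
  by apply/funext => s; rewrite big_cons Pj.
rewrite (_ : (fun _ => _) = fun s => \sum_(j <- r | P j) F j s); first exact: IHr.
by apply/funext => s; rewrite big_cons Pj.
Qed.

Lemma pd_sum (al : I) (J : Type) (r : seq J) (P : pred J) (F : J -> V -> C) t :
  (forall j, P j -> differentiable (F j) t) ->
  pd al (fun s => \sum_(j <- r | P j) F j s) t = \sum_(j <- r | P j) pd al (F j) t.
Proof.
move=> Fd; elim: r => [|j r IHr].
  rewrite big_nil (_ : (fun _ => _) = cst 0); last by apply/funext => s; rewrite big_nil.
  exact: pd_cst.
rewrite big_cons; case Pj: (P j).
  rewrite (_ : (fun _ => _) = fun s => F j s + \sum_(j <- r | P j) F j s).
    by rewrite -IHr; apply: pdD; [exact: Fd|exact: differentiable_bigsum].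
  by apply/funext => s; rewrite big_cons Pj.
rewrite (_ : (fun _ => _) = fun s => \sum_(j <- r | P j) F j s); first exact: IHr.
by apply/funext => s; rewrite big_cons Pj.
Qed.

Lemma pd_crd (al be : I) t : pd al (fun s : V => crd s be) t = (al == be)%:R.
Proof.
rewrite /pd /derive; apply: cvg_lim; first exact: norm_hausdorff.
apply: cvg_near_cst; near=> h; rewrite /= /crd !mxE eqxx (inj_eq enum_rank_inj) addrK.
have h0 : h != 0 by near: h; exact: nbhs_dnbhs_neq.
by rewrite [LHS]mulKf // eq_sym.
Unshelve. all: by end_near. Qed.

Section Domain.
Variable D : set V.
Hypothesis Do : open D.

Lemma near_dom (P : V -> Prop) t : D t -> (forall s, D s -> P s) ->
  \forall s \near t, P s.
Proof.
move=> Dt DP; have Dn : nbhs t D by exact: open_nbhs_nbhs.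
by apply: filterS Dn => s /DP.
Qed.

Lemma holo_ext f g : (forall s, D s -> f s = g s) -> holo D f -> holo D g.
Proof.
move=> fg fh t Dt; apply: near_eq_differentiable (fh t Dt); exact: near_dom.
Qed.

Lemma pd_ext (al : I) f g t : D t -> (forall s, D s -> f s = g s) ->
  pd al f t = pd al g t.
Proof. by move=> Dt fg; apply: pd_near_eq; exact: near_dom. Qed.

Lemma holo_cst (c : C) : holo D (fun=> c).
Proof. by move=> t _; exact: differentiable_cst. Qed.

Lemma holoD f g : holo D f -> holo D g -> holo D (fun s => f s + g s).
Proof. by move=> fh gh t Dt; apply: differentiableD; [exact: fh|exact: gh]. Qed.

Lemma holoN f : holo D f -> holo D (fun s => - f s).
Proof. by move=> fh t Dt; apply: differentiableN; exact: fh. Qed.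

Lemma holoB f g : holo D f -> holo D g -> holo D (fun s => f s - g s).
Proof. by move=> fh gh; apply: holoD => //; exact: holoN. Qed.

Lemma holoM f g : holo D f -> holo D g -> holo D (fun s => f s * g s).
Proof. by move=> fh gh t Dt; apply: differentiableM; [exact: fh|exact: gh]. Qed.

Lemma holoV f : holo D f -> (forall s, D s -> f s != 0) -> holo D (fun s => (f s)^-1).
Proof.
by move=> fh f0 t Dt; apply: differentiableV; [exact: fh|exact: f0].
Qed.

Lemma holo_sum (J : Type) (r : seq J) (P : pred J) (F : J -> V -> C) :
  (forall j, P j -> holo D (F j)) -> holo D (fun s => \sum_(j <- r | P j) F j s).
Proof.
by move=> Fh t Dt; apply: differentiable_bigsum => j Pj; exact: Fh.
Qed.

Lemma holo_crd be : holo D (fun s : V => crd s be).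
Proof. by move=> t _; exact: differentiable_coord. Qed.

End Domain.
End Holomorphic.

(** Besides having holomorphic coefficients, the series are bounded below in order uniformly on [D].
    Each coefficient of a product is then one finite sum of holomorphic functions, of the same
    length at all points. *)
HB.lock Definition lfam (R : realType) (I : finType) (D : set 'rV[Cx R]_#|I|)
    (f : 'rV[Cx R]_#|I| -> laurent (Cx R)) : Prop :=
  (exists N, forall t, D t -> lge N (f t)) /\ hololaurent D f.

(** The derivative at fixed local parameter. The uniform bound in [lfam] makes the derivatives of
    the coefficients a Laurent series, so that for such families the default 0 is not met on [D]
    ([ldiffE]). *)
HB.lock Definition ldiff (R : realType) (I : finType) (al : I)
    (f : 'rV[Cx R]_#|I| -> laurent (Cx R)) (t : 'rV[Cx R]_#|I|) : laurent (Cx R) :=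
  xget 0 [set h : laurent (Cx R) | forall k, lcoef h k = pd al (fun s => lcoef (f s) k) t].

Lemma field_logder (F : fieldType) (n : nat) (u du : F) : u != 0 -> n%:R != 0 :> F ->
  du = n%:R * u ^+ n.-1 * du / (n%:R * u ^+ n) * u.
Proof.
case: n => [|n] u0 n0; first by rewrite eqxx in n0.
rewrite exprS [n.+1.-1]/=; have := expf_neq0 n u0.
by move: (u ^+ n) (n.+1%:R : F) n0 => a b b0 a0; field; rewrite a0 b0 u0.
Qed.

Section LaurentFamilies.
Variables (R : realType) (I : finType).
Local Notation C := (Cx R).
Local Notation V := 'rV[C]_#|I|.
Local Notation L := (laurent C).
Variable D : set V.
Hypothesis Do : open D.
Implicit Types (f g l : V -> L) (c : V -> C) (al : I) (t : V).

Local Notation lfam := (lfam D).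

Lemma lfamP f : lfam f <-> (exists N, forall t, D t -> lge N (f t)) /\ hololaurent D f.
Proof. by rewrite lfam.unlock. Qed.

Lemma lfam_ext f g : (forall s, D s -> f s = g s) -> lfam f -> lfam g.
Proof.
move=> fg /lfamP[[N fN] fh]; apply/lfamP; split; first by exists N => t Dt; rewrite -fg //; exact: fN.
by move=> k; apply: holo_ext (fh k) => // s Ds; rewrite fg.
Qed.

Lemma lfam_holo f k : lfam f -> holo D (fun s => lcoef (f s) k).
Proof. by case/lfamP=> _; apply. Qed.

Lemma lfam_cst (u : L) : lfam (fun=> u).
Proof.
apply/lfamP; split; last by move=> k; exact: holo_cst.
by have [N uN] := lcoef_bounded u; exists N => t _.
Qed.

Lemma lfam_const c : holo D c -> lfam (fun s => lconst (c s)).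
Proof.
move=> ch; apply/lfamP; split; first by exists 0 => t _; exact: lge_const.
move=> k; have [k0|k0] := eqVneq k 0.
  by apply: holo_ext ch => // s _; rewrite lcoefC k0.
by apply: (holo_ext Do _ (holo_cst (D := D) 0)) => s _; rewrite lcoefC (negbTE k0).
Qed.

Lemma lfamD f g : lfam f -> lfam g -> lfam (fun s => f s + g s).
Proof.
move=> /lfamP[[N fN] fh] /lfamP[[M gM] gh]; apply/lfamP; split; last by move=> k; apply: holoD; [exact: fh|exact: gh].
exists (Num.min N M) => t Dt; apply: lgeD.
  by apply: lge_le (fN t Dt); rewrite ge_min lexx.
by apply: lge_le (gM t Dt); rewrite ge_min lexx orbT.
Qed.

Lemma lfamN f : lfam f -> lfam (fun s => - f s).
Proof.
move=> /lfamP[[N fN] fh]; apply/lfamP; split; last by move=> k; apply: holoN; exact: fh.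
by exists N => t Dt; apply: lgeN; exact: fN.
Qed.

Lemma lfamB f g : lfam f -> lfam g -> lfam (fun s => f s - g s).
Proof. by move=> fl gl; apply: lfamD => //; exact: lfamN. Qed.

Lemma lfamM_coef f g N M k : (forall t, D t -> lge N (f t)) ->
  (forall t, D t -> lge M (g t)) -> exists q : nat, forall t, D t ->
  lcoef (f t * g t) k = \sum_(i < q) lcoef (f t) (i%:Z + N) * lcoef (g t) (k - N - i%:Z).
Proof.
move=> fN gM; exists (absz (k - N - M)%R).+1 => t Dt.
by apply: lcoefM_sum; [exact: fN|apply: lge_le (gM t Dt); lia].
Qed.

Lemma lfamM f g : lfam f -> lfam g -> lfam (fun s => f s * g s).
Proof.
move=> /lfamP[[N fN] fh] /lfamP[[M gM] gh]; apply/lfamP; split.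
  by exists (N + M) => t Dt; apply: lgeM; [exact: fN|exact: gM].
move=> k; have [q fgE] := lfamM_coef k fN gM.
apply: (holo_ext Do (fun s Ds => esym (fgE s Ds))).
by apply: holo_sum => i _; apply: holoM; [exact: fh|exact: gh].
Qed.

Lemma lfam_sum (J : Type) (r : seq J) (P : pred J) (F : J -> V -> L) :
  (forall j, P j -> lfam (F j)) -> lfam (fun s => \sum_(j <- r | P j) F j s).
Proof.
move=> Fl; elim: r => [|j r IHr].
  by apply: lfam_ext (lfam_cst 0) => s _; rewrite big_nil.
case Pj: (P j); last by apply: lfam_ext IHr => s _; rewrite big_cons Pj.
by apply: lfam_ext (lfamD (Fl j Pj) IHr) => s _; rewrite big_cons Pj.
Qed.

Lemma lfamX f k : lfam f -> lfam (fun s => f s ^+ k).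
Proof.
move=> fl; elim: k => [|k IHk]; first exact: lfam_cst.
by apply: lfam_ext (lfamM fl IHk) => s _; rewrite exprS.
Qed.

(** The recursion that solves [f * f^-1 = 1] divides only by the leading coefficient, which sits at
    the same place [N] on all of [D]. *)
Lemma lfamV f N : (forall s, D s -> lord N (f s)) -> lfam f -> lfam (fun s => (f s)^-1).
Proof.
move=> fN /lfamP[_ fh]; apply/lfamP; split; first by exists (- N) => t /fN/lordV/lord_ge.
have gN s : D s -> lge (- N) (f s)^-1 by move=> /fN/lordV/lord_ge.
suff H (k : nat) : holo D (fun s => lcoef (f s)^-1 (k%:Z - N)).
  move=> k; have [kN|kN] := ltP k (- N).
    by apply: (holo_ext Do _ (holo_cst (D := D) 0)) => s Ds; rewrite gN.
  by have := H (absz (k + N)%R); rewrite (_ : _ - N = k) //; lia.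
have [q] := ubnP k; elim: q => // q IHq in k *; rewrite ltnS => kq.
apply: (@holo_ext _ _ _ Do (fun s => (lcoef (f s) N)^-1 * ((k == 0%N)%:R -
    \sum_(i < k) lcoef (f s) (i.+1%:Z + N) * lcoef (f s)^-1 ((k - i.+1)%N%:Z - N)))).
  move=> s Ds; have f0 := lord_neq0 (fN s Ds).
  have := @lcoefM_sum _ N (f s) (f s)^-1 k%:Z k.+1 (lord_ge (fN s Ds)).
  rewrite divff // lcoef1 => ->; last by apply: lge_le (gN s Ds); lia.
  rewrite big_ord_recl /= add0r subr0.
  under [X in _ + X - _]eq_bigr => i _.
    rewrite (_ : k%:Z - N - (bump 0 i)%:Z = (k - i.+1)%N%:Z - N); last first.
      by rewrite /bump; have := ltn_ord i; lia.
    over.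
  by rewrite addrK mulKf // (fN s Ds).2.
apply: holoM; first by apply: holoV; [exact: fh|move=> s /fN[]].
apply: holoB; first exact: holo_cst.
apply: holo_sum => i _; apply: holoM; first exact: fh.
by apply: IHq; have := ltn_ord i; lia.
Qed.

Lemma lfamVn f N k : (forall s, D s -> lord N (f s)) -> lfam f -> lfam (fun s => f s ^- k).
Proof.
move=> fN fl; apply: (@lfamV _ (k%:Z * N)); last exact: lfamX.
by move=> s Ds; apply: lordX; exact: fN.
Qed.

Lemma lfam_lderiv f : lfam f -> lfam (fun s => lderiv (f s)).
Proof.
move=> /lfamP[[N fN] fh]; apply/lfamP; split; first by exists (N - 1) => t Dt; apply: lge_lderiv; exact: fN.
by move=> k; apply: holoM; [exact: holo_cst|exact: fh].
Qed.

(** Integration recovers all coefficients but the constant one. Families of logarithms are treated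
    in this way, their derivatives being quotients. *)
Lemma lfam_lderiv_inv l : (forall s, D s -> lge 0 (l s)) ->
  holo D (fun s => lcoef (l s) 0) -> lfam (fun s => lderiv (l s)) -> lfam l.
Proof.
move=> l0 lh /lfamP[_ dlh]; apply/lfamP; split; first by exists 0.
move=> k; have [->//|k0] := eqVneq k 0.
apply: (@holo_ext _ _ _ Do (fun s => k%:~R^-1 * lcoef (lderiv (l s)) (k - 1))).
  by move=> s _; rewrite lcoef_lderiv subrK mulKf // intr_eq0.
by apply: holoM; [exact: holo_cst|exact: dlh].
Qed.

(* The coefficients of a root u of f are determined by the leading one through
   the differential equation u' = u f' / (n f). *)
Lemma lfam_root (n : nat) (u f : V -> L) N : (0 < n)%N ->
  (forall s, D s -> u s ^+ n = f s) -> (forall s, D s -> lord N (u s)) -> lfam f ->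
  holo D (fun s => lcoef (u s) N) -> lfam u.
Proof.
move=> n0 uf uN fl uh; pose q s := lderiv (f s) / (n%:R * f s).
have fN s : D s -> lord (n%:Z * N) (f s) by move=> Ds; rewrite -uf //; apply: lordX; exact: uN.
have nf s : D s -> lord (n%:Z * N) (n%:R * f s).
  move=> Ds; rewrite -(rmorph_nat (@lconst C)) -[_ * N]add0r.
  by apply: lordM (fN s Ds); apply: lord_const; rewrite pnatr_eq0 -lt0n.
have ql : lfam q.
  apply: lfamM; first exact: lfam_lderiv.
  by apply: lfamV nf _; apply: lfamM => //; exact: lfam_cst.
have q1 s : D s -> lge (-1) (q s).
  move=> Ds; apply: lge_le (lge_lord_dvd (lge_lderiv (lord_ge (fN s Ds))) (nf s Ds)); lia.
have uq s : D s -> lderiv (u s) = q s * u s.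
  move=> Ds; have u0 := lord_neq0 (uN s Ds); rewrite /q -uf //.
  have -> : lderiv (u s ^+ n) = n%:R * u s ^+ n.-1 * lderiv (u s).
    elim: (n) => [|k IHk]; first by rewrite expr0 -(rmorph1 (@lconst C)) lderiv_const !mul0r.
    rewrite exprS lderivM IHk -natr1; case: k {IHk} => [|k] /=.
      by rewrite !expr0; ring.
    by rewrite exprS; ring.
  apply: field_logder u0 _.
  by rewrite -(rmorph_nat (@lconst C)) fmorph_eq0 pnatr_eq0 -lt0n.
apply/lfamP; split; first by exists N => s /uN/lord_ge.
suff H (k : nat) : holo D (fun s => lcoef (u s) (N + k%:Z)).
  move=> k; have [kN|kN] := ltP k N.
    by apply: (holo_ext Do _ (holo_cst (D := D) 0)) => s /uN[uk _]; rewrite uk.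
  by have := H (absz (k - N)%R); rewrite (_ : N + _ = k) //; lia.
have [r] := ubnP k; elim: r => // r IHr in k *; rewrite ltnS => kr.
have [->|k0] := posnP k; first by rewrite addr0.
(* The residue of u'/u is the order [N]. It cancels against the factor [N + k] of the derivative and
   leaves the nonzero factor [k] before the coefficient sought. *)
have qE s : D s -> lcoef (q s) (-1) = N%:~R.
  move=> Ds; apply: (mulIf (uN s Ds).2).
  rewrite -(lcoefM_low (q1 s Ds) (lord_ge (uN s Ds))) -uq // lcoef_lderiv.
  by rewrite addrC addrA subrr add0r.
apply: (@holo_ext _ _ _ Do (fun s => k%:R^-1 *
    \sum_(i < k) lcoef (q s) i%:Z * lcoef (u s) (N + (k - i.+1)%N%:Z))).
  move=> s Ds.
  have := @lcoefM_sum _ (-1) (q s) (u s) (N + k%:Z - 1) k.+1 (q1 s Ds).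
  rewrite -uq // lcoef_lderiv opprK subrK => E0.
  have uNk : lge (N + k%:Z - k.+1%:Z + 1) (u s) by apply: lge_le (lord_ge (uN s Ds)); lia.
  move: (E0 uNk).
  rewrite big_ord_recl add0r qE // subr0 rmorphD mulrDl => /addrI E.
  apply: (mulfI (_ : k%:R != 0)); first by rewrite pnatr_eq0 -lt0n.
  rewrite mulVKf ?pnatr_eq0 -?lt0n // [RHS]E; apply: eq_bigr => i _.
  have li := ltn_ord i; congr (lcoef _ _ * lcoef _ _); rewrite /= /bump; lia.
apply: holoM; first exact: holo_cst.
apply: holo_sum => i _; apply: holoM; first exact: lfam_holo.
by apply: IHr; have := ltn_ord i; lia.
Qed.

Local Notation ldiff := (@ldiff R I).

Lemma ldiffE al f t k : lfam f -> D t ->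
  lcoef (ldiff al f t) k = pd al (fun s => lcoef (f s) k) t.
Proof.
move=> /lfamP[[N fN] fh] Dt; rewrite ldiff.unlock; case: xgetP => [h _ ->//|] ex.
have hN : exists N, forall k, k < N -> pd al (fun s => lcoef (f s) k) t = 0.
  exists N => j jN; rewrite (pd_ext (g := fun=> 0) Do al Dt) ?pd_cst // => s Ds.
  exact: fN.
by have /= := ex (Laurent hN); case.
Qed.

Lemma lge_ldiff al f t N : lfam f -> D t -> (forall s, D s -> lge N (f s)) ->
  lge N (ldiff al f t).
Proof.
move=> fl Dt fN k kN; rewrite ldiffE // (pd_ext (g := fun=> 0) Do al Dt) ?pd_cst //.
by move=> s Ds; exact: fN.
Qed.

Lemma ldiff_ext al f g t : D t -> lfam f -> (forall s, D s -> f s = g s) ->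
  ldiff al f t = ldiff al g t.
Proof.
move=> Dt fl fg; apply: laurentP => k.
rewrite (ldiffE al k fl Dt) (ldiffE al k (lfam_ext fg fl) Dt).
by apply: (pd_ext Do al Dt) => s Ds; rewrite fg.
Qed.

Lemma ldiffD al f g t : D t -> lfam f -> lfam g ->
  ldiff al (fun s => f s + g s) t = ldiff al f t + ldiff al g t.
Proof.
move=> Dt fl gl; apply: laurentP => k.
rewrite lcoefD (ldiffE al k fl Dt) (ldiffE al k gl Dt) (ldiffE al k (lfamD fl gl) Dt).
by apply: pdD; apply: lfam_holo.
Qed.

Lemma ldiffM al f g t : D t -> lfam f -> lfam g ->
  ldiff al (fun s => f s * g s) t = ldiff al f t * g t + f t * ldiff al g t.
Proof.
move=> Dt fl gl; apply: laurentP => k; rewrite lcoefD (ldiffE al k (lfamM fl gl) Dt).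
have /lfamP[[N fN] fh] := fl; have /lfamP[[M gM] gh] := gl.
pose q := (absz (k - N - M)%R).+1.
rewrite (pd_ext (g := fun s => \sum_(i < q) lcoef (f s) (i%:Z + N) *
  lcoef (g s) (k - N - i%:Z)) Do al Dt); last first.
  move=> s Ds; apply: lcoefM_sum; first exact: fN.
  by apply: lge_le (gM s Ds); lia.
rewrite (@lcoefM_sum _ N _ _ _ q); [|exact: lge_ldiff|apply: lge_le (gM t Dt); lia].
rewrite (@lcoefM_sum _ N (f t) _ _ q); [|exact: fN|]; last first.
  by apply: lge_le (lge_ldiff al gl Dt gM); lia.
rewrite pd_sum; last first.
  by move=> i _; apply: differentiableM; [exact: fh|exact: gh].
rewrite -big_split; apply: eq_bigr => i _ /=.
rewrite (ldiffE al _ fl Dt) (ldiffE al _ gl Dt).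
by apply: pdM; [exact: fh|exact: gh].
Qed.

Lemma ldiff_const al c t : D t -> holo D c ->
  ldiff al (fun s => lconst (c s)) t = lconst (pd al c t).
Proof.
move=> Dt ch; apply: laurentP => k; rewrite (ldiffE al k (lfam_const ch) Dt).
rewrite lcoefC; case: ifP => k0.
  by apply: (pd_ext Do al Dt) => s _; rewrite lcoefC k0.
by rewrite (_ : (fun _ => _) = fun=> 0) ?pd_cst //; apply/funext => s; rewrite lcoefC k0.
Qed.

Lemma ldiff_cst al (u : L) t : D t -> ldiff al (fun=> u) t = 0.
Proof.
by move=> Dt; apply: laurentP => k; rewrite ldiffE ?pd_cst //; exact: lfam_cst.
Qed.

Lemma ldiff_lderiv al f t : D t -> lfam f ->
  ldiff al (fun s => lderiv (f s)) t = lderiv (ldiff al f t).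
Proof.
move=> Dt fl; apply: laurentP => k.
rewrite (ldiffE al k (lfam_lderiv fl) Dt) lcoef_lderiv (ldiffE al _ fl Dt) pdM; last 2 first.
- exact: differentiable_cst.
- exact: lfam_holo.
by rewrite pd_cst mul0r add0r.
Qed.

End LaurentFamilies.

(** * Partial fractions with moving poles *)

(* One interface for the derivations in play: d/dz and the derivatives in the
   flat coordinates at fixed z, acting on functions or on Laurent expansions.
   [S] is the class of admissible families, [near] the sense in which they
   have to agree to have the same derivative at [x]. *)
Record derivation (T : Type) (F : fieldType) (S : (T -> F) -> Prop)
    (near : (T -> Prop) -> Prop) (x : T) (d : (T -> F) -> F) : Prop := Derivation {
  der_ext : forall f g, near (fun y => f y = g y) -> S f -> d f = d g;
  der_near : forall P Q : T -> Prop, (forall y, P y -> Q y) -> near P -> near Q;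
  dom1 : S (fun=> 1);
  dom0 : S (fun=> 0);
  domD : forall f g, S f -> S g -> S (fun y => f y + g y);
  domN : forall f, S f -> S (fun y => - f y);
  domM : forall f g, S f -> S g -> S (fun y => f y * g y);
  der1 : d (fun=> 1) = 0;
  derD : forall f g, S f -> S g -> d (fun y => f y + g y) = d f + d g;
  derM : forall f g, S f -> S g -> d (fun y => f y * g y) = d f * g x + f x * d g }.

Section DerivationTheory.
Variables (T : Type) (F : fieldType) (S : (T -> F) -> Prop).
Variables (near : (T -> Prop) -> Prop) (x : T) (d : (T -> F) -> F).
Hypothesis dd : derivation S near x d.
Implicit Types f g u : T -> F.

Lemma der0 : d (fun=> 0) = 0.
Proof.
have h := derD dd (dom0 dd) (dom0 dd).
have {}h : d (fun=> 0) = d (fun=> 0) + d (fun=> 0).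
  by rewrite -h; congr d; apply/funext => y; rewrite addr0.
by move/eqP: h; rewrite -subr_eq0 opprD addNKr oppr_eq0 => /eqP.
Qed.

Lemma derN f : S f -> d (fun y => - f y) = - d f.
Proof.
move=> Sf; apply/eqP; rewrite -addr_eq0 -(derD dd) //; last exact: (domN dd).
by rewrite -der0; apply/eqP; congr d; apply/funext => y; rewrite addNr.
Qed.

Lemma derB f g : S f -> S g -> d (fun y => f y - g y) = d f - d g.
Proof.
move=> Sf Sg; rewrite (derD dd (g := fun y => - g y)) ?derN //.
exact: (domN dd).
Qed.

Lemma domB f g : S f -> S g -> S (fun y => f y - g y).
Proof. by move=> Sf Sg; apply: (domD dd (g := fun y => - g y)) => //; exact: (domN dd). Qed.

Lemma domX f k : S f -> S (fun y => f y ^+ k).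
Proof.
move=> Sf; elim: k => [|k IHk].
  by have := dom1 dd; congr S; apply/funext => y; rewrite expr0.
by have := domM dd Sf IHk; congr S; apply/funext => y; rewrite exprS.
Qed.

Lemma derX f k : S f -> d (fun y => f y ^+ k) = k%:R * f x ^+ k.-1 * d f.
Proof.
move=> Sf; elim: k => [|k IHk].
  by rewrite !mul0r -(der1 dd); congr d; apply/funext => y; rewrite expr0.
have -> : (fun y => f y ^+ k.+1) = (fun y => f y * f y ^+ k).
  by apply/funext => y; rewrite exprS.
rewrite (derM dd Sf (domX k Sf)) IHk -natr1; case: k {IHk} => [|k] /=.
  by rewrite !expr0; ring.
by rewrite exprS; ring.
Qed.

Lemma dom_sum (J : Type) (r : seq J) (P : pred J) (G : J -> T -> F) :
  (forall j, P j -> S (G j)) -> S (fun y => \sum_(j <- r | P j) G j y).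
Proof.
move=> SG; elim: r => [|j r IHr].
  by have := dom0 dd; congr S; apply/funext => y; rewrite big_nil.
case Pj: (P j); last by move: IHr; congr S; apply/funext => y; rewrite big_cons Pj.
by have := domD dd (SG j Pj) IHr; congr S; apply/funext => y; rewrite big_cons Pj.
Qed.

Lemma der_sum (J : Type) (r : seq J) (P : pred J) (G : J -> T -> F) :
  (forall j, P j -> S (G j)) ->
  d (fun y => \sum_(j <- r | P j) G j y) = \sum_(j <- r | P j) d (G j).
Proof.
move=> SG; elim: r => [|j r IHr].
  by rewrite big_nil -[RHS]der0; congr d; apply/funext => y; rewrite big_nil.
rewrite big_cons; case Pj: (P j).
  rewrite -IHr -(derD dd (SG j Pj) (dom_sum r SG)).
  by congr d; apply/funext => y; rewrite big_cons Pj.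
by rewrite -IHr; congr d; apply/funext => y; rewrite big_cons Pj.
Qed.

Lemma dom_nat k : S (fun=> k%:R).
Proof.
elim: k => [|k IHk]; first exact: (dom0 dd).
by have := domD dd IHk (dom1 dd); congr S; apply/funext => y; rewrite natr1.
Qed.

Lemma der_nat k : d (fun=> k%:R) = 0.
Proof.
elim: k => [|k IHk]; first exact: der0.
rewrite -[RHS]addr0 -[X in X + _]IHk -[X in _ + X](der1 dd).
rewrite -(derD dd (dom_nat k) (dom1 dd)).
by congr d; apply/funext => y; rewrite natr1.
Qed.

Lemma der_natM k f : S f -> d (fun y => k%:R * f y) = k%:R * d f.
Proof. by move=> Sf; rewrite (derM dd (dom_nat k) Sf) der_nat mul0r add0r. Qed.

Lemma derV u : S u -> S (fun y => (u y)^-1) -> near (fun y => u y != 0) -> u x != 0 ->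
  d (fun y => (u y)^-1) = - (d u / u x ^+ 2).
Proof.
move=> Su Sv nu ux; have := derM dd Su Sv.
have -> : d (fun y => u y * (u y)^-1) = 0.
  rewrite -(der1 dd); apply: (der_ext dd) (domM dd Su Sv).
  by apply: (der_near dd) nu => y uy; rewrite divff.
move=> /esym/eqP; rewrite addrC addr_eq0 => /eqP h.
by apply: (mulfI ux); rewrite h; field.
Qed.

Lemma derVn u k : S u -> S (fun y => (u y)^-1) -> near (fun y => u y != 0) -> u x != 0 ->
  d (fun y => u y ^- k) = - (k%:R * (u x ^- k.+1) * d u).
Proof.
move=> Su Sv nu ux; have -> : (fun y => u y ^- k) = (fun y => (u y)^-1 ^+ k).
  by apply/funext => y; rewrite exprVn.
rewrite (derX _ Sv) derV //; case: k => [|k]; first by rewrite !mul0r oppr0.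
rewrite exprVn [k.+1.-1]/= !exprS; have := expf_neq0 k ux.
by move: (u x ^+ k) => a a0; field; rewrite a0 ux.
Qed.

End DerivationTheory.

Section PartialFractions.
Variables (K F : fieldType) (inj : K -> F).

(* The terms (0, k, c) and (s, k, c), s > 0, stand for c z^k and
   c (z - a_s)^{-k}. *)
Definition pfb (a : nat -> K) (e : nat * nat) (z : F) : F :=
  if e.1 == 0%N then z ^+ e.2 else (z - inj (a e.1)) ^- e.2.
Definition pfe (a : nat -> K) (l : seq (nat * nat * K)) (z : F) : F :=
  \sum_(e <- l) inj e.2 * pfb a e.1 z.
(** An exponent 0 acquires the coefficient 0, so its truncated predecessor is harmless. *)
Definition pfdz (l : seq (nat * nat * K)) : seq (nat * nat * K) :=
  [seq if e.1.1 == 0%N then (0%N, e.1.2.-1, e.1.2%:R * e.2)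
       else (e.1.1, e.1.2.+1, - (e.1.2%:R * e.2)) | e <- l].

End PartialFractions.

Definition pfat (T K : Type) (l : seq (nat * nat * (T -> K))) (t : T) :
  seq (nat * nat * K) := [seq (e.1, e.2 t) | e <- l].

(** Each term yields two, from its coefficient and from the motion of its pole. For powers of z the
    second one is kept, with coefficient 0. *)
Definition pfdt (T : Type) (K : fieldType) (dc : (T -> K) -> K) (a : nat -> T -> K)
    (t : T) (l : seq (nat * nat * (T -> K))) : seq (nat * nat * K) :=
  flatten [seq [:: (e.1, dc e.2);
    (e.1.1, e.1.2.+1,
     if e.1.1 == 0%N then 0 else e.1.2%:R * e.2 t * dc (a e.1.1))] | e <- l].

Section PartialFractionDerivation.
Variables (T : Type) (F : fieldType) (S : (T -> F) -> Prop).
Variables (near : (T -> Prop) -> Prop) (x : T) (d : (T -> F) -> F).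
Hypothesis dd : derivation S near x d.
Variables (U : Type) (K : fieldType) (inj : {rmorphism K -> F}).
Variables (H : (U -> K) -> Prop) (cf : (U -> K) -> T -> F) (t : U).
Variables (dc : (U -> K) -> K) (Z : T -> F).
Hypothesis cfS : forall c, H c -> S (cf c).
Hypothesis cfx : forall c, cf c x = inj (c t).
Hypothesis cfd : forall c, H c -> d (cf c) = inj (dc c).
Hypothesis ZS : S Z.
Variables (a : nat -> U -> K) (l : seq (nat * nat * (U -> K))).
Hypothesis lH : forall e, e \in [seq e.1 | e <- l] -> e.1 != 0%N ->
  [/\ H (a e.1), S (fun y => (Z y - cf (a e.1) y)^-1),
      near (fun y => Z y - cf (a e.1) y != 0) & Z x - inj (a e.1 t) != 0].
Hypothesis cH : forall e, List.In e l -> H e.2.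

Let b (e : nat * nat) (y : T) : F :=
  if e.1 == 0%N then Z y ^+ e.2 else (Z y - cf (a e.1) y) ^- e.2.

Lemma pfb_der (e : nat * nat) : e \in [seq e.1 | e <- l] -> S (b e) /\
  d (b e) = (if e.1 == 0%N then e.2%:R * Z x ^+ e.2.-1 * d Z
    else - (e.2%:R * (Z x - inj (a e.1 t)) ^- e.2.+1 * (d Z - inj (dc (a e.1))))).
Proof.
move=> el; have := lH el; rewrite /b; case: eqP => [_ _|_ /(_ isT)[Ha Sv nu ux]].
  by split; [exact: (domX dd)|exact: (derX dd)].
have Su : S (fun y => Z y - cf (a e.1) y) by apply: (domB dd) => //; exact: cfS.
split.
  have := domX dd e.2 Sv; congr S; apply/funext => y; by rewrite exprVn.
rewrite (derVn dd) ?cfx // (derB dd) ?cfd //.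
exact: cfS.
Qed.

(** [Z] is left free so that one computation serves all cases: [d Z] is 1 for d/dz and 0 for
    derivatives at fixed z. *)
Lemma pfe_der : S (fun y => \sum_(e <- l) cf e.2 y * b e.1 y) /\
  d (fun y => \sum_(e <- l) cf e.2 y * b e.1 y) =
  pfe inj (a^~ t) (pfdt dc a t l) (Z x) + d Z * pfe inj (a^~ t) (pfdz (pfat l t)) (Z x).
Proof.
have : forall e, List.In e l -> H e.2 /\ (S (b e.1) /\
  d (b e.1) = (if e.1.1 == 0%N then e.1.2%:R * Z x ^+ e.1.2.-1 * d Z
    else - (e.1.2%:R * (Z x - inj (a e.1.1 t)) ^- e.1.2.+1 * (d Z - inj (dc (a e.1.1)))))).
  move=> e el; split; first exact: cH.
  apply: pfb_der; elim: (l) el => //= e' l' IHl [->|/IHl el].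
    by rewrite mem_head.
  by rewrite in_cons el orbT.
elim: (l) => [|e l' IHl] lP.
  rewrite /pfe /= !big_nil mulr0 addr0; split.
    by have := dom0 dd; congr S; apply/funext => y; rewrite big_nil.
  by rewrite -[RHS](der0 dd); congr d; apply/funext => y; rewrite big_nil.
have [|IH1 IH2] := IHl; first by move=> e' el; apply: lP; right.
have [He [Sb db]] := lP e (or_introl erefl).
have Se : S (fun y => cf e.2 y * b e.1 y) by apply: (domM dd) => //; exact: cfS.
have -> : (fun y => \sum_(e0 <- e :: l') cf e0.2 y * b e0.1 y) =
    (fun y => cf e.2 y * b e.1 y + \sum_(e0 <- l') cf e0.2 y * b e0.1 y).
  by apply/funext => y; rewrite big_cons.
split; first exact: (domD dd).
rewrite (derD dd) // IH2 (derM dd) //; last exact: cfS.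
rewrite cfd // cfx db /pfe /= !big_cons /b /pfb /= cfx.
case: ifP => e0; rewrite ?e0 /= ?e0 ?(eqP e0) ?rmorph0 ?rmorphN !rmorphM !rmorph_nat.
  by move: (\sum_(_ <- _) _) (\sum_(_ <- _) _) (Z x ^+ _) (Z x ^+ _) (Z x ^+ _) =>
    A B c1 c2 c3; ring.
by move: (\sum_(_ <- _) _) (\sum_(_ <- _) _) (_ ^- _) (_ ^- _) => A B c1 c2; ring.
Qed.

End PartialFractionDerivation.

Lemma In_map (T U : Type) (f : T -> U) (l : seq T) y :
  List.In y (map f l) -> exists2 x, List.In x l & y = f x.
Proof.
elim: l => //= x l IHl [<-|/IHl[x' xl ->]]; first by exists x; [left|].
by exists x'; [right|].
Qed.

Lemma In_cat (T : Type) (r s : seq T) y :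
  List.In y (r ++ s) -> List.In y r \/ List.In y s.
Proof.
elim: r => [|z r IHr] /=; first by right.
by case=> [->|/IHr[]]; [left; left|left; right|right].
Qed.

Lemma In_flatten_map (T U : Type) (f : T -> seq U) (l : seq T) y :
  List.In y (flatten (map f l)) -> exists2 x, List.In x l & List.In y (f x).
Proof.
elim: l => //= x l IHl yl; case: (In_cat yl) => [xf|/IHl[x' xl yf]].
  by exists x; [left|].
by exists x'; [right|].
Qed.

Lemma lderivN (K : fieldType) (f : laurent K) : lderiv (- f) = - lderiv f.
Proof. by apply: laurentP => k; rewrite lcoefN !lcoef_lderiv lcoefN mulrN. Qed.

(** * Derivatives at fixed z of expansions at moving points *)

Section MovingCentre.
Variables (R : realType) (I : finType).
Local Notation C := (Cx R).
Local Notation V := 'rV[C]_#|I|.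
Local Notation L := (laurent C).
Variable D : set V.
Hypothesis Do : open D.
Implicit Types (f g l : V -> L) (al : I) (t : V) (P : option (V -> C)).
Local Notation lfam := (lfam D).

Definition pt P t : option C := omap (fun a => a t) P.
Definition centre P : Prop := if P is Some a then holo D a else True.
Definition onD (Q : V -> Prop) : Prop := forall s, D s -> Q s.

(* The derivative at fixed z of a family expanded at the moving point P: the
   local parameter z - a moves with the flat coordinates. *)
Definition Dt al P f t : L :=
  ldiff al f t - (if P is Some a then lconst (pd al a t) * lderiv (f t) else 0).

Lemma der_dzo P t : D t -> derivation lfam onD t (fun f => dzo (pt P t) (f t)).
Proof.
move=> Dt; split.
- by move=> f g fg _; rewrite fg.
- by move=> Q Q' QQ' Qh s /Qh/QQ'.
- exact: lfam_cst.
- exact: lfam_cst.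
- by move=> f g; exact: lfamD.
- by move=> f; exact: lfamN.
- by move=> f g; exact: lfamM.
- by rewrite -(rmorph1 (@lconst C)) dzo_const.
- by move=> f g _ _; exact: dzoD.
- by move=> f g _ _; exact: dzoM.
Qed.

Lemma field_derM (F : fieldType) (df dg a f' g' f g : F) :
  df * g + f * dg - a * (f' * g + f * g') = (df - a * f') * g + f * (dg - a * g').
Proof. by ring. Qed.

Lemma der_Dt al P t : D t -> derivation lfam onD t (fun f => Dt al P f t).
Proof.
move=> tD; split.
- move=> f g fg fl; rewrite /Dt (ldiff_ext Do al tD fl fg).
  by case: P => [a|] //; rewrite fg.
- by move=> Q Q' QQ' Qh s /Qh/QQ'.
- exact: lfam_cst.
- exact: lfam_cst.
- by move=> f g; exact: lfamD.
- by move=> f; exact: lfamN.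
- by move=> f g; exact: lfamM.
- rewrite /Dt (ldiff_cst Do) //; case: P => [a|]; rewrite ?subr0 //.
  by rewrite -(rmorph1 (@lconst C)) lderiv_const mulr0 subr0.
- move=> f g fl gl; rewrite /Dt (ldiffD Do al tD fl gl); case: P => [a|].
    by rewrite lderivD mulrDr opprD addrACA.
  by rewrite !subr0.
- move=> f g fl gl; rewrite /Dt (ldiffM Do al tD fl gl); case: P => [a|].
    by rewrite lderivM; exact: field_derM.
  by rewrite !subr0.
Qed.

Lemma Dt_const al P c t : D t -> holo D c ->
  Dt al P (fun s => lconst (c s)) t = lconst (pd al c t).
Proof.
move=> tD ch; rewrite /Dt (ldiff_const Do al tD ch); case: P => [a|].
  by rewrite lderiv_const mulr0 subr0.
by rewrite subr0.
Qed.

Lemma lfam_zo P : centre P -> lfam (fun s => zo (pt P s)).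
Proof.
case: P => [a|] /= ah; last exact: lfam_cst.
by apply: lfamD; [exact: lfam_const|exact: lfam_cst].
Qed.

(** In z = a + x the derivative of [a] cancels against the correction term; this is what fixed z
    means for [Dt]. *)
Lemma Dt_zo al P t : D t -> centre P -> Dt al P (fun s => zo (pt P s)) t = 0.
Proof.
move=> tD; rewrite /Dt; case: P => [a|] /= ah; last by rewrite (ldiff_cst Do) // subr0.
rewrite (ldiffD Do al tD (lfam_const Do ah) (lfam_cst D _)).
by rewrite (ldiff_cst Do) // addr0 (ldiff_const Do al tD ah) lderiv_zat mulr1 subrr.
Qed.

Lemma Dt_dzo al P f t : D t -> lfam f ->
  Dt al P (fun s => dzo (pt P s) (f s)) t = dzo (pt P t) (Dt al P f t).
Proof.
move=> tD fl; rewrite /Dt; case: P => [a|] /=.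
  rewrite (ldiff_lderiv Do al tD fl) lderivD; congr (_ + _).
  by rewrite lderivN lderivM lderiv_const mul0r add0r.
rewrite !subr0 -(ldiff_lderiv Do al tD fl).
have vl : lfam (fun=> lvar C ^+ 2) by exact: lfam_cst.
have dl := lfam_lderiv fl.
have := derN (der_Dt al None tD) (lfamM Do vl dl); rewrite /Dt !subr0 => ->.
by rewrite (ldiffM Do al tD vl dl) (ldiff_cst Do) // mul0r add0r.
Qed.

(** The correction term is a multiple of a derivative in the local parameter and has no residue, so
    the motion of the pole does not affect the derivative of a residue. *)
Lemma reso_Dt al P f t : D t -> lfam f ->
  reso (pt P t) (Dt al P f t) = pd al (fun s => reso (pt P s) (f s)) t.
Proof.
move=> tD fl; rewrite /Dt; case: P => [a|] /=.
  rewrite /res_at lcoefD lcoefN lcoefCM lcoef_lderiv mul0r mulr0 subr0.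
  exact: (ldiffE Do al (-1) fl tD).
rewrite subr0 /res_inf (ldiffE Do al _ fl tD) pdN //; exact: (lfam_holo 1 fl).
Qed.

Lemma dzo_log o (l f : L) : is_log l f -> dzo o l = dzo o f / f.
Proof. by case=> _ _ lE; case: o => [c|] /=; rewrite lE // mulNr mulrA. Qed.

(** Both sides have the same derivative in the local parameter, and the constant coefficients agree
    by [pd_expC]. *)
Lemma ldiff_log al l f t : D t -> lfam l -> lfam f ->
  (forall s, D s -> lord 0 (f s)) -> (forall s, D s -> is_log (l s) (f s)) ->
  ldiff al l t = ldiff al f t / f t.
Proof.
move=> tD ll fl f0 lf; have fV := lfamV Do f0 fl.
have dd := der_Dt al None tD.
have nf : onD (fun s => f s != 0) by move=> s /f0/lord_neq0.
have ft := nf t tD.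
have dfl := lfam_lderiv fl.
have E : ldiff al (fun s => lderiv (l s)) t = lderiv (ldiff al f t / f t).
  rewrite (ldiff_ext Do al (g := fun s => lderiv (f s) * (f s)^-1) tD) //; last 2 first.
  - exact: lfam_lderiv.
  - by move=> s /lf[_ _].
  rewrite (ldiffM Do al tD dfl fV) (ldiff_lderiv Do al tD fl) lderivM.
  have := derV dd fl fV nf ft; rewrite /Dt !subr0 => ->.
  have /= -> := @dzoV C (Some 0) (f t).
  by rewrite !mulrN !mulrA [lderiv (f t) * _]mulrC.
apply/eqP; rewrite -subr_eq0; apply/eqP; apply: laurentP => k; rewrite lcoef0.
have [->|k0] := eqVneq k 0.
  rewrite lcoefD lcoefN (ldiffE Do al _ ll tD).
  have fN s : D s -> lge 0 (f s) by move=> /f0/lord_ge.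
  have f0V := lordV (f0 t tD); rewrite oppr0 in f0V.
  rewrite (lcoef0M (lge_ldiff Do al fl tD fN) (lord_ge f0V)) (ldiffE Do al _ fl tD).
  have := lcoefV (f0 t tD); rewrite oppr0 => ->.
  have -> : pd al (fun s => lcoef (f s) 0) t = pd al (fun s => lcoef (l s) 0) t * lcoef (f t) 0.
    apply: pd_expC.
    - exact: (lfam_holo 0 ll).
    - exact: (lfam_holo 0 fl).
    - by apply: (near_dom Do tD) => s /lf[].
  by rewrite mulfK ?subrr // (f0 t tD).2.
have : lderiv (ldiff al l t - ldiff al f t / f t) = 0.
  by rewrite lderivD -(ldiff_lderiv Do al tD ll) E lderivN subrr.
move/(congr1 (fun u : L => lcoef u (k - 1))); rewrite lcoef_lderiv subrK lcoef0.
by move/eqP; rewrite mulf_eq0 intr_eq0 (negbTE k0) => /eqP.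
Qed.

Lemma Dt_log al P l f t : D t -> lfam l -> lfam f ->
  (forall s, D s -> lord 0 (f s)) -> (forall s, D s -> is_log (l s) (f s)) ->
  Dt al P l t = Dt al P f t / f t.
Proof.
move=> tD ll fl f0 lf; rewrite /Dt (ldiff_log al tD ll fl f0 lf).
case: P => [a|]; last by rewrite !subr0.
by have [_ _ ->] := lf t tD; rewrite mulrBl mulrA.
Qed.

Lemma pfe_Dt (dl : (V -> L) -> L) (dc : (V -> C) -> C) P (a : nat -> V -> C)
    (l : seq (nat * nat * (V -> C))) t : D t -> centre P ->
  derivation lfam onD t dl -> (forall c, holo D c -> dl (fun s => lconst (c s)) = lconst (dc c)) ->
  (forall e, List.In e l -> holo D e.2) ->
  (forall s, s \in [seq e.1.1 | e <- l] -> s != 0%N -> holo D (a s) /\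
     exists N, forall u, D u -> lord N (zo (pt P u) - lconst (a s u))) ->
  let G := fun u => pfe (@lconst C) (a^~ u) (pfat l u) (zo (pt P u)) in
  lfam G /\ dl G = pfe (@lconst C) (a^~ t) (pfdt dc a t l) (zo (pt P t)) +
    dl (fun u => zo (pt P u)) * pfe (@lconst C) (a^~ t) (pfdz (pfat l t)) (zo (pt P t)).
Proof.
move=> tD Pc dd dlc lh la G.
have zl := lfam_zo Pc.
have al e : e \in [seq e.1 | e <- l] -> e.1 != 0%N ->
  [/\ holo D (a e.1), lfam (fun y => (zo (pt P y) - lconst (a e.1 y))^-1),
      onD (fun y => zo (pt P y) - lconst (a e.1 y) != 0)
    & zo (pt P t) - lconst (a e.1 t) != 0].
  move=> el e0; have [|ah [N aN]] := la e.1 _ e0.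
    by have /(map_f fst) := el; rewrite -map_comp.
  have nz y : D y -> zo (pt P y) - lconst (a e.1 y) != 0 by move=> /aN/lord_neq0.
  split=> //; last exact: nz.
  apply: (lfamV Do aN); apply: lfamB => //; exact: lfam_const.
have := pfe_der (inj := @lconst C) (H := holo D) (cf := fun c s => lconst (c s)) dd
  (fun c ch => lfam_const Do ch) (fun c => erefl) dlc zl al lh.
have -> // : (fun y => \sum_(e <- l) lconst (e.2 y) * (if e.1.1 == 0%N then zo (pt P y) ^+ e.1.2
   else (zo (pt P y) - lconst (a e.1.1 y)) ^- e.1.2)) = G.
by apply/funext => y; rewrite /G /pfe /pfat big_map.
Qed.

End MovingCentre.

Lemma pfdt0 (T : Type) (K F : fieldType) (inj : {rmorphism K -> F}) a' (a : nat -> T -> K) t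
  (l : seq (nat * nat * (T -> K))) (z : F) : pfe inj a' (pfdt (fun=> 0) a t l) z = 0.
Proof.
elim: l => [|e l IHl]; first by rewrite /pfe /= big_nil.
rewrite /pfe /= !big_cons -/(pfdt (fun=> 0) a t l) -/(pfe inj a' _ z) IHl /=.
by rewrite mulr0 if_same rmorph0 !mul0r !add0r.
Qed.

(** * Partial fractions as functions and as expansions at regular points *)

Section Values.
Variables (R : realType) (I : finType).
Local Notation C := (Cx R).
Local Notation V := 'rV[C]_#|I|.
Local Notation L := (laurent C).

Lemma der_pd (al : I) (t : V) :
  derivation (fun f : V -> C => differentiable f t) (fun Q => \forall s \near t, Q s) t
    (fun f => pd al f t).
Proof.
split.
- by move=> f g fg _; exact: pd_near_eq.
- by move=> P Q PQ; apply: filterS.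
- exact: differentiable_cst.
- exact: differentiable_cst.
- by move=> f g; exact: differentiableD.
- by move=> f; exact: differentiableN.
- by move=> f g; exact: differentiableM.
- exact: pd_cst.
- by move=> f g; exact: pdD.
- by move=> f g; exact: pdM.
Qed.

Lemma der_derive1 (z : C) :
  derivation (fun f : C -> C => derivable f z 1) (fun Q => \forall y \near z, Q y) z
    (fun f => derive1 f z).
Proof.
split.
- by move=> f g fg _; rewrite !derive1E; exact: near_eq_derive.
- by move=> P Q PQ; apply: filterS.
- exact: derivable_cst.
- exact: derivable_cst.
- by move=> f g; exact: derivableD.
- by move=> f; exact: derivableN.
- by move=> f g; exact: derivableM.
- exact: derive1_cst.
- by move=> f g fz gz; rewrite !derive1E; exact: (deriveD fz gz).
- move=> f g fz gz; rewrite !derive1E addrC [_ * g z]mulrC.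
  exact: (deriveM fz gz).
Qed.

Lemma near_neq (T : normedModType C) (f : T -> C) (t : T) :
  {for t, continuous f} -> f t != 0 -> \forall s \near t, f s != 0.
Proof.
move=> fc f0; have f1 : 0 < `|f t| by rewrite normr_gt0.
move/cvgrPdist_lt : fc => /(_ _ f1); apply: filterS => s; apply: contraTneq => ->.
by rewrite subr0 ltxx.
Qed.

Lemma pfe_pd (al : I) (a : nat -> V -> C) (l : seq (nat * nat * (V -> C))) (t : V) (z : C) :
  (forall e, List.In e l -> differentiable e.2 t) ->
  (forall s, s \in [seq e.1.1 | e <- l] -> s != 0%N -> differentiable (a s) t /\ z <> a s t) ->
  let G := fun u => pfe idfun (a^~ u) (pfat l u) z in
  differentiable G t /\
  pd al G t = pfe idfun (a^~ t) (pfdt (fun c => pd al c t) a t l) z.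
Proof.
move=> lh la G; have dd := der_pd al t.
have zS : differentiable (fun=> z : C) t by exact: differentiable_cst.
have ah e : e \in [seq e.1 | e <- l] -> e.1 != 0%N ->
  [/\ differentiable (a e.1) t, differentiable (fun y => (z - a e.1 y)^-1) t,
      \forall y \near t, z - a e.1 y != 0
    & z - a e.1 t != 0].
  move=> el e0; have [|ah za] := la e.1 _ e0.
    by have /(map_f fst) := el; rewrite -map_comp.
  have za0 : z - a e.1 t != 0 by rewrite subr_eq0; apply/eqP.
  have du : differentiable (fun y => z - a e.1 y) t.
    by apply: differentiableB; [exact: differentiable_cst|exact: ah].
  split=> //; first by apply: differentiableV.
  apply: (@near_neq _ (fun y => z - a e.1 y) t _ za0).
  exact: differentiable_continuous du.
have := pfe_der (inj := idfun) (H := fun c => differentiable c t)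
  (cf := fun c : V -> C => c) (dc := fun c => pd al c t) dd
  (fun c ch => ch) (fun c => erefl) (fun c ch => erefl) zS ah lh.
rewrite pd_cst mul0r addr0.
have -> // : (fun y => \sum_(e <- l) e.2 y * (if e.1.1 == 0%N then z ^+ e.1.2
   else (z - a e.1.1 y) ^- e.1.2)) = G.
by apply/funext => y; rewrite /G /pfe /pfat big_map.
Qed.

Lemma pfe_derive1 (a : nat -> C) (l : seq (nat * nat * C)) (z : C) :
  (forall s, s \in [seq e.1.1 | e <- l] -> s != 0%N -> z <> a s) ->
  derivable (pfe idfun a l) z 1 /\
  derive1 (pfe idfun a l) z = pfe idfun a (pfdz l) z.
Proof.
move=> la; have dd := der_derive1 z.
(* Constant coefficients and poles are families over a one-point space, with the zero derivation. *)
pose l' : seq (nat * nat * (unit -> C)) := [seq (e.1, fun=> e.2) | e <- l].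
have l'E : pfat l' tt = l.
  by rewrite /pfat -map_comp -[RHS]map_id; apply: eq_map => -[].
have ah e : e \in [seq e.1 | e <- l'] -> e.1 != 0%N ->
  [/\ True, derivable (fun y => (y - a e.1)^-1) z 1,
      \forall y \near z, y - a e.1 != 0
    & z - a e.1 != 0].
  move=> el e0; have za := la e.1 _ e0.
  have za0 : z - a e.1 != 0.
    rewrite subr_eq0; apply/eqP; apply: za; have /(map_f fst) := el.
    by rewrite -!map_comp.
  have du : derivable (fun y : C => y - a e.1) z 1.
    by apply: derivableB; [exact: derivable_id|exact: derivable_cst].
  have dV : derivable (fun y : C => (y - a e.1)^-1) z 1.
    apply/derivable1_diffP; apply: differentiableV; last exact: za0.
    by apply/derivable1_diffP; exact: du.
  split; [by []|exact: dV| |exact: za0].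
  apply: (@near_neq _ (fun y : C => y - a e.1) z _ za0).
  by apply: differentiable_continuous; apply/derivable1_diffP; exact: du.
have zS : derivable (fun y : C => y) z 1 by exact: derivable_id.
have [] := @pfe_der _ _ _ _ _ _ dd unit C idfun (fun _ => True) (fun c _ => c tt) tt
  (fun _ => 0) (fun y => y) (fun c _ => derivable_cst (c tt) z 1) (fun c => erefl)
  (fun c _ => derive1_cst (c tt) z) zS (fun s _ => a s) l' ah
  (fun _ _ => Logic.I).
have dz1 : derive1 (fun y : C => y) z = 1 by rewrite derive1E; exact: derive_id.
rewrite l'E pfdt0 add0r dz1 mul1r.
have -> // : (fun y => \sum_(e <- l') e.2 tt * (if e.1.1 == 0%N then y ^+ e.1.2
   else (y - a e.1.1) ^- e.1.2)) = pfe idfun a l.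
by apply/funext => y; rewrite /pfe /l' big_map.
Qed.

(** At a regular point the constant coefficient is the value; through it, identities between
    expansions become identities between functions. *)
Lemma lcoef_pfe (a : nat -> C) (l : seq (nat * nat * C)) (z : C) :
  (forall s, s \in [seq e.1.1 | e <- l] -> s != 0%N -> z <> a s) ->
  lge 0 (pfe (@lconst C) a l (zat z)) /\
  lcoef (pfe (@lconst C) a l (zat z)) 0 = pfe idfun a l z.
Proof.
rewrite /pfe; elim: l => [|e l IHl] la; first by rewrite !big_nil.
have [|IH1 IH2] := IHl; first by move=> s sl; apply: la; rewrite in_cons sl orbT.
have [b0 bE] : lge 0 (pfb (@lconst C) a e.1 (zat z)) /\
    lcoef (pfb (@lconst C) a e.1 (zat z)) 0 = pfb idfun a e.1 z.
  have h (u : L) k : lge 0 u -> lge 0 (u ^+ k) /\ lcoef (u ^+ k) 0 = lcoef u 0 ^+ k.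
    move=> u0; elim: k => [|k [k1 k2]]; first by split; [exact: lge1|rewrite lcoef1].
    rewrite !exprS; split; last by rewrite lcoef0M // k2.
    by have := lgeM u0 k1; rewrite addr0.
  rewrite /pfb; case: ifP => e0.
    by have [h1 ->] := h _ e.1.2 (lge_zat z); rewrite lcoef_zat eqxx mul1r addr0.
  have za : z - a e.1.1 != 0.
    by rewrite subr_eq0; apply/eqP; apply: la; rewrite ?mem_head ?e0.
  have l0 := lord_zat za; have l0V := lordV l0; rewrite oppr0 in l0V.
  rewrite -exprVn zatB; have [h1 ->] := h _ e.1.2 (lord_ge l0V).
  have := lcoefV l0; rewrite oppr0 => ->.
  by split=> //; rewrite lcoef_zat eqxx mul1r addr0 exprVn.
rewrite !big_cons; split; first by apply: lgeD => //; exact: lge_constM.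
by rewrite lcoefD lcoefCM bE IH2.
Qed.

Lemma lge_pfe (a : nat -> C) (l : seq (nat * nat * C)) (z : C) :
  (forall s, s \in [seq e.1.1 | e <- l] -> s != 0%N -> z <> a s) ->
  lge 0 (pfe (@lconst C) a l (zat z)).
Proof. by case/lcoef_pfe. Qed.

Lemma ratl_pfe (a : nat -> C) (l : seq (nat * nat * C)) :
  ratl (fun o => pfe (@lconst C) a l (zo o)).
Proof.
apply: ratl_sum => e _; apply: ratlM (ratl_const _) _; rewrite /pfb.
case: (e.1.1 == 0%N); first by apply: ratlX; exact: ratl_zo.
by apply: ratlVn; apply: ratlB; [exact: ratl_zo|exact: ratl_const].
Qed.

Lemma pfe_dzo (a : nat -> C) (l : seq (nat * nat * C)) o :
  dzo o (pfe (@lconst C) a l (zo o)) = pfe (@lconst C) a (pfdz l) (zo o).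
Proof.
have dd : derivation (fun _ : unit -> L => True) (fun Q => Q tt) tt (fun f => dzo o (f tt)).
  split=> //; first by move=> f g ->.
  - by move=> P Q; apply.
  - by rewrite -(rmorph1 (@lconst C)) dzo_const.
  - by move=> f g _ _; exact: dzoD.
  - by move=> f g _ _; exact: dzoM.
pose l' : seq (nat * nat * (unit -> C)) := [seq (e.1, fun=> e.2) | e <- l].
have l'E : pfat l' tt = l.
  by rewrite /pfat -map_comp -[RHS]map_id; apply: eq_map => -[].
have ah e : e \in [seq e.1 | e <- l'] -> e.1 != 0%N ->
  [/\ True, True, zo o - lconst (a e.1) != 0 & zo o - lconst (a e.1) != 0].
  by move=> _ _; split=> //; exact: zoB_neq0.
have [_] := @pfe_der _ _ _ _ _ _ dd unit C (@lconst C) (fun _ => True)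
  (fun c _ => lconst (c tt)) tt (fun _ => 0) (fun _ => zo o) (fun _ _ => Logic.I)
  (fun c => erefl) (fun c _ => etrans (dzo_const o (c tt)) (esym (rmorph0 _))) Logic.I (fun s _ => a s) l' ah
  (fun _ _ => Logic.I).
rewrite l'E pfdt0 add0r dzo_zo mul1r => <-.
by rewrite /pfe /l' big_map.
Qed.

End Values.

Lemma pfe_pfdt (T : Type) (K F : fieldType) (inj : {rmorphism K -> F}) a'
    (dc : (T -> K) -> K) (a : nat -> T -> K) t (l : seq (nat * nat * (T -> K))) (z : F) :
  pfe inj a' (pfdt dc a t l) z =
  \sum_(e <- l) (inj (dc e.2) * pfb inj a' e.1 z +
    inj (if e.1.1 == 0%N then 0 else e.1.2%:R * e.2 t * dc (a e.1.1)) *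
    pfb inj a' (e.1.1, e.1.2.+1) z).
Proof.
rewrite /pfe /pfdt big_flatten big_map; apply: eq_bigr => e _.
by rewrite !big_cons big_nil /= addr0.
Qed.

(** * Expansions of lambda at the punctures *)

Section Chart.
Variables (R : realType) (m : nat) (n : nat -> nat).
Hypothesis m_ge1 : (1 <= m)%N.
Hypothesis n_gt0 : forall i, (i <= m)%N -> (0 < n i)%N.
Variable X : flat_chart R m n.
Local Notation C := (Cx R).
Local Notation L := (laurent C).
Local Notation I := (flat_index m n).
Local Notation V := 'rV[C]_#|I|.
Local Notation D := (dom X).
Implicit Types (t : V) (s : nat) (al be ga : I).

Lemma Do : open D. Proof. exact: dom_open. Qed.

Definition apole s t : C := coef X t s 0%N.
(* s = 0 stands for the puncture at infinity, s > 0 for a_{s,0}. *)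
Definition ctr s : option (V -> C) := if s == 0%N then None else Some (apole s).
Definition po s t : option C := pt (ctr s) t.

Definition lamL : seq (nat * nat * (V -> C)) :=
  (0%N, n 0, fun=> (n 0)%:R^-1) ::
  [seq (0%N, j, fun t => coef X t 0%N j) | j <- index_iota 0 (n 0)] ++
  flatten [seq [seq (i, j, fun t => coef X t i j) | j <- index_iota 1 (n i).+1]
          | i <- index_iota 1 m.+1].

Definition pfo (l : seq (nat * nat * (V -> C))) (o : option C) t : L :=
  pfe (@lconst C) (apole^~ t) (pfat l t) (zo o).

Lemma lam_pfe (F : fieldType) (inj : {rmorphism C -> F}) t z :
  lam m n inj (coef X t) z = pfe inj (apole^~ t) (pfat lamL t) z.
Proof.
rewrite /lam /pfe /pfat /lamL /= big_cons map_cat big_cat /= -addrA.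
congr (_ + (_ + _)); first by rewrite -map_comp big_map big_mkord.
rewrite map_flatten big_flatten -map_comp big_map; apply: eq_big_nat => i /andP[i1 _].
rewrite /= -map_comp big_map; apply: eq_big_nat => j _.
by rewrite /pfb /=; case: i i1.
Qed.

Lemma dlam_pfe (F : fieldType) (inj : {rmorphism C -> F}) al t z :
  dlam m n inj (coef X t) (dcoef X al t) z =
  pfe inj (apole^~ t) (pfdt (fun c => pd al c t) apole t lamL) z.
Proof.
rewrite pfe_pfdt /dlam /lamL big_cons big_cat /= pd_cst rmorph0 !mul0r !add0r.
congr (_ + _).
  rewrite big_map big_mkord; apply: eq_bigr => i _ /=.
  by rewrite rmorph0 mul0r addr0.
rewrite big_flatten big_map; apply: eq_big_nat => i /andP[i1 _].
rewrite big_map; apply: eq_big_nat => j _.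
by rewrite /pfb /=; case: i i1.
Qed.

Definition good (l : seq (nat * nat * (V -> C))) : Prop :=
  forall e, List.In e l -> (e.1.1 <= m)%N /\ holo D e.2.

Lemma good_lamL : good lamL.
Proof.
move=> e [<-|]; first by split=> //; exact: holo_cst.
move=> el; case: (In_cat el) => {}el.
  by have [j _ ->] := In_map el; split=> //; exact: coef_holo.
have [i im {}el] := In_flatten_map el; have [j _ ->] := In_map el.
split; last exact: coef_holo.
have {im} : i \in index_iota 1 m.+1.
  elim: (index_iota 1 m.+1) im => //= x r IHr [->|/IHr ir]; first exact: mem_head.
  by rewrite in_cons ir orbT.
by rewrite mem_index_iota ltnS => /andP[].
Qed.

Lemma good_index l : good l -> forall s, s \in [seq e.1.1 | e <- l] -> (s <= m)%N.
Proof.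
move=> lg s; have {}lg e : List.In e l -> (e.1.1 <= m)%N by case/lg.
elim: l lg => //= e l IHl lg; rewrite in_cons => /orP[/eqP->|]; first by apply: lg; left.
by apply: IHl => e' el; apply: lg; right.
Qed.

Lemma holo_apole s : holo D (apole s). Proof. exact: coef_holo. Qed.

Lemma centre_ctr s : centre D (ctr s).
Proof. by rewrite /ctr; case: eqP => //= _; exact: holo_apole. Qed.

Lemma po0 t : po 0 t = None. Proof. by []. Qed.
Lemma poS s t : po s.+1 t = Some (apole s.+1 t). Proof. by []. Qed.

Lemma apole_neq s s' t : D t -> (1 <= s <= m)%N -> (1 <= s' <= m)%N -> s != s' ->
  apole s t != apole s' t.
Proof. by move=> tD; exact: coef_distinct. Qed.

Lemma lord_zo s i t : D t -> (s <= m)%N -> (1 <= i <= m)%N ->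
  lord (if s == 0%N then -1 else if s == i then 1 else 0) (zo (po s t) - lconst (apole i t)).
Proof.
move=> tD sm im; case: s sm => [|s] sm; first exact: lord_zinfB.
rewrite poS /= zatB; case: eqP => [->|/eqP si]; first by rewrite subrr zat0; exact: lord_lvar.
by apply: lord_zat; rewrite subr_eq0 apole_neq.
Qed.

Lemma pf_Dt_hyp l s : good l -> (s <= m)%N ->
  forall i, i \in [seq e.1.1 | e <- l] -> i != 0%N -> holo D (apole i) /\
     exists N, forall u, D u -> lord N (zo (pt (ctr s) u) - lconst (apole i u)).
Proof.
move=> lg sm i il i0; split; first exact: holo_apole.
exists (if s == 0%N then -1 else if s == i then 1 else 0) => u Du.
by apply: lord_zo => //; rewrite lt0n i0 (good_index lg).
Qed.

Lemma lfam_pfo l s : good l -> (s <= m)%N -> lfam D (fun u => pfo l (po s u) u).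
Proof.
move=> lg sm; case: (pselect (exists t, D t)) => [[t tD]|Dn]; last first.
  by apply: (lfam_ext Do _ (lfam_cst D 0)) => t tD; case: Dn; exists t.
have [] := pfe_Dt Do tD (centre_ctr s) (der_dzo Do (ctr s) tD) (dc := fun=> 0) (l := l) (a := apole).
- by move=> c _; rewrite dzo_const rmorph0.
- by move=> e /lg[].
- exact: pf_Dt_hyp.
by [].
Qed.

Lemma Dt_pfo al l s t : D t -> good l -> (s <= m)%N ->
  Dt al (ctr s) (fun u => pfo l (po s u) u) t =
  pfe (@lconst C) (apole^~ t) (pfdt (fun c => pd al c t) apole t l) (zo (po s t)).
Proof.
move=> tD lg sm.
have [|||_] := pfe_Dt Do tD (centre_ctr s) (der_Dt Do al (ctr s) tD)
  (dc := fun c => pd al c t) (l := l) (a := apole).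
- by move=> c ch; exact: (Dt_const Do).
- by move=> e /lg[].
- exact: pf_Dt_hyp.
by rewrite (Dt_zo Do al tD (centre_ctr s)) mul0r addr0.
Qed.

Definition lamo (o : option C) t : L := lam m n (@lconst C) (coef X t) (zo o).
Definition dlamo al (o : option C) t : L :=
  dlam m n (@lconst C) (coef X t) (dcoef X al t) (zo o).

Lemma lamoE o t : lamo o t = pfo lamL o t.
Proof. exact: lam_pfe. Qed.

Lemma lfam_lamo s : (s <= m)%N -> lfam D (fun u => lamo (po s u) u).
Proof.
move=> sm; apply: (lfam_ext Do _ (lfam_pfo good_lamL sm)) => u _.
by rewrite lamoE.
Qed.

Lemma Dt_lamo al s t : D t -> (s <= m)%N ->
  Dt al (ctr s) (fun u => lamo (po s u) u) t = dlamo al (po s t) t.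
Proof.
move=> tD sm; rewrite /dlamo dlam_pfe -(Dt_pfo al tD good_lamL sm).
by congr (Dt _ _ _ _); apply/funext => u; exact: lamoE.
Qed.

Definition lead s t : C := if s == 0%N then (n 0)%:R^-1 else coef X t s (n s).

Lemma lead_neq0 s t : D t -> (s <= m)%N -> lead s t != 0.
Proof.
move=> tD sm; rewrite /lead; have [_|s0] := eqVneq s 0%N.
  by rewrite invr_eq0 pnatr_eq0 -lt0n n_gt0.
by apply: coef_lead => //; rewrite lt0n s0.
Qed.

Lemma lamo_lead s t : D t -> (s <= m)%N ->
  lge (1 - (n s)%:Z) (lamo (po s t) t - lconst (lead s t) * lvar C ^- n s).
Proof.
move=> tD sm; have polez i j : (1 <= i <= m)%N -> i != s ->
    lge 0 ((zo (po s t) - lconst (apole i t)) ^- j).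
  move=> im si; have [h _] := lordVn j (lord_zo tD sm im).
  by apply: lge_le h; case: eqP => _ //; rewrite eq_sym (negbTE si); lia.
rewrite /lamo /lam; case: s sm polez => [|s] sm polez.
  rewrite po0 /lead eqxx -exprVn -[(lvar C)^-1]/(@zinf C) /=.
  rewrite -[X in lge _ (X - _)]addrA [X in lge _ (X - _)]addrC addrK.
  apply: lgeD.
    apply: lge_sum => i _; apply: lge_constM; have := lord_ge (lordX i (lord_zinf C)).
    by apply: lge_le; have := ltn_ord i; lia.
  rewrite big_nat; apply: lge_sum => i /andP[i1 im]; rewrite big_nat.
  apply: lge_sum => j /andP[j1 _]; apply: lge_constM.
  have := lord_ge (lordVn j (lord_zinfB (apole i t))); apply: lge_le.
  by have := n_gt0 (leq0n m); lia.
have ns := n_gt0 sm; rewrite poS /lead /=.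
have s1 : s.+1 \in index_iota 1 m.+1 by rewrite mem_index_iota.
rewrite [X in _ + X - _](bigD1_seq s.+1) ?iota_uniq //= big_nat_recr //=.
rewrite zatB subrr zat0 [X in _ + X - _]addrAC addrA addrK.
apply: lgeD; first apply: lgeD.
- apply: (@lge_le _ 0); first by lia.
  by apply: lge_constM; have := @lgeX _ _ _ (n 0) (lge_zat (apole s.+1 t)); rewrite mulr0.
- apply: (@lge_le _ 0); first by lia.
  apply: lge_sum => i _; apply: lge_constM.
  by have := @lgeX _ _ _ i (lge_zat (apole s.+1 t)); rewrite mulr0.
apply: lgeD.
  rewrite big_nat; apply: lge_sum => j /andP[j1 jn]; apply: lge_constM.
  by have := lord_ge (lordVn j (lord_lvar C)); apply: lge_le; lia.
rewrite big_seq_cond; apply: lge_sum => i; rewrite mem_index_iota => /andP[im si].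
rewrite big_nat; apply: lge_sum => j _; apply: lge_constM.
by apply: (@lge_le _ 0); [lia|apply: polez].
Qed.

Lemma lord_lamo s t : D t -> (s <= m)%N -> lord (- (n s)%:Z) (lamo (po s t) t).
Proof.
move=> tD sm; have h := lamo_lead tD sm; rewrite -(subrK (lconst (lead s t) * lvar C ^- n s) (lamo _ _)).
rewrite addrC; apply: lordD h _; last by lia.
have := lordM (lord_const (lead_neq0 tD sm)) (lordVn (n s) (lord_lvar C)).
by rewrite add0r mulr1.
Qed.

(** At infinity the leading coefficient 1/n_0 is constant, which gains one order; at a_{1,0} = 0 the
    pole does not move; at the other poles the motion costs one order. *)
Lemma lge_dlamo al s t : D t -> (s <= m)%N ->
  lge (if s == 0%N then 1 - (n 0)%:Z else if s == 1%N then - (n 1)%:Z else - (n s)%:Z - 1)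
    (dlamo al (po s t) t).
Proof.
move=> tD sm; rewrite -Dt_lamo // /Dt /ctr.
have lN : forall u, D u -> lge (- (n s)%:Z) (lamo (po s u) u).
  by move=> u uD; apply: lord_ge; exact: lord_lamo.
have h := lge_ldiff Do al (lfam_lamo sm) tD lN.
have [s0|s0] := eqVneq s 0%N.
  rewrite subr0 => k kn; have [kn'|kn'] := ltP k (- (n s)%:Z); first exact: h.
  rewrite (ldiffE Do al k (lfam_lamo sm) tD).
  rewrite (pd_ext (g := fun=> (n 0)%:R^-1) Do al tD) ?pd_cst // => u uD.
  have := lamo_lead uD sm; rewrite s0 => /(_ k) /=.
  have kE : k = - (n 0)%:Z by rewrite s0 in kn'; lia.
  rewrite lcoefD lcoefN lcoefCM -exprVn -[(lvar C)^-1]/(@zinf C) lcoef_zinfX kE eqxx mulr1.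
  by move=> /(_ _)/eqP; rewrite subr_eq0 => /(_ _)/eqP-> //; lia.
have [s1|s1] := eqVneq s 1%N.
  subst s; rewrite /apole (pd_ext (g := fun=> 0) Do al tD) ?pd_cst; last first.
    by move=> u uD; exact: coef10.
  by rewrite rmorph0 mul0r subr0.
apply: lgeB; first by apply: lge_le h; lia.
by apply: lge_constM; apply: lge_lderiv; exact: lN.
Qed.

Lemma lord_lderiv (N : int) (f : L) : N != 0 -> lord N f -> lord (N - 1) (lderiv f).
Proof.
move=> N0 [fN f0]; split; first exact: lge_lderiv.
by rewrite lcoef_lderiv subrK mulf_neq0 // intr_eq0.
Qed.

Lemma lord_dzo_lamo s t : D t -> (s <= m)%N ->
  lord (if s == 0%N then 1 - (n 0)%:Z else - (n s)%:Z - 1) (dzo (po s t) (lamo (po s t) t)).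
Proof.
move=> tD sm; have n0 := n_gt0 sm.
have := lord_lderiv _ (lord_lamo tD sm); case: s sm n0 => [|s] sm n0 /(_ _)h.
  have /h {}h : - (n 0)%:Z != 0 by lia.
  apply: lordN; have -> : 1 - (n 0)%:Z = 2%:Z * 1 + (- (n 0)%:Z - 1) by lia.
  by apply: lordM h; apply: lordX; exact: lord_lvar.
by apply: h; lia.
Qed.

Lemma field_dlogV (F : fieldType) (x y w v : F) : w != 0 -> v != 0 ->
  (x * v^-1 + w * - (y / v ^+ 2)) / (w / v) = x / w - y / v.
Proof. by move=> w0 v0; field; rewrite w0 v0. Qed.

Lemma field_dlogM (F : fieldType) (x y w v : F) : w != 0 -> v != 0 ->
  (x * w + v * y) / (v * w) = y / w + x / v.
Proof. by move=> w0 v0; field; rewrite w0 v0. Qed.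

Lemma field_law (F : fieldType) (p q lo' lo ld N l c e k : F) :
  p != 0 -> q != 0 -> N != 0 -> lo != 0 ->
  p * lo' * ld / (p * q) * (l - e * ((c + p^-1) / N)) +
  lo * lo' / (p * q) * (e * (ld / (N * lo)) + k) =
  lo' / q * (l - e * (c / N)) * ld + lo * lo' / (p * q) * k.
Proof. by move=> p0 q0 N0 lo0; field; rewrite lo0 N0 q0 p0. Qed.

Definition wo s t : L := if s == 0%N then winf X t else w X s t.

Lemma wo_root s t : D t -> (s <= m)%N -> wo s t ^+ n s = (n s)%:R * lamo (po s t) t.
Proof.
move=> tD; rewrite /wo; case: s => [|s] sm; first exact: winf_root.
exact: w_root.
Qed.

Lemma natL_neq0 k : (0 < k)%N -> k%:R != 0 :> L.
Proof. by move=> k0; rewrite -(rmorph_nat (@lconst C)) fmorph_eq0 pnatr_eq0 -lt0n. Qed.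

Lemma wo_neq0 s t : D t -> (s <= m)%N -> wo s t != 0.
Proof.
move=> tD sm; have := wo_root tD sm; apply: contra_eq_neq => ->.
rewrite expr0n gtn_eqF ?n_gt0 //= eq_sym mulf_neq0 ?natL_neq0 ?n_gt0 //.
exact: lord_neq0 (lord_lamo tD sm).
Qed.

Lemma lord_wo s t : D t -> (s <= m)%N -> lord (-1) (wo s t).
Proof.
move=> tD sm; have [N wN] := lord_ex (wo_neq0 tD sm).
have nl : lord (- (n s)%:Z) ((n s)%:R * lamo (po s t) t).
  rewrite -[- _]add0r; apply: lordM (lord_lamo tD sm).
  rewrite -(rmorph_nat (@lconst C)); apply: lord_const.
  by rewrite pnatr_eq0 -lt0n n_gt0.
have := lordX (n s) wN; rewrite wo_root // => /(lord_inj nl) nN.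
by have -> : -1 = N by have := n_gt0 sm; nia.
Qed.

(** At infinity the root equation and the normalised leading coefficient 1 force holomorphy; at the
    poles a holomorphic choice of branch is part of the chart. *)
Lemma lfam_wo s : (s <= m)%N -> lfam D (wo s).
Proof.
case: s => [|s] sm; last first.
  apply/lfamP; split; last exact: w_holo.
  by exists (-1) => t tD; apply: lord_ge; exact: lord_wo.
apply: (lfam_root Do (n_gt0 sm) (fun u uD => wo_root uD sm) (fun u uD => lord_wo uD sm)).
  by apply: lfamM; [exact: Do|exact: lfam_cst|exact: lfam_lamo].
apply: (holo_ext Do _ (holo_cst (D := D) 1)) => t tD.
by rewrite /wo /= winf_lead.
Qed.

(** * The germs Lambda at the punctures and their differentials *)

Definition kidx al : option nat :=
  match al with
  | inl _ => None
  | inr (existT i j) => if (j < n i.+1)%N then None else Some i.+1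
  end.

Lemma kidx_le al i : kidx al = Some i -> (1 <= i <= m)%N.
Proof. by case: al => [//|[i' j]] /=; case: ifP => // _ [<-] /=. Qed.

(* [LamS al p.+1 s] is the expansion at the puncture s of the function whose
   residues define theta_{al,p}, and LamS al p its derivative with respect to
   lambda up to the derivative of the logarithms at fixed lambda. *)
Definition LamS al (q s : nat) t : L :=
  match al with
  | inl j => if s == 0%N then
        - (if q is p.+1 then Winf X j.+1 p t else winf X t ^- j.+1) else 0
  | inr (existT i j) =>
      if (j < n i.+1)%N then
        if s == i.+1 then (if q is p.+1 then Wpole X i.+1 j p t else w X i.+1 t ^- j)
        else 0
      else if s == 0%N then - (if q is p.+1 then Linf X i.+1 p t else winf X t ^- n 0)
      else if s == i.+1 then
        (if q is p.+1 then Lpole X i.+1 p t else w X i.+1 t ^- n i.+1)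
      else (if q is p.+1 then Lother X i.+1 s p t else 0)
  end.

Definition Wgen (s j p : nat) t : L := lconst (cnum R n s j p) * wo s t ^+ (p.+1 * n s - j).

Definition logo (i s : nat) t : L :=
  if s == 0%N then log_winf X i t else if s == i then log_w X i t else log_z X i s t.
Definition logarg (i s : nat) t : L :=
  if s == 0%N then wo 0 t / (zo (po 0 t) - lconst (apole i t)) else
  if s == i then (zo (po i t) - lconst (apole i t)) * wo i t
  else zo (po s t) - lconst (apole i t).

Lemma logo_log i s t : D t -> (1 <= i <= m)%N -> (s <= m)%N ->
  is_log (logo i s t) (logarg i s t).
Proof.
move=> tD im sm; rewrite /logo /logarg; have [_|s0] := eqVneq s 0%N.
  exact: log_winf_log.
have [si|si] := eqVneq s i.
  by rewrite /wo /po /ctr; have [i0|_] := eqVneq i 0%N; [rewrite i0 in im|exact: log_w_log].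
rewrite /po /ctr (negbTE s0); apply: log_z_log => //; last by rewrite eq_sym.
by rewrite lt0n s0.
Qed.

Lemma lord_logarg i s t : D t -> (1 <= i <= m)%N -> (s <= m)%N -> lord 0 (logarg i s t).
Proof.
move=> tD im sm; rewrite /logarg; have [_|s0] := eqVneq s 0%N.
  have := lordM (lord_wo tD (leq0n m)) (lordV (lord_zo tD (leq0n m) im)).
  by rewrite opprK addNr.
have im' : (i <= m)%N by case/andP: im.
have h := lord_zo tD sm im; rewrite (negbTE s0) in h; have [si|si] := eqVneq s i.
  by have := lordM h (lord_wo tD sm); rewrite si eqxx subrr.
by rewrite (negbTE si) in h.
Qed.

Lemma lfam_zoB i s : (1 <= i <= m)%N -> (s <= m)%N ->
  lfam D (fun u => zo (po s u) - lconst (apole i u)).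
Proof.
move=> im sm; apply: lfamB; first by apply: (lfam_zo Do); exact: centre_ctr.
by apply: (lfam_const Do); exact: holo_apole.
Qed.

Lemma lfam_logarg i s : (1 <= i <= m)%N -> (s <= m)%N -> lfam D (logarg i s).
Proof.
move=> im sm; rewrite /logarg; have [_|s0] := eqVneq s 0%N.
  apply: lfamM; [exact: Do|exact: lfam_wo|].
  apply: (lfamV Do (N := -1)); last exact: lfam_zoB.
  by move=> u uD; exact: (lord_zo uD (leq0n m) im).
have im' : (i <= m)%N by case/andP: im.
have [si|si] := eqVneq s i; last exact: lfam_zoB.
by apply: lfamM; [exact: Do|exact: lfam_zoB|exact: lfam_wo].
Qed.

(** At infinity the branch is normalised to have constant coefficient 0, and the other coefficients
    come from the derivative; at the poles holomorphy is part of the chart. *)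
Lemma lfam_logo i s : (1 <= i <= m)%N -> (s <= m)%N -> lfam D (logo i s).
Proof.
move=> im sm; have lg u : D u -> is_log (logo i s u) (logarg i s u).
  by move=> uD; exact: logo_log.
have l0 u : D u -> lge 0 (logo i s u) by move=> /lg[].
rewrite /logo; have [s0|s0] := eqVneq s 0%N.
  apply: (lfam_lderiv_inv Do).
  - by move=> u /l0; rewrite /logo s0.
  - by apply: (holo_ext Do _ (holo_cst (D := D) 0)) => u uD; rewrite log_winf_branch.
  apply: (@lfam_ext _ _ _ Do (fun u => lderiv (logarg i s u) * (logarg i s u)^-1)).
    by move=> u /lg[_ _]; rewrite /logo s0.
  apply: lfamM; [exact: Do|apply: lfam_lderiv; exact: lfam_logarg|].
  apply: (lfamV Do (N := 0)); last exact: lfam_logarg.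
  by move=> u uD; exact: lord_logarg.
apply/lfamP; split.
  by exists 0 => u /l0; rewrite /logo (negbTE s0).
have [si|si] := eqVneq s i; first exact: log_w_holo.
by apply: log_z_holo => //; rewrite ?lt0n ?s0 // eq_sym.
Qed.

Definition Lgen (i s p : nat) (c : C) t : L :=
  lamo (po s t) t ^+ p / p`!%:R * (logo i s t - lconst c).

Lemma LamS_inr i (j : 'I_(n (nat_of_ord i).+1).+1) q s t : (n i.+1 <= j)%N ->
  LamS (idx j) q s t = if s == 0%N
    then - (if q is p.+1 then Lgen i.+1 0 p (csum R p / (n 0)%:R) t else wo 0 t ^- n 0)
    else if s == i.+1
    then (if q is p.+1 then Lgen i.+1 s p (csum R p / (n s)%:R) t else wo s t ^- n s)
    else (if q is p.+1 then Lgen i.+1 s p 0 t else 0).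
Proof.
move=> jn; rewrite /LamS /= ltnNge jn /=.
have [s0|s0] := eqVneq s 0%N; first by case: q.
have [si|si] := eqVneq s i.+1.
  subst s; case: q => [|p]; by rewrite // /Lpole /Lgen /logo eqxx.
case: q => [|p] //; rewrite /Lother /Lgen /logo (negbTE s0) (negbTE si) rmorph0 subr0.
by rewrite /lamo /po /ctr (negbTE s0).
Qed.

Section Law.
Variables (s : nat) (t : V) (d : (V -> L) -> L).
Hypotheses (sm : (s <= m)%N) (tD : D t).
Hypothesis dd : derivation (lfam D) (onD D) t d.
Hypothesis dconst : forall c : C, d (fun=> lconst c) = 0.
Hypothesis dlog : forall l f, lfam D l -> lfam D f -> (forall u, D u -> lord 0 (f u)) ->
  (forall u, D u -> is_log (l u) (f u)) -> d l = d f / f t.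

Local Notation ld := (d (fun u => lamo (po s u) u)).
Local Notation lo := (lamo (po s t) t).

Lemma d_wo : d (wo s) = ld / wo s t ^+ (n s).-1.
Proof.
have n0 := n_gt0 sm; have w0 := wo_neq0 tD sm.
have nN := natL_neq0 n0.
have h : d (fun u => wo s u ^+ n s) = d (fun u => (n s)%:R * lamo (po s u) u).
  apply: (der_ext dd); first by move=> u uD; exact: wo_root.
  by apply: (domX dd); exact: lfam_wo.
move: h; rewrite (derX dd _ (lfam_wo sm)) (der_natM dd _ (lfam_lamo sm)) => h.
apply: (mulfI (mulf_neq0 nN (expf_neq0 (n s).-1 w0))); rewrite h.
by rewrite -mulrA [_ * (ld / _)]mulrC divfK // expf_neq0.
Qed.

(** From w^n = n lambda follows d(w^e) = e w^(e-n) d lambda. The constants c_{s,j;p} are built so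
    that their last factor cancels e = (p+1) n - j. *)
Lemma d_Wgen j p : (j < n s)%N ->
  d (Wgen s j p) = (if p is p'.+1 then Wgen s j p' t else wo s t ^- j) * ld.
Proof.
move=> jn; have n0 := n_gt0 sm; have w0 := wo_neq0 tD sm.
pose e := (p.+1 * n s - j)%N.
have e0 : (0 < e)%N by rewrite /e mulSn; lia.
rewrite (derM dd (lfam_cst D _) (domX dd e (lfam_wo sm))) dconst mul0r add0r.
rewrite (derX dd _ (lfam_wo sm)) d_wo.
have eC : e%:R = p.+1%:R * (n s)%:R - j%:R :> C.
  by rewrite /e natrB ?natrM // mulSn; lia.
have cE : cnum R n s j p * e%:R = if p is p'.+1 then cnum R n s j p' else 1.
  rewrite /cnum big_nat_recr //= -eC -mulrA mulVf ?pnatr_eq0 -?lt0n // mulr1.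
  by case: (p) => [|p'] //; rewrite big_geq.
have -> : lconst (cnum R n s j p) * (e%:R * wo s t ^+ e.-1 * (ld / wo s t ^+ (n s).-1)) =
    lconst (cnum R n s j p * e%:R) * (wo s t ^+ e.-1 / wo s t ^+ (n s).-1) * ld.
  by rewrite rmorphM rmorph_nat !mulrA -!mulrA [ld * _]mulrC.
rewrite cE; congr (_ * _); case: p @e e0 {eC cE} => [|p] e e0.
  rewrite rmorph1 mul1r (_ : (n s).-1 = (e.-1 + j)%N) ?exprD ?invfM ?mulrA ?mulfV ?mul1r //.
    exact: expf_neq0.
  by rewrite /e; lia.
rewrite /Wgen; congr (_ * _).
rewrite (_ : e.-1 = ((p.+1 * n s - j) + (n s).-1)%N) ?exprD ?mulfK ?expf_neq0 //.
by rewrite /e !mulSn; lia.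
Qed.

Definition dkap (i : nat) : L :=
  d (fun u => zo (po s u) - lconst (apole i u)) / (zo (po s t) - lconst (apole i t)).

Lemma d_logo i : (1 <= i <= m)%N -> d (logo i s) =
  if s == 0%N then ld / wo s t ^+ n s - dkap i
  else if s == i then ld / wo s t ^+ n s + dkap i else dkap i.
Proof.
move=> im; have n0 := n_gt0 sm; have w0 := wo_neq0 tD sm.
have la := lfam_logarg im sm.
rewrite (dlog (lfam_logo im sm) la); last 2 first.
- by move=> u uD; exact: lord_logarg.
- by move=> u uD; exact: logo_log.
have za0 : zo (po s t) - lconst (apole i t) != 0 by exact: lord_neq0 (lord_zo tD sm im).
have wE : ld / wo s t ^+ n s = d (wo s) / wo s t.
  by rewrite d_wo -(prednK n0) /= exprS invfM mulrA mulrAC.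
have zl := lfam_zoB im sm.
rewrite wE /dkap /logarg; case: (eqVneq s 0%N) zl za0 wE => [s0|s0] zl za0 wE.
  subst s; have zV : lfam D (fun u => (zo (po 0 u) - lconst (apole i u))^-1).
    by apply: (lfamV Do (N := -1)) zl => u uD; exact: (lord_zo uD sm im).
  have nz : onD D (fun u => zo (po 0 u) - lconst (apole i u) != 0).
    by move=> u uD; exact: lord_neq0 (lord_zo uD sm im).
  rewrite (derM dd (lfam_wo sm) zV) (derV dd zl zV nz za0).
  by move: (d _) (d _) (wo 0 t) w0 (_ - _) za0 => x y w1 w10 v v0; exact: field_dlogV.
have [si|//] := eqVneq s i.
subst i; rewrite (derM dd zl (lfam_wo sm)).
by move: (d _) (d _) (wo s t) w0 (_ - _) za0 => x y w1 w10 v v0; exact: field_dlogM.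
Qed.

Lemma lo_neq0 : lo != 0.
Proof. exact: lord_neq0 (lord_lamo tD sm). Qed.

(** Here [e] is 1 if the logarithm contains w_s and 0 otherwise. The harmonic constants come from
    this step: for p > 0 the derivative of log w_s contributes 1/(p n_s) times lambda^(p-1)/(p-1)!,
    which turns c_p/n_s into c_{p-1}/n_s. For p = 0 it remains as the power w_s^(-n_s). *)
Lemma d_Lgen i p (e : C) k : (1 <= i <= m)%N ->
  d (logo i s) = lconst e * (ld / wo s t ^+ n s) + k ->
  d (Lgen i s p (e * (csum R p / (n s)%:R))) =
  (if p is p'.+1 then Lgen i s p' (e * (csum R p' / (n s)%:R)) t
   else lconst e * wo s t ^- n s) * ld + lo ^+ p / p`!%:R * k.
Proof.
move=> im dl; have ll := lfam_logo im sm; have n0 := n_gt0 sm.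
have pV (q : nat) : (q`!%:R : L)^-1 = lconst q`!%:R^-1 by rewrite fmorphV rmorph_nat.
have l1 : lfam D (fun u => lamo (po s u) u ^+ p / p`!%:R).
  by apply: (lfamM Do); [exact: (domX dd p (lfam_lamo sm))|exact: lfam_cst].
have l2 : lfam D (fun u => logo i s u - lconst (e * (csum R p / (n s)%:R))).
  by apply: lfamB => //; exact: lfam_cst.
rewrite (derM dd l1 l2) (derM dd (domX dd p (lfam_lamo sm)) (lfam_cst D _)) pV dconst.
rewrite mulr0 addr0 (derX dd _ (lfam_lamo sm)) (derB dd ll (lfam_cst D _)) dconst subr0 dl -pV.
rewrite wo_root //; case: p {l1 l2 dl} => [|p].
  rewrite !mul0r add0r fact0 expr0 /= mulrDr invfM.
  by rewrite divr1 !mul1r -!mulrA [ld * _]mulrC -!mulrA.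
have cE : csum R p.+1 = csum R p + p.+1%:R^-1 by rewrite /csum big_nat_recr.
have nV k0 : lconst k0.+1%:R^-1 = (k0.+1%:R : L)^-1 by rewrite fmorphV rmorph_nat.
have nE : lconst (n s)%:R^-1 = ((n s)%:R : L)^-1 by rewrite fmorphV rmorph_nat.
have c1 : lconst (e * (csum R p.+1 / (n s)%:R)) =
    lconst e * ((lconst (csum R p) + (p.+1%:R)^-1) / (n s)%:R).
  by rewrite cE -nV -nE -rmorphD -!rmorphM.
have c2 : lconst (e * (csum R p / (n s)%:R)) = lconst e * (lconst (csum R p) / (n s)%:R).
  by rewrite -nE -!rmorphM.
rewrite /Lgen c1 c2 factS natrM exprS [p.+1.-1]/=.
by apply: field_law; rewrite ?natL_neq0 ?fact_gt0 ?lo_neq0.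
Qed.

End Law.

(** The minus sign of [LamS] at infinity turns the [- dkap] of log(w_0/(z - a_{i,0})) into [+ dkap],
    so the kappa terms at all punctures are expansions of one function. Only formal properties of
    [d] enter, which covers d/dz and the derivatives at fixed z together. *)
Lemma LamS_law s t (d : (V -> L) -> L) al p : (s <= m)%N -> D t ->
  derivation (lfam D) (onD D) t d -> (forall c : C, d (fun=> lconst c) = 0) ->
  (forall l f, lfam D l -> lfam D f -> (forall u, D u -> lord 0 (f u)) ->
    (forall u, D u -> is_log (l u) (f u)) -> d l = d f / f t) ->
  d (LamS al p.+1 s) = LamS al p s t * d (fun u => lamo (po s u) u) +
    lamo (po s t) t ^+ p / p`!%:R * (if kidx al is Some i then dkap s t d i else 0).
Proof.
move=> sm tD dd dconst dlog.
case: al => [j|[i j]].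
  rewrite /= mulr0 addr0 /LamS; have [s0|s0] := eqVneq s 0%N; last by rewrite (der0 dd) mul0r.
  subst s; have jn : (j.+1 < n 0)%N by have := ltn_ord j; lia.
  rewrite (derN dd (f := Wgen 0 j.+1 p)); last first.
    by apply: (lfamM Do); [exact: lfam_cst|exact: (domX dd _ (lfam_wo sm))].
  by rewrite (d_Wgen sm tD dd dconst) // mulNr; case: p.
case: (ltnP j (n i.+1)) => jn.
  rewrite /kidx jn mulr0 addr0 /LamS jn.
  have [si|si] := eqVneq s i.+1; last by rewrite (der0 dd) mul0r.
  by subst s; rewrite (d_Wgen sm tD dd dconst p jn); case: p.
have -> : kidx (idx j) = Some i.+1 by rewrite /kidx /= ltnNge jn.
have im : (1 <= i.+1 <= m)%N by rewrite /= ltn_ord.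
have E := d_logo sm tD dd dlog im.
have -> : LamS (idx j) p.+1 s = if s == 0%N
    then fun u => - Lgen i.+1 0 p (csum R p / (n 0)%:R) u
    else if s == i.+1 then Lgen i.+1 s p (csum R p / (n s)%:R) else Lgen i.+1 s p 0.
  by apply/funext => u; rewrite LamS_inr //; do 2?case: ifP.
rewrite LamS_inr //; have [s0|s0] := eqVneq s 0%N.
  subst s; rewrite eqxx in E; rewrite (derN dd); last first.
    apply: (lfamM Do); last by apply: lfamB; [exact: lfam_logo|exact: lfam_cst].
    by apply: (lfamM Do); [exact: (domX dd _ (lfam_lamo sm))|exact: lfam_cst].
  have h := d_Lgen sm tD dd dconst p (e := 1) (k := - dkap 0 t d i.+1) im.
  rewrite !mul1r in h; rewrite h // opprD mulrN opprK mulNr.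
  by case: p {h} => //= p; rewrite !mul1r.
rewrite (negbTE s0) in E; have [si|si] := eqVneq s i.+1.
  have si' : (s == i.+1) = true by exact/eqP.
  rewrite si' in E; have h := d_Lgen sm tD dd dconst p (e := 1) (k := dkap s t d i.+1) im.
  rewrite !mul1r in h; rewrite h //.
  by case: p {h} => //= p; rewrite !mul1r.
rewrite (negbTE si) in E; have h := d_Lgen sm tD dd dconst p (e := 0) (k := dkap s t d i.+1) im.
rewrite !mul0r ?(rmorph0 (@lconst C)) ?mul0r ?add0r in h; rewrite h //.
by case: p {h} => //= p; rewrite !mul0r.
Qed.

Lemma lfam_LamS al q s : (s <= m)%N -> lfam D (LamS al q s).
Proof.
move=> sm; have lW k : lfam D (fun u => wo s u ^- k).
  by apply: (lfamVn Do (N := -1)); [move=> u uD; exact: lord_wo|exact: lfam_wo].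
have lWg j p : lfam D (Wgen s j p).
  by apply: (lfamM Do); [exact: lfam_cst|apply: (lfamX Do); exact: lfam_wo].
have lL i p c : (1 <= i <= m)%N -> lfam D (Lgen i s p c).
  move=> im; apply: (lfamM Do); last by apply: lfamB; [exact: lfam_logo|exact: lfam_cst].
  by apply: (lfamM Do); [apply: (lfamX Do); exact: lfam_lamo|exact: lfam_cst].
case: al => [j|[i j]].
  rewrite /LamS; have [s0|s0] := eqVneq s 0%N; last exact: lfam_cst.
  by subst s; apply: lfamN; case: q => [|p]; [exact: lW|exact: (lWg j.+1 p)].
case: (ltnP j (n i.+1)) => jn.
  rewrite /LamS jn; have [s0|s0] := eqVneq s i.+1; last exact: lfam_cst.
  by subst s; case: q => [|p]; [exact: lW|exact: (lWg j p)].
have im : (1 <= i.+1 <= m)%N by rewrite /= ltn_ord.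
apply: (@lfam_ext _ _ _ Do (fun t => if s == 0%N
    then - (if q is p.+1 then Lgen i.+1 0 p (csum R p / (n 0)%:R) t else wo 0 t ^- n 0)
    else if s == i.+1
    then (if q is p.+1 then Lgen i.+1 s p (csum R p / (n s)%:R) t else wo s t ^- n s)
    else (if q is p.+1 then Lgen i.+1 s p 0 t else 0))).
  by move=> t _; rewrite -(LamS_inr q s t jn).
have [s0|s0] := eqVneq s 0%N.
  by subst s; apply: lfamN; case: q => [|p]; [exact: lW|exact: lL].
have [si|si] := eqVneq s i.+1; first by case: q => [|p]; [exact: lW|exact: lL].
by case: q => [|p]; [exact: lfam_cst|exact: lL].
Qed.

(* The derivatives of kappa = log (z - a_{i,0}) for al = t_{i,n_i}, and of
   kappa = 0 for the other al, in z and at fixed z in the flat coordinate ga. *)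
Definition kz al (o : option C) t : L :=
  if kidx al is Some i then (zo o - lconst (apole i t))^-1 else 0.
Definition kt ga al (o : option C) t : L :=
  if kidx al is Some i then - (lconst (pd ga (apole i) t) / (zo o - lconst (apole i t)))
  else 0.

Local Notation lam' s t := (dzo (po s t) (lamo (po s t) t)).

Lemma LamS_dzo al p s t : D t -> (s <= m)%N ->
  dzo (po s t) (LamS al p.+1 s t) =
  LamS al p s t * lam' s t + lamo (po s t) t ^+ p / p`!%:R * kz al (po s t) t.
Proof.
move=> tD sm; rewrite (LamS_law (d := fun f => dzo (po s t) (f t)) al p sm tD).
- congr (_ + _ * _); rewrite /kz; case: (kidx al) => // i; rewrite /dkap.
  by rewrite dzoD dzo_zo -rmorphN dzo_const addr0 mul1r.
- exact: (der_dzo Do (ctr s) tD).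
- by move=> c; exact: dzo_const.
- by move=> l f _ _ _ lf; apply: dzo_log; exact: lf.
Qed.

Lemma Dt_zoB ga i s t : D t -> (s <= m)%N ->
  Dt ga (ctr s) (fun u => zo (po s u) - lconst (apole i u)) t = - lconst (pd ga (apole i) t).
Proof.
move=> tD sm.
rewrite (derB (der_Dt Do ga (ctr s) tD) (lfam_zo Do (centre_ctr s)) (lfam_const Do (@holo_apole i))).
by rewrite (Dt_zo Do ga tD (centre_ctr s)) sub0r (Dt_const Do _ _ tD (@holo_apole i)).
Qed.

Lemma LamS_Dt ga al p s t : D t -> (s <= m)%N ->
  Dt ga (ctr s) (LamS al p.+1 s) t =
  LamS al p s t * dlamo ga (po s t) t + lamo (po s t) t ^+ p / p`!%:R * kt ga al (po s t) t.
Proof.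
move=> tD sm; rewrite (LamS_law (d := fun f => Dt ga (ctr s) f t) al p sm tD).
- rewrite Dt_lamo //; congr (_ + _ * _); rewrite /kt.
  by case: (kidx al) => // i; rewrite /dkap Dt_zoB // mulNr.
- exact: (der_Dt Do ga (ctr s) tD).
- by move=> c; rewrite (Dt_const Do _ _ tD (holo_cst (D := D) c)) pd_cst rmorph0.
- by move=> l f ll fl f0 lf; exact: (Dt_log Do _ _ tD ll fl f0 lf).
Qed.

Definition psum (F : nat -> C) : C := \sum_(0 <= s < m.+1) F s.

Lemma psum1 s (F : nat -> C) : (s <= m)%N ->
  (forall s', (s' <= m)%N -> s' != s -> F s' = 0) -> psum F = F s.
Proof.
move=> sm F0; rewrite /psum (bigD1_seq s) ?iota_uniq ?mem_index_iota ?ltnS //=.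
rewrite big1_seq ?addr0 // => s' /andP[ss']; rewrite mem_index_iota ltnS => /andP[_ s'm].
exact: F0.
Qed.

Lemma eq_psum F G : (forall s, (s <= m)%N -> F s = G s) -> psum F = psum G.
Proof. by move=> FG; apply: eq_big_nat => s /andP[_]; rewrite ltnS; exact: FG. Qed.

Lemma psumD F G : psum (fun s => F s + G s) = psum F + psum G.
Proof. by rewrite /psum big_split. Qed.

Lemma psumN F : psum (fun s => - F s) = - psum F.
Proof. by rewrite /psum sumrN. Qed.

Lemma psumM c F : psum (fun s => c * F s) = c * psum F.
Proof. by rewrite /psum mulr_sumr. Qed.

Lemma psum_sum (J : Type) (r : seq J) (P : pred J) (F : J -> nat -> C) :
  psum (fun s => \sum_(j <- r | P j) F j s) = \sum_(j <- r | P j) psum (F j).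
Proof. exact: exchange_big. Qed.

Lemma theta_res al p t : theta X al p t =
  psum (fun s => reso (po s t) (LamS al p.+1 s t / zo (po s t))).
Proof.
case: al => [j|[i j]].
  rewrite (@psum1 0 _ (leq0n m)); first by rewrite /LamS eqxx mulNr raddfN.
  by move=> s sm s0; rewrite /LamS (negbTE s0) mul0r raddf0.
rewrite /theta; case: ifP => jn.
  rewrite (@psum1 i.+1 _ (ltn_ord i)); first by rewrite /LamS jn eqxx.
  by move=> s sm si; rewrite /LamS jn (negbTE si) mul0r raddf0.
rewrite /psum big_ltn // -addrA; congr (_ + _).
  by rewrite /LamS jn eqxx /= mulNr raddfN.
have im : i.+1 \in index_iota 1 m.+1 by rewrite mem_index_iota /= ltnS ltn_ord.
rewrite [RHS](bigD1_seq i.+1) ?iota_uniq //=; congr (_ + _).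
  by rewrite jn eqxx.
rewrite [LHS]big_seq_cond [RHS]big_seq_cond; apply: eq_bigr => s.
rewrite mem_index_iota => /andP[/andP[s1 _] si]; rewrite jn (negbTE si).
by case: s s1 si.
Qed.

(** * Differentiation at fixed lambda and the flat coordinates *)

Definition psi ga (o : option C) t : L :=
  dlamo ga o t / (zo o * dzo o (lamo o t)).

(* The derivative at fixed lambda: it kills w_s, so it acts on an expansion in
   w_s through the coefficients. *)
Definition fixd ga s t (f : V -> L) : L :=
  Dt ga (ctr s) f t - dlamo ga (po s t) t / lam' s t * dzo (po s t) (f t).

Lemma field_fixD (F : fieldType) (da db x y c : F) :
  da + db - c * (x + y) = (da - c * x) + (db - c * y).
Proof. by ring. Qed.

Lemma field_fixz (F : fieldType) (a l z : F) : z != 0 -> 0 - a / l * 1 = - (a / (z * l) * z).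
Proof. by move=> z0; rewrite sub0r mulr1 invfM mulrA mulrAC divfK. Qed.

Lemma field_fixV (F : fieldType) (a b c f : F) : a / f - c * (b / f) = (a - c * b) / f.
Proof. by rewrite mulrBl mulrA. Qed.

Lemma field_fix0 (F : fieldType) (a l : F) : l != 0 -> a - a / l * l = 0.
Proof. by move=> l0; rewrite divfK // subrr. Qed.

Lemma field_fixM (F : fieldType) (a b da db x y c : F) :
  da * b + a * db - c * (x * b + a * y) = (da - c * x) * b + a * (db - c * y).
Proof. by ring. Qed.

Lemma der_fixd ga s t : D t -> derivation (lfam D) (onD D) t (fixd ga s t).
Proof.
move=> tD; have d1 := der_Dt Do ga (ctr s) tD; have d2 := der_dzo Do (ctr s) tD.
split.
- by move=> f g fg fl; rewrite /fixd (der_ext d1 fg fl) (der_ext d2 fg fl).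
- by move=> Q Q' QQ' Qh u /Qh/QQ'.
- exact: lfam_cst.
- exact: lfam_cst.
- by move=> f g; exact: lfamD.
- by move=> f; exact: lfamN.
- by move=> f g; exact: (lfamM Do).
- by rewrite /fixd (der1 d1) (der1 d2) mulr0 subr0.
- by move=> f g fl gl; rewrite /fixd (derD d1 fl gl) (dzoD (po s t) (f t) (g t)); exact: field_fixD.
- by move=> f g fl gl; rewrite /fixd (derM d1 fl gl) (dzoM (po s t) (f t) (g t)); exact: field_fixM.
Qed.

Lemma lam'_neq0 s t : D t -> (s <= m)%N -> lam' s t != 0.
Proof. by move=> tD sm; exact: lord_neq0 (lord_dzo_lamo tD sm). Qed.

Lemma fixd_lamo ga s t : D t -> (s <= m)%N -> fixd ga s t (fun u => lamo (po s u) u) = 0.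
Proof. by move=> tD sm; rewrite /fixd Dt_lamo //; apply: field_fix0; exact: lam'_neq0. Qed.

Lemma fixd_wo ga s t : D t -> (s <= m)%N -> fixd ga s t (wo s) = 0.
Proof.
by move=> tD sm; rewrite (d_wo sm tD (der_fixd ga s tD)) fixd_lamo // mul0r.
Qed.

Lemma fixd_const ga s t c : D t -> holo D c ->
  fixd ga s t (fun u => lconst (c u)) = lconst (pd ga c t).
Proof.
by move=> tD ch; rewrite /fixd (Dt_const Do _ _ tD ch) dzo_const mulr0 subr0.
Qed.

Lemma fixd_woVn ga s t k : D t -> (s <= m)%N -> fixd ga s t (fun u => wo s u ^- k) = 0.
Proof.
move=> tD sm; have wl := lfam_wo sm.
have wV : lfam D (fun u => (wo s u)^-1).
  by apply: (lfamV Do (N := -1)) wl => u uD; exact: lord_wo.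
rewrite (derVn (der_fixd ga s tD) k wl wV); first by rewrite fixd_wo // mulr0 oppr0.
  by move=> u uD; exact: wo_neq0.
exact: wo_neq0.
Qed.

Lemma zo_neq0 s t : D t -> (s <= m)%N -> zo (po s t) != 0.
Proof.
move=> tD sm; have := lord_neq0 (lord_zo tD sm (i := 1) _); rewrite m_ge1 => /(_ isT).
by rewrite /apole coef10 // rmorph0 subr0.
Qed.

(** This identifies [psi ga] as minus the derivative of log z at fixed lambda, the quantity
    controlled by the expansions that define the flat coordinates. *)
Lemma fixd_zo ga s t : D t -> (s <= m)%N ->
  fixd ga s t (fun u => zo (po s u)) = - (psi ga (po s t) t * zo (po s t)).
Proof.
move=> tD sm; rewrite /fixd (Dt_zo Do ga tD (centre_ctr s)) dzo_zo /psi.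
by apply: field_fixz; exact: zo_neq0.
Qed.

Lemma fixd_log ga s t l f : D t -> lfam D l -> lfam D f ->
  (forall u, D u -> lord 0 (f u)) -> (forall u, D u -> is_log (l u) (f u)) ->
  fixd ga s t l = fixd ga s t f / f t.
Proof.
move=> tD ll fl f0 lf; rewrite /fixd (Dt_log Do _ _ tD ll fl f0 lf).
by rewrite (dzo_log _ (lf t tD)); exact: field_fixV.
Qed.

Lemma field_fixd (F : fieldType) (x a l l' y : F) : l' != 0 ->
  x - a * y - (l - a * l') / l' * y = x - l / l' * y.
Proof. by move=> l0; field. Qed.

Lemma field_fixd_inf (F : fieldType) (x l l' y v : F) : l' != 0 -> v != 0 ->
  x - l / - (v ^+ 2 * l') * - (v ^+ 2 * y) = x - l / l' * y.
Proof.
move=> l0 v0; have := expf_neq0 2 v0; move: (v ^+ 2) => w w0.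
by rewrite invrN !mulrN mulNr opprK; congr (x - _); field; rewrite l0 w0.
Qed.

(** Motion of the centre and choice of parameter cancel in [fixd], which becomes a formula in the
    local parameter alone. As lambda has a pole, the quotient of its two derivatives has order at
    least 1 and makes up for the order lost in [lderiv f]. *)
Lemma lge_fixd ga s t N f : D t -> (s <= m)%N -> lfam D f ->
  (forall u, D u -> lge N (f u)) -> lge N (fixd ga s t f).
Proof.
move=> tD sm fl fN; have lN u : D u -> lge (- (n s)%:Z) (lamo (po s u) u).
  by move=> uD; apply: lord_ge; exact: lord_lamo.
have nl : lord (- (n s)%:Z - 1) (lderiv (lamo (po s t) t)).
  by apply: lord_lderiv (lord_lamo tD sm); have := n_gt0 sm; lia.
have -> : fixd ga s t f = ldiff ga f t -
    ldiff ga (fun u => lamo (po s u) u) t / lderiv (lamo (po s t) t) * lderiv (f t).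
  rewrite /fixd -(Dt_lamo ga tD sm) /Dt /ctr.
  have {}nl := lord_neq0 nl; case: (s) nl => [|s'] nl.
    by rewrite !subr0; apply: field_fixd_inf nl (lord_neq0 (lord_lvar C)).
  by rewrite [s'.+1 == 0%N]/=; exact: field_fixd nl.
apply: lgeB; first exact: (lge_ldiff Do ga fl tD fN).
have := lgeM (lge_lord_dvd (lge_ldiff Do ga (lfam_lamo sm) tD lN) nl) (lge_lderiv (fN t tD)).
by apply: lge_le; lia.
Qed.

Lemma expands_in_lge (l w : L) c N : lge 0 l -> lord (-1) w -> expands_in l w c ->
  lge N.+1%:Z (l - \sum_(j < N.+1) lconst (c j) * w ^- j).
Proof.
move=> l0 w1 lw k kN; have wj (j : nat) : lge j (w ^- j).
  by have [h _] := lordVn j w1; apply: lge_le h; lia.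
have [k0|k0] := ltP k 0.
  rewrite lcoefD lcoefN l0 // lcoef_sum big1 ?subr0 // => j _.
  by rewrite lcoefCM (wj j) ?mulr0 //; lia.
have -> : k = (absz k)%:Z by lia.
have kN' : (absz k < N.+1)%N by lia.
move: (absz k) kN' => q qN {kN k0 k}; rewrite lcoefD lcoefN lw lcoef_sum.
apply/eqP; rewrite subr_eq0; apply/eqP.
rewrite -(big_mkord xpredT (fun j => c j * lcoef (w ^- j) q)).
rewrite -(big_mkord xpredT (fun j => lcoef (lconst (c j) * w ^- j) q)).
rewrite [RHS](big_cat_nat _ qN) //= [X in _ = _ + X]big_nat [X in _ = _ + X]big1 ?addr0.
  by apply: eq_bigr => j _; rewrite lcoefCM.
by move=> j /andP[qj _]; rewrite lcoefCM (wj j) ?mulr0 //; lia.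
Qed.

(** Powers of w_s are constants for [fixd], so only the coefficients are differentiated, and the
    remainder keeps its order. *)
Lemma fixd_expand ga s t (ell : V -> L) (N : nat) (c : V -> 'I_N.+1 -> C) :
  D t -> (s <= m)%N -> lfam D ell -> (forall j, holo D (fun u => c u j)) ->
  (forall u, D u -> lge N.+1%:Z (ell u - \sum_(j < N.+1) lconst (c u j) * wo s u ^- j)) ->
  lge N.+1%:Z (fixd ga s t ell - \sum_(j < N.+1) lconst (pd ga (fun u => c u j) t) * wo s t ^- j).
Proof.
move=> tD sm ll ch lc; have dd := der_fixd ga s tD.
have lW k : lfam D (fun u => wo s u ^- k).
  by apply: (lfamVn Do (N := -1)); [move=> u uD; exact: lord_wo|exact: lfam_wo].
have lt j : lfam D (fun u => lconst (c u j) * wo s u ^- j).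
  by apply: (lfamM Do); [apply: (lfam_const Do); exact: ch|exact: lW].
have lT : lfam D (fun u => \sum_(j < N.+1) lconst (c u j) * wo s u ^- j).
  by apply: (lfam_sum Do) => j _; exact: lt.
have <- : fixd ga s t (fun u => \sum_(j < N.+1) lconst (c u j) * wo s u ^- j) =
    \sum_(j < N.+1) lconst (pd ga (fun u => c u j) t) * wo s t ^- j.
  rewrite (der_sum dd _ (fun j _ => lt j)); apply: eq_bigr => j _.
  rewrite (derM dd (lfam_const Do (ch j)) (lW j)) (fixd_woVn ga j tD sm) mulr0 addr0.
  by rewrite (fixd_const _ _ tD (ch j)).
by rewrite -(derB dd ll lT); apply: (lge_fixd ga tD sm _ lc); exact: lfamB.
Qed.

Lemma idx_eq (i : 'I_m) (j j' : 'I_(n i.+1).+1) : (idx j == idx j') = (j == j').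
Proof.
by rewrite -[LHS]/(Tagged (fun i : 'I_m => 'I_(n i.+1).+1) j == Tagged _ j') eq_Tagged.
Qed.

(** The right side is the derivative along [ga] of sum_j t_{i,j} w_i^(-j) with w_i held fixed. *)
Lemma LamS0_S ga (i : 'I_m) t :
  LamS ga 0 i.+1 t = \sum_(j < (n i.+1).+1) lconst (ga == idx j)%:R * wo i.+1 t ^- j.
Proof.
have E0 : (forall j : 'I_(n i.+1).+1, ga != idx j) -> 0 =
    \sum_(j < (n i.+1).+1) lconst (ga == idx j)%:R * wo i.+1 t ^- j.
  by move=> gaj; rewrite big1 // => j _; rewrite (negbTE (gaj j)) rmorph0 mul0r.
case: ga E0 => [j|[i' j]] E0; first by rewrite -E0.
have [ii|ii] := eqVneq i i'; last first.
  have ii' : (i.+1 == i'.+1) = false by rewrite eqSS; apply/negbTE.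
  rewrite -E0; first by rewrite /LamS /= ii'; case: ifP.
  by move=> j'; apply: contra_neq ii => -[].
subst i'; rewrite (bigD1 j) //= big1 ?addr0.
  rewrite (_ : (_ == idx j) = true); last exact: eqxx.
  rewrite (rmorph1 (@lconst C)) mul1r /LamS /= eqxx.
  case: ifP => // jn; congr (_ ^- _); have := ltn_ord j; lia.
by move=> j' j'j; rewrite -/(idx j) idx_eq eq_sym (negbTE j'j) rmorph0 mul0r.
Qed.

Lemma lge_woVn s t j : D t -> (s <= m)%N -> lge j%:Z (wo s t ^- j).
Proof.
by move=> tD sm; have [h _] := lordVn j (lord_wo tD sm); apply: lge_le h; lia.
Qed.

(** For t_{i,n_i} the germ at infinity is - w_0^(-n_0), of order n_0; the error term absorbs it, so
    that only the t_{0,j} are visible at infinity. *)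
Lemma LamS0_0 ga t : D t -> lge (n 0)%:Z (LamS ga 0 0 t +
  \sum_(j < (n 0).-1) lconst (ga == idx0 m j)%:R * wo 0 t ^- j.+1).
Proof.
move=> tD; case: ga => [j|[i j]].
  rewrite (bigD1 j) //= big1 ?addr0.
    by rewrite eqxx rmorph1 mul1r addNr.
  move=> j' j'j; rewrite (_ : (_ == _) = false) ?rmorph0 ?mul0r //.
  by apply/negbTE; apply: contra_neq j'j => -[].
rewrite big1 ?addr0; last by move=> j' _; rewrite rmorph0 mul0r.
rewrite /LamS; case: ifP => _ //=; apply: lgeN.
exact: (@lge_woVn 0 t (n 0) tD (leq0n m)).
Qed.

Lemma lord_zo_pole1 t : D t -> lord 1 (zo (po 1 t)).
Proof.
move=> tD; have := lord_zo tD m_ge1 (i := 1); rewrite m_ge1 => /(_ isT) /=.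
by rewrite /apole coef10 // rmorph0 subr0.
Qed.

Lemma lord_zo_pole s t : D t -> (1 < s <= m)%N -> lord 0 (zo (po s t)).
Proof.
move=> tD /andP[s1 sm]; have := lord_zo tD sm (i := 1); rewrite m_ge1 => /(_ isT).
rewrite /apole coef10 // rmorph0 subr0; case: s s1 sm => // -[//|s] _ _.
by rewrite eqSS.
Qed.

Lemma lord_zo_inf t : lord (-1) (zo (po 0 t)).
Proof. exact: lord_zinf. Qed.

Lemma field_psiS (F : fieldType) (p z w : F) : z != 0 -> w != 0 ->
  - (p * z) * w / (z * w) = - p.
Proof. by move=> z0 w0; field; rewrite w0 z0. Qed.

(* The thermodynamic identity: expanding log z in w_s and differentiating at
   fixed lambda. *)
Lemma psi_LamS_S ga (i : 'I_m) t : D t ->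
  lge (n i.+1).+1%:Z (psi ga (po i.+1 t) t + LamS ga 0 i.+1 t).
Proof.
move=> tD; have sm := ltn_ord i; set s := nat_of_ord i in sm *.
(* The logarithm and its expansion are given pointwise. Chosen as a family they are holomorphic,
   because the derivative of the logarithm is that of [f] divided by [f] and its constant
   coefficient is the coordinate t_{i,0}. *)
have /choice[lc lcP] : forall u, exists lc : L * (nat -> C), D u ->
    [/\ is_log lc.1 (zat (coef X u s.+1 0%N) * (if s.+1 == 1%N then w X s.+1 u else 1)),
        expands_in lc.1 (w X s.+1 u) lc.2
      & forall j : 'I_(n s.+1).+1, lc.2 j = crd u (idx j)].
  move=> u; case: (pselect (D u)) => [Du|nD]; last by exists (0, fun=> 0).
  by have [l [c lP]] := flatS i Du; exists (l, c).
pose f u := zo (po s.+1 u) * (if s.+1 == 1%N then wo s.+1 u else 1).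
have zl := lfam_zo Do (centre_ctr s.+1).
have fl : lfam D f.
  have W : lfam D (fun u => if s.+1 == 1%N then wo s.+1 u else 1).
    by case: (s.+1 == 1%N) => /=; [exact: (lfam_wo sm)|exact: (lfam_cst D 1)].
  exact: (lfamM Do zl W).
have f0 u : D u -> lord 0 (f u).
  move=> uD; rewrite /f; have [s1|s1] := eqVneq s.+1 1%N.
    by rewrite s1; have := lordM (lord_zo_pole1 uD) (lord_wo uD m_ge1).
  by rewrite mulr1; apply: lord_zo_pole => //; rewrite sm andbT; lia.
have lf u : D u -> is_log (lc u).1 (f u) by move=> /lcP[].
have lw u : D u -> lge 0 (lc u).1 by move=> /lf[].
have ll : lfam D (fun u => (lc u).1).
  apply: (lfam_lderiv_inv Do lw).
    apply: (holo_ext Do _ (@holo_crd _ _ D (idx (ord0 : 'I_(n s.+1).+1)))) => u uD.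
    have [_ lE cE] := lcP u uD; rewrite (lE 0%N) big_ord1 (cE ord0) expr0 invr1 lcoef1.
    by rewrite mulr1.
  apply: (@lfam_ext _ _ _ Do (fun u => lderiv (f u) / f u)).
    by move=> u /lf[_ _ ->].
  by apply: (lfamM Do); [exact: lfam_lderiv|exact: (lfamV Do f0 fl)].
have lE u : D u -> lge (n s.+1).+1%:Z ((lc u).1 -
    \sum_(j < (n s.+1).+1) lconst (crd u (idx j)) * wo s.+1 u ^- j).
  move=> uD; have [_ lE cE] := lcP u uD.
  have := expands_in_lge (N := n s.+1) (lw u uD) (lord_wo uD sm) lE.
  by under eq_bigr do rewrite cE.
have := fixd_expand ga (c := fun u j => crd u (idx j)) tD sm ll (fun j => @holo_crd _ _ D _) lE.
under eq_bigr do rewrite pd_crd.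
rewrite -LamS0_S (fixd_log _ _ tD ll fl f0 lf).
have -> : fixd ga s.+1 t f / f t = - psi ga (po s.+1 t) t.
  have z0 := zo_neq0 tD sm; have w0 := wo_neq0 tD sm; rewrite /f.
  have dd := der_fixd ga s.+1 tD.
  case: (s.+1 == 1%N).
    rewrite (derM dd zl (lfam_wo sm)) fixd_wo // mulr0 addr0 fixd_zo //.
    by move: (psi _ _ _) (zo _) z0 (wo _ t) w0 => p z z1 w1 w10; exact: field_psiS.
  have -> : (fun u => zo (po s.+1 u) * 1) = (fun u => zo (po s.+1 u)).
    by apply/funext => u; rewrite mulr1.
  by rewrite fixd_zo // mulr1 mulNr mulfK.
by rewrite -opprD => /lgeN; rewrite opprK.
Qed.

Lemma field_psi0 (F : fieldType) (p z w : F) : z != 0 -> w != 0 ->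
  (0 * z^-1 + w * - (- (p * z) / z ^+ 2)) / (w / z) = p.
Proof. by move=> z0 w0; field; rewrite w0 z0. Qed.

(** At infinity the coordinates expand log(w_0/z), whose derivative at fixed lambda is [+ psi]; this
    is the origin of the minus sign of [LamS] there. They enter up to w_0^(-(n_0-1)), so the error
    has order n_0. *)
Lemma psi_LamS_0 ga t : D t -> lge (n 0)%:Z (psi ga (po 0 t) t + LamS ga 0 0 t).
Proof.
move=> tD; have sm := leq0n m; have n0 := n_gt0 sm.
have /choice[lc lcP] : forall u, exists lc : L * (nat -> C), D u ->
    [/\ is_log lc.1 (winf X u / zinf), lcoef lc.1 0 = 0, expands_in lc.1 (winf X u) lc.2,
        lc.2 0%N = 0 & forall j : 'I_(n 0).-1, lc.2 j.+1 = crd u (idx0 m j)].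
  move=> u; case: (pselect (D u)) => [Du|nD]; last by exists (0, fun=> 0).
  by have [l [c lP]] := flat0 Du; exists (l, c).
pose f u := wo 0 u / zo (po 0 u).
have zl := lfam_zo Do (centre_ctr 0).
have zV : lfam D (fun u => (zo (po 0 u))^-1).
  by apply: (lfamV Do (N := -1)) zl => u _; exact: lord_zo_inf.
have fl : lfam D f by apply: (lfamM Do) => //; exact: lfam_wo.
have f0 u : D u -> lord 0 (f u).
  by move=> uD; have := lordM (lord_wo uD sm) (lordV (lord_zo_inf u)).
have lf u : D u -> is_log (lc u).1 (f u) by move=> /lcP[].
have lw u : D u -> lge 0 (lc u).1 by move=> /lf[].
have ll : lfam D (fun u => (lc u).1).
  apply: (lfam_lderiv_inv Do lw).
    by apply: (holo_ext Do _ (holo_cst (D := D) 0)) => u /lcP[_ -> _ _ _].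
  apply: (@lfam_ext _ _ _ Do (fun u => lderiv (f u) / f u)).
    by move=> u /lf[_ _ ->].
  by apply: (lfamM Do); [exact: lfam_lderiv|exact: (lfamV Do f0 fl)].
pose c (u : V) (j : 'I_(n 0).-1.+1) : C :=
  if unlift ord0 j is Some j' then crd u (@idx0 m n j') else 0.
have ch j : holo D (fun u => c u j).
  by rewrite /c; case: (unlift ord0 j) => [j'|]; [exact: holo_crd|exact: holo_cst].
have lE u : D u -> lge (n 0).-1.+1%:Z ((lc u).1 -
    \sum_(j < (n 0).-1.+1) lconst (c u j) * wo 0 u ^- j).
  move=> uD; have [_ _ lE c0 cE] := lcP u uD.
  have := expands_in_lge (N := (n 0).-1) (lw u uD) (lord_wo uD sm) lE.
  congr (lge _ (_ - _)); apply: eq_bigr => j _; congr (lconst _ * _); rewrite /c.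
  case: unliftP => [j' ->|->]; [exact: cE|exact: c0].
have := fixd_expand ga tD sm ll ch lE.
rewrite big_ord_recl {1}/c unlift_none pd_cst rmorph0 mul0r add0r.
under eq_bigr => j _.
  have -> : pd ga (fun u => c u (lift ord0 j)) t = (ga == idx0 m j)%:R.
    by rewrite -(pd_crd ga (idx0 m j) t); congr pd; apply/funext => u; rewrite /c liftK.
  over.
rewrite (fixd_log _ _ tD ll fl f0 lf).
have -> : fixd ga 0 t f / f t = psi ga (po 0 t) t.
  have z0 := zo_neq0 tD sm; have w0 := wo_neq0 tD sm; have dd := der_fixd ga 0 tD.
  have nz : onD D (fun u => zo (po 0 u) != 0) by move=> u uD; exact: zo_neq0.
  rewrite /f (derM dd (lfam_wo sm) zV) (derV dd zl zV nz z0) fixd_wo // fixd_zo //.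
  by move: (psi _ _ _) (zo _) z0 (wo 0 t) w0 => p z z0 w1 w10; exact: field_psi0.
move=> h; have {}h : lge (n 0)%:Z (psi ga (po 0 t) t -
    \sum_j lconst (ga == idx0 m j)%:R / wo 0 t ^+ lift ord0 j).
  by apply: lge_le h; rewrite prednK.
have := lgeD h (LamS0_0 ga tD).
rewrite addrACA [X in lge _ (_ + X)](_ : _ = 0) ?addr0 //.
exact: addNr.
Qed.

Lemma psi_LamS ga s t : D t -> (s <= m)%N ->
  lge (if s == 0%N then (n 0)%:Z else (n s)%:Z + 1) (psi ga (po s t) t + LamS ga 0 s t).
Proof.
move=> tD; case: s => [|s] sm; first exact: psi_LamS_0.
have := @psi_LamS_S ga (Ordinal sm) t tD.
by rewrite /= intS addrC.
Qed.

(** * Regularity of the coefficients *)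

Definition holo2 (f : V -> C) : Prop := holo D f /\ forall ga, holo D (pd ga f).

Lemma holo2_cst (c : C) : holo2 (fun=> c).
Proof.
split=> [|ga]; first exact: holo_cst.
by apply: (holo_ext Do _ (@holo_cst _ _ D 0)) => u _; rewrite pd_cst.
Qed.

Lemma holo2D f g : holo2 f -> holo2 g -> holo2 (fun u => f u + g u).
Proof.
move=> [f1 f2] [g1 g2]; split=> [|ga]; first exact: holoD.
apply: (holo_ext Do _ (holoD (f2 ga) (g2 ga))) => u uD.
by rewrite pdD; [|exact: f1|exact: g1].
Qed.

Lemma holo2N f : holo2 f -> holo2 (fun u => - f u).
Proof.
move=> [f1 f2]; split=> [|ga]; first exact: holoN.
apply: (holo_ext Do _ (holoN (f2 ga))) => u uD.
by rewrite pdN; [|exact: f1].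
Qed.

Lemma holo2M f g : holo2 f -> holo2 g -> holo2 (fun u => f u * g u).
Proof.
move=> [f1 f2] [g1 g2]; split=> [|ga]; first exact: holoM.
apply: (holo_ext Do _ (holoD (holoM (f2 ga) g1) (holoM f1 (g2 ga)))) => u uD.
by rewrite pdM; [|exact: f1|exact: g1].
Qed.

Lemma holo2_ext f g : (forall u, D u -> f u = g u) -> holo2 f -> holo2 g.
Proof.
move=> fg [f1 f2]; split=> [|ga]; first exact: (holo_ext Do fg).
by apply: (holo_ext Do _ (f2 ga)) => u uD; exact: (pd_ext Do ga uD).
Qed.

Lemma holo2V f : holo2 f -> (forall u, D u -> f u != 0) -> holo2 (fun u => (f u)^-1).
Proof.
move=> [f1 f2] f0; split=> [|ga]; first exact: holoV.
have fV := holoV f1 f0.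
apply: (holo_ext Do _ (holoN (holoM (f2 ga) (holoM fV fV)))) => u uD.
have := pdM ga (f1 u uD) (fV u uD).
rewrite (pd_ext (g := fun=> 1) Do ga uD) => [|v vD]; last by rewrite mulfV // f0.
rewrite pd_cst => /esym/eqP; rewrite addrC addr_eq0 => /eqP h.
by apply: (mulfI (f0 u uD)); rewrite h mulrN mulrCA [f u * _]mulrC mulfVK // f0.
Qed.

Lemma holo2_sum (J : eqType) (r : seq J) (F : J -> V -> C) :
  (forall j, j \in r -> holo2 (F j)) -> holo2 (fun u => \sum_(j <- r) F j u).
Proof.
elim: r => [|j r IHr] Fj.
  by apply: (holo2_ext _ (holo2_cst 0)) => u _; rewrite big_nil.
have h1 := Fj j (mem_head j r).
have h2 : holo2 (fun u => \sum_(j <- r) F j u).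
  by apply: IHr => i ir; apply: Fj; rewrite in_cons ir orbT.
by apply: (holo2_ext _ (holo2D h1 h2)) => u _; rewrite big_cons.
Qed.

Lemma holo2X f k : holo2 f -> holo2 (fun u => f u ^+ k).
Proof.
move=> f2; elim: k => [|k IHk]; first exact: (holo2_cst 1).
by apply: (holo2_ext _ (holo2M f2 IHk)) => u _; rewrite exprS.
Qed.

Lemma lfam_dzo P f : lfam D f -> lfam D (fun u => dzo (pt P u) (f u)).
Proof.
move=> fl; have f' := lfam_lderiv fl; case: P => [a|] /=; first exact: f'.
by apply: lfamN; apply: (lfamM Do) f'; exact: (lfam_cst D).
Qed.

Lemma lord_zo1 s t : D t -> (s <= m)%N ->
  lord (if s == 0%N then -1 else if s == 1%N then 1 else 0) (zo (po s t)).
Proof.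
by move=> tD sm; have := lord_zo tD sm (i := 1) m_ge1; rewrite /apole coef10 // rmorph0 subr0.
Qed.

(** Multiplying [psi_LamS] by z lambda' compares polar parts. At a_{1,0} = 0 the factor z gains one
    order, so the constant coefficient is compared as well. *)
Lemma lge_dlamo_LamS al s t : D t -> (s <= m)%N ->
  lge (s == 1%N)%:Z (dlamo al (po s t) t + zo (po s t) * lam' s t * LamS al 0 s t).
Proof.
move=> tD sm; have z0 := zo_neq0 tD sm; have l0 := lam'_neq0 tD sm.
have -> : dlamo al (po s t) t = zo (po s t) * lam' s t * psi al (po s t) t.
  by rewrite /psi mulrC divfK // mulf_neq0.
rewrite -mulrDr; have h := psi_LamS al tD sm.
have := lgeM (lgeM (lord_ge (lord_zo1 tD sm)) (lord_ge (lord_dzo_lamo tD sm))) h.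
by apply: lge_le; case: s {sm z0 l0 h} => [|[|s]] /=; lia.
Qed.

(** The coefficient agrees with one of [- z lambda' LamS], a family already known to be holomorphic:
    derivatives of lambda are expressed without derivatives in the flat coordinates, which
    bootstraps the regularity of the coefficients. *)
Lemma holo_dlamo al s (k : int) : (s <= m)%N -> k < (s == 1%N)%:Z ->
  holo D (fun u => lcoef (dlamo al (po s u) u) k).
Proof.
move=> sm ks.
have fl : lfam D (fun u => zo (po s u) * lam' s u * LamS al 0 s u).
  apply: (lfamM Do); last exact: lfam_LamS.
  by apply: (lfamM Do); [exact: (lfam_zo Do (centre_ctr s))|exact: (lfam_dzo _ (lfam_lamo sm))].
apply: (holo_ext Do _ (holoN (lfam_holo k fl))) => u uD.
have /eqP := lge_dlamo_LamS al uD sm ks.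
by rewrite lcoefD addr_eq0 => /eqP ->.
Qed.

Lemma lcoef_lvarVn k (j : int) : lcoef (lvar C ^- k) j = (j == - k%:Z)%:R.
Proof. by rewrite -exprVn -[(lvar C)^-1]/(@zinf C) lcoef_zinfX. Qed.

Lemma lcoef_pfb s e t j : D t -> (s <= m)%N -> (e.1 <= m)%N -> (0 < j)%N ->
  lcoef (pfb (@lconst C) (apole^~ t) e (zo (po s t))) (- j%:Z) = (e == (s, j))%:R.
Proof.
move=> tD sm em j0; case: e em => i k /= im; rewrite /pfb /= xpair_eqE.
have [->|i0] := eqVneq i 0%N.
  case: s sm => [|s] sm; first by rewrite /= lcoef_zinfX eqr_opp eqz_nat eq_sym.
  rewrite poS; have := @lgeX _ _ _ k (lge_zat (apole s.+1 t)); rewrite mulr0.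
  by move=> -> //; lia.
have i1 : (1 <= i <= m)%N by rewrite lt0n i0.
have h := lordVn k (lord_zo tD sm i1); have [si|si] := eqVneq i s; last first.
  have [h0 _] := h; rewrite /= h0 //; case: ifP => _; first lia.
  by rewrite eq_sym (negbTE si); lia.
subst i; case: s sm i0 {i1 h im} => // s sm _.
by rewrite poS /= zatB subrr zat0 lcoef_lvarVn eqr_opp eqz_nat [k == j]eq_sym.
Qed.

Lemma lcoef_pfo l s t j : good l -> D t -> (s <= m)%N -> (0 < j)%N ->
  lcoef (pfo l (po s t) t) (- j%:Z) = \sum_(e <- l) e.2 t * (e.1 == (s, j))%:R.
Proof.
move=> lg tD sm j0; rewrite /pfo /pfe big_map lcoef_sum.
elim: l lg => [|e l IHl] lg; first by rewrite !big_nil.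
rewrite !big_cons lcoefCM lcoef_pfb //; last by have [] := lg e (or_introl erefl).
by rewrite IHl // => e' e'l; apply: lg; right.
Qed.

Lemma lcoef_lamo s t j : D t -> (s <= m)%N -> (0 < j)%N -> (j < n s + (s != 0%N))%N ->
  lcoef (lamo (po s t) t) (- j%:Z) = coef X t s j.
Proof.
move=> tD sm j0 jn; rewrite lamoE (lcoef_pfo good_lamL) // /lamL big_cons big_cat /=.
rewrite big_map big_flatten big_map /=.
case: s sm jn => [|s] sm jn; rewrite !xpair_eqE /= ?addn0 ?addn1 in jn *.
  rewrite gtn_eqF ?mulr0 ?add0r // [X in _ + X]big1_seq ?addr0; last first.
    move=> i /=; rewrite mem_index_iota => /andP[i1 _]; rewrite big_map.
    by rewrite big1 // => k _; rewrite /= xpair_eqE gtn_eqF // mulr0.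
  rewrite (bigD1_seq j) ?iota_uniq ?mem_index_iota //= eqxx mulr1 big1 ?addr0 // => k kj.
  by rewrite xpair_eqE (negbTE kj) mulr0.
rewrite mulr0 add0r big1 ?add0r; last by move=> k _; rewrite mulr0.
rewrite (bigD1_seq s.+1) ?iota_uniq ?mem_index_iota //= [X in _ + X]big1 ?addr0; last first.
  by move=> i /negbTE si; rewrite big_map big1 // => k _; rewrite /= xpair_eqE si mulr0.
rewrite big_map (bigD1_seq j) ?iota_uniq ?mem_index_iota ?j0 //= !eqxx mulr1.
by rewrite big1 ?addr0 // => k kj; rewrite xpair_eqE (negbTE kj) andbF mulr0.
Qed.

Lemma lcoef_ldiff_lamo al s t k : D t -> (s.+1 <= m)%N ->
  lcoef (dlamo al (po s.+1 t) t) k = pd al (fun u => lcoef (lamo (po s.+1 u) u) k) t -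
    pd al (apole s.+1) t * lcoef (lderiv (lamo (po s.+1 t) t)) k.
Proof.
move=> tD sm; rewrite -(Dt_lamo al tD sm) /Dt lcoefD lcoefN lcoefCM.
by rewrite (ldiffE Do al k (lfam_lamo sm) tD).
Qed.

(** At a_{s,0} the coefficient of order - n_s - 1 of d_ga lambda is n_s a_{s,n_s} d_ga a_{s,0}, and
    it is holomorphic by [holo_dlamo]. *)
Lemma holo2_apole s : (1 <= s <= m)%N -> holo2 (apole s).
Proof.
case: s => // s /= sm; split=> [|ga]; first exact: holo_apole.
have n0 := n_gt0 sm.
have h := holo_dlamo ga sm (k := - (n s.+1)%:Z - 1) ltac:(lia).
have nz u : D u -> (n s.+1)%:R * coef X u s.+1 (n s.+1) != 0.
  by move=> uD; rewrite mulf_neq0 ?pnatr_eq0 -?lt0n //; exact: coef_lead.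
have c0 : holo D (fun u => (n s.+1)%:R * coef X u s.+1 (n s.+1)).
  by apply: holoM; [exact: holo_cst|exact: coef_holo].
apply: (holo_ext Do _ (holoM h (holoV c0 nz))) => u uD.
rewrite lcoef_ldiff_lamo // (pd_ext (g := fun=> 0) Do ga uD) ?pd_cst; last first.
  by move=> v vD; have [hv _] := lord_lamo vD sm; apply: hv; lia.
rewrite lcoef_lderiv subrK lcoef_lamo //=; last by rewrite addn1.
apply: (mulIf (nz u uD)); rewrite divfK ?nz // sub0r.
by rewrite mulrNz mulNr mulrN opprK.
Qed.

Lemma holo2_lcoef_lamo s (k : int) : (s <= m)%N -> k < (s == 1%N)%:Z ->
  holo2 (fun u => lcoef (lamo (po s u) u) k).
Proof.
move=> sm ks; split=> [|ga]; first exact: (lfam_holo k (lfam_lamo sm)).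
have h := holo_dlamo ga sm ks; case: s sm ks h => [|s] sm ks h.
  apply: (holo_ext Do _ h) => u uD; rewrite -(Dt_lamo ga uD sm) /Dt subr0.
  by rewrite (ldiffE Do ga k (lfam_lamo sm) uD).
have [_ a'] := holo2_apole (s := s.+1) sm.
have l' := lfam_holo k (lfam_lderiv (lfam_lamo sm)).
apply: (holo_ext Do _ (holoD h (holoM (a' ga) l'))) => u uD.
by rewrite lcoef_ldiff_lamo // subrK.
Qed.

Lemma holo2_coef s j : (s <= m)%N -> (0 < j)%N -> (j < n s + (s != 0%N))%N ->
  holo2 (fun u => coef X u s j).
Proof.
move=> sm j0 jn; apply: (holo2_ext _ (@holo2_lcoef_lamo s (- j%:Z) sm _)); last lia.
by move=> u uD; exact: lcoef_lamo.
Qed.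

(** a_{0,0} is not a polar coefficient. It is recovered from the constant coefficient at a_{1,0} =
    0, which [holo2_lcoef_lamo] covers, by subtracting the values of the other principal parts. *)
Lemma lcoef0_lamo1 t : D t -> lcoef (lamo (po 1 t) t) 0 = coef X t 0%N 0%N +
  \sum_(2 <= i < m.+1) \sum_(1 <= j < (n i).+1) coef X t i j * (- apole i t) ^- j.
Proof.
move=> tD; have n0 := n_gt0 (leq0n m).
have z0 j : lcoef (zo (po 1 t) ^+ j) 0 = (j == 0%N)%:R.
  by rewrite poS /= /apole coef10 // zat0 lcoef_lvarX; congr (_%:R); case: j.
rewrite /lamo /lam !lcoefD lcoefCM z0 gtn_eqF // mulr0 add0r lcoef_sum; congr (_ + _).
  rewrite (bigD1 (Ordinal n0)) //= lcoefCM z0 mulr1 big1 ?addr0 // => j j0.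
  by rewrite lcoefCM z0 (_ : (_ == _) = false) ?mulr0 //; apply: negbTE.
rewrite lcoef_sum big_ltn // lcoef_sum [X in X + _]big_nat [X in X + _]big1 ?add0r; last first.
  move=> j /andP[j1 _]; rewrite lcoefCM poS /= zatB subrr zat0 lcoef_lvarVn.
  by rewrite eq_sym oppr_eq0 (_ : _ == _ = false) ?mulr0 //; lia.
apply: eq_big_nat => i /andP[i1 im]; rewrite lcoef_sum; apply: eq_bigr => j _.
rewrite lcoefCM; congr (_ * _).
have i0 : (1 <= i <= m)%N by lia.
have h : lord 0 (zo (po 1 t) - lconst (apole i t)).
  by have := lord_zo tD m_ge1 i0; rewrite /= ltn_eqF.
have := lcoefV (lordX j h); rewrite mulr0 oppr0 => ->; congr (_^-1).
rewrite poS /= zatB {1}/apole coef10 // sub0r.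
by elim: j => [|j IHj]; rewrite ?lcoef1 // !exprS lcoef0M ?IHj ?lcoef_zat ?mulr0 /=;
  [rewrite mul1r addr0|exact: lge_zat|have := @lgeX _ _ _ j (lge_zat (- apole i t)); rewrite mulr0].
Qed.

Lemma holo2_coef00 : holo2 (fun u => coef X u 0%N 0%N).
Proof.
pose S u := \sum_(2 <= i < m.+1) \sum_(1 <= j < (n i).+1) coef X u i j * (- apole i u) ^- j.
have S2 : holo2 S.
  apply: holo2_sum => i; rewrite mem_index_iota => im; apply: holo2_sum => j.
  rewrite mem_index_iota => jn; apply: holo2M; first by apply: holo2_coef; lia.
  apply: holo2V; last first.
    move=> u uD; rewrite expf_neq0 // oppr_eq0 -(coef10 uD) eq_sym.
    by apply: apole_neq => //; lia.
  by apply: holo2X; apply: holo2N; apply: holo2_apole; lia.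
have l2 := @holo2_lcoef_lamo 1 0 m_ge1 isT.
apply: (holo2_ext _ (holo2D l2 (holo2N S2))) => u uD.
by rewrite lcoef0_lamo1 // addrK.
Qed.

Definition good2 (l : seq (nat * nat * (V -> C))) : Prop :=
  forall e, List.In e l -> (e.1.1 <= m)%N /\ holo2 e.2.

Lemma In_index_iota x a b : List.In x (index_iota a b) -> x \in index_iota a b.
Proof.
elim: (index_iota a b) => //= y r IHr [->|/IHr ir]; first exact: mem_head.
by rewrite in_cons ir orbT.
Qed.

Lemma good2_lamL : good2 lamL.
Proof.
move=> e [<-|]; first by split=> //; exact: holo2_cst.
move=> el; case: (In_cat el) => {}el.
  have [j /In_index_iota + ->] := In_map el; rewrite mem_index_iota /= => jn; split=> //.
  by case: j jn => [|j] jn; [exact: holo2_coef00|apply: holo2_coef => //; rewrite addn0].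
have [i /In_index_iota im {}el] := In_flatten_map el.
have [j /In_index_iota jn ->] := In_map el; move: im jn; rewrite !mem_index_iota /= => im jn.
by split; [lia|apply: holo2_coef; lia].
Qed.

Definition pdl al (l : seq (nat * nat * (V -> C))) : seq (nat * nat * (V -> C)) :=
  flatten [seq [:: (e.1, pd al e.2); (e.1.1, e.1.2.+1,
    fun t => if e.1.1 == 0%N then 0 else e.1.2%:R * e.2 t * pd al (apole e.1.1) t)] | e <- l].

Lemma pdl_pfdt al l t :
  pfat (pdl al l) t = pfdt (fun c => pd al c t) apole t l.
Proof. by rewrite /pdl /pfat /pfdt; elim: l => //= e l ->. Qed.

Lemma good_pdl al l : good2 l -> good (pdl al l).
Proof.
move=> lg e el; have [e' /lg[em [h h']]] := In_flatten_map el.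
case=> [<-|[<-|//]]; split=> //=; case: eqP => [_|/eqP e0]; first exact: holo_cst.
apply: holoM; first by apply: holoM => //; exact: holo_cst.
have ep : (1 <= e'.1.1 <= m)%N by rewrite lt0n e0.
by have [_ ha] := holo2_apole ep; exact: ha.
Qed.

Lemma dlamoE al o t : dlamo al o t = pfo (pdl al lamL) o t.
Proof. by rewrite /dlamo dlam_pfe /pfo pdl_pfdt. Qed.

Lemma lfam_dlamo al s : (s <= m)%N -> lfam D (fun u => dlamo al (po s u) u).
Proof.
move=> sm; have h := @lfam_pfo (pdl al lamL) s (@good_pdl al _ good2_lamL) sm.
by apply: (lfam_ext Do _ h) => u _; rewrite dlamoE.
Qed.

(** * Residues at the critical points and the metric *)

Lemma is_poleP t s c : ~ is_pole m (coef X t) c -> (1 <= s <= m)%N -> c <> apole s t.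
Proof. by move=> cp sm cE; apply: cp; exists s. Qed.

Lemma good_pole_hyp l t c : good l -> ~ is_pole m (coef X t) c ->
  forall s, s \in [seq e.1.1 | e <- pfat l t] -> s != 0%N -> c <> apole s t.
Proof.
move=> lg cp s sl s0; apply: (is_poleP cp); rewrite lt0n s0 /=.
by apply: (good_index lg); move: sl; rewrite -map_comp.
Qed.

Lemma lge_pfo l t c : good l -> ~ is_pole m (coef X t) c -> lge 0 (pfo l (Some c) t).
Proof. by move=> lg cp; apply: lge_pfe; exact: good_pole_hyp. Qed.

Lemma ratl_pfo l t : ratl (fun o => pfo l o t).
Proof. exact: ratl_pfe. Qed.

Lemma ratl_lamo t : ratl (fun o => lamo o t).
Proof. by apply: ratl_ext (ratl_pfo lamL t) => o; rewrite lamoE. Qed.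

Lemma ratl_dlamo al t : ratl (fun o => dlamo al o t).
Proof. by apply: ratl_ext (ratl_pfo (pdl al lamL) t) => o; rewrite dlamoE. Qed.

Lemma lge_lamo_reg t c : ~ is_pole m (coef X t) c -> lge 0 (lamo (Some c) t).
Proof. by move=> cp; rewrite lamoE; apply: (lge_pfo good_lamL cp). Qed.

Lemma lge_dlamo_reg al t c : ~ is_pole m (coef X t) c -> lge 0 (dlamo al (Some c) t).
Proof. by move=> cp; rewrite dlamoE; apply: (lge_pfo (@good_pdl al _ good2_lamL) cp). Qed.

Local Notation lamd o t := (dzo o (lamo o t)).

Lemma ratl_lamd t : ratl (fun o => lamd o t).
Proof. exact: ratl_dzo (ratl_lamo t). Qed.

Lemma lamd_neq0 o t : D t -> lamd o t != 0.
Proof.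
by move=> tD; apply: (ratl_neq0 (o := po 0 t) (ratl_lamd t)); exact: lam'_neq0.
Qed.

Lemma lamX_pfe t : lamX X t = pfe idfun (apole^~ t) (pfat lamL t).
Proof. by apply/funext => z; exact: lam_pfe. Qed.

Lemma index_pfdz (l : seq (nat * nat * C)) :
  [seq e.1.1 | e <- pfdz l] = [seq e.1.1 | e <- l].
Proof. by elim: l => //= e l ->; case: ifP => // /eqP ->. Qed.

Lemma lcoef_lamd t c : ~ is_pole m (coef X t) c ->
  lge 0 (lamd (Some c) t) /\ lcoef (lamd (Some c) t) 0 = derive1 (lamX X t) c.
Proof.
move=> cp; have h := good_pole_hyp good_lamL cp.
rewrite lamX_pfe lamoE (pfe_dzo (apole^~ t) (pfat lamL t) (Some c)).
have [_ ->] := pfe_derive1 h.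
by apply: lcoef_pfe => s; rewrite index_pfdz; exact: h.
Qed.

Lemma lord_lamd t c : ~ is_pole m (coef X t) c -> ~ crit X t c -> lord 0 (lamd (Some c) t).
Proof.
move=> cp ncr; have [h0 hc] := lcoef_lamd cp; split=> //.
by apply/eqP; rewrite hc => h; apply: ncr.
Qed.

Lemma lord_zo_reg t c : D t -> ~ is_pole m (coef X t) c -> lord 0 (zo (Some c)).
Proof.
move=> tD cp; apply: lord_zat; apply/eqP => c0; apply: cp; exists 1%N => //.
by rewrite coef10.
Qed.

(** lambda' is a nonzero rational function and has finitely many zeros, so the sums over [crit X t]
    are finite sums. *)
Lemma crit_seq t : D t -> exists r : seq C, uniq r /\ crit X t = [set` r].
Proof.
move=> tD; have [r rP] := ratl_ord0 (ratl_lamd t) (lamd_neq0 None tD).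
exists (undup (seq.filter (fun c => `[< crit X t c >]) r)); split; first exact: undup_uniq.
apply/seteqP; split=> c /=; rewrite mem_undup mem_filter; last by case/andP => /asboolP.
move=> cr; apply/andP; split; first exact/asboolP.
apply: contraT => /rP[_]; case: (cr) => cp d0.
by have [_ ->] := lcoef_lamd cp; rewrite d0 eqxx.
Qed.

Lemma crit_sum F t : D t -> ratl F ->
  (forall c, ~ is_pole m (coef X t) c -> ~ crit X t c -> lge 0 (F (Some c))) ->
  \sum_(c \in crit X t) res_at (F (Some c)) + psum (fun s => reso (po s t) (F (po s t))) = 0.
Proof.
move=> tD Fr Freg; have [r [ur rE]] := crit_seq tD.
pose pl := [seq apole s t | s <- index_iota 1 m.+1].
have upl : uniq pl.
  rewrite map_inj_in_uniq ?iota_uniq // => s s'; rewrite !mem_index_iota => sm s'm sE.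
  by apply: contra_eq sE; exact: apole_neq.
have plP c : c \in pl <-> is_pole m (coef X t) c.
  split=> [/mapP[s]|[s sm ->]].
    by rewrite mem_index_iota ltnS => sm ->; exists s.
  by apply/mapP; exists s; rewrite // mem_index_iota ltnS.
have u : uniq (r ++ pl).
  rewrite cat_uniq ur upl andbT /=; apply/hasPn => c /plP cp; apply/negP => cr.
  by have [] : crit X t c; rewrite ?rE.
have := residue_theorem Fr u; rewrite rE -fsbig_seq // big_cat /= -addrA => h.
rewrite /psum big_ltn // po0 [X in _ + X]addrC; rewrite big_map in h.
rewrite (eq_big_nat _ _ (F2 := fun s => reso (Some (apole s t)) (F (Some (apole s t))))).
  apply: h => c; rewrite mem_cat negb_or => /andP[cr cp].
  apply: Freg; first by move=> /plP; apply/negP.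
  by rewrite rE /=; apply/negP.
by move=> s /andP[s1 _]; case: s s1.
Qed.

(* The functions z^{-1} d lambda for tangent vectors d are exactly these. *)
Definition tangent (h : option C -> L) t : Prop :=
  [/\ ratl h, forall c, ~ is_pole m (coef X t) c -> lge 0 (h (Some c))
    & forall s, (s <= m)%N ->
        lge (if s == 0%N then 2 - (n 0)%:Z else - (n s)%:Z - 1) (h (po s t))].

(** By [pair_crit] this is the metric pairing of the tangent vector z h with the coordinate field
    [be], computed at the punctures. *)
Definition pair (h : option C -> L) be t : C :=
  psum (fun s => reso (po s t) (h (po s t) * LamS be 0 s t)).

Definition dlz al t : option C -> L := fun o => dlamo al o t / zo o.

Lemma tan_dlz al t : D t -> tangent (dlz al t) t.
Proof.
move=> tD; split.
- by apply: ratlM; [exact: ratl_dlamo|apply: ratlV; exact: ratl_zo].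
- move=> c cp; have := lge_lord_dvd (@lge_dlamo_reg al t c cp) (lord_zo_reg tD cp).
  by rewrite subr0.
move=> s sm; have := lge_lord_dvd (lge_dlamo al tD sm) (lord_zo1 tD sm).
by apply: lge_le; case: s sm => [|[|s]] sm /=; lia.
Qed.

Lemma reso_po s t f : lge (if s == 0%N then 2 else 0) f -> reso (po s t) f = 0.
Proof. by case: s => [|s] h; apply: lge_reso. Qed.

(** The orders in [tangent] and in [psi_LamS] are complementary: their sum is 2 at infinity and 0 at
    the poles, so the error terms have no residue. *)
Lemma pair_psi h be t : D t -> tangent h t ->
  psum (fun s => reso (po s t) (h (po s t) * psi be (po s t) t)) = - pair h be t.
Proof.
move=> tD [_ _ hp]; apply/eqP; rewrite -subr_eq0 opprK -psumD; apply/eqP.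
rewrite /psum big_nat big1 // => s /andP[_ sm]; rewrite -raddfD -mulrDr; apply: reso_po.
have := lgeM (hp s sm) (psi_LamS be tD (s := s) sm); apply: lge_le.
by case: eqP => s0; lia.
Qed.

Lemma pair_crit h be t : D t -> tangent h t ->
  \sum_(c \in crit X t) res_at (h (Some c) * psi be (Some c) t) = pair h be t.
Proof.
move=> tD ht; case: (ht) => hr hreg _.
have := @crit_sum (fun o => h o * psi be o t) t tD _ _.
rewrite pair_psi // => H; apply/eqP; rewrite -subr_eq0; apply/eqP; apply: H.
  apply: ratlM => //; apply: ratlM; first exact: ratl_dlamo.
  by apply: ratlV; apply: ratlM; [exact: ratl_zo|exact: ratl_lamd].
move=> c cp ncr; rewrite -[0 : int]addr0; apply: lgeM; first exact: hreg.
have hh := lge_lord_dvd (@lge_dlamo_reg be t c cp) (lordM (lord_zo_reg tD cp) (lord_lamd cp ncr)).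
by apply: lge_le hh.
Qed.

Lemma field_eta (F : fieldType) (a b z l : F) : a / z * (b / (z * l)) = a * b / (z ^+ 2 * l).
Proof. by rewrite mulf_div mulrA expr2. Qed.

Lemma eta_pair al be t : D t -> eta X al be t = pair (dlz al t) be t.
Proof.
move=> tD; rewrite -(pair_crit be tD (tan_dlz al tD)) /eta.
by apply: eq_fsbigr => c _; congr res_at; apply/esym; exact: field_eta.
Qed.

(** * The metric in flat coordinates *)

Definition ldeg al s : option nat :=
  match al with
  | inl j => if s == 0%N then Some j.+1 else None
  | inr (existT i j) => if s == 0%N then (if (j < n i.+1)%N then None else Some (n 0))
      else if s == i.+1 then Some (nat_of_ord j) else None
  end.

Lemma LamS0_ldeg al s t : LamS al 0 s t =
  if ldeg al s is Some k then lconst (if s == 0%N then -1 else 1) * wo s t ^- k else 0.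
Proof.
case: al => [j|[i j]] /=.
  by case: s => [|s] //=; rewrite rmorphN1 mulN1r.
case: s => [|s] /=.
  by case: ifP => _ //; rewrite rmorphN1 mulN1r.
rewrite eqSS; case: (ltnP j (n i.+1)) => jn; case: eqP => // si; rewrite ?(rmorph1 (@lconst C)) ?mul1r.
  by rewrite si.
have -> : nat_of_ord j = n i.+1 by have := ltn_ord j; lia.
by rewrite si.
Qed.

(** The dual index for the metric. The ordinals of [idx0] start at t_{0,1}, so reversal sends
    t_{0,j} to t_{0,n_0-j}; it sends t_{i,j} to t_{i,n_i-j}. *)
Definition bar al : I :=
  match al with
  | inl j => idx0 m (rev_ord j)
  | inr (existT i j) => idx (rev_ord j)
  end.

Lemma barK : involutive bar.
Proof. by case=> [j|[i j]] /=; rewrite /idx0 /idx rev_ordK. Qed.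

(** At infinity all degrees are positive, so the degree n_0 that belongs to t_{i,n_i} is never
    completed to a sum n_0; dual indices meet at a single puncture. *)
Lemma psum_ldeg al be :
  psum (fun s => if ldeg al s is Some a then
     if ldeg be s is Some b then (a + b == n s)%:R else 0 else 0) = (be == bar al)%:R.
Proof.
case: al => [j|[i j]]; have n0 := n_gt0 (leq0n m).
  rewrite (@psum1 0 _ (leq0n m)); last by move=> [|s] //.
  case: be => [k|[i k]] /=.
    have -> : (inl k == idx0 m (rev_ord j)) = (val k == val (rev_ord j)) by [].
    congr (nat_of_bool _)%:R; rewrite /=.
    by have := ltn_ord j; have := ltn_ord k; lia.
  by case: ifP => // _; congr (_%:R); lia.
have im := ltn_ord i; rewrite (@psum1 i.+1 _ im); last first.
  move=> [|s] sm si /=; last by rewrite (negbTE si).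
  case: ifP => // _; case: be => [k|[i' k]] /=; first by rewrite (_ : _ == _ = false) //; lia.
  by case: ifP => // _; rewrite (_ : _ == _ = false) //; lia.
rewrite /= eqxx; case: be => [k|[i' k]] //=.
rewrite eqSS; case: eqP => ii.
  have {}ii : i = i' by exact: val_inj.
  subst i'; congr (_%:R); rewrite (_ : (_ == idx _) = (k == rev_ord j)); last exact: idx_eq.
  rewrite -val_eqE /=.
  by have := ltn_ord j; have := ltn_ord k; lia.
rewrite (_ : (_ == _) = false) //; apply/eqP => -[/(congr1 val) ii' _].
by apply: ii.
Qed.

Lemma ring_dX (F : fieldType) (f g d q : F) : d * (f * g) + f * (q * g * d) = (q + 1) * (f * g) * d.
Proof. by ring. Qed.

Lemma dzoX o (f : L) k : dzo o (f ^+ k.+1) = k.+1%:R * f ^+ k * dzo o f.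
Proof.
elim: k => [|k IHk]; first by rewrite expr1 expr0 !mul1r.
by rewrite exprS dzoM IHk -[k.+2%:R]natr1 exprS; exact: ring_dX.
Qed.

Lemma field_dlog_inf (F : fieldType) (v d f : F) : - (v ^+ 2 * d) / f = - (v * (v * (d / f))).
Proof. by rewrite mulNr expr2 -!mulrA. Qed.

Lemma reso_dlog o (f : L) N : lord N f -> reso o (dzo o f / f) = N%:~R.
Proof.
move=> fN; have h := lcoefM_low (lge_lderiv (lord_ge fN)) (lord_ge (lordV fN)).
rewrite lcoefV // lcoef_lderiv subrK -mulrA mulfV ?mulr1 ?(proj2 fN) // in h.
have {}h : lcoef (lderiv f / f) (-1) = N%:~R by rewrite -h; congr lcoef; lia.
case: o => [c|]; first exact: h.
rewrite -[LHS]/(- lcoef (- (lvar C ^+ 2 * lderiv f) / f) 1) field_dlog_inf lcoefN opprK.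
rewrite 2!lcoef_lvarM (_ : 1 - 1 - 1 = -1 :> int); [exact: h|by []].
Qed.

Lemma field_wk0 (F : fieldType) (u d w : F) : u != 0 -> w != 0 -> (u * w)^-1 * (w * d) = d / u.
Proof. by move=> u0 w0; field; rewrite u0 w0. Qed.
Lemma field_wk1 (F : fieldType) (w v d q : F) : w != 0 -> q != 0 ->
  w^-1 * (w * v * d) = q^-1 * (q * v * d).
Proof. by move=> w0 q0; field; rewrite w0 q0. Qed.
Lemma field_wk2 (F : fieldType) (w u v d q : F) : w != 0 -> v != 0 -> u != 0 -> q != 0 ->
  (w * (u * (u * v)))^-1 * (w * d) = - q^-1 * - (q * v * d / (u * v) ^+ 2).
Proof. by move=> w0 v0 u0 q0; field; rewrite w0 v0 u0 q0. Qed.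

(** The product is the derivative of a multiple of a power of [u], except for the exponent -1, where
    it is the logarithmic derivative and its residue is the order of [u]. *)
Lemma reso_wk o (u : L) N p k : lord N u ->
  reso o (u ^- k * (u ^+ p * dzo o u)) = if k == p.+1 then N%:~R else 0.
Proof.
move=> uN; have u0 := lord_neq0 uN; have q0 j : j.+1%:R != 0 :> C by rewrite pnatr_eq0.
have qL (j : nat) : j.+1%:R = lconst (j.+1%:R : C) by rewrite rmorph_nat.
have qL0 (j : nat) : j.+1%:R != 0 :> L by exact: natL_neq0.
case: (ltngtP k p.+1) => kp.
- have -> : p = (k + (p - k))%N by lia.
  move: (p - k)%N => j; rewrite exprD.
  rewrite (field_wk1 _ _ (expf_neq0 k u0) (qL0 j)) -(dzoX o u j) qL -(fmorphV (@lconst C)) reso_constM.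
  by rewrite reso_dzo mulr0.
- have -> : k = (p + (k - p.+2).+2)%N by lia.
  move: (k - p.+2)%N => j; rewrite exprD !exprS.
  have h := field_wk2 (dzo o u) (expf_neq0 p u0) (expf_neq0 j u0) u0 (qL0 j).
  rewrite h {h} -(dzoX o u j) -(exprS u j) -(dzoV o (u ^+ j.+1)) qL -(fmorphV (@lconst C)) -(rmorphN (@lconst C)) reso_constM.
  by rewrite reso_dzo mulr0.
by rewrite kp exprS field_wk0 ?expf_neq0 //; exact: reso_dlog.
Qed.

Lemma reso_wo_lam' s k t : D t -> (s <= m)%N ->
  reso (po s t) (wo s t ^- k * lam' s t) = - (k == n s)%:R.
Proof.
move=> tD sm; have n0 := n_gt0 sm.
have w' := d_wo sm tD (der_dzo Do (ctr s) tD).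
have -> : lam' s t = wo s t ^+ (n s).-1 * dzo (po s t) (wo s t).
  by rewrite w' mulrC divfK // expf_neq0 // wo_neq0.
rewrite (reso_wk _ _ _ (lord_wo tD sm)) prednK //.
by case: eqP => _; rewrite ?oppr0.
Qed.

Lemma lge_LamS0 al s t : D t -> (s <= m)%N ->
  lge (if s == 0%N then 1 else 0) (LamS al 0 s t).
Proof.
move=> tD sm; have n0 := n_gt0 (leq0n m); rewrite LamS0_ldeg.
case E : (ldeg al s) => [k|]; last by case: eqP => _; exact: lge0.
apply: lge_constM; apply: lge_le (@lge_woVn s t k tD sm).
case: s sm E => [|s] sm //=; case: al => [j [<-] //|[i j]] /=.
by case: ifP => // _ [<-].
Qed.

Lemma field_pl (F : fieldType) (d z l : F) : l != 0 -> d / z = d / (z * l) * l.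
Proof.
move=> l0; have [->|z0] := eqVneq z 0; first by rewrite mul0r invr0 mulr0 mul0r.
by field; rewrite z0 l0.
Qed.

Lemma dlz_psi al o t : D t -> dlz al t o = psi al o t * lamd o t.
Proof. by move=> tD; apply: field_pl; exact: lamd_neq0. Qed.

Lemma ring_LL (F : fieldType) (p a b l : F) : p * l * b + a * b * l = (p + a) * (l * b).
Proof. by ring. Qed.

Lemma ring_sq (F : fieldType) (e u v l : F) : e * e = 1 -> e * u * (e * v) * l = u * v * l.
Proof. by move=> e1; rewrite mulrACA e1 mul1r. Qed.

(** With [psi] replaced by [- LamS] there remain residues of w_s^(-a-b) lambda', nonzero exactly for
    a + b = n_s. The signs at infinity square to 1. *)
Lemma pair_dlz al be t : D t -> pair (dlz al t) be t = (be == bar al)%:R.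
Proof.
move=> tD; rewrite -psum_ldeg; apply: eq_psum => s sm.
have l1 : lge (if s == 0%N then 1 - (n 0)%:Z else - (n s)%:Z - 1) (lam' s t).
  exact: lord_ge (lord_dzo_lamo tD sm).
have : reso (po s t) (dlz al t (po s t) * LamS be 0 s t +
    LamS al 0 s t * LamS be 0 s t * lam' s t) = 0.
  apply: reso_po; rewrite dlz_psi // ring_LL.
  have := lgeM (psi_LamS al tD sm) (lgeM l1 (lge_LamS0 be tD sm)); apply: lge_le.
  by case: eqP => s0; [subst s; lia|lia].
rewrite raddfD /= => /eqP; rewrite addr_eq0 => /eqP ->.
rewrite !LamS0_ldeg; case: (ldeg al s) => [a|]; last by rewrite !mul0r raddf0 oppr0.
case: (ldeg be s) => [b|]; last by rewrite mulr0 mul0r raddf0 oppr0.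
set e := lconst _; have e1 : e * e = 1.
  by rewrite /e -rmorphM; case: eqP => _; rewrite ?mulrNN mulr1.
by rewrite (ring_sq _ _ _ e1) -invfM -exprD reso_wo_lam' // opprK.
Qed.

Lemma etaE al be t : D t -> eta X al be t = (be == bar al)%:R.
Proof. by move=> tD; rewrite eta_pair // pair_dlz. Qed.

(** The metric is the permutation matrix of the involution [bar], hence its own inverse. *)
Lemma etainvE al be t : D t -> etainv (eta X) al be t = (be == bar al)%:R.
Proof.
move=> tD; rewrite /etainv; set M := \matrix_(_, _) _.
have ME k l : M k l = (enum_val l == bar (enum_val k))%:R by rewrite mxE etaE.
have MM : M *m M = 1%:M.
  apply/matrixP => k l; rewrite !mxE (bigD1 (enum_rank (bar (enum_val k)))) //= big1.
    rewrite !ME enum_rankK eqxx mul1r barK addr0 (inj_eq enum_val_inj) eq_sym //.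
  move=> j jk; rewrite ME (_ : (_ == _) = false) ?mul0r //.
  by apply: contra_neqF jk => /eqP <-; rewrite enum_valK.
have [Mu _] := mulmx1_unit MM.
have -> : invmx M = M by rewrite -[LHS]mulmx1 -MM mulKmx.
by rewrite ME !enum_rankK.
Qed.

Lemma sum_bar (f : I -> C) ep : \sum_(de : I) f de * (ep == bar de)%:R = f (bar ep).
Proof.
rewrite (bigD1 (bar ep) isT) /= barK eqxx mulr1 big1 ?addr0 // => de dep.
rewrite (_ : (_ == _) = false) ?mulr0 //.
by apply: contra_neqF dep => /eqP ->; rewrite barK.
Qed.

Lemma structcE ep be ga t : D t ->
  structc (eta X) (c3 X) ep be ga t = c3 X be ga (bar ep) t.
Proof.
move=> tD.
transitivity (\sum_(de : I) c3 X be ga de t * (ep == bar de)%:R).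
  by apply: eq_bigr => de _; rewrite (etainvE _ _ tD).
exact: (sum_bar (fun de => c3 X be ga de t)).
Qed.

Lemma tanD h h' t : tangent h t -> tangent h' t -> tangent (fun o => h o + h' o) t.
Proof.
move=> [h1 h2 h3] [h1' h2' h3']; split; first exact: ratlD.
- by move=> c cp; apply: lgeD; [exact: h2|exact: h2'].
by move=> s sm; apply: lgeD; [exact: h3|exact: h3'].
Qed.

Lemma tanM (c : C) h t : tangent h t -> tangent (fun o => lconst c * h o) t.
Proof.
move=> [h1 h2 h3]; split; first by apply: ratlM => //; exact: ratl_const.
- by move=> z zp; apply: lge_constM; exact: h2.
by move=> s sm; apply: lge_constM; exact: h3.
Qed.

Lemma tan0 t : tangent (fun=> 0) t.
Proof.
split=> [|c _|s _]; [|exact: lge0|exact: lge0].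
by apply: ratl_ext (ratl_const 0) => o; rewrite rmorph0.
Qed.

Lemma tan_sum (J : Type) (r : seq J) (h : J -> option C -> L) t :
  (forall j, tangent (h j) t) -> tangent (fun o => \sum_(j <- r) h j o) t.
Proof.
move=> hj; elim: r => [|j r IHr].
  by have -> : (fun o => \sum_(j <- [::]) h j o) = (fun=> 0);
    [apply/funext => o; rewrite big_nil|exact: tan0].
have -> : (fun o => \sum_(i <- j :: r) h i o) = (fun o => h j o + \sum_(i <- r) h i o).
  by apply/funext => o; rewrite big_cons.
exact: tanD.
Qed.

Lemma pairD h h' be t : pair (fun o => h o + h' o) be t = pair h be t + pair h' be t.
Proof. by rewrite /pair -psumD; apply: eq_psum => s _; rewrite mulrDl raddfD. Qed.

Lemma pairM (c : C) h be t : pair (fun o => lconst c * h o) be t = c * pair h be t.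
Proof. by rewrite /pair -psumM; apply: eq_psum => s _; rewrite -mulrA reso_constM. Qed.

Lemma pair_sum (J : Type) (r : seq J) (h : J -> option C -> L) be t :
  pair (fun o => \sum_(j <- r) h j o) be t = \sum_(j <- r) pair (h j) be t.
Proof.
by rewrite /pair -psum_sum; apply: eq_psum => s _; rewrite mulr_suml raddf_sum.
Qed.

(** The pairings with the w_s^(-j) remove polar coefficients one at a time, from the lowest; a
    function without poles that vanishes at infinity is 0. *)
Lemma pair_nondeg h t : D t -> tangent h t -> (forall be, pair h be t = 0) -> forall o, h o = 0.
Proof.
move=> tD [h1 h2 h3] hp.
(* When the orders match, the residue of [h * w^-k] is, up to sign, the product of the two lowest
   coefficients, so its vanishing raises the order of [h] by one. *)
have step s (k : nat) N : (s <= m)%N -> lge N (h (po s t)) ->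
    N - (if s == 0%N then 1 else -1) + k%:Z = 0 ->
    reso (po s t) (h (po s t) * wo s t ^- k) = 0 -> lge (N + 1) (h (po s t)).
  move=> sm hN Nk rk; have wk := lordVn k (lord_wo tD sm).
  have := lcoefM_low hN (lord_ge wk).
  have -> : lcoef (h (po s t) * wo s t ^- k) (N + - (k%:Z * -1)) = 0.
    have -> : N + - (k%:Z * -1) = if s == 0%N then 1 else -1 by case: ifP Nk => _; lia.
    case: s sm hN Nk rk {wk} => [|s] sm hN Nk rk //=.
    by apply/eqP; rewrite -oppr_eq0 -[X in X == 0]/(res_inf _); apply/eqP.
  move=> /esym/eqP; rewrite mulf_eq0 (negbTE (proj2 wk)) orbF => /eqP h0 j jN.
  by have [/hN //|jN'] := ltP j N; have -> : j = N by lia.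
have hS s : (0 < s <= m)%N -> lge 0 (h (po s t)).
  case: s => // s sm; suff H k : (k <= (n s.+1).+1)%N -> lge (- (n s.+1)%:Z - 1 + k%:Z) (h (po s.+1 t)).
    by apply: lge_le (H _ (leqnn _)); lia.
  elim: k => [_|k IHk kn]; first by rewrite addr0; exact: (h3 s.+1 sm).
  have -> : - (n s.+1)%:Z - 1 + k.+1%:Z = - (n s.+1)%:Z - 1 + k%:Z + 1 by lia.
  pose j := (n s.+1 - k)%N; have jn : (j < (n s.+1).+1)%N by rewrite /j; lia.
  apply: (step s.+1 j) => //=; [by apply: IHk; lia|by rewrite /j; lia|].
  have := hp (@idx m n (Ordinal sm) (Ordinal jn)); rewrite /pair.
  rewrite (@psum1 s.+1 _ sm); first by rewrite LamS0_ldeg /= eqxx (rmorph1 (@lconst C)) mul1r.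
  (* The field of t_{i,n_i} also has a germ at infinity, of order n_0; against the order 2 - n_0 of
     [h] it has no residue. *)
  move=> s' s'm s's; rewrite LamS0_ldeg; case: s' s'm s's => [|s'] s'm s's /=.
    case: ifP => _ /=; first by rewrite mulr0 /res_inf lcoef0 oppr0.
    have := lgeM (h3 0%N (leq0n m)) (lge_constM (-1) (@lge_woVn 0 t (n 0) tD (leq0n m))).
    by move=> hh; apply: (@reso_po 0 t); apply: (lge_le _ hh) => /=; lia.
  by rewrite (negbTE s's) mulr0.
have hinf : lge 1 (h (po 0 t)).
  have n0 := n_gt0 (leq0n m).
  suff H k : (k <= (n 0).-1)%N -> lge (2 - (n 0)%:Z + k%:Z) (h (po 0 t)).
    by apply: lge_le (H _ (leqnn _)); lia.
  elim: k => [_|k IHk kn]; first by rewrite addr0; exact: (h3 0%N (leq0n m)).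
  have -> : 2 - (n 0)%:Z + k.+1%:Z = 2 - (n 0)%:Z + k%:Z + 1 by lia.
  pose j := ((n 0).-2 - k)%N; have jn : (j < (n 0).-1)%N by rewrite /j; lia.
  apply: (step 0%N j.+1) => //=; [by apply: IHk; lia|by rewrite /j; lia|].
  have := hp (@idx0 m n (Ordinal jn)); rewrite /pair (@psum1 0 _ (leq0n m)); last first.
    by move=> [|s] // _ _; rewrite /LamS /= mulr0.
  rewrite -[LamS _ _ _ _]/(- (winf X t ^- j.+1)) mulrN (raddfN (reso (po 0 t))).
  by move=> /eqP; rewrite oppr_eq0 => /eqP.
apply: liouville0 => // c; have [[s sm ->]|cp] := pselect (is_pole m (coef X t) c).
  by case: s sm => // s sm; exact: (hS s.+1).
exact: h2.
Qed.

(** [bar] lists the dual basis, so the difference of the two sides pairs to zero with every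
    coordinate field. *)
Lemma tan_expand h t : D t -> tangent h t ->
  forall o, h o = \sum_(ep : I) lconst (pair h (bar ep) t) * dlz ep t o.
Proof.
move=> tD ht o; pose g o := \sum_(ep <- enum I) lconst (pair h (bar ep) t) * dlz ep t o.
have gt : tangent g t by apply: tan_sum => ep; apply: tanM; exact: tan_dlz.
have dt : tangent (fun o => h o + lconst (-1) * g o) t by apply: tanD => //; exact: tanM.
suff E be : pair (fun o => h o + lconst (-1) * g o) be t = 0.
  have := pair_nondeg tD dt E o; rewrite (rmorphN1 (@lconst C)) mulN1r => /eqP.
  by rewrite subr_eq0 /g big_enum => /eqP.
rewrite pairD pairM pair_sum big_enum (bigD1 (bar be) isT) big1 => [|ep].
  by rewrite pairM (pair_dlz _ _ tD) /= !barK eqxx mulr1 addr0 mulN1r subrr.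
rewrite pairM (pair_dlz _ _ tD) /= => epb; rewrite (_ : (_ == _) = false) ?mulr0 //.
by apply: contra_neqF epb => /eqP ->; rewrite barK.
Qed.

(** * Derivatives of the densities *)

Lemma psum_global F t : D t -> ratl F ->
  (forall c, ~ is_pole m (coef X t) c -> lge 0 (F (Some c))) ->
  psum (fun s => reso (po s t) (F (po s t))) = 0.
Proof.
move=> tD Fr Freg; have := crit_sum tD Fr (fun c cp _ => Freg c cp).
by rewrite fsbig1 ?add0r // => c [cp _]; apply: lge_res_at; exact: Freg.
Qed.

Lemma holo_reso s f : lfam D f -> holo D (fun u => reso (po s u) (f u)).
Proof.
move=> fl; case: s => [|s]; last exact: (lfam_holo (-1) fl).
exact: (holoN (lfam_holo 1 fl)).
Qed.

Lemma holo_psum (F : nat -> V -> C) : (forall s, (s <= m)%N -> holo D (F s)) ->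
  holo D (fun u => psum (fun s => F s u)).
Proof.
move=> Fh; apply: (holo_ext Do (f := fun u => \sum_(s < m.+1) F s u)).
  by move=> u _; rewrite /psum big_mkord.
by apply: holo_sum => s _; apply: Fh; rewrite -ltnS.
Qed.

Lemma pd_psum (F : nat -> V -> C) ga t : D t -> (forall s, (s <= m)%N -> holo D (F s)) ->
  pd ga (fun u => psum (fun s => F s u)) t = psum (fun s => pd ga (F s) t).
Proof.
move=> tD Fh; rewrite (pd_ext (g := fun u => \sum_(s < m.+1) F s u) Do ga tD); last first.
  by move=> u _; rewrite /psum big_mkord.
by rewrite pd_sum /psum ?big_mkord // => s _; apply: Fh => //; rewrite -ltnS.
Qed.

Lemma pd_psum_reso (f : nat -> V -> L) ga t : D t -> (forall s, (s <= m)%N -> lfam D (f s)) ->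
  pd ga (fun u => psum (fun s => reso (po s u) (f s u))) t =
  psum (fun s => reso (po s t) (Dt ga (ctr s) (f s) t)).
Proof.
move=> tD fl; rewrite pd_psum // => [|s sm]; last exact: holo_reso (fl s sm).
by apply: eq_psum => s sm; rewrite (reso_Dt Do ga _ tD (fl s sm)).
Qed.

Lemma lfam_zV s : (s <= m)%N -> lfam D (fun u => (zo (po s u))^-1).
Proof.
move=> sm; have zl := lfam_zo Do (centre_ctr s).
by apply: (lfamV Do _ zl) => u uD; exact: lord_zo1 uD sm.
Qed.

Lemma lfam_dlz al s : (s <= m)%N -> lfam D (fun u => dlz al u (po s u)).
Proof. by move=> sm; apply: (lfamM Do (lfam_dlamo al sm)); exact: lfam_zV. Qed.

Lemma lfam_thetag al p s : (s <= m)%N -> lfam D (fun u => LamS al p s u / zo (po s u)).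
Proof. by move=> sm; apply: (lfamM Do (lfam_LamS al p sm)); exact: lfam_zV. Qed.

Lemma lfam_thetad al p ga s : (s <= m)%N -> lfam D (fun u => LamS al p s u * dlz ga u (po s u)).
Proof. by move=> sm; apply: (lfamM Do (lfam_LamS al p sm)); exact: lfam_dlz. Qed.

Lemma theta_ext al p : theta X al p =
  fun t => psum (fun s => reso (po s t) (LamS al p.+1 s t / zo (po s t))).
Proof. by apply/funext => t; exact: theta_res. Qed.

Lemma holo_theta al p : holo D (theta X al p).
Proof.
rewrite theta_ext; apply: (holo_psum (F := fun s t => reso (po s t) _)) => s sm.
exact: holo_reso (lfam_thetag al p.+1 sm).
Qed.

Lemma Dt_zV ga s t : D t -> (s <= m)%N -> Dt ga (ctr s) (fun u => (zo (po s u))^-1) t = 0.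
Proof.
move=> tD sm; have zl := lfam_zo Do (centre_ctr s).
rewrite (derV (der_Dt Do ga (ctr s) tD) zl (lfam_zV sm) _ (zo_neq0 tD sm)).
  by rewrite (Dt_zo Do ga tD (centre_ctr s)) mul0r oppr0.
by move=> u uD; exact: zo_neq0.
Qed.

Lemma Dt_divz ga s f t : D t -> (s <= m)%N -> lfam D f ->
  Dt ga (ctr s) (fun u => f u / zo (po s u)) t = Dt ga (ctr s) f t / zo (po s t).
Proof.
move=> tD sm fl; rewrite (derM (der_Dt Do ga (ctr s) tD) fl (lfam_zV sm)).
by rewrite Dt_zV // mulr0 addr0.
Qed.

Lemma ratl_kz al t : ratl (fun o => kz al o t).
Proof.
rewrite /kz; case: (kidx al) => [i|].
  by apply: ratlV; apply: ratlB; [exact: ratl_zo|exact: ratl_const].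
by apply: ratl_ext (ratl_const 0) => o; rewrite rmorph0.
Qed.

Lemma ratl_kt ga al t : ratl (fun o => kt ga al o t).
Proof.
rewrite /kt; case: (kidx al) => [i|].
  apply: ratlN; apply: ratlM; first exact: ratl_const.
  by apply: ratlV; apply: ratlB; [exact: ratl_zo|exact: ratl_const].
by apply: ratl_ext (ratl_const 0) => o; rewrite rmorph0.
Qed.

Lemma lord_zoB_reg t c i : ~ is_pole m (coef X t) c -> (1 <= i <= m)%N ->
  lord 0 (zo (Some c) - lconst (apole i t)).
Proof.
move=> cp im; rewrite zatB; apply: lord_zat; rewrite subr_eq0; apply/eqP.
exact: is_poleP cp im.
Qed.

Lemma lge_kz al t c : ~ is_pole m (coef X t) c -> lge 0 (kz al (Some c) t).
Proof.
move=> cp; rewrite /kz; case E : (kidx al) => [i|]; last exact: lge0.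
by have := lord_ge (lordV (lord_zoB_reg cp (kidx_le E))); rewrite oppr0.
Qed.

Lemma lge_kt ga al t c : ~ is_pole m (coef X t) c -> lge 0 (kt ga al (Some c) t).
Proof.
move=> cp; rewrite /kt; case E : (kidx al) => [i|]; last exact: lge0.
apply: lgeN; apply: lge_constM.
by have := lord_ge (lordV (lord_zoB_reg cp (kidx_le E))); rewrite oppr0.
Qed.

Definition lamp p (o : option C) t : L := lamo o t ^+ p / p`!%:R.

Lemma ratl_lamp p t : ratl (fun o => lamp p o t).
Proof.
apply: ratlM; first by apply: ratlX; exact: ratl_lamo.
by apply: ratlV; exact: ratl_nat.
Qed.

Lemma lampE p o t : lamp p o t = lconst (p`!%:R^-1) * lamo o t ^+ p.
Proof. by rewrite /lamp mulrC (fmorphV (@lconst C)) (rmorph_nat (@lconst C)). Qed.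

Lemma lge_lamp p t c : ~ is_pole m (coef X t) c -> lge 0 (lamp p (Some c) t).
Proof.
move=> cp; rewrite lampE; apply: lge_constM.
by have := @lgeX _ _ _ p (@lge_lamo_reg t c cp); rewrite mulr0.
Qed.

Lemma pd_theta al p ga t : D t -> pd ga (theta X al p) t =
  psum (fun s => reso (po s t) (LamS al p s t * dlz ga t (po s t))).
Proof.
move=> tD; rewrite theta_ext.
rewrite (pd_psum_reso (f := fun s u => LamS al p.+1 s u / zo (po s u)) ga tD); last first.
  by move=> s sm; exact: lfam_thetag.
have : psum (fun s => reso (po s t) (lamp p (po s t) t * kt ga al (po s t) t / zo (po s t))) = 0.
  apply: (psum_global (F := fun o => lamp p o t * kt ga al o t / zo o) tD).
    apply: ratlM; last by apply: ratlV; exact: ratl_zo.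
    by apply: ratlM; [exact: ratl_lamp|exact: ratl_kt].
  move=> c cp; have h := lgeM (@lge_lamp p t c cp) (@lge_kt ga al t c cp).
  by have := lgeM h (lord_ge (lordV (lord_zo_reg tD cp))); rewrite oppr0 !addr0.
move=> k0; rewrite -[RHS]addr0 -{}k0 -psumD; apply: eq_psum => s sm.
rewrite (Dt_divz ga tD sm (lfam_LamS al p.+1 sm)) LamS_Dt // mulrDl raddfD.
by congr (reso _ _ + _); rewrite /dlz mulrA.
Qed.

(** * The product and the Hessian of lambda *)

Lemma dzoB o (f g : L) : dzo o (f - g) = dzo o f - dzo o g.
Proof.
by case: o => [c|] /=; rewrite lderivD lderivN // mulrDr mulrN opprD.
Qed.

(** The functions F and K of the decomposition. [Fm] is built from the structure constants; that it
    carries the whole singular part at the critical points is the content of [lge_Kf_reg]. *)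
Definition Fm be ga t o : L :=
  \sum_(ep : I) lconst (structc (eta X) (c3 X) ep be ga t) * psi ep o t.
Definition Kf be ga t o : L := dlamo be o t * psi ga o t - Fm be ga t o.

Lemma ratl_psi ga t : ratl (fun o => psi ga o t).
Proof.
apply: ratlM; first exact: ratl_dlamo.
by apply: ratlV; apply: ratlM; [exact: ratl_zo|exact: ratl_lamd].
Qed.

Lemma lge_psi_reg ga t c : D t -> ~ is_pole m (coef X t) c -> ~ crit X t c ->
  lge 0 (psi ga (Some c) t).
Proof.
move=> tD cp ncr.
have h := lge_lord_dvd (@lge_dlamo_reg ga t c cp) (lordM (lord_zo_reg tD cp) (lord_lamd cp ncr)).
by apply: lge_le h.
Qed.

Lemma lge_dlz_reg ga t c : D t -> ~ is_pole m (coef X t) c -> lge 0 (dlz ga t (Some c)).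
Proof. by move=> tD cp; have [_ + _] := tan_dlz ga tD; exact. Qed.

Lemma ratl_Fm be ga t : ratl (Fm be ga t).
Proof.
by apply: ratl_sum => ep _; apply: ratlM; [exact: ratl_const|exact: ratl_psi].
Qed.

Lemma ratl_Kf be ga t : ratl (Kf be ga t).
Proof.
apply: ratlB; last exact: ratl_Fm.
by apply: ratlM; [exact: ratl_dlamo|exact: ratl_psi].
Qed.

Lemma field_c3 (F : fieldType) (a b d z l : F) : l != 0 -> z != 0 ->
  l * (a * (b / (z * l))) * (d / (z * l)) = a * b * d / (z ^+ 2 * l).
Proof. by move=> l0 z0; field; rewrite l0 z0. Qed.

Lemma ring_split3 (F : fieldType) (l g h p : F) : l * (g + h) * p - g * (p * l) = l * h * p.
Proof. by ring. Qed.

Lemma zo_neq0_all (o : option C) : zo o != 0.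
Proof. by have := @zoB_neq0 C o 0; rewrite rmorph0 subr0. Qed.

(* lambda' times the part of d_be lambda d_ga lambda / (z lambda') that is
   singular at the critical points is tangent, and its pairings are the c3. *)
Lemma lge_Kf_reg be ga t c : D t -> ~ is_pole m (coef X t) c -> lge 0 (Kf be ga t (Some c)).
Proof.
move=> tD cp0; pose F o := dlamo be o t * psi ga o t.
have Fr : ratl F by apply: ratlM; [exact: ratl_dlamo|exact: ratl_psi].
(* [h] takes the poles at critical points, [g] all others and the polynomial part; [h] will turn out
   to be [Fm]. *)
have [g [h [[gr hr] FE gc hc hinf]]] := @ratl_split C F (fun c => ~~ `[< crit X t c >]) Fr.
have {}gc z : crit X t z -> lge 0 (g (Some z)).
  by move=> zc; apply: gc; rewrite negbK; exact/asboolP.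
have {}hc z : ~ crit X t z -> lge 0 (h (Some z)).
  by move=> zc; apply: hc; exact/asboolPn.
have FEl o : lamd o t * F o = dlamo be o t * dlz ga t o.
  by rewrite dlz_psi // mulrC mulrA.
(* At a critical point [lambda' h] is a regular germ minus [lambda' g], hence regular; the zero of
   [h] at infinity gives the order 2 - n_0 required there. *)
have th : tangent (fun o => lamd o t * h o) t.
  split; first by apply: ratlM => //; exact: ratl_lamd.
    move=> z zp; have [zl _] := lcoef_lamd zp.
    have [zc|zc] := pselect (crit X t z); last by rewrite -[0]addr0; apply: lgeM => //; exact: hc.
    have -> : lamd (Some z) t * h (Some z) =
        dlamo be (Some z) t * dlz ga t (Some z) - lamd (Some z) t * g (Some z).
      by rewrite -FEl FE mulrDr [_ + lamd _ _ * h _]addrC addrK.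
    apply: lgeB; rewrite -[0]addr0; apply: lgeM; [exact: lge_dlamo_reg|exact: lge_dlz_reg|by []|].
    exact: gc.
  move=> s sm; have hl := lord_ge (lord_dzo_lamo tD sm).
  case: s sm hl => [|s] sm hl /=.
    by have := lgeM hl hinf; apply: lge_le; lia.
  rewrite -[_ - 1]addr0; apply: lgeM; first exact: hl.
  apply: hc => -[+ _]; apply; exists s.+1 => //.
have E ep : pair (fun o => lamd o t * h o) (bar ep) t = structc (eta X) (c3 X) ep be ga t.
  rewrite structcE // -(pair_crit _ tD th) /c3; apply: eq_fsbigr => z /set_mem zc.
  have zp : ~ is_pole m (coef X t) z by case: zc.
  (* The share of [g] in the pairing has no residue at a critical point, so [h] may be replaced by
     the full quotient [F], which gives the integrand of [c3]. *)
  have r0 : res_at (g (Some z) * (psi (bar ep) (Some z) t * lamd (Some z) t)) = 0.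
    apply: lge_res_at; rewrite -[0]addr0; apply: lgeM; first exact: gc.
    by rewrite -dlz_psi //; exact: lge_dlz_reg.
  have -> : res_at (lamd (Some z) t * h (Some z) * psi (bar ep) (Some z) t) =
      res_at (lamd (Some z) t * F (Some z) * psi (bar ep) (Some z) t).
    rewrite -(ring_split3 _ (g (Some z))) -FE; move: r0 (lamd _ _ * F _ * _) => + Y.
    by move: (g _ * _) => W W0; rewrite -[LHS]/(res_at Y - res_at W) W0 subr0.
  rewrite /F /psi; congr res_at; apply: field_c3; [exact: lamd_neq0|exact: (zo_neq0_all (Some z))].
have hE o : h o = Fm be ga t o.
  have l0 := lamd_neq0 o tD; apply: (mulfI l0).
  rewrite (tan_expand tD th) /Fm mulr_sumr; apply: eq_bigr => ep _.
  by rewrite E (dlz_psi _ _ tD) mulrA [RHS]mulrC.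
have -> : Kf be ga t (Some c) = g (Some c) by rewrite /Kf -hE -/(F (Some c)) FE addrK.
have [zc|zc] := pselect (crit X t c); first exact: gc.
have -> : g (Some c) = F (Some c) - h (Some c) by rewrite FE addrK.
apply: lgeB; last exact: hc.
by rewrite -[0]addr0; apply: lgeM; [exact: lge_dlamo_reg|exact: lge_psi_reg].
Qed.

Lemma lge_psi ga s t : D t -> (s <= m)%N ->
  lge (if s == 0%N then 1 else 0) (psi ga (po s t) t).
Proof.
move=> tD sm; have n0 := n_gt0 sm.
rewrite -[psi _ _ _](addrK (LamS ga 0 s t)); apply: lgeB; last exact: lge_LamS0.
by apply: lge_le (psi_LamS ga tD sm); case: eqP => s0; [subst s|]; lia.
Qed.

Lemma lge_Fm be ga s t : D t -> (s <= m)%N ->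
  lge (if s == 0%N then 1 else 0) (Fm be ga t (po s t)).
Proof. by move=> tD sm; apply: lge_sum => ep _; apply: lge_constM; exact: lge_psi. Qed.

Definition d2lamo be ga o t : L :=
  pfe (@lconst C) (apole^~ t) (pfdt (fun c => pd be c t) apole t (pdl ga lamL)) (zo o).

Lemma Dt_dlamo be ga s t : D t -> (s <= m)%N ->
  Dt be (ctr s) (fun u => dlamo ga (po s u) u) t = d2lamo be ga (po s t) t.
Proof.
move=> tD sm; rewrite /d2lamo -(Dt_pfo be tD (@good_pdl ga _ good2_lamL) sm).
by congr (Dt _ _ _ _); apply/funext => u; exact: dlamoE.
Qed.

Lemma ratl_d2lamo be ga t : ratl (fun o => d2lamo be ga o t).
Proof. exact: ratl_pfe. Qed.

Lemma index_pfdt (dc : (V -> C) -> C) t (l : seq (nat * nat * (V -> C))) s :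
  s \in [seq e.1.1 | e <- pfdt dc apole t l] -> s \in [seq e.1.1 | e <- l].
Proof.
rewrite /pfdt; elim: l => //= e l IHl; rewrite !in_cons.
by case/or3P => [->|->|/IHl ->]; rewrite ?orbT.
Qed.

Lemma lge_d2lamo_reg be ga t c : ~ is_pole m (coef X t) c -> lge 0 (d2lamo be ga (Some c) t).
Proof.
move=> cp; apply: lge_pfe => s /index_pfdt sl s0; apply: (is_poleP cp); rewrite lt0n s0 /=.
exact: (good_index (@good_pdl ga _ good2_lamL) sl).
Qed.

Lemma field_hess (F : fieldType) (d a b b' l' z : F) (p : F) : z != 0 -> l' != 0 ->
  l' * (d / (z * l') + a * - (z * b' / (z * l') ^+ 2) - b / l' * p) =
  d / z - (b' * (a / (z * l')) + b * p).
Proof. by move=> z0 l0; field; rewrite z0 l0. Qed.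

(** Up to sign and the factor lambda' this is a second derivative of log z at fixed lambda. At the
    punctures it measures the discrepancy in [hessian], up to the derivative of [Fm]. *)
Lemma fixd_psi be ga s t : D t -> (s <= m)%N ->
  lam' s t * fixd be s t (fun u => psi ga (po s u) u) =
  d2lamo be ga (po s t) t / zo (po s t) -
  dzo (po s t) (dlamo be (po s t) t * psi ga (po s t) t).
Proof.
move=> tD sm; have z0 := zo_neq0 tD sm; have l0 := lam'_neq0 tD sm.
have zl := lfam_zo Do (centre_ctr s); have ll := lfam_dzo (ctr s) (lfam_lamo sm).
have zll := lfamM Do zl ll; have dd := der_Dt Do be (ctr s) tD.
have zlV : lfam D (fun u => (zo (po s u) * lam' s u)^-1).
  apply: (lfamV Do _ zll) => u uD.
  exact: lordM (lord_zo1 uD sm) (lord_dzo_lamo uD sm).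
rewrite /fixd [X in _ * (X - _)](derM dd (lfam_dlamo ga sm) zlV).
have nz : onD D (fun u => zo (po s u) * lam' s u != 0).
  by move=> u uD; exact: mulf_neq0 (zo_neq0 uD sm) (lam'_neq0 uD sm).
rewrite (derV dd zll zlV nz (nz t tD)).
rewrite (derM dd zl ll) (Dt_zo Do be tD (centre_ctr s)) mul0r add0r.
rewrite (Dt_dzo Do be _ tD (lfam_lamo sm)) Dt_dlamo // Dt_lamo // dzoM.
rewrite {2}/psi; exact: (field_hess _ _ _ _ _ z0 l0).
Qed.

Lemma lfam_psi ga s : (s <= m)%N -> lfam D (fun u => psi ga (po s u) u).
Proof.
move=> sm; apply: (lfamM Do); first exact: lfam_dlamo.
have zll := lfamM Do (lfam_zo Do (centre_ctr s)) (lfam_dzo (ctr s) (lfam_lamo sm)).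
by apply: (lfamV Do _ zll) => u uD; exact: lordM (lord_zo1 uD sm) (lord_dzo_lamo uD sm).
Qed.

Lemma fixd_LamS0 be ga s t : D t -> (s <= m)%N -> fixd be s t (LamS ga 0 s) = 0.
Proof.
move=> tD sm; have dd := der_fixd be s tD; case E : (ldeg ga s) => [k|]; last first.
  rewrite (_ : LamS ga 0 s = fun=> 0); first exact: (der0 dd).
  by apply/funext => u; rewrite LamS0_ldeg E.
rewrite (_ : LamS ga 0 s = fun u => lconst (if s == 0%N then -1 else 1) * wo s u ^- k); last first.
  by apply/funext => u; rewrite LamS0_ldeg E.
have cl : lfam D (fun=> lconst (if s == 0%N then -1 else 1 : C)) by exact: lfam_cst.
have wl : lfam D (fun u => wo s u ^- k).
  by apply: (lfamVn Do (N := -1)); [move=> u uD; exact: lord_wo|exact: lfam_wo].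
rewrite (derM dd cl wl) fixd_woVn // (fixd_const _ _ tD) ?pd_cst; last exact: holo_cst.
by rewrite rmorph0 mul0r mulr0 addr0.
Qed.

(** [fixd] preserves orders and annihilates [LamS ga 0 s], so the estimate [psi_LamS] can be
    differentiated. *)
Lemma lge_fixd_psi be ga s t : D t -> (s <= m)%N ->
  lge (if s == 0%N then (n 0)%:Z else (n s)%:Z + 1)
    (fixd be s t (fun u => psi ga (po s u) u)).
Proof.
move=> tD sm; have dd := der_fixd be s tD.
have pl := lfam_psi ga sm; have Ll := lfam_LamS ga 0 sm.
rewrite -[fixd _ _ _ _]addr0 -(fixd_LamS0 be ga tD sm) -(derD dd pl Ll).
apply: (lge_fixd be tD sm (lfamD pl Ll)) => u uD; exact: psi_LamS.
Qed.

(** Off the punctures both terms are regular. At a puncture the difference is [- lambda' fixd psi]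
    minus the derivative of [Fm], where the order of [fixd psi] makes up for that of lambda'; at
    infinity it vanishes. *)
Lemma hessian be ga t o : D t -> dzo o (Kf be ga t o) = d2lamo be ga o t / zo o.
Proof.
move=> tD; apply/eqP; rewrite -subr_eq0; apply/eqP; move: o.
apply: liouville0.
- apply: ratlB; first exact: ratl_dzo (ratl_Kf be ga t).
  by apply: ratlM; [exact: ratl_d2lamo|apply: ratlV; exact: ratl_zo].
- move=> c; have [[s sm ->]|cp] := pselect (is_pole m (coef X t) c); last first.
    apply: lgeB; first by apply: lge0_lderiv; exact: lge_Kf_reg.
    have := lge_lord_dvd (@lge_d2lamo_reg be ga t c cp) (lord_zo_reg tD cp).
    by rewrite subr0.
  case: s sm => // s sm; rewrite -[Some _]/(po s.+1 t).
  have -> : dzo (po s.+1 t) (Kf be ga t (po s.+1 t)) - d2lamo be ga (po s.+1 t) t / zo (po s.+1 t) =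
      - (lam' s.+1 t * fixd be s.+1 t (fun u => psi ga (po s.+1 u) u))
      - dzo (po s.+1 t) (Fm be ga t (po s.+1 t)).
    by rewrite fixd_psi // opprB /Kf dzoB [RHS]addrAC.
  apply: lgeB; last by apply: lge0_lderiv; exact: (lge_Fm be ga tD sm).
  apply: lgeN; have := lgeM (lord_ge (lord_dzo_lamo tD sm)) (lge_fixd_psi be ga tD sm).
  by apply: lge_le => /=; lia.
rewrite -(po0 t); have sm := leq0n m.
have -> : dzo (po 0 t) (Kf be ga t (po 0 t)) - d2lamo be ga (po 0 t) t / zo (po 0 t) =
    - (lam' 0 t * fixd be 0 t (fun u => psi ga (po 0 u) u))
    - dzo (po 0 t) (Fm be ga t (po 0 t)).
  by rewrite fixd_psi // opprB /Kf dzoB [RHS]addrAC.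
apply: lgeB.
  apply: lgeN; have := lgeM (lord_ge (lord_dzo_lamo tD sm)) (lge_fixd_psi be ga tD sm).
  by apply: lge_le => /=; lia.
by have := @lge_dzo _ (po 0 t) _ _ (lge_Fm be ga tD sm); apply: lge_le.
Qed.

Lemma pd2_theta al be ga p t : D t -> pd be (pd ga (theta X al p)) t =
  psum (fun s => reso (po s t)
    (Dt be (ctr s) (fun u => LamS al p s u * dlz ga u (po s u)) t)).
Proof.
move=> tD.
rewrite (pd_ext (g := fun u => psum (fun s => reso (po s u) (LamS al p s u * dlz ga u (po s u)))) Do be tD).
  rewrite (pd_psum_reso (f := fun s u => LamS al p s u * dlz ga u (po s u)) be tD) // => s sm.
  exact: lfam_thetad.
by move=> u uD; exact: pd_theta.
Qed.

Lemma field_cond1 (F : fieldType) (a db lp kt kz dg l q x y S K : F) :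
  dg = y * l -> K = db * y - S ->
  (a * db + lp * kt) * dg + q * x - (a * (l * S) + lp * (kt * dg - K * kz)) =
  (a * l + lp * kz) * K + q * x.
Proof. by move=> -> ->; ring. Qed.

Lemma structc_theta al be ga p t : D t ->
  \sum_(ep : I) structc (eta X) (c3 X) ep be ga t * pd ep (theta X al p) t =
  psum (fun s => reso (po s t) (LamS al p s t * (lam' s t * Fm be ga t (po s t)))).
Proof.
move=> tD; under eq_bigr => ep _ do rewrite pd_theta // -psumM.
rewrite -psum_sum; apply: eq_psum => s sm.
rewrite /Fm !mulr_sumr (raddf_sum (reso (po s t))); apply: eq_bigr => ep _.
rewrite -reso_constM dlz_psi //; congr reso.
by rewrite [psi _ _ _ * _]mulrC mulrCA; congr (_ * _); rewrite mulrCA.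
Qed.

Lemma theta_cond1 al be ga p t : D t ->
  pd be (pd ga (theta X al p.+1)) t =
  \sum_(ep : I) structc (eta X) (c3 X) ep be ga t * pd ep (theta X al p) t.
Proof.
move=> tD; rewrite pd2_theta //.
rewrite structc_theta //.
(* The terms in lambda^p/p! are collected into one rational function with poles at the punctures
   only. *)
have g0 : psum (fun s => reso (po s t) (lamp p (po s t) t *
    (kt be al (po s t) t * dlz ga t (po s t) - Kf be ga t (po s t) * kz al (po s t) t))) = 0.
  apply: (psum_global (F := fun o => lamp p o t * (kt be al o t * dlz ga t o - Kf be ga t o * kz al o t)) tD).
    apply: ratlM; first exact: ratl_lamp.
    apply: ratlB; apply: ratlM; [exact: ratl_kt| |exact: ratl_Kf|exact: ratl_kz].
    by have [] := tan_dlz ga tD.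
  move=> c cp; rewrite -[0]addr0; apply: lgeM; first exact: lge_lamp.
  apply: lgeB; rewrite -[0]addr0; apply: lgeM.
  - exact: lge_kt.
  - exact: lge_dlz_reg.
  - exact: lge_Kf_reg.
  - exact: lge_kz.
rewrite -[RHS]addr0 -{}g0 -psumD; apply: eq_psum => s sm.
rewrite -raddfD; apply/eqP; rewrite -subr_eq0 -raddfB; apply/eqP.
(* The integrands differ by the total derivative of [LamS al p.+1 * Kf]; given [hessian], this is
   the identity [field_cond1]. *)
rewrite -[RHS](reso_dzo (po s t) (LamS al p.+1 s t * Kf be ga t (po s t))); congr reso.
rewrite dzoM hessian // (LamS_dzo al p tD sm).
have dd := der_Dt Do be (ctr s) tD.
rewrite (derM dd (lfam_LamS al p.+1 sm) (lfam_dlz ga sm)) (LamS_Dt be al p tD sm).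
rewrite (Dt_divz be tD sm (lfam_dlamo ga sm)) Dt_dlamo //.
by apply: field_cond1 (dlz_psi _ _ tD) _.
Qed.

(** * The Euler field *)

(** The weight of the coordinate [al] under the Euler field; the spectrum is 1/2 - [deg]. *)
Definition deg al : C :=
  match al with
  | inl j => j.+1%:R / (n 0)%:R
  | inr (existT i j) => j%:R / (n i.+1)%:R
  end.

(** From p - 1 to p the harmonic constant grows by 1/p, so multiplying a logarithmic germ by lambda
    leaves a multiple 1/n_s of lambda^p/p!. The sign at infinity is that of [LamS]. *)
Definition elog al s : C := if kidx al is Some i then
  (if s == 0%N then - (n 0)%:R^-1 else if s == i then (n s)%:R^-1 else 0) else 0.

Lemma lam_wo s t : D t -> (s <= m)%N ->
  lamo (po s t) t = lconst (n s)%:R^-1 * wo s t ^+ n s.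
Proof.
move=> tD sm; rewrite wo_root // (fmorphV (@lconst C)) (rmorph_nat (@lconst C)).
by rewrite mulKf //; exact: natL_neq0 (n_gt0 sm).
Qed.

Lemma field_lamW (F : fieldType) (N p j c : F) : N != 0 ->
  N^-1 * (c * (p * N - j)) = (p - j / N) * c.
Proof. by move=> N0; field. Qed.

Lemma field_lamW2 (F : fieldType) (a b c x y : F) : y != 0 ->
  a * y * (b * c * (x / y)) = a * (b * c) * x.
Proof. by move=> y0; field. Qed.

(** Multiplication by lambda = w^n/n raises the exponent by n, and consecutive constants differ by
    the factor (p+1) n - j, which is divided by n. *)
Lemma lam_Wgen s j p t : D t -> (s <= m)%N -> (j < n s)%N ->
  lamo (po s t) t * (if p is p'.+1 then Wgen s j p' t else wo s t ^- j) =
  lconst (p.+1%:R - j%:R / (n s)%:R) * Wgen s j p t.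
Proof.
move=> tD sm jn; have n0 := n_gt0 sm; have w0 := wo_neq0 tD sm.
pose e := (p.+1 * n s - j)%N.
have eC : e%:R = p.+1%:R * (n s)%:R - j%:R :> C.
  by rewrite /e natrB ?natrM // mulSn; lia.
have e0 : e%:R != 0 :> C by rewrite pnatr_eq0 /e mulSn; lia.
have cE : cnum R n s j p * e%:R = if p is p'.+1 then cnum R n s j p' else 1.
  rewrite /cnum big_nat_recr //= -eC -mulrA mulVf // mulr1.
  by case: (p) => [|p'] //; rewrite big_geq.
have -> : (if p is p'.+1 then Wgen s j p' t else wo s t ^- j) =
    lconst (cnum R n s j p * e%:R) * (wo s t ^+ e / wo s t ^+ n s).
  rewrite cE /e; case: (p) => [|p'].
    rewrite mul1n (rmorph1 (@lconst C)) mul1r.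
    rewrite -[in X in _ = _ / X](subnK (ltnW jn)) exprD invfM mulrA mulfV ?mul1r //.
    exact: expf_neq0.
  rewrite /Wgen; congr (_ * _).
  rewrite (_ : (p'.+2 * n s - j)%N = ((p'.+1 * n s - j) + n s)%N) ?exprD ?mulfK ?expf_neq0 //.
  by rewrite !mulSn; lia.
have Nn : (n s)%:R != 0 :> C by rewrite pnatr_eq0 -lt0n.
rewrite lam_wo // /Wgen -/e eC [RHS]mulrA -(rmorphM (@lconst C)) -(field_lamW _ _ _ Nn).
rewrite !(rmorphM (@lconst C)).
exact: (field_lamW2 _ _ _ _ (expf_neq0 (n s) w0)).
Qed.

Lemma field_lamL (F : fieldType) (l q lf k N c e f : F) : N != 0 -> k != 0 -> f != 0 ->
  l * (q / f * (lf - e * (c / N))) =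
  k * (l * q / (k * f) * (lf - e * ((c + k^-1) / N))) + e / N * (l * q / (k * f)).
Proof. by move=> N0 k0 f0; field; rewrite N0 k0 f0. Qed.

Lemma lam_Lgen i s p (e : C) t : D t -> (s <= m)%N ->
  lamo (po s t) t * (if p is p'.+1 then Lgen i s p' (e * (csum R p' / (n s)%:R)) t
     else lconst e * wo s t ^- n s) =
  lconst p%:R * Lgen i s p (e * (csum R p / (n s)%:R)) t +
  lconst (e / (n s)%:R) * lamp p (po s t) t.
Proof.
move=> tD sm; have n0 := n_gt0 sm; have w0 := wo_neq0 tD sm.
case: p => [|p].
  rewrite (rmorph0 (@lconst C)) mul0r add0r lampE fact0 invr1 expr0 (rmorph1 (@lconst C)) !mulr1.
  by rewrite lam_wo // mulrACA mulfV ?expf_neq0 // mulr1 -(rmorphM (@lconst C)) mulrC.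
have cE : csum R p.+1 = csum R p + p.+1%:R^-1 by rewrite /csum big_nat_recr.
have nV k0 : lconst k0.+1%:R^-1 = (k0.+1%:R : L)^-1.
  by rewrite (fmorphV (@lconst C)) (rmorph_nat (@lconst C)).
have nE : lconst (n s)%:R^-1 = ((n s)%:R : L)^-1.
  by rewrite (fmorphV (@lconst C)) (rmorph_nat (@lconst C)).
have c1 : lconst (e * (csum R p.+1 / (n s)%:R)) =
    lconst e * ((lconst (csum R p) + (p.+1%:R)^-1) / (n s)%:R).
  by rewrite cE -nV -nE -(rmorphD (@lconst C)) -!(rmorphM (@lconst C)).
have c2 : lconst (e * (csum R p / (n s)%:R)) = lconst e * (lconst (csum R p) / (n s)%:R).
  by rewrite -nE -!(rmorphM (@lconst C)).
have c3' : lconst (e / (n s)%:R) = lconst e / (n s)%:R by rewrite -nE -(rmorphM (@lconst C)).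
rewrite /Lgen /lamp c1 c2 c3' factS natrM exprS (rmorph_nat (@lconst C)).
by apply: field_lamL; rewrite ?natL_neq0 ?fact_gt0.
Qed.

Lemma lam_LamS al p s t : D t -> (s <= m)%N ->
  lamo (po s t) t * LamS al p s t =
  lconst (p.+1%:R - deg al) * LamS al p.+1 s t + lconst (elog al s) * lamp p (po s t) t.
Proof.
move=> tD sm; have e00 : lconst (0 : C) * lamp p (po s t) t = 0.
  by rewrite (rmorph0 (@lconst C)) mul0r.
case: al => [j|[i j]].
  rewrite /elog /= e00 addr0; case: (eqVneq s 0%N) => [s0|s0]; last by rewrite !mulr0.
  subst s; have jn : (j.+1 < n 0)%N by have := ltn_ord j; lia.
  by have := @lam_Wgen 0 j.+1 p t tD sm jn; rewrite !mulrN => <-; case: p {e00}.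
case: (ltnP j (n i.+1)) => jn.
  rewrite /elog /kidx jn e00 addr0 /LamS jn; case: (eqVneq s i.+1) => [si|si]; last by rewrite !mulr0.
  by subst s; have := @lam_Wgen i.+1 j p t tD sm jn => <-; case: p {e00}.
have jE : nat_of_ord j = n i.+1 by have := ltn_ord j; lia.
have -> : deg (inr (existT (fun i : 'I_m => 'I_(n i.+1).+1) i j)) = 1.
  by rewrite /= jE mulfV // pnatr_eq0 -lt0n n_gt0 // ltn_ord.
rewrite -[p.+1%:R]natr1 addrK !(@LamS_inr i j) //.
have -> : elog (inr (existT (fun i : 'I_m => 'I_(n i.+1).+1) i j)) s =
    if s == 0%N then - (n 0)%:R^-1 else if s == i.+1 then (n s)%:R^-1 else 0.
  by rewrite /elog /= ltnNge jn.
case: (eqVneq s 0%N) => [s0|s0].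
  subst s; have := lam_Lgen i.+1 p 1 tD sm; rewrite !mul1r => E.
  rewrite !mulrN (rmorphN (@lconst C)) mulNr -opprD -E.
  by congr (- (_ * _)); case: p {E e00} => // p; rewrite mul1r.
case: (eqVneq s i.+1) => [si|si].
  have := lam_Lgen i.+1 p 1 tD sm; rewrite !mul1r => <-.
  by congr (_ * _); case: p {e00} => // p; rewrite mul1r.
have := lam_Lgen i.+1 p 0 tD sm; rewrite !mul0r (rmorph0 (@lconst C)) !mul0r addr0 => E.
by rewrite -E; case: p {E e00} => //= p; rewrite mul0r.
Qed.

Lemma pd_theta0 al be t : D t -> pd be (theta X al 0) t = (al == bar be)%:R.
Proof. by move=> tD; rewrite pd_theta // -(pair_dlz be al tD) /pair; apply: eq_psum => s _; rewrite mulrC. Qed.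

(** The gradient is that of a coordinate since the metric is constant; connectedness of the chart
    yields a single constant. *)
Lemma theta0_crd al : exists k : C, forall t, D t -> theta X al 0 t = crd t (bar al) + k.
Proof.
pose g t := theta X al 0 t - crd t (bar al).
have gh : holo D g by apply: holoB; [exact: holo_theta|exact: holo_crd].
have g' be t : D t -> pd be g t = 0.
  move=> tD; have h1 := @holo_theta al 0 t tD; have h2 := @holo_crd _ _ D (bar al) t tD.
  have h3 : differentiable (fun u : V => - crd u (bar al)) t by exact: (holoN (@holo_crd _ _ D (bar al))).
  rewrite /g (pdD be h1 h3) (pdN be h2) pd_crd pd_theta0 //.
  rewrite (_ : (al == bar be) = (be == bar al)) ?subrr //.
  by apply/eqP/eqP => ->; rewrite barK.
have [[t0 t0D]|nD] := pselect (exists t, D t); last by exists 0 => t tD; case: nD; exists t.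
exists (g t0) => t tD.
rewrite -(connected_pd0 Do (@dom_connected _ _ _ X) gh g' tD t0D) /g.
by rewrite addrC subrK.
Qed.

(* z^{-1} E lambda for the Euler field E. *)
Definition hE t o : L := (lamo o t - lconst (n 0)%:R^-1 * (zo o * lamd o t)) / zo o.

Lemma ring_zy (F : fieldType) (z a q g : F) : z * (a * (q * g)) = q * (a * (z * g)).
Proof. by ring. Qed.

(** The leading term z^(n_0)/n_0 is homogeneous and annihilated by 1 - (z/n_0) d/dz. This gives the
    order that tangency requires at infinity. *)
Lemma lge_hE_inf t : D t ->
  lge (1 - (n 0)%:Z) (lamo (po 0 t) t - lconst (n 0)%:R^-1 * (zo (po 0 t) * lamd (po 0 t) t)).
Proof.
move=> tD; have sm := leq0n m; have n0 := n_gt0 sm.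
have Nn : (n 0)%:R != 0 :> C by rewrite pnatr_eq0 -lt0n.
have := lamo_lead tD sm; rewrite /lead eqxx -exprVn -/(@zinf C).
set r := lamo _ _ - _ => rl; pose y := lconst (n 0)%:R^-1 * @zinf C ^+ n 0.
have lE : lamo (po 0 t) t = y + r by rewrite /r addrC subrK.
have zy : @zinf C * dzo None y = lconst (n 0)%:R * y.
  rewrite /y dzoM dzo_const mul0r add0r -(prednK n0) dzoX (dzo_zo None) mulr1 prednK //.
  rewrite ring_zy -exprS prednK // (rmorph_nat (@lconst C)).
  by [].
rewrite lE dzoD mulrDr mulrDr -[zo _]/zinf -[po 0 t]/None zy mulrA -(rmorphM (@lconst C)).
rewrite mulVf // (rmorph1 (@lconst C)) mul1r opprD addrACA subrr add0r.
apply: lgeB => //; apply: lge_constM.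
have := lgeM (lord_ge (lord_zinf C)) (@lge_dzo _ None _ _ rl); apply: lge_le.
by lia.
Qed.

Lemma tan_hE t : D t -> tangent (hE t) t.
Proof.
move=> tD; split.
- apply: ratlM; last by apply: ratlV; exact: ratl_zo.
  apply: ratlB; first exact: ratl_lamo.
  apply: ratlM; first exact: ratl_const.
  by apply: ratlM; [exact: ratl_zo|exact: ratl_lamd].
- move=> c cp; have z0 := lord_zo_reg tD cp; have [l0 _] := lcoef_lamd cp.
  rewrite -[0](subrr (0 : int)); apply: (lge_lord_dvd _ z0).
  apply: lgeB; first exact: lge_lamo_reg.
  by apply: lge_constM; rewrite -[0]addr0; apply: lgeM => //; exact: lord_ge z0.
move=> [|s] sm /=.
  have := lge_lord_dvd (lge_hE_inf tD) (lord_zo_inf t); apply: lge_le; lia.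
have z0 := lord_zo1 tD sm; have zz := lord_neq0 z0.
rewrite /hE mulrBl; apply: lgeB.
  have := lge_lord_dvd (lord_ge (lord_lamo tD sm)) z0; apply: lge_le.
  by case: s {sm z0 zz} => [|s] /=; lia.
rewrite -mulrA [zo _ * _]mulrC mulfK //; apply: lge_constM.
exact: lord_ge (lord_dzo_lamo tD sm).
Qed.

Definition euler al t : C := pair (hE t) (bar al) t.

Lemma lcoef0_dlamo al t z : D t -> ~ is_pole m (coef X t) z ->
  lcoef (dlamo al (Some z) t) 0 = pd al (fun u => lamX X u z) t.
Proof.
move=> tD zp; rewrite dlamE // dlamoE dlam_pfe -pdl_pfdt.
by have [] := lcoef_pfe (good_pole_hyp (@good_pdl al _ good2_lamL) zp).
Qed.

Lemma lcoef0_lamo t z : ~ is_pole m (coef X t) z -> lcoef (lamo (Some z) t) 0 = lamX X t z.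
Proof.
move=> zp; rewrite lamX_pfe lamoE.
by have [] := lcoef_pfe (good_pole_hyp good_lamL zp).
Qed.

Lemma tan_eval h t z : D t -> ~ is_pole m (coef X t) z -> tangent h t ->
  \sum_(al : I) pair h (bar al) t * pd al (fun u => lamX X u z) t =
  lcoef (zo (Some z) * h (Some z)) 0.
Proof.
move=> tD zp ht; rewrite (tan_expand tD ht) mulr_sumr lcoef_sum.
apply: eq_bigr => al _; rewrite mulrCA lcoefCM; congr (_ * _).
rewrite -lcoef0_dlamo // /dlz [zo _ * _]mulrC divfK //.
exact: zo_neq0_all.
Qed.

Lemma lcoef0_zat (c : C) : lcoef (zat c) 0 = c.
Proof. by rewrite lcoef_zat mul1r addr0. Qed.

Lemma euler_is_euler : is_euler X euler.
Proof.
move=> t z tD zp; rewrite /euler (tan_eval tD zp (tan_hE tD)) /hE.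
rewrite [zo _ * _]mulrC divfK ?zo_neq0_all // lcoefD lcoefN lcoefCM lcoef0_lamo //.
have [l0 l1] := lcoef_lamd zp.
rewrite (lcoef0M (lge_zat z) l0) l1 lcoef0_zat; congr (_ - _).
by rewrite mulrA [_^-1 * _]mulrC.
Qed.

Definition elogres al p t : C :=
  psum (fun s => elog al s * reso (po s t) (lamp p (po s t) t / zo (po s t))).

Lemma field_eul (F : fieldType) (a b c d e : F) : c != 0 ->
  d * ((a - e * (c * b)) / c) + e * (d * b) = a * d / c.
Proof. by move=> c0; field. Qed.

(** The part of E lambda proportional to z lambda' contributes nothing, because [LamS al p] times
    lambda' is a z-derivative up to a kappa term whose residues cancel. The part lambda acts by
    multiplication, evaluated by [lam_LamS]. *)
Lemma euler_theta al p t : D t ->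
  \sum_(ga : I) euler ga t * pd ga (theta X al p) t =
  (p.+1%:R - deg al) * theta X al p t + elogres al p t.
Proof.
move=> tD.
have -> : \sum_(ga : I) euler ga t * pd ga (theta X al p) t =
    psum (fun s => reso (po s t) (LamS al p s t * hE t (po s t))).
  under eq_bigr => ga _ do rewrite pd_theta // -psumM.
  rewrite -psum_sum; apply: eq_psum => s sm.
  rewrite (tan_expand tD (tan_hE tD)) mulr_sumr (raddf_sum (reso (po s t))).
  by apply: eq_bigr => ga _; rewrite -reso_constM; congr reso; exact: mulrCA.
have g0 : psum (fun s => reso (po s t) (lamp p (po s t) t * kz al (po s t) t)) = 0.
  apply: (psum_global (F := fun o => lamp p o t * kz al o t) tD).
    by apply: ratlM; [exact: ratl_lamp|exact: ratl_kz].
  move=> c cp; rewrite -[0]addr0; apply: lgeM; first exact: lge_lamp.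
  exact: lge_kz.
have g1 : psum (fun s => reso (po s t) (LamS al p s t * lamd (po s t) t)) = 0.
  apply/eqP; rewrite -oppr_eq0 -psumN -[X in _ == X]g0; apply/eqP; apply: eq_psum => s sm.
  apply/eqP; rewrite eqr_oppLR -addr_eq0; apply/eqP.
  rewrite -(reso_dzo (po s t) (LamS al p.+1 s t)) (LamS_dzo al p tD sm).
  by rewrite -raddfD.
rewrite theta_res /elogres -psumM -psumD.
transitivity (psum (fun s => reso (po s t) (LamS al p s t * hE t (po s t)) +
   (n 0)%:R^-1 * reso (po s t) (LamS al p s t * lamd (po s t) t))).
  by rewrite psumD psumM g1 mulr0 addr0.
apply: eq_psum => s sm; rewrite -!reso_constM -!raddfD; congr reso.
have z0 := zo_neq0 tD sm.
rewrite /hE [lconst (_ - _) * _]mulrA [lconst (elog _ _) * _]mulrA -mulrDl -(lam_LamS al p tD sm).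
by move: (lamo _ _) (lamd _ _) (zo _) z0 (LamS _ _ _ _) (lconst _) => a b c c0 d e; exact: field_eul.
Qed.

(** For p = 0 these are residues of dz/z, which are constant. *)
Lemma elogres0 al be t : D t -> pd be (elogres al 0) t = 0.
Proof.
move=> tD; rewrite /elogres.
have fl s : (s <= m)%N -> lfam D (fun u => lconst (elog al s) * (zo (po s u))^-1).
  by move=> sm; apply: (lfamM Do (lfam_cst D _)); exact: lfam_zV.
rewrite (pd_ext (g := fun u => psum (fun s => reso (po s u) (lconst (elog al s) * (zo (po s u))^-1))) Do be tD).
  rewrite (pd_psum_reso (f := fun s u => lconst (elog al s) * (zo (po s u))^-1) be tD fl).
  rewrite /psum big_nat big1 // => s /andP[_ sm].
  have dd := der_Dt Do be (ctr s) tD.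
  rewrite (derM dd (lfam_cst D _) (lfam_zV sm)) (Dt_const Do be _ tD (@holo_cst _ _ D (elog al s))) pd_cst.
  by rewrite Dt_zV // (rmorph0 (@lconst C)) mul0r mulr0 addr0 raddf0.
move=> u uD; apply: eq_psum => s _; rewrite reso_constM /lamp expr0 fact0.
by rewrite divr1 mul1r.
Qed.

Lemma holo_elogres al p : holo D (elogres al p).
Proof.
apply: (holo_psum (F := fun s u => elog al s * reso (po s u) (lamp p (po s u) u / zo (po s u)))) => s sm.
apply: holoM; first exact: holo_cst.
apply: holo_reso; apply: (lfamM Do); last exact: lfam_zV.
by apply: (lfamM Do); [exact: (lfamX Do p (lfam_lamo sm))|exact: lfam_cst].
Qed.

Lemma holo_pd_theta al p ga : holo D (pd ga (theta X al p)).
Proof.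
apply: (holo_ext Do (f := fun u => psum (fun s => reso (po s u) (LamS al p s u * dlz ga u (po s u))))).
  by move=> u uD; rewrite pd_theta.
apply: (holo_psum (F := fun s u => reso (po s u) (LamS al p s u * dlz ga u (po s u)))) => s sm.
exact: holo_reso (lfam_thetad al p ga sm).
Qed.

(** The gradient of [theta X (bar be) 0] is the coordinate covector of [be], so the case p = 0 of
    [euler_theta] computes E itself. *)
Lemma eulerE be t : D t ->
  euler be t = (1 - deg (bar be)) * theta X (bar be) 0 t + elogres (bar be) 0 t.
Proof.
move=> tD; rewrite -[1]/(1%:R) -euler_theta // (bigD1 be isT) big1 => [|ga /= gb].
  by rewrite pd_theta0 // eqxx mulr1; exact/esym/addr0.
rewrite pd_theta0 // (_ : (_ == _) = false) ?mulr0 //.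
by apply: contra_neqF gb => /eqP /(can_inj barK) ->.
Qed.

Lemma deg_bar al : deg al + deg (bar al) = 1.
Proof.
have np s : (s <= m)%N -> (n s)%:R != 0 :> C by move=> sm; rewrite pnatr_eq0 -lt0n n_gt0.
case: al => [j|[i j]] /=; rewrite -mulrDl -natrD.
  rewrite (_ : (_ + _)%N = n 0) ?mulfV ?np //.
  by have := ltn_ord j; have := n_gt0 (leq0n m); lia.
rewrite (_ : (_ + _)%N = n i.+1) ?mulfV ?np ?ltn_ord //.
by have := ltn_ord j; lia.
Qed.

Lemma holo_euler be : holo D (euler be).
Proof.
apply: (holo_ext Do (f := fun u => (1 - deg (bar be)) * theta X (bar be) 0 u + elogres (bar be) 0 u)).
  by move=> u uD; rewrite eulerE.
apply: holoD; last exact: holo_elogres.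
by apply: holoM; [exact: holo_cst|exact: holo_theta].
Qed.

Lemma pd_euler al be t : D t -> pd al (euler be) t = deg be * (al == be)%:R.
Proof.
move=> tD; rewrite (pd_ext (g := fun u => (1 - deg (bar be)) * theta X (bar be) 0 u + elogres (bar be) 0 u) Do al tD).
  have h1 := @holo_theta (bar be) 0 t tD.
  have h2 : differentiable (fun u => (1 - deg (bar be)) * theta X (bar be) 0 u) t.
    by apply: (holoM (holo_cst _) (@holo_theta (bar be) 0)) tD.
  rewrite (pdD al h2 (@holo_elogres _ 0 t tD)) elogres0 // addr0.
  rewrite (pdM al (@holo_cst _ _ D _ t tD) h1) pd_cst mul0r add0r pd_theta0 //.
  rewrite -(deg_bar be) addrK (inj_eq (can_inj barK)) eq_sym //.
by move=> u uD; rewrite eulerE.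
Qed.

Lemma c3C al be ga t : c3 X al be ga t = c3 X be al ga t.
Proof. rewrite /c3.
apply: eq_fsbigr => c _.
apply: (congr1 (@res_at C)).
move: (dlam_at X al t c) (dlam_at X be t c) (dlam_at X ga t c) => x y z.
by rewrite [x * y]mulrC. Qed.

(** For p = 0 both sides vanish; for larger p the recursion reduces the claim to the symmetry of
    [c3]. *)
Lemma pd_theta_comm al be ga p t : D t ->
  pd be (pd ga (theta X al p)) t = pd ga (pd be (theta X al p)) t.
Proof.
move=> tD; case: p => [|p].
  have h b g : pd b (pd g (theta X al 0)) t = 0.
    rewrite (pd_ext (g := fun=> (al == bar g)%:R) Do b tD) ?pd_cst //.
    by move=> u uD; rewrite pd_theta0.
  by rewrite !h.
rewrite (theta_cond1 al be ga p tD) (theta_cond1 al ga be p tD); apply: eq_bigr => ep _.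
by rewrite (structcE ep be ga tD) (structcE ep ga be tD) c3C.
Qed.

Lemma sum_delta (f : I -> C) be : \sum_(ga : I) f ga * (be == ga)%:R = f be.
Proof.
rewrite (bigD1 be isT) /= eqxx mulr1 big1 ?addr0 // => ga gb.
by rewrite eq_sym (negbTE gb) mulr0.
Qed.

(** Differentiating [euler_theta] along [be] also differentiates the component of E, which accounts
    for the extra [deg be]. *)
Lemma euler_pd_theta al be p t : D t ->
  \sum_(ga : I) euler ga t * pd ga (pd be (theta X al p)) t =
  (p.+1%:R - deg al - deg be) * pd be (theta X al p) t + pd be (elogres al p) t.
Proof.
move=> tD; have th := @holo_theta al p t tD; have eh := @holo_elogres al p t tD.
have pth ga := @holo_pd_theta al p ga t tD.
have h : pd be (fun u => \sum_(ga : I) euler ga u * pd ga (theta X al p) u) t =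
    (p.+1%:R - deg al) * pd be (theta X al p) t + pd be (elogres al p) t.
  rewrite (pd_ext (g := fun u => (p.+1%:R - deg al) * theta X al p u + elogres al p u) Do be tD).
    have h2 : differentiable (fun u => (p.+1%:R - deg al) * theta X al p u) t.
      by apply: (holoM (holo_cst _) (@holo_theta al p)) tD.
    by rewrite (pdD be h2 eh) (pdM be (@holo_cst _ _ D _ t tD) th) pd_cst mul0r add0r.
  by move=> u uD; rewrite euler_theta.
move: h; rewrite pd_sum => [|ga _]; last first.
  exact: (holoM (holo_euler ga) (@holo_pd_theta al p ga)) tD.
under eq_bigr => ga _ do
  rewrite (pdM be (holo_euler ga tD) (pth ga)) (pd_euler be ga tD)
    (pd_theta_comm al be ga p tD) mulrAC.
rewrite big_split /= (sum_delta (fun ga => deg ga * pd ga (theta X al p) t)).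
by move=> h; rewrite mulrBl addrAC -h addrC addKr.
Qed.

(** The matrix R_1; the other R_s are 0. Its nonzero columns belong to the t_{i,n_i} and its nonzero
    rows to the t_{i',0}, because the anomaly [elogres] consists of residues of lambda^(p+1)/(p+1)!
    dz/z at the punctures. *)
Definition R1 (ep al : I) : C :=
  match ep with
  | inl _ => 0
  | inr (existT i' j') => if nat_of_ord j' == 0%N then
      (if kidx al is Some i then (n 0)%:R^-1 + (if i'.+1 == i then (n i)%:R^-1 else 0) else 0)
      else 0
  end.

(** For j = 0 the constants collapse: c_{i,0;p} = 1/((p+1)! n_i^(p+1)), while w_i^((p+1) n_i) = (n_i
    lambda)^(p+1). *)
Lemma theta_pole (i : 'I_m) p t : D t ->
  theta X (@idx m n i ord0) p t =
  reso (po i.+1 t) (lamp p.+1 (po i.+1 t) t / zo (po i.+1 t)).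
Proof.
move=> tD; have im := ltn_ord i; have n0 := n_gt0 im.
transitivity (reso (po i.+1 t) (Wpole X i.+1 0 p t / zo (po i.+1 t))); first by rewrite /= n0.
suff -> : Wpole X i.+1 0 p t = lamp p.+1 (po i.+1 t) t by [].
rewrite /Wpole lampE lam_wo // exprMn mulrA -(rmorphXn (@lconst C)) -(rmorphM (@lconst C)).
rewrite /wo /= subn0 -exprM [(n i.+1 * _)%N]mulnC; congr (lconst _ * _).
rewrite /cnum; elim: p => [|p IHp].
  by rewrite big_nat1 subr0 mul1r factS fact0 muln1 invr1 mul1r expr1.
rewrite big_nat_recr //= IHp subr0 [in RHS]factS natrM !invfM [in RHS]exprS.
by rewrite mulrACA; congr (_ * _); exact: mulrC.
Qed.

Lemma elogresS al p t : D t ->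
  elogres al p.+1 t = \sum_(ep : I) theta X ep p t * R1 ep al.
Proof.
move=> tD; have sE : \sum_(ep : I) theta X ep p t * R1 ep al =
    \sum_(i' < m) theta X (@idx m n i' ord0) p t * R1 (@idx m n i' ord0) al.
  pose G ep := theta X ep p t * R1 ep al.
  have -> : \sum_(ep : I) G ep = \sum_(j < (n 0).-1) G (inl j) +
      \sum_(q : {i' : 'I_m & 'I_(n i'.+1).+1}) G (inr q) by rewrite big_sumType.
  rewrite [X in X + _]big1 ?add0r => [|j _]; last exact: mulr0.
  pose F (i' : 'I_m) (j' : 'I_(n i'.+1).+1) := theta X (idx j') p t * R1 (idx j') al.
  rewrite (eq_bigr (fun q : {i' : 'I_m & 'I_(n i'.+1).+1} => F (tag q) (tagged q))).
    rewrite -(sig_big_dep xpredT (fun _ _ => true) F); apply: eq_bigr => i' _.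
    rewrite big_ord_recl big1 => [|j' _]; first exact: addr0.
    by rewrite /F /R1 /= mulr0.
  by case.
rewrite {}sE /elogres /elog; under [RHS]eq_bigr => i' _ do rewrite theta_pole //.
rewrite /R1 /=; case E : (kidx al) => [i|]; last first.
  rewrite /psum big1 => [|s _]; last by rewrite mul0r.
  by rewrite big1 // => i _; rewrite mulr0.
have im := kidx_le E.
pose r s := reso (po s t) (lamp p.+1 (po s t) t / zo (po s t)).
(* The residue at infinity, of weight -1/n_0, is moved to the poles, where [theta_pole] recognises
   densities; hence the term 1/n_0 in every row t_{i',0} of [R1]. *)
have r0 : r 0%N = - \sum_(1 <= s < m.+1) r s.
  apply/eqP; rewrite -addr_eq0; apply/eqP.
  rewrite -[RHS](@psum_global (fun o => lamp p.+1 o t / zo o) t tD).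
  - by rewrite /psum [in RHS]big_ltn.
  - by apply: ratlM; [exact: ratl_lamp|apply: ratlV; exact: ratl_zo].
  move=> c cp; have := lge_lord_dvd (@lge_lamp p.+1 t c cp) (lord_zo_reg tD cp).
  by rewrite subr0.
rewrite /psum big_ltn // eqxx -/(r 0%N) r0 mulrNN mulr_sumr -big_split /=.
rewrite big_add1 big_mkord; apply: eq_bigr => i' _.
rewrite -/(r i'.+1) -mulrDl mulrC; congr (_ * (_ + _)).
by case: eqP => [->|].
Qed.

Lemma hamiltonian_theta : hamiltonian_densities D (eta X) (c3 X) euler 1 (theta X).
Proof.
have d0 i : deg (@idx m n i ord0) = 0 by rewrite /= mul0r.
have dk al i : kidx al = Some i -> deg al = 1.
  case: al => [//|[i' j]] /=; case: ltnP => // ij _.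
  have -> : nat_of_ord j = n i'.+1 by have := ltn_ord j; lia.
  by rewrite mulfV // pnatr_eq0 -lt0n n_gt0 // ltn_ord.
(* Nonzero entries lead from weight 1 to weight 0, so the spectrum differs by exactly 1. *)
have R0 ep al : R1 ep al != 0 -> deg ep = 0 /\ deg al = 1.
  case: ep => [j|[i j]] /=; first by rewrite eqxx.
  case: (eqVneq (nat_of_ord j) 0%N) => [->|_]; last by rewrite eqxx.
  by case E : (kidx al) => [k|]; [rewrite mul0r (dk _ _ E)|rewrite eqxx].
(* For s = 1 the required sign is +, so lowering an index of [R1] has to give a symmetric matrix;
   its nonzero entries have the form 1/n_0 + delta_{ik}/n_k. *)
have Rsym be al : R1 (bar be) al = R1 (bar al) be.
  have H (a b : I) : R1 (bar a) b = match kidx a, kidx b with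
      | Some i, Some k => (n 0)%:R^-1 + (if i == k then (n k)%:R^-1 else 0) | _, _ => 0 end.
    case: a => [j|[i j]] //=.
    rewrite subSS subn_eq0 ltnNge; by case: leqP.
  rewrite !H; case: (kidx be) (kidx al) => [i|] [k|] //.
  by rewrite eq_sym; case: eqP => [->|].
exists (fun al => 1 / 2 - deg al), (fun s ep al => if s == 1%N then R1 ep al else 0).
split.
- move=> al be t tD; rewrite pd_euler // (_ : 2 - 1 = 1 :> C); last by rewrite [2]mulrS addrAC subrr add0r.
  by rewrite mulrBl; case: eqP => [->|_]; rewrite ?mulr0.
- exact: holo_theta.
- move=> al be ga p t tD; exact: theta_cond1.
- split.
  + move=> al be p t tD; rewrite (euler_pd_theta al be p tD).
    have -> : p.+1%:R - deg al - deg be = p%:R + (1 / 2 - deg al) + (1 / 2 - deg be).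
      by rewrite -natr1; move: (deg al) (deg be) => x y; field.
    apply: (congr1 (fun x => _ + x)); case: p => [|p].
      by rewrite elogres0 // (pd_ext (g := fun=> 0) Do be tD) ?pd_cst // => u _; rewrite big_geq.
    apply: (pd_ext Do be tD) => u uD; rewrite (elogresS al p uD) big_ltn // subn1.
    rewrite [X in _ = _ + X]big_nat [X in _ = _ + X]big1 ?addr0 // => s /andP[s1 _].
    by rewrite big1 // => ep _; rewrite gtn_eqF ?mulr0.
  + move=> s al be s0; case: (eqVneq s 1%N) => // ->; apply: contra_neq_eq => /R0[-> ->].
    by rewrite subr0 opprB addrCA subrr addr0.
  + move=> s al be t s0 tD; case: (eqVneq s 1%N) => [->|_]; last first.
      have z (f g : I -> C) c : \sum_(ga : I) 0 * f ga = c * \sum_(ga : I) 0 * g ga.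
        by rewrite !big1 ?mulr0 // => ga _; exact: mul0r.
      exact: (z (fun ga => eta X ga be t) (fun ga => eta X ga al t)).
    rewrite expr2 mulrNN !mul1r.
    have S (a b : I) : \sum_(ga : I) R1 ga a * eta X ga b t = R1 (bar b) a.
      rewrite -(sum_bar (fun ga => R1 ga a)); apply: eq_bigr => ga _.
      by rewrite (etaE ga b tD).
    exact: (etrans (S al be) (etrans (Rsym be al) (esym (S be al)))).
move=> al; have [k kP] := theta0_crd al; exists k => t tD; rewrite kP //.
apply: (congr1 (fun x => x + k)); rewrite -(sum_delta (fun be => crd t be)).
apply: eq_bigr => be _; rewrite (etaE al be tD) mulrC.
by rewrite eq_sym.
Qed.

(** * The flows *)

Lemma princpartE (c : C) (f : L) (N : nat) z : lge (- N%:Z) f ->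
  princpart c f z = \sum_(1 <= j < N.+1) lcoef f (- j%:Z) * (z - c) ^- j.
Proof.
move=> fN; pose r : seq int := [seq - (j%:Z) | j <- index_iota 1 N.+1].
have ru : uniq r by rewrite map_inj_uniq ?iota_uniq // => i j /oppr_inj [].
rewrite /princpart -(fsbig_widen [set` r]); last 2 first.
- by move=> k /= /mapP[j]; rewrite mem_index_iota => jN ->; lia.
- move=> k /= [k1 kr]; rewrite fN ?mul0r //; case: (ltP k (- N%:Z)) => // kN; exfalso.
  by apply: kr; apply/mapP; exists (absz k); rewrite ?mem_index_iota; lia.
rewrite -fsbig_seq // big_map; apply: eq_bigr => j _.
by rewrite exprnN.
Qed.

Lemma polpartE (f : L) (N : nat) z : lge (- N%:Z) f ->
  polpart_inf f z = \sum_(0 <= j < N.+1) lcoef f (- j%:Z) * z ^+ j.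
Proof.
move=> fN; pose r : seq int := [seq - (j%:Z) | j <- index_iota 0 N.+1].
have ru : uniq r by rewrite map_inj_uniq ?iota_uniq // => i j /oppr_inj [].
rewrite /polpart_inf -(fsbig_widen [set` r]); last 2 first.
- by move=> k /= /mapP[j]; rewrite mem_index_iota => jN ->; lia.
- move=> k /= [k1 kr]; rewrite fN ?mul0r //; case: (ltP k (- N%:Z)) => // kN; exfalso.
  by apply: kr; apply/mapP; exists (absz k); rewrite ?mem_index_iota; lia.
by rewrite -fsbig_seq // big_map; apply: eq_bigr => j _; rewrite opprK.
Qed.

Definition proj s (f : L) (z : C) t : C :=
  if s == 0%N then polpart_inf f z else princpart (apole s t) f z.

(** A bound common to all points and punctures makes the singular parts finite sums of fixed length,
    hence families of partial fractions. *)
Lemma LamS_bound al q : exists N : nat, forall s, (s <= m)%N -> forall u, D u ->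
  lge (- N%:Z) (LamS al q s u).
Proof.
have /choice[N NP] : forall s, exists N : nat, (s <= m)%N -> forall u, D u ->
    lge (- N%:Z) (LamS al q s u).
  move=> s; case: (leqP s m) => sm; last by exists 0%N.
  have /lfamP[[M MP] _] := lfam_LamS al q sm; exists (absz M) => _ u uD.
  by apply: lge_le (MP u uD); lia.
exists (\max_(s < m.+1) N s) => s sm u uD; apply: lge_le (NP s sm u uD).
have := @leq_bigmax _ (fun s : 'I_m.+1 => N s) (Ordinal (sm : (s < m.+1)%N)).
by move=> /= h; lia.
Qed.

(** * The Hamiltonian vector field as a tangent vector *)

Section Flow.
Variables (al : I) (p N : nat).
Hypothesis LamN : forall s, (s <= m)%N -> forall u, D u -> lge (- N%:Z) (LamS al p.+1 s u).

(** The exponents start at 0 at infinity, where the polynomial part includes the constant term, and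
    at 1 at the poles. *)
Definition prl s : seq (nat * nat * (V -> C)) :=
  [seq (s, j, fun u => lcoef (LamS al p.+1 s u) (- j%:Z)) | j <- index_iota (s != 0%N) N.+1].
Definition prlall : seq (nat * nat * (V -> C)) :=
  flatten [seq prl s | s <- index_iota 0 m.+1].

Lemma proj_pfe s t z : D t -> (s <= m)%N ->
  proj s (LamS al p.+1 s t) z t = pfe idfun (apole^~ t) (pfat (prl s) t) z.
Proof.
move=> tD sm; rewrite /proj /pfe /prl !big_map; case: s sm => [|s] sm /=.
  by rewrite (polpartE _ (LamN sm tD)); apply: eq_bigr.
by rewrite (princpartE _ _ (LamN sm tD)); apply: eq_bigr.
Qed.

Lemma good_prl s : (s <= m)%N -> good (prl s).
Proof.
move=> sm e el; have [j _ ->] := In_map el; split=> //=.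
exact: lfam_holo (lfam_LamS al p.+1 sm).
Qed.

Lemma good_prlall : good prlall.
Proof.
move=> e el; have [s /In_index_iota + h] := In_flatten_map el.
by rewrite mem_index_iota ltnS => sm; exact: good_prl h.
Qed.

Lemma lcoef_prlall s t j : D t -> (s <= m)%N -> ((s != 0%N) <= j)%N ->
  \sum_(e <- prlall) e.2 t * (e.1 == (s, j))%:R = lcoef (LamS al p.+1 s t) (- j%:Z).
Proof.
move=> tD sm j0; rewrite /prlall big_flatten big_map.
rewrite (bigD1_seq s) ?iota_uniq ?mem_index_iota //= [X in _ + X]big1 ?addr0; last first.
  by move=> i /negbTE si; rewrite big_map big1 // => k _; rewrite /= xpair_eqE si mulr0.
rewrite big_map; case: (leqP j N) => jN.
  rewrite (bigD1_seq j) ?iota_uniq ?mem_index_iota ?j0 //= eqxx mulr1.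
  by rewrite big1 ?addr0 // => k kj; rewrite xpair_eqE (negbTE kj) andbF mulr0.
rewrite big_seq big1; first by rewrite (LamN sm tD) //; lia.
move=> k; rewrite mem_index_iota => kN; rewrite /= xpair_eqE (_ : k == j = false) ?andbF ?mulr0 //.
by lia.
Qed.

Lemma lcoef0_pfb_inf e t : D t -> (e.1 <= m)%N -> ((e.1 != 0%N) <= e.2)%N ->
  lcoef (pfb (@lconst C) (apole^~ t) e (zo (po 0 t))) 0 = (e == (0%N, 0%N))%:R.
Proof.
move=> tD; case: e => i k /= im ik; rewrite /pfb /= xpair_eqE.
have [_|i0] := eqVneq i 0%N.
  by rewrite lcoef_zinfX; congr (_%:R); rewrite eq_sym oppr_eq0 eqz_nat.
have i1 : (1 <= i <= m)%N by rewrite lt0n i0.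
have [h _] := lordVn k (lord_zo tD (leq0n m) i1).
by rewrite /= h //=; move: ik; rewrite i0 /=; lia.
Qed.

Lemma lcoef0_pfo_inf l t : D t ->
  (forall e, List.In e l -> (e.1.1 <= m)%N && ((e.1.1 != 0%N) <= e.1.2)%N) ->
  lcoef (pfo l (po 0 t) t) 0 = \sum_(e <- l) e.2 t * (e.1 == (0%N, 0%N))%:R.
Proof.
move=> tD lP; rewrite /pfo /pfe big_map lcoef_sum.
elim: l lP => [|e l IHl] lP; first by rewrite !big_nil.
have /andP[e1 e2] := lP e (or_introl erefl).
rewrite !big_cons lcoefCM lcoef0_pfb_inf // IHl // => e' e'l; apply: lP; right.
exact: e'l.
Qed.

(** At infinity the principal parts at the poles vanish and the constant term is subtracted too, so
    the remainder even vanishes there. *)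
Lemma lge_prlall s t : D t -> (s <= m)%N ->
  lge (if s == 0%N then 1 else 0) (LamS al p.+1 s t - pfo prlall (po s t) t).
Proof.
move=> tD sm k k0; rewrite lcoefD lcoefN.
have [kn|kn] := ltP k 0.
  pose j := absz k; have kE : k = - j%:Z by lia.
  rewrite kE (lcoef_pfo good_prlall tD sm) ?lcoef_prlall ?subrr //; lia.
have {}kn : k = 0 /\ s = 0%N by case: eqP k0 => [->|_]; lia.
case: kn => kE sE; subst s k; rewrite -(@lcoef_prlall 0 t 0 tD sm) //.
rewrite lcoef0_pfo_inf ?subrr // => e el.
have [s /In_index_iota + h] := In_flatten_map el; rewrite mem_index_iota ltnS => sm'.
have [j /In_index_iota + ->] := In_map h; rewrite mem_index_iota => /andP[j0 _] /=.
by rewrite j0 andbT.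
Qed.

Definition dprl de o t : L :=
  pfe (@lconst C) (apole^~ t) (pfdt (fun c => pd de c t) apole t prlall) (zo o).

(* z^{-1} {B + lambda^p/p! kappa, lambda} along the coordinate de, where B is
   minus the sum of the singular parts of [LamS al p.+1] at the punctures.  At a
   puncture B differs from minus [LamS al p.+1] by a regular germ [Qs], which
   makes this tangent. *)
Definition hfl de t o : L :=
  (lamp p o t * kz al o t - dzo o (pfo prlall o t)) * dlamo de o t -
  (lamp p o t * kt de al o t - dprl de o t) * lamd o t.

Definition Qs s t : L := LamS al p.+1 s t - pfo prlall (po s t) t.

Lemma lfam_Qs s : (s <= m)%N -> lfam D (Qs s).
Proof. by move=> sm; apply: lfamB; [exact: lfam_LamS|exact: (lfam_pfo good_prlall sm)]. Qed.

Lemma dzo_Qs s t : D t -> (s <= m)%N ->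
  lamp p (po s t) t * kz al (po s t) t - dzo (po s t) (pfo prlall (po s t) t) =
  dzo (po s t) (Qs s t) - LamS al p s t * lam' s t.
Proof.
move=> tD sm; rewrite /Qs dzoB (LamS_dzo al p tD sm) -/(lamp p (po s t) t).
by rewrite [X in _ = X - _ - _]addrC addrAC addrK.
Qed.

Lemma Dt_Qs de s t : D t -> (s <= m)%N ->
  lamp p (po s t) t * kt de al (po s t) t - dprl de (po s t) t =
  Dt de (ctr s) (Qs s) t - LamS al p s t * dlamo de (po s t) t.
Proof.
move=> tD sm; have dd := der_Dt Do de (ctr s) tD.
rewrite (derB dd (lfam_LamS al p.+1 sm) (lfam_pfo good_prlall sm)) (LamS_Dt de al p tD sm).
rewrite (Dt_pfo de tD good_prlall sm) -/(dprl de (po s t) t) -/(lamp p (po s t) t).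
by rewrite [X in _ = X - _ - _]addrC addrAC addrK.
Qed.

Lemma ring_hfl (F : fieldType) (q l a b d : F) : (q - a * l) * d - (b - a * d) * l = q * d - b * l.
Proof. by ring. Qed.

(** The terms with [LamS al p] drop out, being proportional to the pair of derivatives of lambda, as
    in the bracket of a function of lambda with lambda. *)
Lemma hfl_Qs de s t : D t -> (s <= m)%N ->
  hfl de t (po s t) = dzo (po s t) (Qs s t) * dlamo de (po s t) t -
    Dt de (ctr s) (Qs s) t * lam' s t.
Proof. by move=> tD sm; rewrite /hfl dzo_Qs // Dt_Qs // ring_hfl. Qed.

Lemma lge_dzo_Qs s t : D t -> (s <= m)%N ->
  lge (if s == 0%N then 2 else 0) (dzo (po s t) (Qs s t)).
Proof.
move=> tD sm; have := lge_prlall tD sm; rewrite -/(Qs s t); case: s sm => [|s] sm /= h.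
  exact: (@lge_dzo _ None _ _ h).
exact: lge0_lderiv.
Qed.

Lemma lge_Dt_Qs de s t : D t -> (s <= m)%N ->
  lge (if s == 0%N then 1 else 0) (Dt de (ctr s) (Qs s) t).
Proof.
move=> tD sm; have h u : D u -> lge (if s == 0%N then 1 else 0) (Qs s u).
  by move=> uD; exact: lge_prlall.
have h' := lge_ldiff Do de (lfam_Qs sm) tD h.
rewrite /Dt; case: s sm h h' => [|s] sm h h' /=; first by rewrite subr0.
by apply: lgeB => //; apply: lge_constM; apply: lge0_lderiv; exact: h.
Qed.

Lemma ratl_hfl de t : ratl (hfl de t).
Proof.
apply: ratlB; apply: ratlM.
- apply: ratlB; last exact: ratl_dzo (ratl_pfo prlall t).
  by apply: ratlM; [exact: ratl_lamp|exact: ratl_kz].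
- exact: ratl_dlamo.
- apply: ratlB; last exact: ratl_pfe.
  by apply: ratlM; [exact: ratl_lamp|exact: ratl_kt].
- exact: ratl_lamd.
Qed.

Lemma lge_hflz t c : ~ is_pole m (coef X t) c ->
  lge 0 (lamp p (Some c) t * kz al (Some c) t - dzo (Some c) (pfo prlall (Some c) t)).
Proof.
move=> cp; apply: lgeB; last by apply: lge0_lderiv; apply: (lge_pfo good_prlall cp).
by rewrite -[0]addr0; apply: lgeM; [exact: lge_lamp|exact: lge_kz].
Qed.

Lemma lge_hflt de t c : ~ is_pole m (coef X t) c ->
  lge 0 (lamp p (Some c) t * kt de al (Some c) t - dprl de (Some c) t).
Proof.
move=> cp; apply: lgeB.
  by rewrite -[0]addr0; apply: lgeM; [exact: lge_lamp|exact: lge_kt].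
apply: lge_pfe => s /index_pfdt sl s0; apply: (is_poleP cp); rewrite lt0n s0 /=.
exact: (good_index good_prlall sl).
Qed.

Lemma tan_hfl de t : D t -> tangent (hfl de t) t.
Proof.
move=> tD; split; first exact: ratl_hfl.
- move=> c cp; have [l0 _] := lcoef_lamd cp.
  apply: lgeB; rewrite -[0]addr0; apply: lgeM.
  + exact: lge_hflz.
  + exact: lge_dlamo_reg.
  + exact: lge_hflt.
  + exact: l0.
move=> s sm; rewrite hfl_Qs //; apply: lgeB.
  have := lgeM (lge_dzo_Qs tD sm) (lge_dlamo de tD sm); apply: lge_le.
  by case: s sm => [|[|s]] sm /=; lia.
have := lgeM (lge_Dt_Qs de tD sm) (lord_ge (lord_dzo_lamo tD sm)); apply: lge_le.
by case: s sm => [|s] sm /=; lia.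
Qed.

Lemma ring_hflpsi (F : fieldType) (a b d y l K M : F) : d * y - M = K ->
  (a * d - b * l) * y - (a * K - b * (y * l)) = a * M.
Proof. by move=> <-; ring. Qed.

Lemma ring_hflFm (F : fieldType) (q a l M : F) : (q - a * l) * M + a * (l * M) = q * M.
Proof. by ring. Qed.

(** At a critical point the regularity of [Kf] and of [psi] times lambda' reduces the integrand to
    its first factor times [Fm]. The residue theorem moves this to the punctures; there the
    derivative of [Qs] times [Fm] has no residue, and the part with [LamS al p] is evaluated by
    [structc_theta]. *)
Lemma pair_hfl de be t : D t ->
  pair (hfl de t) be t = pd de (pd be (theta X al p.+1)) t.
Proof.
move=> tD; rewrite theta_cond1 // structc_theta // -(pair_crit be tD (tan_hfl de tD)).
pose F o := (lamp p o t * kz al o t - dzo o (pfo prlall o t)) * Fm de be t o.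
have Fr : ratl F.
  apply: ratlM; last exact: ratl_Fm.
  apply: ratlB; last exact: ratl_dzo (ratl_pfo prlall t).
  by apply: ratlM; [exact: ratl_lamp|exact: ratl_kz].
have FmE o : Fm de be t o = dlamo de o t * psi be o t - Kf de be t o.
  by rewrite /Kf opprB addrC subrK.
have Freg c : ~ is_pole m (coef X t) c -> ~ crit X t c -> lge 0 (F (Some c)).
  move=> cp ncr; rewrite -[0]addr0; apply: lgeM; first exact: lge_hflz.
  rewrite FmE; apply: lgeB; last exact: lge_Kf_reg.
  by rewrite -[0]addr0; apply: lgeM; [exact: lge_dlamo_reg|exact: lge_psi_reg].
have cE c : crit X t c ->
    res_at (hfl de t (Some c) * psi be (Some c) t) = res_at (F (Some c)).
  move=> -[cp _].
  set k1 := lamp p (Some c) t * kz al (Some c) t - dzo (Some c) (pfo prlall (Some c) t).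
  set k2 := lamp p (Some c) t * kt de al (Some c) t - dprl de (Some c) t.
  have k10 : lge 0 k1 by exact: lge_hflz.
  have k20 : lge 0 k2 by exact: lge_hflt.
  have r0 : res_at (k1 * Kf de be t (Some c) - k2 * (psi be (Some c) t * lamd (Some c) t)) = 0.
    apply: lge_res_at; apply: lgeB; rewrite -[0]addr0; apply: lgeM => //.
      exact: lge_Kf_reg.
    by rewrite -dlz_psi //; exact: lge_dlz_reg.
  have := @ring_hflpsi _ k1 k2 (dlamo de (Some c) t) (psi be (Some c) t) (lamd (Some c) t) _
    (Fm de be t (Some c)) erefl.
  rewrite -/(Kf de be t (Some c)) => E.
  rewrite -[RHS]/(res_at (k1 * Fm de be t (Some c))) -E.
  by rewrite -[RHS]/(res_at (hfl de t (Some c) * psi be (Some c) t) - res_at (k1 * Kf de be t (Some c) -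
    k2 * (psi be (Some c) t * lamd (Some c) t))) r0 subr0.
have -> : \sum_(c \in crit X t) res_at (hfl de t (Some c) * psi be (Some c) t) =
    \sum_(c \in crit X t) res_at (F (Some c)).
  by apply: eq_fsbigr => c /set_mem; exact: cE.
have := crit_sum tD Fr Freg => /eqP; rewrite addr_eq0 => /eqP ->.
rewrite -psumN; apply: eq_psum => s sm; apply/eqP; rewrite eq_sym -addr_eq0.
rewrite addrC -raddfD; apply/eqP; rewrite /F dzo_Qs // ring_hflFm; apply: reso_po.
have := lgeM (lge_dzo_Qs tD sm) (lge_Fm de be tD sm); apply: lge_le.
by case: s sm.
Qed.

End Flow.

(** * Evaluation of the vector field at a regular point *)

Lemma lcoef0X (f : L) k : lge 0 f -> lcoef (f ^+ k) 0 = lcoef f 0 ^+ k.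
Proof.
move=> f0; elim: k => [|k IHk]; first by rewrite !expr0 lcoef1.
have fk := @lgeX _ _ _ k f0; rewrite mulr0 in fk.
by rewrite !exprS lcoef0M // IHk.
Qed.

Lemma lcoef0_lamp k t z : ~ is_pole m (coef X t) z ->
  lcoef (lamp k (Some z) t) 0 = lamX X t z ^+ k / k`!%:R.
Proof.
move=> zp; rewrite lampE lcoefCM lcoef0X ?lcoef0_lamo // 1?mulrC //.
exact: lge_lamo_reg.
Qed.

Lemma lcoef0_zoBV i t z : ~ is_pole m (coef X t) z -> (1 <= i <= m)%N ->
  lcoef (zo (Some z) - lconst (apole i t))^-1 0 = (z - apole i t)^-1.
Proof.
move=> zp im; have h := lord_zoB_reg zp im; have := lcoefV h; rewrite oppr0 => ->.
by rewrite zatB lcoef0_zat.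
Qed.

Definition kzv al t z : C := if kidx al is Some i then (z - apole i t)^-1 else 0.
Definition ktv (a' : nat -> C) al t z : C :=
  if kidx al is Some i then - (a' i / (z - apole i t)) else 0.

Lemma lcoef0_kz al t z : ~ is_pole m (coef X t) z ->
  lcoef (kz al (Some z) t) 0 = kzv al t z.
Proof.
by move=> zp; rewrite /kz /kzv; case E : (kidx al) => [i|] //; exact: lcoef0_zoBV zp (kidx_le E).
Qed.

Lemma lcoef0_kt de al t z : ~ is_pole m (coef X t) z ->
  lcoef (kt de al (Some z) t) 0 = ktv (fun i => pd de (apole i) t) al t z.
Proof.
move=> zp; rewrite /kt /ktv; case E : (kidx al) => [i|] //.
by rewrite lcoefN lcoefCM (lcoef0_zoBV zp (kidx_le E)).
Qed.

Lemma pfo_pd l de t z : D t -> good l -> ~ is_pole m (coef X t) z ->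
  differentiable (fun u => pfe idfun (apole^~ u) (pfat l u) z) t /\
  pd de (fun u => pfe idfun (apole^~ u) (pfat l u) z) t =
  pfe idfun (apole^~ t) (pfdt (fun c => pd de c t) apole t l) z.
Proof.
move=> tD lg zp; apply: pfe_pd.
  by move=> e /lg[_ eh]; exact: eh.
move=> s sl s0; split; first exact: holo_apole.
by apply: (is_poleP zp); rewrite lt0n s0 (good_index lg).
Qed.

Lemma pfo_derive1 l t z : good l -> ~ is_pole m (coef X t) z ->
  derivable (pfe idfun (apole^~ t) (pfat l t)) z 1 /\
  derive1 (pfe idfun (apole^~ t) (pfat l t)) z = pfe idfun (apole^~ t) (pfdz (pfat l t)) z.
Proof. by move=> lg zp; apply: pfe_derive1; exact: good_pole_hyp. Qed.

Section Value.
Variables (al : I) (p N : nat).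
Hypothesis LamN : forall s, (s <= m)%N -> forall u, D u -> lge (- N%:Z) (LamS al p.+1 s u).
Local Notation P s u z := (pfe idfun (apole^~ u) (pfat (prl al p N s) u) z).

Lemma pfe_prlall_z t z : pfe idfun (apole^~ t) (pfdz (pfat (prlall al p N) t)) z =
  psum (fun s => pfe idfun (apole^~ t) (pfdz (pfat (prl al p N s) t)) z).
Proof.
rewrite /pfe /pfdz /pfat /prlall big_map big_map big_flatten big_map.
by apply: eq_bigr => s _; rewrite [RHS]big_map [RHS]big_map.
Qed.

Lemma pfe_prlall_t de t z :
  pfe idfun (apole^~ t) (pfdt (fun c => pd de c t) apole t (prlall al p N)) z =
  psum (fun s => pfe idfun (apole^~ t) (pfdt (fun c => pd de c t) apole t (prl al p N s)) z).
Proof.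
rewrite pfe_pfdt /prlall big_flatten big_map.
by apply: eq_bigr => s _; rewrite [RHS]pfe_pfdt.
Qed.

(** The tangent vector z [hfl] is expanded in the coordinate fields with the coefficients given by
    [pair_hfl], and all germs at z are replaced by their constant coefficients. *)
Lemma flow_value de t z : D t -> ~ is_pole m (coef X t) z ->
  \sum_(ga : I) pd de (pd (bar ga) (theta X al p.+1)) t * pd ga (fun u => lamX X u z) t =
  z * ((lamX X t z ^+ p / p`!%:R * kzv al t z -
        psum (fun s => derive1 (fun z' => P s t z') z)) * pd de (fun u => lamX X u z) t -
       (lamX X t z ^+ p / p`!%:R * ktv (fun i => pd de (apole i) t) al t z -
        psum (fun s => pd de (fun u => P s u z) t)) * derive1 (lamX X t) z).
Proof.
move=> tD zp; have [l0 l1] := lcoef_lamd zp.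
transitivity (lcoef (zo (Some z) * hfl al p N de t (Some z)) 0).
  rewrite -(tan_eval tD zp (tan_hfl LamN de tD)); apply: eq_bigr => ga _.
  by rewrite (pair_hfl LamN de _ tD).
have a0 := @lge_hflz al p N t z zp; have b0 := @lge_hflt al p N de t z zp.
have d0 := @lge_dlamo_reg de t z zp.
have ad := lgeM a0 d0; have bl := lgeM b0 l0; rewrite addr0 in ad bl.
rewrite (lcoef0M (lge_zat z) (lgeB ad bl)) lcoef0_zat; congr (_ * _).
rewrite lcoefD lcoefN (lcoef0M a0 d0) (lcoef0M b0 l0) l1 lcoef0_dlamo //.
rewrite 2!lcoefD 2!lcoefN (lcoef0M (lge_lamp p zp) (lge_kz al zp)).
rewrite (lcoef0M (lge_lamp p zp) (lge_kt de al zp)) lcoef0_lamp // lcoef0_kz // lcoef0_kt //.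
have -> : lcoef (dzo (Some z) (pfo (prlall al p N) (Some z) t)) 0 =
    psum (fun s => derive1 (fun z' => P s t z') z).
  rewrite (pfe_dzo (apole^~ t) (pfat (prlall al p N) t) (Some z)).
  have h := good_pole_hyp (@good_prlall al p N) zp.
  have [_ ->] : lge 0 (pfe (@lconst C) (apole^~ t) (pfdz (pfat (prlall al p N) t)) (zat z)) /\
      lcoef (pfe (@lconst C) (apole^~ t) (pfdz (pfat (prlall al p N) t)) (zat z)) 0 =
      pfe idfun (apole^~ t) (pfdz (pfat (prlall al p N) t)) z.
    by apply: lcoef_pfe => s; rewrite index_pfdz; exact: h.
  rewrite pfe_prlall_z; apply: eq_psum => s sm.
  have [_ h'] := pfo_derive1 (@good_prl al p N s sm) zp.
  exact: (esym h').
have -> : lcoef (dprl al p N de (Some z) t) 0 = psum (fun s => pd de (fun u => P s u z) t).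
  have [_ ->] : lge 0 (dprl al p N de (Some z) t) /\ lcoef (dprl al p N de (Some z) t) 0 =
      pfe idfun (apole^~ t) (pfdt (fun c => pd de c t) apole t (prlall al p N)) z.
    apply: lcoef_pfe => s /index_pfdt sl s0; apply: (is_poleP zp); rewrite lt0n s0 /=.
    exact: (good_index (@good_prlall al p N) sl).
  rewrite pfe_prlall_t; apply: eq_psum => s sm.
  have [_ h'] := pfo_pd de tD (@good_prl al p N s sm) zp.
  exact: (esym h').
by [].
Qed.

End Value.

(** * Derivatives along the loop and brackets *)

Lemma ring_cderM (F : fieldType) (c f f0 g g0 : F) :
  c * (f * g - f0 * g0) = c * (f - f0) * g + f0 * (c * (g - g0)).
Proof. by ring. Qed.

Lemma cderM (f g : R -> C) x a b : cder f x a -> cder g x b ->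
  cder (fun y => f y * g y) x (a * g x + f x * b).
Proof.
move=> fa gb; have gc := cder_continuous gb.
have gc' : g (h + x) @[h --> 0^'] --> g x.
  have h0 : (h + x) @[h --> (0 : R)^'] --> x.
    rewrite -[X in _ --> X]add0r; apply: cvgD; last exact: cvg_cst.
    exact: nbhs_dnbhs.
  exact: (cvg_comp _ _ h0 gc).
have E : (fun h : R => (h%:C%C : C)^-1 *: (f (h + x) * g (h + x) - f x * g x)) =
    (fun h => ((h%:C%C : C)^-1 *: (f (h + x) - f x)) * g (h + x) +
       f x * ((h%:C%C : C)^-1 *: (g (h + x) - g x))).
  by apply/funext => h; exact: ring_cderM.
rewrite /cder E.
exact: (cvgD (cvgM fa gc') (cvgM (cvg_cst (f x)) gb)).
Qed.

(** The exponential is again differentiated along a real line, and the derivative of [l] along that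
    line is its complex derivative. *)
Lemma derive1_log (l : C -> C) (a z : C) : z != a -> derivable l z 1 ->
  (\forall z' \near z, expC (l z') = z' - a) -> derive1 l z = (z - a)^-1.
Proof.
move=> za ld le; have za0 : z - a != 0 by rewrite subr_eq0.
have lD : differentiable l z by exact/derivable1_diffP.
pose v y : C := z + y%:C%C *: (1 : C).
have v0 : v 0 = z by rewrite /v scale0r addr0.
have vc : cder v 0 (1 : C) by exact: cder_line.
have lv : cder (l \o v) 0 ('d l z (1 : C)).
  have h : differentiable l (v 0) by rewrite v0.
  by have := cder_comp vc h; rewrite v0.
have ev := cder_expC lv.
have vB : cder (fun y => v y - a) 0 (1 : C).
  by have := cderD vc (cder_cst (- a) 0); rewrite addr0.
have vle : \forall y \near (0 : R), expC ((l \o v) y) = v y - a.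
  have := cder_continuous vc; rewrite v0; exact: (fun h => h _ le).
have := cder_unique (near_cder vle ev) vB; rewrite /= v0 (nbhs_singleton le).
rewrite derive1E deriveE // => h.
by apply: (mulIf za0); rewrite mulVf.
Qed.

Lemma lin_sum (U A K Q : I -> C) (z a l b : C) :
  \sum_(de : I) U de * (z * (a * A de - (l * K de - Q de) * b)) =
  z * (a * (\sum_(de : I) U de * A de) -
       (l * (\sum_(de : I) U de * K de) - \sum_(de : I) U de * Q de) * b).
Proof.
rewrite !mulr_sumr -sumrB mulr_suml -sumrB mulr_sumr; apply: eq_bigr => de _.
by ring.
Qed.

Section Curve.
Variables (u : R -> V) (x : R) (z : C).
Hypothesis Du : D (u x).
Hypothesis du : forall al, derivablex (fun y => crd (u y) al) x.
Hypothesis zp : ~ is_pole m (coef X (u x)) z.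

Definition dx (G : V -> C) : C := \sum_(de : I) derivx (fun y => crd (u y) de) x * pd de G (u x).

Lemma cder_dx (G : V -> C) : differentiable G (u x) -> cder (fun y => G (u y)) x (dx G).
Proof. by move=> Gd; exact: (cder_pd du Gd). Qed.

Lemma near_Du : \forall y \near x, D (u y).
Proof.
have := cder_continuous (cder_row du); apply; apply: open_nbhs_nbhs; split=> //.
exact: Do.
Qed.

(** Records the two partial derivatives at (z, x) that enter [bracket], so that brackets are
    computed by rules and compared by ring identities. *)
Definition bder (f : C -> R -> C) (fz fx : C) : Prop :=
  [/\ derivable (f^~ x) z 1, derive1 (f^~ x) z = fz & cder (f z) x fx].

Lemma bder_bracket f fz fx g gz gx : bder f fz fx -> bder g gz gx ->
  bracket f g z x = z * (fz * gx - fx * gz).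
Proof.
move=> [_ f1 f2] [_ g1 g2]; have /cderP[_ f3] := f2; have /cderP[_ g3] := g2.
by rewrite /bracket f1 g1 f3 g3 mulrBr !mulrA.
Qed.

Lemma bder_eq f g fz gz fx gx : (forall z' y, f z' y = g z' y) -> fz = gz -> fx = gx ->
  bder f fz fx -> bder g gz gx.
Proof.
move=> fg <- <-; suff -> : f = g by [].
by apply/funext => z'; apply/funext => y; exact: fg.
Qed.

Lemma bderN f fz fx : bder f fz fx -> bder (fun z' y => - f z' y) (- fz) (- fx).
Proof.
have dd := @der_derive1 R z; move=> [h1 h2 h3]; split.
- exact: (domN dd h1).
- by rewrite (derN dd h1) h2.
have e (w : C) : w *: (-1 : C) = - w by exact: mulrN1.
have := cderZ (w := -1 : C) h3; rewrite e.
have -> // : (fun y => f z y *: (-1 : C)) = (fun y => - f z y) by apply/funext => y; exact: e.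
Qed.

Lemma bderD f fz fx g gz gx : bder f fz fx -> bder g gz gx ->
  bder (fun z' y => f z' y + g z' y) (fz + gz) (fx + gx).
Proof.
have dd := @der_derive1 R z; move=> [h1 h2 h3] [k1 k2 k3]; split.
- exact: (domD dd h1 k1).
- by rewrite (derD dd h1 k1) h2 k2.
exact: cderD.
Qed.

Lemma bderM f fz fx g gz gx : bder f fz fx -> bder g gz gx ->
  bder (fun z' y => f z' y * g z' y) (fz * g z x + f z x * gz) (fx * g z x + f z x * gx).
Proof.
have dd := @der_derive1 R z; move=> [h1 h2 h3] [k1 k2 k3]; split.
- exact: (domM dd h1 k1).
- by rewrite (derM dd h1 k1) h2 k2.
exact: cderM.
Qed.

Lemma bderX f fz fx k : bder f fz fx ->
  bder (fun z' y => f z' y ^+ k) (k%:R * f z x ^+ k.-1 * fz) (k%:R * f z x ^+ k.-1 * fx).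
Proof.
move=> fb; elim: k => [|k IHk].
  rewrite !mul0r; split; [exact: derivable_cst|exact: derive1_cst|exact: cder_cst].
have h a : a * f z x ^+ k + f z x * (k%:R * f z x ^+ k.-1 * a) = k.+1%:R * f z x ^+ k * a.
  case: k {IHk} => [|k]; first by rewrite !expr0 !mul0r mulr0 addr0 mulr1 !mul1r.
  by rewrite /= -[k.+2%:R]natr1 exprS; exact: ring_dX.
apply: (bder_eq _ (h fz) (h fx) (bderM fb IHk)) => z' y.
exact/esym/exprS.
Qed.

Lemma bder_cst (c : C) : bder (fun _ _ => c) 0 0.
Proof. by split; [exact: derivable_cst|exact: derive1_cst|exact: cder_cst]. Qed.

Lemma bder_ext f g fz fx : (forall z', f z' x = g z' x) ->
  (\forall y \near x, f z y = g z y) -> bder f fz fx -> bder g fz fx.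
Proof.
move=> e1 e2 [h1 h2 h3].
have e : f^~ x = g^~ x by apply/funext.
split; [rewrite -e; exact: h1|rewrite -e; exact: h2|exact: near_cder e2 h3].
Qed.

Lemma bder_pfe l : good l ->
  bder (fun z' y => pfe idfun (apole^~ (u y)) (pfat l (u y)) z')
    (derive1 (fun z' => pfe idfun (apole^~ (u x)) (pfat l (u x)) z') z)
    (dx (fun v => pfe idfun (apole^~ v) (pfat l v) z)).
Proof.
move=> lg; have [h _] := pfo_derive1 lg zp; split; [exact: h|by []|].
have [h' _] := pfo_pd (@idx m n (Ordinal m_ge1) ord0) Du lg zp.
exact: cder_dx h'.
Qed.

Local Notation lz := (derive1 (lamX X (u x)) z).
Local Notation lx := (dx (fun v => lamX X v z)).

Lemma bder_lam : bder (fun z' y => lamX X (u y) z') lz lx.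
Proof.
have := bder_pfe good_lamL; rewrite -lamX_pfe => h.
have E : (fun v => pfe idfun (apole^~ v) (pfat lamL v) z) = (fun v => lamX X v z).
  by apply/funext => v; rewrite lamX_pfe.
rewrite E in h; apply: (bder_eq _ erefl erefl h) => z' y.
by rewrite lamX_pfe.
Qed.

Lemma dx_psum (w : nat -> V -> C) :
  \sum_(de : I) derivx (fun y => crd (u y) de) x * psum (fun s => pd de (w s) (u x)) =
  psum (fun s => dx (w s)).
Proof.
under eq_bigr do rewrite -psumM.
by rewrite -psum_sum.
Qed.

Section Flows.
Variables (al : I) (p N : nat).
Hypothesis LamN : forall s, (s <= m)%N -> forall v, D v -> lge (- N%:Z) (LamS al p.+1 s v).
Local Notation P s v z' := (pfe idfun (apole^~ v) (pfat (prl al p N s) v) z').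
Local Notation pz s := (derive1 (fun z' => P s (u x) z') z).
Local Notation px s := (dx (fun v => P s v z)).
Local Notation lamq := (lamX X (u x) z ^+ p / p`!%:R).

(** Raising the index is [bar], and the x-derivative of the gradient is a sum over [de] of second
    derivatives of the density; [flow_value] evaluates each summand. *)
Lemma lam_flowE : lam_flow X al p u z x =
  z * ((lamq * kzv al (u x) z - psum (fun s => pz s)) * lx -
       (lamq * ktv (fun i => dx (apole i)) al (u x) z - psum (fun s => px s)) * lz).
Proof.
rewrite /lam_flow.
have pf ga : principal_flow (eta X) (theta X) al p u x ga = dx (pd (bar ga) (theta X al p.+1)).
  have dE be : derivx (fun y => pd be (theta X al p.+1) (u y)) x = dx (pd be (theta X al p.+1)).
    have := cder_dx (@holo_pd_theta al p.+1 be (u x) Du).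
    by case/cderP.
  rewrite /principal_flow; rewrite -(sum_delta (fun be => dx (pd be (theta X al p.+1)))).
  apply: eq_bigr => be _; rewrite (etainvE ga be Du) dE mulrC.
  by rewrite eq_sym.
transitivity (\sum_(de : I) derivx (fun y => crd (u y) de) x *
   \sum_(ga : I) pd de (pd (bar ga) (theta X al p.+1)) (u x) * pd ga (fun v => lamX X v z) (u x)).
  under eq_bigr => ga _ do rewrite pf /dx mulr_suml.
  rewrite exchange_big /=; apply: eq_bigr => de _; rewrite mulr_sumr.
  by apply: eq_bigr => ga _; rewrite mulrA.
have kE : ktv (fun i => dx (apole i)) al (u x) z =
    \sum_(de : I) derivx (fun y => crd (u y) de) x * ktv (fun i => pd de (apole i) (u x)) al (u x) z.
  rewrite /ktv; case: (kidx al) => [i|]; last by rewrite big1 // => de _; rewrite mulr0.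
  rewrite /dx mulr_suml -sumrN; apply: eq_bigr => de _.
  by rewrite mulrN mulrA.
rewrite kE -dx_psum -lin_sum; apply: eq_bigr => de _.
by rewrite (flow_value LamN de Du zp).
Qed.

Lemma proj_bder s : (s <= m)%N ->
  bder (fun z' y => proj s (LamS al p.+1 s (u y)) z' (u y)) (pz s) (px s).
Proof.
move=> sm; apply: bder_ext (bder_pfe (@good_prl al p N s sm)) => [z'|].
  by rewrite (proj_pfe LamN _ Du sm).
(* The partial fraction form is valid in the chart, where [u y] stays for y near [x]. *)
have := near_Du; apply: filterS => y yD.
by rewrite (proj_pfe LamN _ yD sm).
Qed.

Local Notation Pf s := (fun z' y => proj s (LamS al p.+1 s (u y)) z' (u y)).
Local Notation lambda := (fun z' y => lamX X (u y) z').

Lemma lam_flow_brackets : lam_flow X al p u z x =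
  z * (lamq * kzv al (u x) z * lx - lamq * ktv (fun i => dx (apole i)) al (u x) z * lz) -
  psum (fun s => bracket (Pf s) lambda z x).
Proof.
have -> : psum (fun s => bracket (Pf s) lambda z x) =
    psum (fun s => z * lx * pz s + (- (z * lz)) * px s).
  apply: eq_psum => s sm; rewrite (bder_bracket (proj_bder sm) bder_lam).
  move: (pz s) (px s) lx lz => a b c d; by ring.
rewrite psumD !psumM lam_flowE.
move: (psum (fun s => pz s)) (psum (fun s => px s)) lx lz => a b c d.
move: (lamq * _) (lamq * _) => e f; by ring.
Qed.

End Flows.

Local Notation lambda := (fun z' y => lamX X (u y) z').

Lemma eq_sum_neq (F G : nat -> C) i : (forall s, (0 < s)%N -> s != i -> F s = G s) ->
  \sum_(1 <= s < m.+1 | s != i) F s = \sum_(1 <= s < m.+1 | s != i) G s.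
Proof.
move=> FG; rewrite big_nat_cond [RHS]big_nat_cond.
by apply: eq_bigr => s /andP[/andP[s1 _]]; exact: FG.
Qed.

Lemma polpartN (f : L) z' : polpart_inf (- f) z' = - polpart_inf f z'.
Proof.
have [M fM] := lge_ex f; have {}fM : lge (- (absz M)%:Z) f by apply: lge_le fM; lia.
rewrite (polpartE _ fM) (polpartE _ (lgeN fM)) -sumrN.
by apply: eq_bigr => j _; rewrite lcoefN mulNr.
Qed.

Lemma proj0 s z' t : proj s 0 z' t = 0.
Proof.
have h : lge (- 0%:Z) (0 : L) by exact: lge0.
rewrite /proj; case: eqP => _.
  by rewrite (polpartE _ h) big_nat1 lcoef0 mul0r.
by rewrite (princpartE _ _ h) big_geq.
Qed.

Lemma bracket_proj0 s (f : R -> L) : (forall y, f y = 0) ->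
  bracket (fun z' y => proj s (f y) z' (u y)) lambda z x = 0.
Proof.
move=> f0; have b0 : bder (fun z' y => proj s (f y) z' (u y)) 0 0.
  by apply: (bder_eq _ erefl erefl (bder_cst 0)) => z' y; rewrite f0 proj0.
by rewrite (bder_bracket b0 bder_lam) !mul0r subrr mulr0.
Qed.

Lemma kzv_None al t : kidx al = None -> kzv al t z = 0.
Proof. by rewrite /kzv => ->. Qed.
Lemma ktv_None a' al t : kidx al = None -> ktv a' al t z = 0.
Proof. by rewrite /ktv => ->. Qed.

Lemma flow0 (j : 'I_(n 0).-1) p : lam_flow X (idx0 m j) p u z x =
  bracket (fun z' y => polpart_inf (Winf X j.+1 p (u y)) z') lambda z x.
Proof.
have [N LN] := LamS_bound (idx0 m j) p.+1.
rewrite (lam_flow_brackets LN) kzv_None // ktv_None // !mulr0 !mul0r subrr mulr0 sub0r.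
rewrite (@psum1 0 _ (leq0n m)) => [|s sm s0]; last first.
  by apply: bracket_proj0 => y; rewrite /LamS /= (negbTE s0).
have b0 := proj_bder LN (leq0n m).
(* [LamS] carries a minus sign at infinity, which accounts for the opposite signs of the flows at
   infinity and at the poles. *)
have E z' y : - proj 0 (LamS (idx0 m j) p.+1 0 (u y)) z' (u y) =
    polpart_inf (Winf X j.+1 p (u y)) z'.
  by rewrite /proj eqxx -polpartN opprK.
have b1 := bder_eq E erefl erefl (bderN b0).
rewrite (bder_bracket b0 bder_lam) (bder_bracket b1 bder_lam) -mulrN; congr (_ * _).
by rewrite opprB !mulNr opprK addrC.
Qed.

Lemma flowS (i : 'I_m) (j : 'I_(n i.+1).+1) p : (j < n i.+1)%N ->
  lam_flow X (idx j) p u z x =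
  - bracket (fun z' y => princpart (apole i.+1 (u y)) (Wpole X i.+1 j p (u y)) z') lambda z x.
Proof.
move=> jn; have [N LN] := LamS_bound (idx j) p.+1.
have kN : kidx (idx j) = None by rewrite /= jn.
rewrite (lam_flow_brackets LN) kzv_None // ktv_None // !mulr0 !mul0r subrr mulr0 sub0r.
rewrite (@psum1 i.+1 _ (ltn_ord i)) => [|s sm si]; last first.
  by apply: bracket_proj0 => y; rewrite /LamS /= jn (negbTE si).
have E y : LamS (idx j) p.+1 i.+1 (u y) = Wpole X i.+1 j p (u y) by rewrite /LamS /= jn eqxx.
suff -> : (fun z' y => proj i.+1 (LamS (idx j) p.+1 i.+1 (u y)) z' (u y)) =
  (fun z' y => princpart (apole i.+1 (u y)) (Wpole X i.+1 j p (u y)) z') by [].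
by apply/funext => z'; apply/funext => y; rewrite E.
Qed.

Lemma bder_log i ell : (1 <= i <= m)%N -> is_log_branch (fun y => apole i (u y)) ell z x ->
  bder ell (z - apole i (u x))^-1 (- (dx (apole i) / (z - apole i (u x)))).
Proof.
move=> im [lz' lx' dz dX]; have za : z != apole i (u x) by exact/eqP/(is_poleP zp im).
have za0 : z - apole i (u x) != 0 by rewrite subr_eq0.
split; [exact: dz|exact: derive1_log za dz lz'|].
have c1 : cder (ell z) x (derivx (ell z) x) by apply/cderP.
have ev := cder_expC c1.
have c2 : cder (fun y => z - apole i (u y)) x (- dx (apole i)).
  have h := cder_dx (@holo_apole i (u x) Du).
  have e (w : C) : w *: (-1 : C) = - w by exact: mulrN1.
  have := cderD (cder_cst z x) (cderZ (w := -1 : C) h); rewrite add0r e.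
  have -> // : (fun y => cst z y + apole i (u y) *: (-1 : C)) = (fun y => z - apole i (u y)).
  by apply/funext => y; rewrite e.
have := cder_unique (near_cder lx' ev) c2; rewrite (nbhs_singleton lx') => h.
by rewrite -mulNr -h mulfK.
Qed.

Lemma ring_flow_log (F : fieldType) (a b c S B T : F) : B = - b - c -> a = T ->
  a - (b + (c + S)) = B - S + T.
Proof. by move=> -> ->; ring. Qed.

Lemma flow_log (i : 'I_m) p ell : is_log_branch (fun y => apole i.+1 (u y)) ell z x ->
  lam_flow X (idx (ord_max : 'I_(n i.+1).+1)) p u z x =
  bracket (fun z' y => polpart_inf (Linf X i.+1 p (u y)) z' -
    princpart (apole i.+1 (u y)) (Lpole X i.+1 p (u y)) z') lambda z x
  - \sum_(1 <= s < m.+1 | s != i.+1) bracket (fun z' y =>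
      princpart (apole s (u y)) (Lother X i.+1 s p (u y)) z') lambda z x
  + bracket (fun z' y => lamX X (u y) z' ^+ p / p`!%:R * ell z' y) lambda z x.
Proof.
move=> le; have im := ltn_ord i; pose al : I := idx (ord_max : 'I_(n i.+1).+1).
have [N LN] := LamS_bound al p.+1.
have kE : kidx al = Some i.+1 by rewrite /al /= ltnn.
rewrite (lam_flow_brackets LN).
have -> : kzv al (u x) z = (z - apole i.+1 (u x))^-1 by rewrite /kzv kE.
have -> : ktv (fun i => dx (apole i)) al (u x) z = - (dx (apole i.+1) / (z - apole i.+1 (u x))).
  by rewrite /ktv kE.
(* In the bracket with lambda the derivatives of the factor lambda^p/p! cancel, which leaves the
   kappa terms of [lam_flow_brackets]. *)
have bl := bderM (bderM (bderX p bder_lam) (bder_cst (p`!%:R^-1))) (bder_log (i := i.+1) im le).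
rewrite (bder_bracket bl bder_lam) {bl}.
pose B s := bracket (fun z' y => proj s (LamS al p.+1 s (u y)) z' (u y)) lambda z x.
have -> : psum (fun s => bracket (fun z' y => proj s (LamS al p.+1 s (u y)) z' (u y)) lambda z x) =
    B 0%N + (B i.+1 + \sum_(1 <= s < m.+1 | s != i.+1) B s).
  by rewrite /psum big_ltn // (bigD1_seq i.+1) ?iota_uniq ?mem_index_iota.
have E0 y : LamS al p.+1 0 (u y) = - Linf X i.+1 p (u y) by rewrite /LamS /= ltnn.
have E1 y : LamS al p.+1 i.+1 (u y) = Lpole X i.+1 p (u y) by rewrite /LamS /= ltnn eqxx.
have E2 s y : (0 < s)%N -> s != i.+1 -> LamS al p.+1 s (u y) = Lother X i.+1 s p (u y).
  by case: s => // s _ si; rewrite /LamS /= ltnn (negbTE si).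
have -> : \sum_(1 <= s < m.+1 | s != i.+1) bracket (fun z' y =>
      princpart (apole s (u y)) (Lother X i.+1 s p (u y)) z') lambda z x =
    \sum_(1 <= s < m.+1 | s != i.+1) B s.
  apply: eq_sum_neq => s s1 si; rewrite /B.
  suff -> : (fun z' y => proj s (LamS al p.+1 s (u y)) z' (u y)) =
    (fun z' y => princpart (apole s (u y)) (Lother X i.+1 s p (u y)) z') by [].
  by apply/funext => z'; apply/funext => y; rewrite E2 // /proj gtn_eqF.
have b0 := proj_bder LN (leq0n m); have b1 := proj_bder LN im.
have E z' y : - proj 0 (LamS al p.+1 0 (u y)) z' (u y) +
    - proj i.+1 (LamS al p.+1 i.+1 (u y)) z' (u y) =
    polpart_inf (Linf X i.+1 p (u y)) z' -
    princpart (apole i.+1 (u y)) (Lpole X i.+1 p (u y)) z'.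
  by rewrite E0 E1 /proj eqxx polpartN opprK.
have b2 := bder_eq E erefl erefl (bderD (bderN b0) (bderN b1)).
have h0 : B 0%N = z * _ := bder_bracket b0 bder_lam.
have h1 : B i.+1 = z * _ := bder_bracket b1 bder_lam.
have h2 := bder_bracket b2 bder_lam.
apply: ring_flow_log.
  rewrite h0 h1; apply: (etrans h2).
  move: (derive1 _ _) (derive1 _ _) (derive1 _ _) (dx _) (dx _) (dx _) => a b c d e f.
  by ring.
move: (derive1 _ _) (dx _) (dx _) (lamX X (u x) z) (ell z x) (_ - apole i.+1 (u x))^-1.
by move=> d e e' a b c; rewrite mulr0 !addr0; ring.
Qed.

End Curve.

End Chart.

Theorem theorem1p5 (R : realType) (m : nat) (n : nat -> nat)
    (m_ge1 : (1 <= m)%N) (n_gt0 : forall i, (i <= m)%N -> (0 < n i)%N)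
    (X : flat_chart R m n) :
  (exists E : flat_index m n -> 'rV[Cx R]_#|flat_index m n| -> Cx R,
     is_euler X E /\
     hamiltonian_densities (dom X) (eta X) (c3 X) E 1 (theta X)) /\
  (forall (u : R -> 'rV[Cx R]_#|flat_index m n|) (x : R) (z : Cx R),
     dom X (u x) -> (forall al, derivablex (fun y => crd (u y) al) x) ->
     ~ is_pole m (coef X (u x)) z ->
     let lambda := fun z' y => lamX X (u y) z' in
     let a := fun i y => coef X (u y) i 0%N in
     [/\ forall (j : 'I_(n 0).-1) (p : nat), (1 <= p)%N ->
           lam_flow X (idx0 m j) p.-1 u z x =
           bracket (fun z' y => polpart_inf (Winf X j.+1 p.-1 (u y)) z')
             lambda z x,
         forall (i : 'I_m) (j : 'I_(n i.+1).+1) (p : nat),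
           (j < n i.+1)%N -> (1 <= p)%N ->
           lam_flow X (idx j) p.-1 u z x =
           - bracket (fun z' y =>
               princpart (a i.+1 y) (Wpole X i.+1 j p.-1 (u y)) z') lambda z x
       & forall (i : 'I_m) (p : nat) (ell : Cx R -> R -> Cx R),
           is_log_branch (a i.+1) ell z x ->
           lam_flow X (idx (ord_max : 'I_(n i.+1).+1)) p u z x =
           bracket (fun z' y => polpart_inf (Linf X i.+1 p (u y)) z' -
               princpart (a i.+1 y) (Lpole X i.+1 p (u y)) z') lambda z x
           - \sum_(1 <= s < m.+1 | s != i.+1)
               bracket (fun z' y =>
                 princpart (a s y) (Lother X i.+1 s p (u y)) z') lambda z x
           + bracket (fun z' y => lambda z' y ^+ p / p`!%:R * ell z' y)
               lambda z x]).
Proof.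
split.
  exists (euler X); split; first exact: euler_is_euler.
  exact: hamiltonian_theta.
move=> u x z Du du zp lambda a; split.
- by move=> j p _; exact: flow0.
- by move=> i j p jn _; exact: flowS.
- by move=> i p ell le; exact: flow_log.
Qed.
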